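(* Let $\phi$ and $\psi$ be norms on $\mathbb{R}^2$. Then there exists a complete graphical translating solution to the anisotropic mean curvature flow with surface tension $\phi$ and mobility $\psi$ in $\mathbb{R}^2$ which is given (up to dilations and translations) by $\partial E_t=\partial E+t\,e_2$, where $\partial E$ solves the translator equation $$e_2\cdot\nu(p)=-\psi(\nu(p))\,H_\phi(p,E),\qquad p\in\partial E.$$ In particular, $\partial E$ is the graph of a convex function $u:I\to\mathbb{R}$, where $I$ is an interval. If moreover $\phi\in C^2(\mathbb{R}^2\setminus\{0\})$ and $\phi^2$ is uniformly convex, then $u$ is characterized as the unique solution to $$\psi(-u',1)\,\phi_{xx}(-u',1)\,u''=1,\qquad u(0)=u'(0)=0.$$
   Context: Points of $\mathbb{R}^2$ are written $(x,z)$, $e_2=(0,1)$, and $\phi_{xx}$ is the second partial derivative of $\phi$ in its first variable. In the regular case the domain $I$ of the solution $u$ of the ordinary differential equation is its maximal interval of existence. Regularity: a norm $\varphi$ is called regular if $\varphi\in C^2(\mathbb{R}^2\setminus\{0\})$ and $\varphi^2$ is uniformly convex, i.e. $\nabla^2(\varphi^2)\ge\lambda\,\mathrm{Id}$ away from $0$ for some $\lambda>0$. Flow: the anisotropic mean curvature flow is $\partial_t p\cdot\nu(p)=-\psi(\nu(p))H_\phi(p,E_t)$, $p\in\partial E_t$, with $\nu$ the unit normal and anisotropic mean curvature $H_\phi(p,E)=\mathrm{div}_\tau(\nabla\phi(\nu(p)))$ if $\phi$ is regular, and $H_\phi(p,E)\in\mathrm{div}_\tau(\partial\phi(\nu(p)))$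 ($\partial\phi$ the subdifferential, $\mathrm{div}_\tau$ the tangential divergence) in general. Since the graphs considered need not be entire, one considers the evolution of the curve $\partial E$, that is the graph of $u$, with normal at $(x,u(x))$ oriented as $(-u'(x),1)$ (up to normalization). If $\phi$ is regular and $u$ is $C^2$, the translator equation for the graph of $u$ reads $-\psi(-u',1)\,\big(\phi_x(-u',1)\big)'=1$. Notion of solution (level set sense): for a uniformly continuous $U_0:\mathbb{R}^2\to\mathbb{R}$, let $U$ be the unique continuous (distributional) solution of $U_t=\psi(\nabla U)\,\mathrm{div}(\nabla\phi(\nabla U))$, $U(\cdot,0)=U_0$; it is known that it exists and coincides with the locally uniform limit of the viscosity solutions of $\partial_tU_n=\psi(\nabla U_n)\,\mathrm{div}(\nabla\phi_n(\nabla U_n))$, $U_n(\cdot,0)=U_0$, for any regular norms $\phi_n\to\phi$ locally uniformly (if $\phi$ is regular, $U$ is itself the viscosity solution). A family of hypersurfaces $\partial E_t$, $t\ge0$, is a solution to the flow if there is a uniformly continuous $U_0$ with $E_0=\{U_0\le0\}$, $\partial E_0=\{U_0=0\}$, and $\partial E_t=\{U(\cdot,t)=0\}$ for all $t\ge 0$. For nonregular $\phi$, ''$\partial E$ solves the translator equation'' is meant in the sense that $\partial E+te_2$ is a solution to the flow in this sense. A complete graphical translator is a solution of the form $\partial E_t=\partial E_0+ct\,e_2$, $c\in\mathbb{R}$, where $\partial E_0$ is a complete hypersurface which solves $c\,e_2\cdot\nu(p)=-\psi(\nu(p))H_\phi(p,E_0)$ and is the graph of a function $u:\Omega\to\mathbb{R}$,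 with $\Omega\subseteq\mathbb{R}$ open.
   Formalization: For non-regular φ, ∂E is the graph of u over I together with upward vertical half-lines at endpoints of I that belong to I; the literal graph claim fails e.g. for the ℓ¹ norm, whose translator bounds a half-strip. For regular φ, I is open and ∂E is literally the graph. *)

(* Defs.v *)
From HB Require Import structures.
From mathcomp Require Import all_boot all_order all_algebra.
From mathcomp Require Import all_classical all_reals all_analysis.

Set Implicit Arguments.
Unset Strict Implicit.
Unset Printing Implicit Defensive.

Import Order.TTheory GRing.Theory Num.Theory.
Import numFieldNormedType.Exports.

Local Open Scope classical_set_scope.
Local Open Scope ring_scope.

(* Points (x, z) of the plane are pairs in [R * R]; space-time points are pairs
   [(p, t)] in [R * R * R]. *)

Section Calculus.
Context {R : realType}.

(* All directional derivatives exist and are continuous; in finite dimension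
   this is C^1 on the open set A. *)
Definition C1_on (V : normedModType R) (A : set V) (f : V -> R) : Prop :=
  forall v p, A p -> derivable f p v /\ {for p, continuous (fun q => 'D_v f q)}.

Definition C2_on (V : normedModType R) (A : set V) (f : V -> R) : Prop :=
  C1_on A f /\ forall v, C1_on A (fun q => 'D_v f q).

Definition e1 : R * R := (1, 0).
Definition e2 : R * R := (0, 1).

Definition dx (f : R * R -> R) (p : R * R) : R := 'D_e1 f p.
Definition dz (f : R * R -> R) (p : R * R) : R := 'D_e2 f p.
Definition dxx (f : R * R -> R) : R * R -> R := dx (dx f).
Definition dxz (f : R * R -> R) : R * R -> R := dz (dx f).
Definition dzz (f : R * R -> R) : R * R -> R := dz (dz f).

Definition frontier (T : topologicalType) (A : set T) : set T :=
  closure A `\` interior A.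

End Calculus.

Section Norms.
Context {R : realType}.

Definition is_norm (phi : R * R -> R) : Prop :=
  [/\ forall p, 0 <= phi p,
      forall p, phi p = 0 -> p = 0,
      forall a p, phi (a *: p) = `|a| * phi p &
      forall p q, phi (p + q) <= phi p + phi q].

(* The Hessian of f is bounded below by lambda Id away from the origin. *)
Definition uniformly_convex (f : R * R -> R) : Prop :=
  exists2 lambda : R, 0 < lambda & forall (p : R * R) (a b : R), p != 0 ->
    lambda * (a ^+ 2 + b ^+ 2) <=
      dxx f p * a ^+ 2 + 2 * dxz f p * (a * b) + dzz f p * b ^+ 2.

Definition regular_norm (phi : R * R -> R) : Prop :=
  [/\ is_norm phi,
      C2_on [set p | p != 0] phi &
      uniformly_convex (fun p => phi p ^+ 2)].

End Norms.

Section LevelSetEquation.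
Context {R : realType}.
Implicit Types (phi psi : R * R -> R) (U : R * R * R -> R).

(* psi(p) tr(D^2 phi(p) X), so that psi(grad U) div(grad phi(grad U)) is
   F(grad U, D^2 U).  The symmetric matrix X is the triple of its entries
   (X_xx, X_xz, X_zz). *)
Definition level_set_op phi psi (pX : R * R * (R * R * R)) : R :=
  let: (p, (a, b, c)) := pX in
  psi p * (dxx phi p * a + 2 * dxz phi p * b + dzz phi p * c).

(* F is singular at p = 0 (D^2 phi is homogeneous of degree -1): viscosity
   solutions are defined through its semicontinuous envelopes. *)
Definition level_set_op_upper phi psi (pX : R * R * (R * R * R)) : \bar R :=
  limf_esup (fun qY => (level_set_op phi psi qY)%:E)
    (within [set qY | qY.1 != 0] (nbhs pX)).

Definition level_set_op_lower phi psi (pX : R * R * (R * R * R)) : \bar R :=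
  limf_einf (fun qY => (level_set_op phi psi qY)%:E)
    (within [set qY | qY.1 != 0] (nbhs pX)).

Definition sx : R * R * R := (e1, 0).
Definition sz : R * R * R := (e2, 0).
Definition st : R * R * R := (0, 1).

Definition space_jet (g : R * R * R -> R) (q : R * R * R) :
    R * R * (R * R * R) :=
  (('D_sx g q, 'D_sz g q),
   ('D_sx (fun q' => 'D_sx g q') q,
    'D_sz (fun q' => 'D_sx g q') q,
    'D_sz (fun q' => 'D_sz g q') q)).

Definition viscosity_subsolution phi psi U : Prop :=
  forall g : R * R * R -> R, C2_on [set q : R * R * R | 0 < q.2] g ->
  forall q : R * R * R, 0 < q.2 ->
  (\forall q' \near q, U q' - g q' <= U q - g q) ->
  (('D_st g q)%:E <= level_set_op_upper phi psi (space_jet g q))%E.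

Definition viscosity_supersolution phi psi U : Prop :=
  forall g : R * R * R -> R, C2_on [set q : R * R * R | 0 < q.2] g ->
  forall q : R * R * R, 0 < q.2 ->
  (\forall q' \near q, U q - g q <= U q' - g q') ->
  (level_set_op_lower phi psi (space_jet g q) <= ('D_st g q)%:E)%E.

(* Uniform continuity on R^2 x [0, T] for every T: for uniformly continuous
   initial data this is the class in which the viscosity solution exists and
   is unique. *)
Definition unif_continuous_in_finite_time U : Prop :=
  forall T e : R, 0 < T -> 0 < e -> exists2 d : R, 0 < d &
    forall q q' : R * R * R,
      0 <= q.2 <= T -> 0 <= q'.2 <= T -> `|q - q'| < d -> `|U q - U q'| < e.

Definition viscosity_solution phi psi (U0 : R * R -> R) U : Prop :=
  [/\ unif_continuous_in_finite_time U,
      forall p, U (p, 0) = U0 p,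
      viscosity_subsolution phi psi U &
      viscosity_supersolution phi psi U].

(* The continuous solution U of the level set equation for an arbitrary norm
   phi: the locally uniform limit on R^2 x [0, +oo[ of the viscosity solutions
   U_n for regular norms phi_n -> phi, whatever the approximation.  That the
   U_n exist, are unique and converge is the classical well-posedness theory,
   so this determines U on t >= 0.  If phi is regular, U is itself the
   viscosity solution. *)
Definition level_set_solution phi psi (U0 : R * R -> R) U : Prop :=
  [/\ {within [set q : R * R * R | 0 <= q.2], continuous U},
      forall p, U (p, 0) = U0 p,
      regular_norm phi -> viscosity_solution phi psi U0 U &
      forall (phi_ : nat -> R * R -> R) (U_ : nat -> R * R * R -> R),
        (forall n, regular_norm (phi_ n)) ->
        (forall K, compact K -> {uniform K, phi_ @ \oo --> phi}) ->
        (forall n, viscosity_solution (phi_ n) psi U0 (U_ n)) ->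
        forall K : set (R * R * R), compact K -> K `<=` [set q | 0 <= q.2] ->
          {uniform K, U_ @ \oo --> U}].

(* The family of hypersurfaces [frontier (E t)], t >= 0, is a solution to
   the flow. *)
Definition anisotropic_flow phi psi (E : R -> set (R * R)) : Prop :=
  exists (U0 : R * R -> R) (U : R * R * R -> R),
    [/\ unif_continuous U0,
        level_set_solution phi psi U0 U,
        E 0 = [set p | U0 p <= 0],
        frontier (E 0) = [set p | U0 p = 0] &
        forall t, 0 <= t -> frontier (E t) = [set p | U (p, t) = 0]].

End LevelSetEquation.

Section Graphs.
Context {R : realType}.
Implicit Types (I : set R) (u : R -> R) (phi psi : R * R -> R).

(* E + t e_2 *)
Definition shift_up (E : set (R * R)) (t : R) : set (R * R) :=
  [set p | E (p.1, p.2 - t)].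

Definition graph I u : set (R * R) := [set p | I p.1 /\ p.2 = u p.1].

(* The graph together with the vertical half-lines issuing upwards from its
   end points, if any (none when I is open): these occur for crystalline phi,
   e.g. the translator of the l^1 norm is the boundary of a half-strip. *)
Definition completed_graph I u : set (R * R) :=
  graph I u `|` [set p | [/\ I p.1, ~ interior I p.1 & u p.1 <= p.2]].

(* The complement of the open strict epigraph of u, so that (-u', 1) is the
   outer normal on the graph. *)
Definition below_graph I u : set (R * R) :=
  [set p | ~ (interior I p.1 /\ u p.1 < p.2)].

(* - psi(-u', 1) (phi_x(-u', 1))' = 1, that is e_2 . nu = - psi(nu) H_phi along
   the graph of u for the normal direction (-u', 1). *)
Definition translator_equation phi psi I u : Prop :=
  forall x, I x ->
    derivable (fun y : R => dx phi (- derive1 u y, 1)) x 1 /\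
    - psi (- derive1 u x, 1) *
      derive1 (fun y : R => dx phi (- derive1 u y, 1)) x = 1.

Definition translator_ode phi psi I u : Prop :=
  [/\ C2_on I u,
      forall x, I x ->
        psi (- derive1 u x, 1) * dxx phi (- derive1 u x, 1) *
          derive1 (derive1 u) x = 1,
      u 0 = 0 &
      derive1 u 0 = 0].

(* u is the unique solution of the initial value problem and the open interval
   I is its maximal interval of existence. *)
Definition maximal_translator_solution phi psi I u : Prop :=
  [/\ open I, is_interval I, I 0, translator_ode phi psi I u &
      forall (J : set R) (v : R -> R), open J -> is_interval J -> J 0 ->
        translator_ode phi psi J v ->
        J `<=` I /\ forall x, J x -> v x = u x].

End Graphs.

(* Main.v *)
(* Write f(s) = phi(-s, 1) and w(s) = psi(-s, 1).  For regular phi let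
   L'' = w f''; then u is the Legendre transform of L, because L'(u') = x is
   the translator equation integrated once.  With
   l(s) = L(s) - al s + h >= c (1 + |s|) and K the convex set on which
   s x - z <= l(s) for all s, the dilated translators lam K + (t / lam) e_2 are
   again solutions and they foliate the plane, so lam, as a function of
   (x, z, t), has level sets moving by the flow; U = cutoff (1 - lam),
   recentered, is the viscosity solution.

   For regular phi_n converging to an arbitrary norm phi, two integrations by
   parts in L_n'' = w f_n'' show that L_n converges locally uniformly modulo
   affine functions; the limit L defines u and U.  The solutions U_n with
   initial datum U(., 0) are squeezed by comparison between foliations built on
   modifications of L_n.  Comparison holds on compact boxes; the far field is
   controlled by one-dimensional barriers, since the foliation becomes
   independent of z as z -> +oo. *)

Require Import Defs.
From HB Require Import structures.
From mathcomp Require Import all_boot all_order all_algebra.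
From mathcomp Require Import all_classical all_reals all_analysis.
From mathcomp Require Import ring lra.

Import Order.TTheory GRing.Theory Num.Theory.
Import numFieldNormedType.Exports.

Local Open Scope classical_set_scope.
Local Open Scope ring_scope.

(** * Calculus on the line and in normed modules *)

(** In the directions (s, -1) the function l is the support function of K. The bound l >= c (1 +
    |s|) puts the centre of the dilations inside K, so the leaves are nested and [dilation] is
    Lipschitz. The curvature of lam K is that of K divided by lam, hence the speed 1 / lam. Leaves
    with lam < 1/2 are discarded to keep 1 / lam bounded; the cutoff, constant for lam outside
    [1/2, 3/2], hides this.

    No regularity of [dilation] beyond Lipschitz is assumed: quadratic expansions at a point are
    derived and suffice. Since the barriers carry such expansions, comparison is a maximum principle
    at one point, without doubling of variables. An error C (dz - s dx)^2 is harmless however large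
    C is: the operator ignores second derivatives along the gradient.

    The obstacle is uniformity in n. L_n tends to L only locally uniformly, and convexity carries
    closeness to infinite slopes from below only. The closeness asked of L_n must not depend on
    phi_n, whereas the far-field radii may, since they are used for one n at a time. *)

Section RealCalculus.
Context {R : realType}.
Implicit Types (f g h : R -> R) (x y a b e d k : R).

Lemma continuous_epsP f x : {for x, continuous f} <->
  forall e, 0 < e -> exists2 d, 0 < d & forall y, `|y - x| < d -> `|f y - f x| < e.
Proof.
split.
- move=> /cvgrPdist_lt fx e e0; have /nbhs_ballP[d /= d0 dfx] := fx e e0.
  exists d => // y yx; rewrite distrC; apply: dfx.
  by rewrite /ball /= distrC.
- move=> fx; apply/cvgrPdist_lt => e e0; have [d d0 dfx] := fx e e0.
  apply/nbhs_ballP; exists d => //= y; rewrite /ball /= => xy.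
  by rewrite distrC; apply: dfx; rewrite distrC.
Qed.

Lemma is_derive1_epsP f x a : is_derive x 1 f a <->
  forall e, 0 < e -> exists2 d, 0 < d & forall k, `|k| < d ->
    `|f (x + k) - f x - a * k| <= e * `|k|.
Proof.
split.
- move=> [dfx fxa] e e0.
  move: dfx => /cvg_ex[l fl].
  have la : l = a by rewrite -fxa /derive; apply/esym/cvg_lim.
  rewrite {}la in fl.
  move/cvgrPdist_le : fl => /(_ e e0) /= /nbhs_ballP[d /= d0 dk].
  exists d => // k kd.
  have [->|k0] := eqVneq k 0; first by rewrite addr0 subrr mulr0 subr0 !normr0 mulr0.
  have /= := dk k; rewrite /ball /= sub0r normrN => /(_ kd k0).
  rewrite /shift /= /GRing.scale /= mulr1 (addrC k x) => H.
  have -> : f (x + k) - f x - a * k = - ((a - k^-1 * (f (x + k) - f x)) * k).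
    by field.
  by rewrite normrN normrM ler_wpM2r.
- move=> H.
  have fl : h^-1 *: ((f \o shift x) (h *: (1:R)) - f x) @[h --> 0^'] --> a.
    apply/cvgrPdist_le => e e0; have [d d0 dk] := H e e0.
    apply/nbhs_ballP; exists d => //= k; rewrite /ball /= sub0r normrN => kd k0.
    rewrite /shift /= /GRing.scale /= mulr1 (addrC k x).
    have k0' : 0 < `|k| by rewrite normr_gt0.
    rewrite -(ler_pM2r k0') -normrM.
    have -> : (a - k^-1 * (f (x + k) - f x)) * k = - (f (x + k) - f x - a * k).
      by field.
    by rewrite normrN; exact: dk.
  apply: DeriveDef; first by apply/cvg_ex; exists a.
  exact/cvg_lim.
Qed.

Lemma is_derive1_continuous f x a : is_derive x 1 f a -> {for x, continuous f}.
Proof. by move=> [+ _] => /derivable1_diffP /differentiable_continuous. Qed.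

Lemma MVT_le f f' (a b : R) : a <= b ->
  (forall x, a <= x <= b -> is_derive x 1 f (f' x)) ->
  exists2 c, a <= c <= b & f b - f a = f' c * (b - a).
Proof.
move=> ab df.
have [||c] := @MVT_segment _ f f' a b ab.
- by move=> x; rewrite in_itv /= => /andP[/ltW ax /ltW xb]; apply: df; rewrite ax.
- apply: derivable_within_continuous => x; rewrite in_itv /= => /df[]//.
- by rewrite in_itv /= => acb fc; exists c.
Qed.

Lemma MVT_norm_le f f' (x y k : R) :
  (forall c, `|c - x| <= `|y - x| -> is_derive c 1 f (f' c)) ->
  (forall c, `|c - x| <= `|y - x| -> `|f' c| <= k) ->
  `|f y - f x| <= k * `|y - x|.
Proof.
move=> df f'k; have [xy|yx] := leP x y.
- have [c|c /andP[xc cy] ->] := @MVT_le f f' x y xy.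
    by move=> /andP[xc cy]; apply: df; rewrite !ger0_norm ?subr_ge0 ?lerD2r//.
  rewrite normrM ler_wpM2r// f'k// !ger0_norm ?subr_ge0 ?lerD2r//.
- have [c|c /andP[xc cy]] := @MVT_le f f' y x (ltW yx).
    move=> /andP[xc cy]; apply: df; rewrite !(distrC _ x) !ger0_norm ?subr_ge0 ?lerD2l ?lerN2//.
    exact: ltW.
  rewrite distrC => ->; rewrite normrM (distrC x y) ler_wpM2r// f'k//.
  by rewrite !(distrC _ x) !ger0_norm ?subr_ge0 ?lerD2l ?lerN2// ltW.
Qed.

Lemma derive_ge0_le f f' (a b : R) : a <= b ->
  (forall x, a <= x <= b -> is_derive x 1 f (f' x)) ->
  (forall x, a <= x <= b -> 0 <= f' x) -> f a <= f b.
Proof.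
move=> ab df f'0; have [c acb fab] := MVT_le _ _ _ _ ab df.
by rewrite -subr_ge0 fab mulr_ge0 ?subr_ge0 ?f'0.
Qed.

(** The fundamental theorem is applied to integrals from a fixed left end point. The primitives
    [Q n] from [- n.+1], normalised at 0, agree where both are available, and near any x a single
    index serves, so they glue. *)
Lemma antiderivative h : continuous h ->
  exists H : R -> R, H 0 = 0 /\ forall x, is_derive x 1 H (h x).
Proof.
move=> ch.
pose P (n : nat) (x : R) := (\int[lebesgue_measure]_(t in [set` `[(- (n.+1%:R) : R), x]]) (h t))%R.
have itg (a u : R) : lebesgue_measure.-integrable `[a, u] (EFin \o h).
  apply: continuous_compact_integrable; first exact: segment_compact.
  exact: continuous_subspaceT.
have dP n x : - (n.+1%:R) < x -> is_derive x 1 (P n) (h x).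
  move=> nx; have x1 : x < x + 1 by rewrite ltrDl.
  have [dF Fx] := @continuous_FTC1_closed R h (- (n.+1%:R)) x (x + 1) x1 (itg _ _) nx (ch x).
  by apply: DeriveDef; [exact: dF|rewrite -derive1E; exact: Fx].
pose Q n x := P n x - P n 0.
have Qn n m x : - (n.+1%:R) < x -> (n <= m)%N -> Q n x = Q m x.
  move=> nx nm.
  have mx : - (m.+1%:R) < x.
    by apply: le_lt_trans nx; rewrite lerN2 ler_nat ltnS.
  pose D y := P n y - P m y.
  have dD y : `|y - 0| <= `|x - 0| -> - n.+1%:R < x -> (- n.+1%:R < y) -> is_derive y 1 D 0.
    move=> _ _ ny.
    have my : - (m.+1%:R) < y.
      by apply: le_lt_trans ny; rewrite lerN2 ler_nat ltnS.
    have := is_deriveB (dP n y ny) (dP m y my); rewrite subrr; exact.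
  have n0 : - (n.+1%:R) < 0 :> R by rewrite oppr_lt0 ltr0n.
  suff : D x = D 0 by rewrite /D /Q; lra.
  have [x0|x0] := leP 0 x.
    have [c|c _] := @MVT_le D (fun=> 0) 0 x x0; last by rewrite mul0r => /eqP; rewrite subr_eq0 => /eqP.
    move=> /andP[c0 cx]; apply: dD => //; last exact: lt_le_trans c0.
    by rewrite !subr0 !ger0_norm.
  have [c|c _] := @MVT_le D (fun=> 0) x 0 (ltW x0); last by rewrite mul0r => /eqP; rewrite subr_eq0 => /eqP.
  move=> /andP[c0 cx]; apply: dD => //; last exact: lt_le_trans c0.
  by rewrite !subr0 !ler0_norm ?lerN2 // ltW.
exists (fun x => Q (Num.truncn `|x|) x); split; first by rewrite /Q subrr.
move=> x.
have trn (y : R) : - (Num.truncn `|y|).+1%:R < y.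
  have := truncnS_gt `|y|; rewrite ltrNl; apply: le_lt_trans.
  by rewrite -normrN ler_norm.
set N := (Num.truncn (`|x| + 1)).
have QN y : `|y| <= `|x| + 1 -> Q (Num.truncn `|y|) y = Q N y.
  by move=> yx; apply: Qn; [exact: trn|exact: le_truncn].
have Nx : - (N.+1%:R) < x.
  apply: le_lt_trans (trn x); rewrite lerN2 ler_nat ltnS; apply: le_truncn; lra.
have dQ : is_derive x 1 (Q N) (h x).
  have := is_deriveB (dP N x Nx) (is_derive_cst (P N 0) x 1); rewrite subr0; exact.
apply: near_eq_is_derive dQ.
near=> y; apply/esym/QN.
have : `|x - y| < 1 by near: y; apply: cvgr_dist_lt.
have := ler_normB x (x - y); rewrite (_ : x - (x - y) = y); last by ring.
lra.
Unshelve. all: by end_near. Qed.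

(** Pointwise forms of the derivation rules, which unify with the abstractions used below;
    [is_derive_eqf] postpones the algebra on the value of the derivative. *)
Lemma is_derive_cstf (c x : R) : is_derive x 1 (fun=> c) 0.
Proof. exact: is_derive_cst. Qed.

Lemma is_derive_idf (x : R) : is_derive x 1 (fun y : R => y) 1.
Proof. exact: is_derive_id. Qed.

Lemma is_derive_addf f g x a b : is_derive x 1 f a -> is_derive x 1 g b ->
  is_derive x 1 (fun y => f y + g y) (a + b).
Proof. exact: is_deriveD. Qed.

Lemma is_derive_subf f g x a b : is_derive x 1 f a -> is_derive x 1 g b ->
  is_derive x 1 (fun y => f y - g y) (a - b).
Proof. exact: is_deriveB. Qed.

Lemma is_derive_oppf f x a : is_derive x 1 f a -> is_derive x 1 (fun y => - f y) (- a).
Proof. exact: is_deriveN. Qed.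

Lemma is_derive_mulf f g x a b : is_derive x 1 f a -> is_derive x 1 g b ->
  is_derive x 1 (fun y => f y * g y) (a * g x + f x * b).
Proof.
move=> df dg; rewrite (_ : a * g x + f x * b = f x *: b + g x *: a); first exact: is_deriveM.
by rewrite addrC (mulrC a).
Qed.

Lemma is_derive_scalef (k : R) f x a : is_derive x 1 f a ->
  is_derive x 1 (fun y => k * f y) (k * a).
Proof. exact: is_deriveZ. Qed.

Lemma is_derive_compf f g x a b : is_derive (g x) 1 f a -> is_derive x 1 g b ->
  is_derive x 1 (fun y => f (g y)) (a * b).
Proof. exact: is_derive1_comp. Qed.

Lemma is_derive_ext f g x a : (forall y, f y = g y) -> is_derive x 1 f a ->
  is_derive x 1 g a.
Proof. by move=> /funext ->. Qed.

Lemma is_derive_eqf f x a b : a = b -> is_derive x 1 f a -> is_derive x 1 f b.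
Proof. by move=> ->. Qed.

End RealCalculus.

(** * Directional derivatives, symmetry and bilinearity of second derivatives *)

Section Directional.
Context {R : realType} {V : normedModType R}.
Implicit Types (f : V -> R) (A : set V) (p q v w : V) (s h k : R).

Let addr2K p q v : p + q + v - p = q + v.
Proof. by rewrite addrAC (addrAC p) subrr add0r. Qed.

Lemma is_derive_lineP f p v s d :
  is_derive (p + s *: v) v f d <-> is_derive s 1 (fun h : R => f (p + h *: v)) d.
Proof.
have E : (fun h : R => h^-1 *: ((f \o shift (p + s *: v)) (h *: v) - f (p + s *: v))) =
   (fun h : R => h^-1 *: (((fun h => f (p + h *: v)) \o shift s) (h *: (1:R)) - f (p + s *: v))).
  apply/funext => h /=; congr (_ *: (f _ - _)).
  by rewrite /shift /= [_%:A]mulr1 scalerDl addrCA.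
have D1 : derivable f (p + s *: v) v = derivable (fun h : R => f (p + h *: v)) s 1.
  exact: (congr1 (fun F : R -> R => cvg (F @ 0^')) E).
have D2 : 'D_v f (p + s *: v) = 'D_1 (fun h : R => f (p + h *: v)) s.
  exact: (congr1 (fun F : R -> R => lim (F @ 0^')) E).
split=> -[dfv <-].
  by apply: DeriveDef; [rewrite -D1|rewrite D2].
by apply: DeriveDef; [rewrite D1|rewrite D2].
Qed.

Lemma is_derive0_lineP f p v d :
  is_derive p v f d <-> is_derive (0 : R) 1 (fun h : R => f (p + h *: v)) d.
Proof. by rewrite -is_derive_lineP scale0r addr0. Qed.

Lemma continuous_norm_epsP f p : {for p, continuous f} <->
  forall e : R, 0 < e -> exists2 d : R, 0 < d & forall q, `|q - p| < d -> `|f q - f p| < e.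
Proof.
split.
- move=> /cvgrPdist_lt fx e e0; have /nbhs_ballP[d /= d0 dfx] := fx e e0.
  exists d => // y yx; rewrite distrC; apply: dfx.
  by rewrite -ball_normE /ball /= distrC.
- move=> fx; apply/cvgrPdist_lt => e e0; have [d d0 dfx] := fx e e0.
  apply/nbhs_ballP; exists d => //= y; rewrite -ball_normE /ball /= => xy.
  by rewrite distrC; apply: dfx; rewrite distrC.
Qed.

Lemma open_normP A p : open A -> A p ->
  exists2 d : R, 0 < d & forall q, `|q - p| < d -> A q.
Proof.
move=> oA Ap; have /nbhs_ballP[d /= d0 dA] : nbhs p A by exact: open_nbhs_nbhs.
by exists d => // q qp; apply: dA; rewrite -ball_normE /= distrC.
Qed.

Lemma deriveZ_dir f p v k : derivable f p v -> is_derive p (k *: v) f (k * 'D_v f p).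
Proof.
move=> /derivableP /is_derive0_lineP /is_derive1_epsP fv.
apply/is_derive0_lineP/is_derive1_epsP => e e0.
have [d d0 fd] := fv (e / (`|k| + 1)) (divr_gt0 e0 (ltr_wpDl (normr_ge0 _) ltr01)).
have k1 : 0 < `|k| + 1 by rewrite ltr_wpDl.
exists (d / (`|k| + 1)); first exact: divr_gt0.
move=> h hd; have hkd : `|h * k| < d.
  rewrite normrM; move: hd; rewrite ltr_pdivlMr//; apply: le_lt_trans.
  by rewrite ler_wpM2l// lerDl.
have := fd _ hkd; rewrite !add0r !scale0r scalerA.
rewrite (_ : k * 'D_v f p * h = 'D_v f p * (h * k)); last by ring.
move=> /le_trans; apply; rewrite normrM mulrACA -[leRHS]mulr1.
rewrite -mulrA [X in _ * X](_ : _ = `|h| * (`|k| / (`|k| + 1))); last by field; rewrite gt_eqF.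
rewrite mulr1 ler_wpM2l ?(ltW e0)// ler_piMr// ler_pdivrMr// mul1r lerDl//.
Qed.

(** The mean value theorem along w, started from points p + s v near p: the derivative at the
    intermediate point is uniformly close to the one at p. This replaces full differentiability,
    which [C1_on] does not provide directly. *)
Lemma C1_on_continuous_along A f p v w : open A -> C1_on A f -> A p ->
  forall e : R, 0 < e -> exists2 d : R, 0 < d & forall s h, `|s| < d -> `|h| < d ->
    exists2 c : R, `|c| <= `|h| &
    A (p + s *: v + c *: w) /\
    f (p + s *: v + h *: w) - f (p + s *: v) = 'D_w f (p + s *: v + c *: w) * h
    /\ `|'D_w f (p + s *: v + c *: w) - 'D_w f p| < e.
Proof.
move=> oA Cf Ap e e0.
have [r r0 rA] := open_normP _ _ oA Ap.
have [_ /continuous_norm_epsP/(_ e e0)[r' r'0 fr']] := Cf w p Ap.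
set m := Num.min r r'.
have m0 : 0 < m by rewrite lt_min r0.
set N := `|v| + `|w| + 1.
have N0 : 0 < N by rewrite /N addrC ltr_wpDr ?addr_ge0.
exists (m / N); first exact: divr_gt0.
move=> s h; rewrite !ltr_pdivlMr// => sd hd.
have near (c : R) : `|c| <= `|h| -> `|p + s *: v + c *: w - p| < m.
  move=> ch; rewrite addr2K.
  apply: le_lt_trans (ler_normD _ _) _; rewrite !normrZ.
  have [sh|hs] := leP `|s| `|h|.
  - apply: le_lt_trans hd; rewrite /N !mulrDr mulr1 -addrA lerD//.
      by rewrite ler_wpM2r.
    by rewrite -[leLHS]addr0 lerD// ler_wpM2r.
  - apply: le_lt_trans sd; rewrite /N !mulrDr mulr1 -addrA lerD//.
    rewrite -[leLHS]addr0 lerD// ler_wpM2r//.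
    by rewrite (le_trans ch)// ltW.
have nA (c : R) : `|c| <= `|h| -> A (p + s *: v + c *: w).
  by move=> ch; apply: rA; apply: lt_le_trans (near c ch) _; rewrite ge_min lexx.
pose g (c : R) := f (p + s *: v + c *: w).
pose g' (c : R) := 'D_w f (p + s *: v + c *: w).
have dg (c : R) : `|c| <= `|h| -> is_derive c 1 g (g' c).
  by move=> ch; apply/is_derive_lineP/derivableP; have [] := Cf w _ (nA c ch).
have [c ch gh] : exists2 c : R, `|c| <= `|h| & g h - g 0 = g' c * (h - 0).
  have [h0|h0] := leP 0 h.
    have [|c /andP[c0 ch] ->] := MVT_le g g' 0 h h0.
      by move=> x /andP[x0 xh]; apply: dg; rewrite !ger0_norm.
    by exists c => //; rewrite !ger0_norm.
  have [|c /andP[hc c0] E] := MVT_le g g' h 0 (ltW h0).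
    by move=> x /andP[hx x0]; apply: dg; rewrite !ler0_norm ?lerN2// ltW.
  exists c; first by rewrite !ler0_norm ?lerN2// ltW.
  by rewrite -opprB E sub0r mulrN opprK subr0.
exists c => //; split; first exact: nA.
split; last by apply: fr'; apply: lt_le_trans (near c ch) _; rewrite ge_min lexx orbT.
by move: gh; rewrite /g /g' scale0r addr0 subr0.
Qed.

(** An increment along v + w is an increment along v followed by one along w from a moved base
    point; the latter is controlled by [C1_on_continuous_along]. *)
Lemma C1_on_deriveD A f p v w : open A -> C1_on A f -> A p ->
  is_derive p (v + w) f ('D_v f p + 'D_w f p).
Proof.
move=> oA Cf Ap; apply/is_derive0_lineP/is_derive1_epsP => e e0.
have e2 : 0 < e / 2 by rewrite divr_gt0.
have [d1 d10 H1] := C1_on_continuous_along A f p v w oA Cf Ap _ e2.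
have [dv _] := Cf v p Ap.
have /derivableP/is_derive0_lineP/is_derive1_epsP/(_ _ e2)[d2 d20 H2] := dv.
exists (Num.min d1 d2); first by rewrite lt_min d10.
move=> h; rewrite lt_min => /andP[h1 h2].
have [c ch [_ [E Ec]]] := H1 h h h1 h1.
have := H2 h h2; rewrite !add0r !scale0r !addr0 => {}H2.
rewrite scalerDr addrA.
have -> : f (p + h *: v + h *: w) - f p - ('D_v f p + 'D_w f p) * h =
   (f (p + h *: v) - f p - 'D_v f p * h) +
   ('D_w f (p + h *: v + c *: w) - 'D_w f p) * h.
  by rewrite mulrBl -E; ring.
apply: le_trans (ler_normD _ _) _.
rewrite (_ : e * `|h| = e / 2 * `|h| + e / 2 * `|h|); last by field.
by rewrite lerD// normrM ler_wpM2r// ltW.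
Qed.

(** The mixed second difference is the increment along w of the difference of f between two points h
    v apart; one mean value estimate in each direction gives its leading term. *)
Lemma C2_on_mixed A f p v w : open A -> C2_on A f -> A p -> forall e : R, 0 < e ->
  exists2 d : R, 0 < d & forall h, `|h| < d ->
  `|f (p + h *: v + h *: w) - f (p + h *: v) - f (p + h *: w) + f p
     - 'D_v (fun q => 'D_w f q) p * (h * h)| <= e * (h * h).
Proof.
move=> oA [Cf Cf2] Ap e e0.
have [r r0 rA] := open_normP _ _ oA Ap.
have e1 : 0 < e by [].
have [d1 d10 H1] := C1_on_continuous_along A (fun q => 'D_w f q) p w v oA (Cf2 w) Ap _ e1.
set N := `|v| + `|w| + 1.
have N0 : 0 < N by rewrite /N addrC ltr_wpDr ?addr_ge0.
exists (Num.min d1 (r / N)); first by rewrite lt_min d10 divr_gt0.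
move=> h; rewrite lt_min ltr_pdivlMr// => /andP[hd hr].
have near (c b : R) : `|c| <= `|h| -> `|b| <= `|h| -> A (p + b *: v + c *: w).
  move=> ch bh; apply: rA; rewrite addr2K.
  apply: le_lt_trans (ler_normD _ _) _; rewrite !normrZ.
  apply: le_lt_trans hr; rewrite /N !mulrDr mulr1 -addrA lerD//.
    by rewrite ler_wpM2r.
  by rewrite -[leLHS]addr0 lerD// ler_wpM2r.
pose g (c : R) := f (p + h *: v + c *: w) - f (p + c *: w).
pose g' (c : R) := 'D_w f (p + h *: v + c *: w) - 'D_w f (p + c *: w).
have dg (c : R) : `|c| <= `|h| -> is_derive c 1 g (g' c).
  move=> ch; apply: is_deriveB.
    apply/is_derive_lineP/derivableP.
    by have [] := Cf w _ (near c h ch (lexx _)).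
  apply/is_derive_lineP/derivableP.
  have := near c 0 ch; rewrite normr0 scale0r addr0 => /(_ (normr_ge0 _)) Ac.
  by have [] := Cf w _ Ac.
have E : g h - g 0 = f (p + h *: v + h *: w) - f (p + h *: v) - f (p + h *: w) + f p.
  by rewrite /g !scale0r !addr0; ring.
rewrite -E.
pose g2 (c : R) := g c - 'D_v (fun q => 'D_w f q) p * h * c.
have -> : g h - g 0 - 'D_v (fun q => 'D_w f q) p * (h * h) = g2 h - g2 0.
  by rewrite /g2; ring.
have -> : e * (h * h) = e * `|h| * `|h - 0|.
  by rewrite subr0 -mulrA -normrM ger0_norm// -expr2 sqr_ge0.
apply: (MVT_norm_le g2 (fun c => g' c - 'D_v (fun q => 'D_w f q) p * h)) => c; rewrite !subr0 => ch.
  apply: is_deriveB; first exact: dg.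
  have := @is_deriveZ R R R id ('D_v (fun q => 'D_w f q) p * h) c 1 1 (is_derive_id _ _).
  by rewrite /GRing.scale /= mulr1.
have [b bh [_ [Eb Eb2]]] := H1 c h (le_lt_trans ch hd) hd.
rewrite /g' (addrAC p) Eb -mulrBl normrM.
by rewrite ler_wpM2r// ltW.
Qed.

(** The second difference of [C2_on_mixed] is symmetric in v and w, so both mixed derivatives are
    its limit after division by h^2. *)
Lemma C2_on_Schwarz A f p v w : open A -> C2_on A f -> A p ->
  'D_v (fun q => 'D_w f q) p = 'D_w (fun q => 'D_v f q) p.
Proof.
move=> oA Cf Ap; set a := LHS; set b := RHS; apply/eqP; rewrite -subr_eq0.
rewrite -normr_le0; apply/ler_addgt0Pr => e e0; rewrite add0r.
have e2 : 0 < e / 2 by rewrite divr_gt0.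
have [d1 d10 H1] := C2_on_mixed A f p v w oA Cf Ap _ e2.
have [d2 d20 H2] := C2_on_mixed A f p w v oA Cf Ap _ e2.
set h := Num.min d1 d2 / 2.
have h0 : 0 < h by rewrite divr_gt0// lt_min d10.
have hm : h < Num.min d1 d2 by rewrite /h ltr_pdivrMr// ltr_pMr ?ltr1n// lt_min d10.
have /H1 : `|h| < d1 by rewrite gtr0_norm// (lt_le_trans hm)// ge_min lexx.
have /H2 : `|h| < d2 by rewrite gtr0_norm// (lt_le_trans hm)// ge_min lexx orbT.
rewrite -/a -/b (addrAC p) => {}H2 {}H1.
have hh0 : 0 < h * h by rewrite mulr_gt0.
rewrite -(ler_pM2r hh0) -{1}(gtr0_norm hh0) -normrM.
set D := f (p + h *: v + h *: w) in H1 H2.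
have -> : (a - b) * (h * h) = (D - f (p + h *: w) - f (p + h *: v) + f p - b * (h * h)) -
  (D - f (p + h *: v) - f (p + h *: w) + f p - a * (h * h)) by ring.
apply: le_trans (ler_normB _ _) _.
rewrite (_ : e * (h * h) = e / 2 * (h * h) + e / 2 * (h * h)); last by field.
exact: (lerD H2 H1).
Qed.

Lemma C2_on_second A f p v w k : open A -> C2_on A f -> A p ->
  'D_(v + k *: w) (fun q => 'D_(v + k *: w) f q) p =
  'D_v (fun q => 'D_v f q) p + 2 * k * 'D_w (fun q => 'D_v f q) p
  + k ^+ 2 * 'D_w (fun q => 'D_w f q) p.
Proof.
move=> oA [Cf Cf2] Ap.
have H q : A q -> 'D_(v + k *: w) f q = 'D_v f q + k * 'D_w f q.
  move=> Aq; have [_ ->] := C1_on_deriveD A f q v (k *: w) oA Cf Aq.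
  by have [_ ->] := deriveZ_dir f q w k (Cf w q Aq).1.
have C g (a b : V) : C1_on A g -> 'D_(a + k *: b) g p = 'D_a g p + k * 'D_b g p.
  move=> Cg; have [_ ->] := C1_on_deriveD A g p a (k *: b) oA Cg Ap.
  by have [_ ->] := deriveZ_dir g p b k (Cg b p Ap).1.
have -> : 'D_(v + k *: w) (fun q => 'D_(v + k *: w) f q) p =
   'D_(v + k *: w) ((fun q => 'D_v f q) + k *: (fun q => 'D_w f q)) p.
  apply: near_eq_derive; have := open_nbhs_nbhs (conj oA Ap).
  by apply: filterS => q /H.
have d1 u : derivable (fun q => 'D_u f q) p (v + k *: w).
  by have [] := Cf2 u (v + k *: w) p Ap.
rewrite (deriveD (d1 v) (@derivableZ _ _ _ _ k _ _ (d1 w))) (deriveZ k (d1 w)).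
rewrite (C _ v w (Cf2 v)) (C _ v w (Cf2 w)).
rewrite (C2_on_Schwarz A f p v w oA (conj Cf Cf2) Ap).
move: ('D_v (fun q => 'D_v f q) p) ('D_w (fun q => 'D_v f q) p) ('D_w (fun q => 'D_w f q) p) => a b c.
have -> : k *: (b + k * c : R) = k * (b + k * c) by [].
ring.
Qed.

End Directional.

(** * Norms on the plane *)

Section PlaneNorms.
Context {R : realType}.
Implicit Types (phi psi h : R * R -> R) (p q v w : R * R) (s r : R).

Lemma pairZE r (a b : R) : r *: ((a, b) : R * R) = (r * a, r * b).
Proof. by []. Qed.

Lemma pairDE (a b c d : R) : (a, b) + (c, d) = (a + c, b + d) :> R * R.
Proof. by []. Qed.

Lemma pairNE (a b : R) : - (a, b) = (- a, - b) :> R * R.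
Proof. by []. Qed.

Lemma plane_decomp p : p = p.1 *: (e1 : R * R) + p.2 *: (e2 : R * R).
Proof.
by case: p => x z; rewrite /e1 /e2 /= !pairZE pairDE !mulr1 !mulr0 addr0 add0r.
Qed.

Lemma plane_neq0_norm p : p != 0 -> 0 < p.1 ^+ 2 + p.2 ^+ 2.
Proof.
case: p => x z /= xz0; rewrite lt_neqAle addr_ge0 ?sqr_ge0// andbT eq_sym.
rewrite paddr_eq0 ?sqr_ge0// !sqrf_eq0.
by apply: contra xz0 => /andP[/eqP -> /eqP ->].
Qed.

Lemma open_neq0 : open [set p : R * R | p != 0].
Proof.
rewrite (_ : [set p : R * R | _] = ~` [set 0]); first exact/closed_openC/accessible_closed_set1/hausdorff_accessible/norm_hausdorff.
by apply/seteqP; split=> p /=; move=> /eqP.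
Qed.

(** The norm of a pair is the maximum norm, so the unit sphere lies in the compact part of the
    square [-1, 1]^2 where [|p|] is at least 1; this part avoids the origin. *)
Lemma sphere_bounds h : (forall p, p != 0 -> {for p, continuous h}) ->
  exists p1 p2, [/\ p1 != 0, p2 != 0 & forall p, `|p| = 1 -> h p1 <= h p <= h p2].
Proof.
move=> ch.
pose A := (`[-1, 1]%classic `*` `[-1, 1]%classic) `&` [set p : R * R | 1 <= `|p|].
have cA : compact A.
  apply: compact_closedI; first by apply: compact_setX; exact: segment_compact.
  apply: (@preimage_closed _ _ (fun p : R * R => `|p|) [set x | 1 <= x]).
    by move=> p _; exact: norm_continuous.
  exact: closed_ge.
have nA p : A p -> p != 0.
  by move=> [_ /= p1]; apply/eqP => p0; move: p1; rewrite p0 normr0 ler10.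
have Ap p : `|p| = 1 -> A p.
  move=> p1; split=> /=; last by rewrite p1.
  move: p1; rewrite prod_normE => p1.
  have a1 : `|p.1| <= 1 by rewrite -p1 le_max lexx.
  have a2 : `|p.2| <= 1 by rewrite -p1 le_max lexx orbT.
  by rewrite !in_itv /= -!ler_norml.
have A0 : A !=set0.
  exists (1, 0); apply: Ap; rewrite prod_normE /= normr1 normr0.
  by apply/max_idPl; rewrite ler01.
have chA : {within A, continuous h}.
  by apply: continuous_in_subspaceT => p; rewrite inE => /nA; exact: ch.
have [p2 Ap2 H2] := compact_EVT_max A0 cA chA.
have [p1 Ap1 H1] := compact_EVT_min A0 cA chA.
exists p1, p2; split; [exact/nA/set_mem|exact/nA/set_mem|].
by move=> p /Ap/mem_set Hp; rewrite H1// H2.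
Qed.

Lemma homogeneous0_bounds h : (forall p, p != 0 -> {for p, continuous h}) ->
  (forall r p, 0 < r -> p != 0 -> h (r *: p) = h p) ->
  exists p1 p2, [/\ p1 != 0, p2 != 0 & forall p, p != 0 -> h p1 <= h p <= h p2].
Proof.
move=> /sphere_bounds[p1 [p2 [p10 p20 H]]] hh; exists p1, p2; split => // p p0.
have np0 : 0 < `|p| by rewrite normr_gt0.
have := H (`|p|^-1 *: p); rewrite normrZ normfV normr_id mulVf ?gt_eqF// => /(_ erefl).
by rewrite hh// invr_gt0.
Qed.

Section OneNorm.
Context (psi : R * R -> R) (hpsi : is_norm psi).

Lemma norm_ge0 p : 0 <= psi p. Proof. by case: hpsi. Qed.

Lemma normD p q : psi (p + q) <= psi p + psi q. Proof. by case: hpsi. Qed.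

Lemma normZ r p : psi (r *: p) = `|r| * psi p. Proof. by case: hpsi. Qed.

Lemma norm_gt0 p : p != 0 -> 0 < psi p.
Proof.
move=> p0; rewrite lt_neqAle norm_ge0 andbT eq_sym; apply: contra p0 => /eqP.
by case: hpsi => _ + _ _ => /(_ p) /[apply] ->.
Qed.

Lemma normN p : psi (- p) = psi p.
Proof. by rewrite -scaleN1r normZ normrN normr1 mul1r. Qed.

Lemma norm_le_coord x z : psi (x, z) <= `|x| * psi e1 + `|z| * psi e2.
Proof. by rewrite (plane_decomp (x, z)) /= -!normZ; exact: normD. Qed.

Lemma slope_neq0 s : (- s, 1) != 0 :> R * R.
Proof. by apply/eqP => -[_ /eqP]; rewrite oner_eq0. Qed.

Lemma norm_continuous_plane : continuous psi.
Proof.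
move=> p; apply/continuous_norm_epsP => e e0.
set C := psi e1 + psi e2 + 1.
have C0 : 0 < C by rewrite /C addrC ltr_wpDr ?addr_ge0 ?norm_ge0.
have L q : psi q <= C * `|q|.
  case: q => x z; apply: le_trans (norm_le_coord x z) _.
  have x1 : `|x| <= `|(x, z)| by rewrite prod_normE le_max lexx.
  have z1 : `|z| <= `|(x, z)| by rewrite prod_normE le_max lexx orbT.
  have := norm_ge0 e1; have := norm_ge0 e2.
  move: x1 z1; rewrite /C; move: `|(x, z)| (psi e1) (psi e2) => n a b *.
  have := normr_ge0 x; have := normr_ge0 z.
  nra.
exists (e / C); first exact: divr_gt0.
move=> q; rewrite ltr_pdivlMr// mulrC => qp.
rewrite ltr_norml; apply/andP; split.
  have := normD q (p - q); rewrite addrC subrK -(normN (p - q)) opprB => h1.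
  have := L (q - p) => h2; rewrite ltrNl opprB.
  by apply: le_lt_trans qp; apply: le_trans h2; rewrite lerBlDl.
have := normD p (q - p); rewrite addrC subrK => h1.
have := L (q - p) => h2.
by apply: le_lt_trans qp; apply: le_trans h2; rewrite lerBlDl.
Qed.

(** The function w of the overview; with phi in place of psi it is the function f. *)
Definition weight s := psi (- s, 1).

Lemma weight_lipschitz s r : `|weight s - weight r| <= psi e1 * `|s - r|.
Proof.
suff H a b : weight a - weight b <= psi e1 * `|a - b|.
  by rewrite ler_norml H andbT lerNl opprB distrC H.
rewrite /weight lerBlDl.
have -> : (- a, 1) = (- b, 1) + (b - a) *: e1 :> R * R.
  by rewrite /e1 pairZE pairDE mulr1 mulr0 addr0 addKr.
by apply: le_trans (normD _ _) _; rewrite lerD2l normZ mulrC distrC.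
Qed.

Lemma weight_le s : weight s <= psi e1 * `|s| + psi e2.
Proof. by have := norm_le_coord (- s) 1; rewrite normrN normr1 mul1r mulrC. Qed.

Lemma norm_lower_bound : exists2 c : R, 0 < c & forall p, c * `|p| <= psi p.
Proof.
have [p _|p1 [p2 [p10 _ H]]] := @sphere_bounds psi; first exact: norm_continuous_plane.
exists (psi p1); first exact: norm_gt0.
move=> p; have [->|p0] := eqVneq p 0.
  by rewrite normr0 mulr0 norm_ge0.
have np0 : 0 < `|p| by rewrite normr_gt0.
have := H (`|p|^-1 *: p); rewrite normrZ normfV normr_id mulVf ?gt_eqF// => /(_ erefl).
by rewrite normZ normfV normr_id mulrC ler_pdivlMr// => /andP[].
Qed.

Lemma weight_lower_bound : exists2 c : R, 0 < c & forall s, c <= weight s.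
Proof.
have [c c0 H] := norm_lower_bound; exists c => // s.
apply: le_trans (H _); rewrite ler_peMr ?(ltW c0)//.
by rewrite prod_normE /= normr1 le_max lexx orbT.
Qed.

Lemma weight_continuous : continuous weight.
Proof.
move=> s; apply/continuous_epsP => e e0.
have C0 : 0 < psi e1 + 1 by rewrite ltr_wpDl ?norm_ge0.
exists (e / (psi e1 + 1)); first exact: divr_gt0.
move=> r; rewrite ltr_pdivlMr// => h.
apply: le_lt_trans (weight_lipschitz _ _) _; apply: le_lt_trans h.
by rewrite mulrC ler_wpM2l// lerDl.
Qed.

End OneNorm.

Section RegularNorm.
Context (phi : R * R -> R) (rphi : regular_norm phi).

Let hphi : is_norm phi. Proof. by case: rphi. Qed.

Let C2phi : C2_on [set p : R * R | p != 0] phi. Proof. by case: rphi. Qed.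

Let C1phi : C1_on [set p : R * R | p != 0] phi. Proof. by case: C2phi. Qed.

Let scale_line r p v (k : R) : r != 0 ->
  r *: (p + k *: (r^-1 *: v)) = r *: p + k *: v.
Proof. by move=> r0; rewrite scalerDr !scalerA (mulrC r) mulfK. Qed.

Lemma regular_norm_derive p v : p != 0 -> is_derive p v phi ('D_v phi p).
Proof. by move=> p0; apply: derivableP; have [] := C1phi v p p0. Qed.

Lemma regular_norm_derive2 p v w : p != 0 ->
  is_derive p w (fun q => 'D_v phi q) ('D_w (fun q => 'D_v phi q) p).
Proof. by move=> p0; apply: derivableP; have [] := C2phi.2 v w p p0. Qed.

Lemma regular_norm_dirD g p : C1_on [set p : R * R | p != 0] g -> p != 0 ->
  'D_p g p = p.1 * dx g p + p.2 * dz g p.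
Proof.
move=> Cg p0; rewrite [X in 'D_X g p](plane_decomp p).
have [_ ->] := C1_on_deriveD _ _ _ (p.1 *: e1) (p.2 *: e2) open_neq0 Cg p0.
by have [_ ->] := deriveZ_dir g p e1 p.1 (Cg e1 p p0).1;
  have [_ ->] := deriveZ_dir g p e2 p.2 (Cg e2 p p0).1.
Qed.

(** Along its own ray phi is affine: phi (p + h p) = (1 + h) phi p for small h. *)
Lemma norm_Euler p : p != 0 -> p.1 * dx phi p + p.2 * dz phi p = phi p.
Proof.
move=> p0; rewrite -regular_norm_dirD//.
have : is_derive (0 : R) 1 (fun h : R => phi (p + h *: p)) (phi p).
  apply: (@near_eq_is_derive _ _ _ (fun h : R => phi p + h * phi p)).
    near=> h; have h1 : 0 < 1 + h.
      have : `|0 - h| < 1 by near: h; exact: cvgr_dist_lt.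
      by rewrite sub0r normrN ltr_norml => /andP[]; lra.
    rewrite -{3}(scale1r p) -scalerDl normZ// gtr0_norm//; ring.
  apply: is_derive_eqf (is_derive_addf _ _ _ _ _ (is_derive_cstf (phi p) 0)
    (is_derive_mulf _ _ _ _ _ (is_derive_idf 0) (is_derive_cstf (phi p) 0))).
  by rewrite mulr0 addr0 mul1r add0r.
by rewrite -is_derive0_lineP => -[].
Unshelve. all: by end_near. Qed.

Lemma norm_derive_scale r p v : r != 0 -> p != 0 ->
  'D_v phi (r *: p) = `|r| / r * 'D_v phi p.
Proof.
move=> r0 p0.
suff : is_derive (r *: p) v phi (`|r| / r * 'D_v phi p) by case.
apply/is_derive0_lineP.
apply: (@is_derive_ext _ (fun h : R => `|r| * phi (p + h *: (r^-1 *: v)))).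
  by move=> h; rewrite -(normZ _ hphi) scale_line.
rewrite -mulrA.
apply: is_derive_scalef; apply/(is_derive0_lineP phi).
by apply: deriveZ_dir; have [] := C1phi v p p0.
Qed.

Lemma norm_derive2_scale r p v w : r != 0 -> p != 0 ->
  'D_w (fun q => 'D_v phi q) (r *: p) = `|r|^-1 * 'D_w (fun q => 'D_v phi q) p.
Proof.
move=> r0 p0.
suff : is_derive (r *: p) w (fun q => 'D_v phi q) (`|r|^-1 * 'D_w (fun q => 'D_v phi q) p) by case.
have rr : `|r|^-1 = `|r| / r * r^-1.
  have : `|r| ^+ 2 = r ^+ 2 by rewrite real_normK// num_real.
  rewrite -mulrA -expr2 exprVn => <-; field.
  by rewrite normr_eq0.
have d1 : is_derive (0 : R) 1 (fun h : R => `|r| / r * 'D_v phi (p + h *: (r^-1 *: w)))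
    (`|r|^-1 * 'D_w (fun q => 'D_v phi q) p).
  rewrite rr -[X in is_derive _ _ _ X]mulrA.
  have [dw _] := C2phi.2 v w p p0.
  exact: is_derive_scalef (iffLR (is_derive0_lineP (fun q => 'D_v phi q) _ _ _)
    (deriveZ_dir (fun q => 'D_v phi q) p w r^-1 dw)).
apply/(is_derive0_lineP (fun q => 'D_v phi q)).
apply: near_eq_is_derive d1.
have : \forall h \near (0 : R), p + h *: (r^-1 *: w) != 0.
  have c : {for (0 : R), continuous (fun h : R => p + h *: (r^-1 *: w))}.
    apply: cvgD; first exact: cvg_cst.
    by apply: cvgZr_tmp; exact: cvg_id.
  have n0 : nbhs (p + (0 : R) *: (r^-1 *: w)) [set q : R * R | q != 0].
    by rewrite scale0r addr0; exact: open_nbhs_nbhs (conj open_neq0 p0).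
  exact: c n0.
by apply: filterS => h ph; rewrite -norm_derive_scale// scale_line.
Qed.

Lemma norm_second_Euler p v : p != 0 -> 'D_p (fun q => 'D_v phi q) p = 0.
Proof.
move=> p0; suff : is_derive p p (fun q => 'D_v phi q) 0 by case.
apply/(is_derive0_lineP (fun q => 'D_v phi q)).
apply: (@near_eq_is_derive _ _ _ (fun=> 'D_v phi p) _ _ _ 0 _ (is_derive_cstf ('D_v phi p) 0)).
near=> h; have h1 : 0 < 1 + h.
  have : `|0 - h| < 1 by near: h; exact: cvgr_dist_lt.
  by rewrite sub0r normrN ltr_norml => /andP[]; lra.
have -> : p + h *: p = (1 + h) *: p by rewrite scalerDl scale1r.
rewrite norm_derive_scale ?gt_eqF//.
by rewrite gtr0_norm// divff ?gt_eqF// mul1r.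
Unshelve. all: by end_near. Qed.

Lemma norm_mixed p : p != 0 -> 'D_e1 (fun q => dz phi q) p = dxz phi p.
Proof. by move=> p0; exact: C2_on_Schwarz open_neq0 C2phi p0. Qed.

(* The Hessian of a norm annihilates p, so it is a multiple of the projection
   onto the orthogonal of p. *)
Lemma norm_Hessian p : p != 0 ->
  [/\ (p.1 ^+ 2 + p.2 ^+ 2) * dxx phi p = p.2 ^+ 2 * (dxx phi p + dzz phi p),
      (p.1 ^+ 2 + p.2 ^+ 2) * dxz phi p = - (p.1 * p.2) * (dxx phi p + dzz phi p) &
      (p.1 ^+ 2 + p.2 ^+ 2) * dzz phi p = p.1 ^+ 2 * (dxx phi p + dzz phi p)].
Proof.
move=> p0.
have A1 : p.1 * dxx phi p + p.2 * dxz phi p = 0.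
  have := norm_second_Euler p e1 p0.
  by rewrite regular_norm_dirD//; exact: C2phi.2.
have A2 : p.1 * dxz phi p + p.2 * dzz phi p = 0.
  have := norm_second_Euler p e2 p0.
  by rewrite regular_norm_dirD ?[dx _ p]norm_mixed//; exact: C2phi.2.
move: A1 A2; move: (p.1) (p.2) (dxx phi p) (dxz phi p) (dzz phi p) => x z a b c A1 A2.
split.
- have -> : (x ^+ 2 + z ^+ 2) * a = z ^+ 2 * a + x * (x * a + z * b) - z * (x * b + z * c) + z ^+ 2 * c by ring.
  by rewrite A1 A2; ring.
- have -> : (x ^+ 2 + z ^+ 2) * b = x * (x * b + z * c) + z * (x * a + z * b) - x * z * (a + c) by ring.
  by rewrite A1 A2; ring.
- have -> : (x ^+ 2 + z ^+ 2) * c = z * (x * b + z * c) - x * (x * a + z * b) + x ^+ 2 * (a + c) by ring.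
  by rewrite A1 A2; ring.
Qed.

(** Uniform convexity of phi^2 is tested on the direction (phi_z, - phi_x) tangent to the level line
    of phi, where the squared gradient term drops out. By [norm_Hessian] and Euler's relation, what
    remains is a positive multiple of the Laplacian. *)
Lemma norm_Laplacian_gt0 p : p != 0 -> 0 < dxx phi p + dzz phi p.
Proof.
move=> p0; have [_ _ [l l0 uc]] := rphi.
have sq v : forall q, q != 0 -> is_derive q v (fun q => phi q ^+ 2) (2 * phi q * 'D_v phi q).
  move=> q q0; apply/(is_derive0_lineP (fun q => phi q ^+ 2)).
  have dl := iffLR (is_derive0_lineP phi _ _ _) (regular_norm_derive q v q0).
  apply: is_derive_eqf (is_derive_mulf _ _ _ _ _ dl dl).
  by rewrite scale0r addr0; ring.
have sqE v q : q != 0 -> 'D_v (fun q => phi q ^+ 2) q = 2 * phi q * 'D_v phi q.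
  by move=> /(sq v) [].
have sq2 v w : 'D_w (fun q => 'D_v (fun q => phi q ^+ 2) q) p =
    2 * 'D_w phi p * 'D_v phi p + 2 * phi p * 'D_w (fun q => 'D_v phi q) p.
  suff : is_derive p w (fun q => 'D_v (fun q => phi q ^+ 2) q)
    (2 * 'D_w phi p * 'D_v phi p + 2 * phi p * 'D_w (fun q => 'D_v phi q) p) by case.
  apply: (@near_eq_is_derive _ _ _ (fun q => 2 * phi q * 'D_v phi q)).
    have := open_nbhs_nbhs (conj open_neq0 p0); apply: filterS => q q0.
    by rewrite sqE.
  apply/(is_derive0_lineP (fun q => 2 * phi q * 'D_v phi q)).
  have d1 := iffLR (is_derive0_lineP phi _ _ _) (regular_norm_derive p w p0).
  have d2 := iffLR (is_derive0_lineP (fun q => 'D_v phi q) _ _ _) (regular_norm_derive2 p v w p0).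
  apply: is_derive_eqf (is_derive_mulf _ _ _ _ _ (is_derive_scalef 2 _ _ _ d1) d2).
  by rewrite scale0r addr0.
have := uc p (dz phi p) (- dx phi p) p0.
have X1 : dxx (fun q => phi q ^+ 2) p = 2 * dx phi p * dx phi p + 2 * phi p * dxx phi p := sq2 e1 e1.
have X2 : dxz (fun q => phi q ^+ 2) p = 2 * dz phi p * dx phi p + 2 * phi p * dxz phi p := sq2 e1 e2.
have X3 : dzz (fun q => phi q ^+ 2) p = 2 * dz phi p * dz phi p + 2 * phi p * dzz phi p := sq2 e2 e2.
rewrite X1 X2 X3.
have [Hxx Hxz Hzz] := norm_Hessian p p0.
have E := norm_Euler p p0.
have pp := norm_gt0 _ hphi p p0.
have pos := plane_neq0_norm p p0.
move: Hxx Hxz Hzz E pp pos.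
move: (p.1) (p.2) (dx phi p) (dz phi p) (phi p) (dxx phi p) (dxz phi p) (dzz phi p).
move=> x z g h f a b c Ha Hb Hc E f0 N0 ineq.
have gh0 : 0 < h ^+ 2 + g ^+ 2.
  have [g0|g0] := eqVneq g 0.
    have [h0|h0] := eqVneq h 0; first by move: E f0; rewrite g0 h0 !mulr0 addr0 => <-; rewrite ltxx.
    by rewrite g0 expr0n addr0 exprn_even_gt0.
  by rewrite ltr_wpDl ?sqr_ge0// exprn_even_gt0.
have {}ineq : l * (h ^+ 2 + g ^+ 2) <= 2 * f * (a * h ^+ 2 - 2 * b * (h * g) + c * g ^+ 2).
  by apply: le_trans (le_trans _ ineq) _; rewrite le_eqVlt; apply/orP; left; apply/eqP; ring.
have key : (x ^+ 2 + z ^+ 2) * (2 * f * (a * h ^+ 2 - 2 * b * (h * g) + c * g ^+ 2)) =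
    2 * f ^+ 3 * (a + c).
  have -> : (x ^+ 2 + z ^+ 2) * (2 * f * (a * h ^+ 2 - 2 * b * (h * g) + c * g ^+ 2)) =
    2 * f * (((x ^+ 2 + z ^+ 2) * a) * h ^+ 2 - 2 * ((x ^+ 2 + z ^+ 2) * b) * (h * g) +
    ((x ^+ 2 + z ^+ 2) * c) * g ^+ 2) by ring.
  by rewrite Ha Hb Hc -E; ring.
have pos : 0 < 2 * f ^+ 3 * (a + c).
  rewrite -key pmulr_rgt0//; apply: lt_le_trans ineq.
  by rewrite mulr_gt0.
by move: pos; rewrite pmulr_rgt0// mulr_gt0// exprn_gt0.
Qed.

Context (psi : R * R -> R) (hpsi : is_norm psi).

(** The Laplacian is the only nonzero eigenvalue of the Hessian of phi. Its degree - 1 and the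
    degree 1 of psi cancel: the product has degree 0 and is therefore bounded away from 0 and
    infinity. *)
Definition mobility_curv p := psi p * (dxx phi p + dzz phi p).

Lemma mobility_curv_gt0 p : p != 0 -> 0 < mobility_curv p.
Proof. by move=> p0; rewrite mulr_gt0 ?norm_Laplacian_gt0// norm_gt0. Qed.

Lemma mobility_curv_scale r p : r != 0 -> p != 0 -> mobility_curv (r *: p) = mobility_curv p.
Proof.
move=> r0 p0; rewrite /mobility_curv (normZ _ hpsi).
rewrite [dxx _ _](norm_derive2_scale _ _ _ _ r0 p0) [dzz _ (_ *: _)](norm_derive2_scale _ _ _ _ r0 p0).
have nr0 : `|r| != 0 by rewrite normr_eq0.
rewrite -mulrDr mulrACA mulfV// mul1r //.
Qed.

Lemma mobility_curv_continuous p : p != 0 -> {for p, continuous mobility_curv}.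
Proof.
move=> p0; apply: (@continuousM R (R * R)%type psi (fun p => dxx phi p + dzz phi p)).
  exact: norm_continuous_plane.
apply: (@continuousD R _ _ (dxx phi) (dzz phi)).
  by have [] := C2phi.2 e1 e1 p p0.
by have [] := C2phi.2 e2 e2 p p0.
Qed.

Lemma mobility_curv_bounds : exists c C, [/\ 0 < c, 0 < C &
  forall p, p != 0 -> c <= mobility_curv p <= C].
Proof.
have [r p r0 p0|p1 [p2 [p10 p20 H]]] := homogeneous0_bounds _ mobility_curv_continuous.
  by apply: mobility_curv_scale; rewrite ?gt_eqF.
by exists (mobility_curv p1), (mobility_curv p2); split => //; exact: mobility_curv_gt0.
Qed.

(** By [norm_Hessian] the operator is [mobility_curv] times the quadratic form X evaluated on the
    unit tangent (z, - x) / |p| of the level line. *)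
Lemma level_set_opE x z a b c : (x, z) != 0 :> R * R ->
  level_set_op phi psi ((x, z), (a, b, c)) =
  mobility_curv (x, z) * (z ^+ 2 * a - 2 * (x * z) * b + x ^+ 2 * c) / (x ^+ 2 + z ^+ 2).
Proof.
move=> xz0; have [/=] := norm_Hessian _ xz0; have := plane_neq0_norm _ xz0.
rewrite /= /mobility_curv.
move: (psi _) (dxx _ _) (dxz _ _) (dzz _ _) => P A B C.
set N := _ + _; set S := A + C => N0 HA HB HC.
have {}N0 : N != 0 by rewrite gt_eqF.
apply: (mulIf N0); rewrite divfK//.
have -> : P * (A * a + 2 * B * b + C * c) * N =
  P * ((N * A) * a + 2 * (N * B) * b + (N * C) * c) by ring.
by rewrite HA HB HC; ring.
Qed.

(** This is f'', the second derivative of [weight phi]; see [is_derive_profile2]. *)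
Definition slope_curv s := dxx phi (- s, 1).

(** Through this identity L'' = w f'' is comparable with 1 / (1 + s^2). *)
Lemma slope_curvE s : weight psi s * slope_curv s = mobility_curv (- s, 1) / (1 + s ^+ 2).
Proof.
have [/= + _ _] := norm_Hessian _ (slope_neq0 s).
have := plane_neq0_norm _ (slope_neq0 s).
rewrite /mobility_curv /weight /slope_curv /= sqrrN expr1n mul1r (addrC (s ^+ 2)) => N0 <-.
by field; rewrite gt_eqF.
Qed.

Lemma slope_curv_gt0 s : 0 < slope_curv s.
Proof.
have w0 : 0 < weight psi s by exact: norm_gt0 (slope_neq0 s).
rewrite -(pmulr_rgt0 _ w0) slope_curvE divr_gt0 ?mobility_curv_gt0 ?slope_neq0//.
by rewrite ltr_pwDl ?sqr_ge0.
Qed.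

End RegularNorm.

Section Profile.
Context (phi : R * R -> R) (rphi : regular_norm phi).

Let hphi : is_norm phi. Proof. by case: rphi. Qed.

Lemma is_derive_slope (g : R * R -> R) s : derivable g (- s, 1) e1 ->
  is_derive s 1 (fun h : R => g (- h, 1)) (- dx g (- s, 1)).
Proof.
move=> dg; have := deriveZ_dir g (- s, 1) e1 (- 1) dg; rewrite scaleN1r mulN1r.
have E : (- s, 1) = (0, 1) + s *: - (e1 : R * R).
  by rewrite /e1 pairNE pairZE pairDE oppr0 mulr0 addr0 add0r mulrN mulr1.
rewrite {1}E => /(is_derive_lineP g).
by apply: is_derive_ext => h; rewrite /e1 pairNE pairZE pairDE oppr0 mulr0 addr0 add0r mulrN mulr1.
Qed.

Lemma is_derive_profile s : is_derive s 1 (weight phi) (- dx phi (- s, 1)).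
Proof. exact: is_derive_slope (@ex_derive _ _ _ _ _ _ _ (regular_norm_derive phi rphi _ e1 (slope_neq0 s))). Qed.

Lemma is_derive_profile2 s :
  is_derive s 1 (fun r => - dx phi (- r, 1)) (slope_curv phi s).
Proof.
have := is_derive_oppf _ _ _ (is_derive_slope (dx phi) s
  (@ex_derive _ _ _ _ _ _ _ (regular_norm_derive2 phi rphi _ e1 e1 (slope_neq0 s)))).
by rewrite opprK.
Qed.

Lemma slope_curv_continuous : continuous (slope_curv phi).
Proof.
move=> s; apply/continuous_epsP => e e0.
case: rphi => _ [_ C2] _.
have [_ /continuous_norm_epsP/(_ e e0)[d d0 H]] := C2 e1 e1 (- s, 1) (slope_neq0 s).
exists d => // r rs; apply: H; rewrite pairNE pairDE subrr prod_normE /= normr0.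
by rewrite opprK addrC distrC gt_max rs.
Qed.

End Profile.



End PlaneNorms.

(** * Foliation by dilated translators *)

Section Dilations.
Context {R : realType}.
Implicit Types (l : R -> R) (x z t s a e c lam m k : R).

(* [in_dilate l x z k m] says that (x, z - k) belongs to m K, where K is the set
   on which s x - z <= l s for all s. *)
Definition in_dilate l x z k m := forall s, s * x - z + k <= m * l s.

(* The leaf lam K + (t / lam) e_2 through (x, z) at time t; a and e make the
   leaves shrink with time, which turns solutions into barriers. *)
Definition dilation l a e x z t :=
  inf [set lam | 2^-1 <= lam /\ in_dilate l x z (t / lam) (lam + a - e * t)].

Section Foliation.
Context (l : R -> R) (c a e : R).
Context (c0 : 0 < c) (lc : forall s, c * (1 + `|s|) <= l s) (e0 : 0 <= e).

Notation P lam x z t := (in_dilate l x z (t / lam) (lam + a - e * t)).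
Notation L := (dilation l a e).

Lemma growth_gt0 s : 0 < l s.
Proof.
by apply: lt_le_trans (lc s); rewrite mulr_gt0// ltr_pwDl.
Qed.

Let l_gt0 := growth_gt0.

(** The leaves are nested: as lam grows, t / lam decreases while the right side increases because l
    is positive. *)
Lemma in_dilate_mono x z t lam lam' : 0 <= t -> 2^-1 <= lam -> lam <= lam' ->
  P lam x z t -> P lam' x z t.
Proof.
move=> t0 l2 ll' H s; have h : (0:R) < 2^-1 by rewrite invr_gt0.
have lp : 0 < lam by apply: lt_le_trans l2.
have tl : t / lam' <= t / lam.
  by rewrite ler_wpM2l// lef_pV2 ?posrE// (lt_le_trans lp).
have := H s; have := l_gt0 s; nra.
Qed.

Lemma in_dilate_large x z t lam : 0 <= t -> e * t <= a -> 2^-1 <= lam ->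
  (`|x| + `|z| + 2 * t) / c <= lam -> P lam x z t.
Proof.
move=> t0 eta l2; rewrite ler_pdivrMr// => H s.
have tl : t / lam <= 2 * t.
  rewrite mulrC ler_wpM2r// -[leRHS]invrK lef_pV2 ?posrE ?invr_gt0//.
  by apply: lt_le_trans l2; rewrite invr_gt0.
have h : (0:R) < 2^-1 by rewrite invr_gt0.
have sx : s * x <= `|s| * `|x| by rewrite -normrM ler_norm.
have z1 : - z <= `|z| by rewrite -normrN ler_norm.
have := lc s; have := normr_ge0 s; have := normr_ge0 x; have := normr_ge0 z.
move: sx z1 tl H; set S := `|s|; set X := `|x|; set Z := `|z|; set T := t / lam.
move=> sx z1 tl H Z0 X0 S0 lS.
have l1 : 0 < lam by apply: lt_le_trans l2.
have : S * X + Z + 2 * t <= lam * (c * (1 + S)) by nra.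
have : lam * (c * (1 + S)) <= (lam + a - e * t) * l s.
  apply: ler_pM => //; last by lra.
    exact: ltW.
  by rewrite mulr_ge0 ?(ltW c0)//; lra.
lra.
Qed.

(** The infimum is attained: a violated constraint at one slope s would still be violated for all
    slightly larger lam, hence at elements of the set close to the infimum. *)
Lemma dilation_leP x z t lam : 0 <= t -> e * t <= a -> 2^-1 <= lam ->
  (L x z t <= lam) <-> P lam x z t.
Proof.
move=> t0 eta l2.
have h2 : (0:R) < 2^-1 by rewrite invr_gt0.
have lb : has_lbound [set lam | 2^-1 <= lam /\ P lam x z t] by exists 2^-1 => y [].
split; last by move=> H; apply: ge_inf.
have hi : has_inf [set lam | 2^-1 <= lam /\ P lam x z t].
  split => //; exists (2^-1 + (`|x| + `|z| + 2 * t) / c).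
  have q0 : 0 <= (`|x| + `|z| + 2 * t) / c.
    by rewrite divr_ge0 ?(ltW c0)// !addr_ge0// mulr_ge0.
  by split; [rewrite lerDl|apply: in_dilate_large => //; rewrite ?lerDl ?lerDr// ltW].
move=> Ll s; rewrite leNgt; apply/negP => gap.
set g := s * x - z + t / lam - (lam + a - e * t) * l s.
have g0 : 0 < g by rewrite /g; lra.
(* When lam moves by d, t / lam moves by at most 4 t d since lam >= 1/2, and the right side by d l
   s; this d uses up at most half of the gap g. *)
pose d := g / (2 * (4 * t + l s + 1)).
have D0 : 0 < 4 * t + l s + 1 by have := l_gt0 s; lra.
have d0 : 0 < d by rewrite divr_gt0// mulr_gt0.
have [lam' [l2' Pl'] l'd] := inf_adherent d0 hi.
have {}l'd : lam' < lam + d by apply: lt_le_trans l'd _; rewrite lerD2r.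
have [ll'|ll'] := leP lam' lam.
  by have := in_dilate_mono _ _ _ _ _ t0 l2' ll' Pl' s; rewrite /g in g0; lra.
have := Pl' s.
have lp : 0 < lam by apply: lt_le_trans l2.
have lp' : 0 < lam' by apply: lt_le_trans l2'.
have i1 : 0 < lam^-1 by rewrite invr_gt0.
have i2 : lam^-1 <= 2 by rewrite -[leRHS]invrK lef_pV2 ?posrE.
have i1' : 0 < lam'^-1 by rewrite invr_gt0.
have i2' : lam'^-1 <= 2 by rewrite -[leRHS]invrK lef_pV2 ?posrE.
have E : t / lam - t / lam' = t * (lam' - lam) * (lam^-1 * lam'^-1).
  by field; rewrite !gt_eqF.
have II : lam^-1 * lam'^-1 <= 4.
  apply: le_trans (_ : 2 * 2 <= 4); last by rewrite -natrM.
  by apply: ler_pM => //; exact: ltW.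
have : t / lam - t / lam' <= t * d * 4.
  rewrite E; apply: ler_pM => //.
  - by rewrite mulr_ge0// subr_ge0 ltW.
  - by rewrite mulr_ge0 ?(ltW i1)// ltW.
  - by rewrite ler_wpM2l//; lra.
have gd : g = d * (2 * (4 * t + l s + 1)) by rewrite /d divfK// gt_eqF// mulr_gt0.
move: gd; rewrite /g; have := l_gt0 s.
move: (t / lam) (t / lam') (l s) D0 => u u' L0 *.
nra.
Qed.

Lemma dilation_ge x z t : 0 <= t -> e * t <= a -> 2^-1 <= L x z t.
Proof.
move=> t0 eta; apply: lb_le_inf; last by move=> y [].
exists (2^-1 + (`|x| + `|z| + 2 * t) / c).
have h2 : (0:R) < 2^-1 by rewrite invr_gt0.
have q0 : 0 <= (`|x| + `|z| + 2 * t) / c.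
  by rewrite divr_ge0 ?(ltW c0)// !addr_ge0// mulr_ge0.
by split; [rewrite lerDl|apply: in_dilate_large => //; rewrite ?lerDl ?lerDr// ltW].
Qed.

Lemma in_dilation x z t : 0 <= t -> e * t <= a -> P (L x z t) x z t.
Proof. by move=> t0 eta; apply/dilation_leP => //; exact: dilation_ge. Qed.

(** Enlarging lam by A / c relaxes the constraint at s by at least A (1 + |s|), which covers the
    change of s x - z + t / lam. The extra e |t' - t| compensates the shrinking of the leaf. *)
Lemma dilation_lipschitz x z t x' z' t' : 0 <= t -> e * t <= a ->
  0 <= t' -> e * t' <= a ->
  L x' z' t' <= L x z t + ((`|x' - x| + `|z' - z| + 2 * `|t' - t|) / c + e * `|t' - t|).
Proof.
move=> t0 eta t'0 eta'.
have H2 := dilation_ge x z t t0 eta; have HP := in_dilation x z t t0 eta.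
move: H2 HP; set lam := L x z t => H2 HP.
set A : R := `|x' - x| + `|z' - z| + 2 * `|t' - t|.
have A0 : 0 <= A by rewrite !addr_ge0// mulr_ge0.
have d0 : 0 <= A / c by rewrite divr_ge0// ltW.
have et0 : 0 <= e * `|t' - t| by rewrite mulr_ge0.
apply/dilation_leP => //; first by lra.
set lam' := lam + _ => s.
have h2 : (0:R) < 2^-1 by rewrite invr_gt0.
have lp : 0 < lam by apply: lt_le_trans H2.
have tl : t' / lam' <= t / lam + 2 * `|t' - t|.
  have -> : t / lam + 2 * `|t' - t| = (t / lam + `|t' - t| / lam) + `|t' - t| * (2 - lam^-1).
    by ring.
  have i2 : 0 <= 2 - lam^-1 by rewrite subr_ge0 -[leRHS]invrK lef_pV2 ?posrE.
  apply: (@le_trans _ _ (t / lam + `|t' - t| / lam)); last first.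
    by rewrite lerDl mulr_ge0.
  rewrite -mulrDl; apply: ler_pM => //.
  - by rewrite invr_ge0 /lam'; lra.
  - by rewrite -lerBlDl ler_norm.
  - by rewrite lef_pV2 ?posrE// /lam'; lra.
have tt : - (e * t') + e * `|t' - t| >= - (e * t).
  have : e * (t' - t) <= e * `|t' - t| by rewrite ler_wpM2l// ler_norm.
  by rewrite mulrBr; lra.
have lm : (lam + a - e * t + A / c) * l s <= (lam' + a - e * t') * l s.
  by rewrite ler_wpM2r ?(ltW (l_gt0 s))// /lam'; lra.
have Al : A * (1 + `|s|) <= A / c * l s.
  rewrite mulrAC; rewrite ler_pdivlMr//; rewrite -mulrA ler_wpM2l// mulrC; exact: lc.
have sx : s * x' <= s * x + `|s| * `|x' - x|.
  by rewrite -lerBlDl -mulrBr -normrM ler_norm.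
have zz : - z' <= - z + `|z' - z|.
  by rewrite -lerBlDl opprK addrC distrC ler_norm.
have := HP s; rewrite mulrDl in lm.
have := normr_ge0 s; have := normr_ge0 (x' - x); have := normr_ge0 (z' - z); have := normr_ge0 (t' - t).
move: sx zz Al lm tl; rewrite /A.
move: `|x' - x| `|z' - z| `|t' - t| `|s| (t / lam) (t' / lam') ((lam' + a - e * t') * l s) ((lam + a - e * t) * l s) => X Z T S u u' K K' *.
have : 0 <= X * S by rewrite mulr_ge0.
have : 0 <= Z * S by rewrite mulr_ge0.
have : 0 <= T * S by rewrite mulr_ge0.
nra.
Qed.

End Foliation.
End Dilations.

(** * The cutoff and its second order Taylor expansion *)

Section Cutoff.
Context {R : realType}.
Implicit Types (r e d : R).

(* [cutoff] is odd and its derivative (1/4 - r ^ 2) ^ 2 vanishes to second order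
   where the clamp starts: the flat parts glue as C^2 and |cutoff''| is bounded
   by e + cutoff' / e, as the singularity of the operator at p = 0 requires. *)
Definition clamp r : R := Num.max (- 2^-1) (Num.min 2^-1 r).

Definition cutoff r : R := clamp r / 16 - clamp r ^+ 3 / 6 + clamp r ^+ 5 / 5.

Definition cutoff' r : R := (4^-1 - clamp r ^+ 2) ^+ 2.

Definition cutoff'' r : R := - 4 * clamp r * (4^-1 - clamp r ^+ 2).

Lemma clampP r : [\/ r <= - 2^-1 /\ clamp r = - 2^-1,
  - 2^-1 <= r <= 2^-1 /\ clamp r = r | 2^-1 <= r /\ clamp r = 2^-1].
Proof.
rewrite /clamp; have h : - 2^-1 <= 2^-1 :> R by lra.
have [r1|r1] := leP 2^-1 r.
  by constructor 3; split => //; apply/max_idPr.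
have [r2|r2] := leP r (- 2^-1).
  by constructor 1; split => //; apply/max_idPl.
by constructor 2; split; [rewrite !ltW|].
Qed.

Lemma clamp_itv r : - 2^-1 <= clamp r <= 2^-1.
Proof. by case: (clampP r) => -[h ->]; lra. Qed.

Lemma clamp_lipschitz r r0 : `|clamp r - clamp r0| <= `|r - r0|.
Proof.
have H a b : b <= a -> `|clamp a - clamp b| <= `|a - b|.
  move=> ba; have : 0 <= clamp a - clamp b <= a - b.
    by case: (clampP a) => -[+ ->]; case: (clampP b) => -[+ ->]; lra.
  move=> /andP[h1 h2]; rewrite !ger0_norm//; lra.
have [h|h] := leP r0 r; first exact: H.
by rewrite distrC (distrC r); exact/H/ltW.
Qed.

Lemma cutoff'_ge0 r : 0 <= cutoff' r. Proof. exact: sqr_ge0. Qed.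

(** With y = 1/4 - c^2, where c is the clamped argument, |cutoff''| <= 2 y and cutoff' = y^2; the
    claim is 2 y <= e + y^2 / e. *)
Lemma cutoff''_le e r : 0 < e -> `|cutoff'' r| <= e + cutoff' r / e.
Proof.
move=> e0; rewrite /cutoff'' /cutoff'.
have /andP[h1 h2] := clamp_itv r; move: (clamp r) h1 h2 => c h1 h2.
set y := 4^-1 - c ^+ 2.
have y0 : 0 <= y by rewrite /y; nra.
have : `|- 4 * c * y| <= 2 * y.
  by rewrite ler_norml; apply/andP; split; nra.
move=> /le_trans; apply.
have : 0 <= (e - y) ^+ 2 / e by rewrite divr_ge0 ?sqr_ge0// ltW.
have -> : (e - y) ^+ 2 / e = e - 2 * y + y ^+ 2 / e by field; rewrite gt_eqF.
by lra.
Qed.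

(** Second order Taylor expansion remains valid across the clamp points, where cutoff' and cutoff''
    vanish. The error is a cubic expression in the clamped increment d plus terms in D - d and D^2 -
    d^2 weighted by y^2 and y. *)
Lemma cutoff_taylor r r0 :
  `|cutoff r - cutoff r0 - cutoff' r0 * (r - r0) - cutoff'' r0 / 2 * (r - r0) ^+ 2|
    <= 4 * `|r - r0| ^+ 3.
Proof.
have dD := clamp_lipschitz r r0.
have /andP[c1 c2] := clamp_itv r; have /andP[c01 c02] := clamp_itv r0.
set D := r - r0 in dD *; set c := clamp r in dD c1 c2 *; set c0 := clamp r0 in dD c01 c02 *.
set d := c - c0 in dD *.
pose y := 4^-1 - c0 ^+ 2.
have -> : cutoff r - cutoff r0 - cutoff' r0 * D - cutoff'' r0 / 2 * D ^+ 2 =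
    d ^+ 3 * ((12 * c0 ^+ 2 - 1) / 6 + c0 * d + d ^+ 2 / 5)
    - y ^+ 2 * (D - d) + 2 * c0 * y * (D ^+ 2 - d ^+ 2).
  by rewrite /cutoff /cutoff' /cutoff'' -/c -/c0 /y /d; field.
have B1 : `|d ^+ 3 * ((12 * c0 ^+ 2 - 1) / 6 + c0 * d + d ^+ 2 / 5)| <= 2 * `|D| ^+ 3.
  rewrite normrM normrX mulrC; apply: ler_pM => //.
    have : -1 <= d <= 1 by rewrite /d; lra.
    move=> /andP[d1 d2].
    have : `|(12 * c0 ^+ 2 - 1) / 6| <= 1 by rewrite ler_norml; apply/andP; split; nra.
    have : `|c0 * d| <= 2^-1.
      by rewrite normrM -[leRHS]mulr1; apply: ler_pM => //; rewrite ler_norml; apply/andP.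
    have : `|d ^+ 2 / 5| <= 5^-1 by rewrite ler_norml; apply/andP; split; nra.
    move: (_ / 6) (c0 * d) (d ^+ 2 / 5) => A B C.
    by rewrite !ler_norml; lra.
  by rewrite lerXn2r ?nnegrE.
(* Either d = D, or y = 0, or the clamp acts on r only; in the last case y <= |d|, and the smallness
   of y pays for the part of the increment that the clamp removes. *)
have B2 : y ^+ 2 * `|D - d| <= `|D| ^+ 3 /\ `|2 * c0 * y| * `|D ^+ 2 - d ^+ 2| <= `|D| ^+ 3.
  have gen : D - d = 0 -> y ^+ 2 * `|D - d| <= `|D| ^+ 3 /\ `|2 * c0 * y| * `|D ^+ 2 - d ^+ 2| <= `|D| ^+ 3.
    move=> /eqP; rewrite subr_eq0 => /eqP ->; rewrite !subrr normr0 !mulr0.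
    by rewrite exprn_ge0.
  have gen0 : y = 0 -> y ^+ 2 * `|D - d| <= `|D| ^+ 3 /\ `|2 * c0 * y| * `|D ^+ 2 - d ^+ 2| <= `|D| ^+ 3.
    by move=> ->; rewrite expr0n /= !(mulr0, mul0r, normr0) exprn_ge0.
  have gen1 : 0 <= d * D -> 0 <= y <= `|d| -> `|D - d| <= `|D| ->
     y ^+ 2 * `|D - d| <= `|D| ^+ 3 /\ `|2 * c0 * y| * `|D ^+ 2 - d ^+ 2| <= `|D| ^+ 3.
    move=> dD0 /andP[y0 yd] DdD.
    have yD : y <= `|D| by apply: le_trans dD.
    split.
      rewrite [leRHS]exprSr; apply: ler_pM => //; first exact: sqr_ge0.
      by rewrite lerXn2r ?nnegrE.
    rewrite [leRHS]exprS; apply: ler_pM => //.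
      rewrite normrM (ger0_norm y0) -[leRHS]mul1r; apply: ler_pM => //.
      by rewrite ler_norml; lra.
    have dd : d ^+ 2 <= D ^+ 2.
      by rewrite -(real_normK (num_real d)) -(real_normK (num_real D)) lerXn2r ?nnegrE.
    rewrite ger0_norm ?subr_ge0// real_normK ?num_real// lerBlDr lerDl sqr_ge0 //.
  case: (clampP r0); rewrite -/c0 => -[hr0 ec0].
  - by apply: gen0; rewrite /y ec0; field.
  - case: (clampP r); rewrite -/c => -[hr ec].
    + have D0 : D <= 0 by rewrite /D; lra.
      have d0 : d <= 0 by rewrite /d; lra.
      apply: gen1; first by rewrite mulr_le0.
        by rewrite (ler0_norm d0) /y /d ec; apply/andP; split; nra.
      rewrite (ler0_norm D0) ler_norml /D /d ec ec0; lra.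
    + by apply: gen; rewrite /D /d ec ec0 subrr.
    + have D0 : 0 <= D by rewrite /D; lra.
      have d0 : 0 <= d by rewrite /d; lra.
      apply: gen1; first by rewrite mulr_ge0.
        by rewrite (ger0_norm d0) /y /d ec; apply/andP; split; nra.
      rewrite (ger0_norm D0) ler_norml /D /d ec ec0; lra.
  - by apply: gen0; rewrite /y ec0; field.
case: B2 => B2 B3.
apply: le_trans (ler_normD _ _) _.
rewrite [leRHS](_ : _ = 3 * `|D| ^+ 3 + `|D| ^+ 3); last by ring.
apply: lerD; last by rewrite normrM.
apply: le_trans (ler_normB _ _) _.
rewrite [leRHS](_ : _ = 2 * `|D| ^+ 3 + `|D| ^+ 3); last by ring.
by apply: lerD => //; rewrite normrM ger0_norm ?sqr_ge0.
Qed.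

Lemma cutoff_lipschitz r r0 : `|cutoff r - cutoff r0| <= `|r - r0|.
Proof.
apply: le_trans (clamp_lipschitz r r0).
have /andP[c1 c2] := clamp_itv r; have /andP[c01 c02] := clamp_itv r0.
rewrite /cutoff; move: (clamp r) (clamp r0) c1 c2 c01 c02 => c b c1 c2 b1 b2.
have -> : c / 16 - c ^+ 3 / 6 + c ^+ 5 / 5 - (b / 16 - b ^+ 3 / 6 + b ^+ 5 / 5) =
   (c - b) * (1 / 16 - (c ^+ 2 + c * b + b ^+ 2) / 6 +
     (c ^+ 2 * c ^+ 2 + c ^+ 2 * (c * b) + (c * b) * (c * b) + (c * b) * b ^+ 2 + b ^+ 2 * b ^+ 2) / 5).
  by field.
rewrite normrM -[leRHS]mulr1 ler_wpM2l//.
have : 0 <= c ^+ 2 <= 4^-1 by nra.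
have : 0 <= b ^+ 2 <= 4^-1 by nra.
have : - 4^-1 <= c * b <= 4^-1 by nra.
move: (c ^+ 2) (b ^+ 2) (c * b) => C B X /andP[X1 X2] /andP[B1 B2] /andP[C1 C2].
by rewrite ler_norml; apply/andP; split; nra.
Qed.

Lemma cutoff_mono r r0 : r0 <= r -> cutoff r0 <= cutoff r.
Proof.
move=> rr; have cc : clamp r0 <= clamp r.
  by case: (clampP r) => -[+ ->]; case: (clampP r0) => -[+ ->]; lra.
have /andP[c1 c2] := clamp_itv r; have /andP[c01 c02] := clamp_itv r0.
rewrite /cutoff; move: (clamp r) (clamp r0) c1 c2 c01 c02 cc => c b c1 c2 b1 b2 cb.
rewrite -subr_ge0.
pose m := (c + b) / 2; pose h := (c - b) / 2.
(* The factor of c - b is the mean of (1/4 - r^2)^2 over [b, c], written as the square of the mean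
   of 1/4 - r^2 plus the variance of r^2; m and h are the midpoint and the half-length. *)
have -> : c / 16 - c ^+ 3 / 6 + c ^+ 5 / 5 - (b / 16 - b ^+ 3 / 6 + b ^+ 5 / 5) =
   (c - b) * ((4^-1 - m ^+ 2 - h ^+ 2 / 3) ^+ 2 + 4 * m ^+ 2 * h ^+ 2 / 3 + 4 * h ^+ 2 * h ^+ 2 / 45).
  by rewrite /m /h; field.
have := sqr_ge0 m; have := sqr_ge0 h; have := sqr_ge0 (4^-1 - m ^+ 2 - h ^+ 2 / 3).
move: (m ^+ 2) (h ^+ 2) ((_ - _) ^+ 2) => A B C C0 B0 A0.
have : 0 <= A * B by rewrite mulr_ge0.
have : 0 <= B * B by rewrite mulr_ge0.
by move=> ? ?; apply: mulr_ge0; lra.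
Qed.

Lemma cutoff_gt0 r : (0 < cutoff r) = (0 < r).
Proof.
have H c : cutoff c = clamp c * (16^-1 - clamp c ^+ 2 / 6 + clamp c ^+ 2 * clamp c ^+ 2 / 5).
  by rewrite /cutoff; field.
rewrite H pmulr_lgt0; last first.
  move: (clamp r ^+ 2) => u.
  have -> : 16^-1 - u / 6 + u * u / 5 = (u - 5 / 12) ^+ 2 / 5 + 1 / 36 by field.
  by rewrite ltr_wpDl// divr_ge0// sqr_ge0.
by case: (clampP r) => -[+ ->]; case: ltP; lra.
Qed.

Lemma cutoffN r : cutoff (- r) = - cutoff r.
Proof.
have -> : cutoff (- r) = - clamp r / 16 - (- clamp r) ^+ 3 / 6 + (- clamp r) ^+ 5 / 5.
  rewrite /cutoff (_ : clamp (- r) = - clamp r)//.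
  by case: (clampP (- r)) => -[+ ->]; case: (clampP r) => -[+ ->]; lra.
by rewrite /cutoff; field.
Qed.

Lemma cutoff_eq0 r : (cutoff r == 0) = (r == 0).
Proof.
have := cutoff_gt0 r; have := cutoff_gt0 (- r); rewrite cutoffN !oppr_gt0.
by move=> H1 H2; case: (ltgtP (cutoff r) 0) H1 H2 => _; case: (ltgtP r 0).
Qed.

Lemma cutoff_hi r : 2^-1 <= r -> cutoff r = cutoff 2^-1.
Proof.
move=> h; rewrite /cutoff (_ : clamp r = clamp 2^-1)//.
by case: (clampP r) => -[+ ->]; case: (clampP 2^-1) => -[+ ->]; lra.
Qed.

Lemma cutoff_lo r : r <= - 2^-1 -> cutoff r = - cutoff 2^-1.
Proof. move=> h; have h' : 2^-1 <= - r by lra.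
by rewrite -(cutoff_hi _ h') cutoffN opprK. Qed.

Lemma cutoff'_hi r : 2^-1 <= r -> cutoff' r = 0.
Proof.
move=> h; rewrite /cutoff' (_ : clamp r = 2^-1); first by field.
by case: (clampP r) => -[+ ->]; lra.
Qed.

Lemma cutoff_le r : cutoff r <= cutoff 2^-1.
Proof.
have [h|/ltW h] := leP 2^-1 r; first by rewrite cutoff_hi.
exact: cutoff_mono.
Qed.

Lemma cutoff_bound r : `|cutoff r| <= 1.
Proof.
have := cutoff_lipschitz (clamp r) 0.
have -> : cutoff (clamp r) = cutoff r.
  rewrite /cutoff (_ : clamp (clamp r) = clamp r)//.
  have /andP[] := clamp_itv r; case: (clampP (clamp r)) => -[+ ->]; lra.
have -> : cutoff 0 = 0 by apply/eqP; rewrite cutoff_eq0.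
rewrite !subr0 => /le_trans; apply.
by have /andP[] := clamp_itv r; rewrite ler_norml; lra.
Qed.

End Cutoff.

(** * Contact slopes and second order expansion of the foliation *)

Section Expansion.
Context {R : realType}.
Implicit Types (x y z s t k m : R).

Definition smooth_profile (l l1 l2 : R -> R) :=
  [/\ forall s, is_derive s 1 l (l1 s), forall s, is_derive s 1 l1 (l2 s) &
      forall s, 0 < l2 s].

Section Profile.
Context (l l1 l2 : R -> R) (sl : smooth_profile l l1 l2).

Lemma profile_slope_lt s t : s < t -> l1 s < l1 t.
Proof.
move=> st; have [_ d2 p2] := sl.
have [c _ E] := MVT_le _ _ _ _ (ltW st) (fun x _ => d2 x).
by rewrite -subr_gt0 E mulr_gt0 ?subr_gt0.
Qed.

Lemma profile_slope_le s t : s <= t -> l1 s <= l1 t.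
Proof. by rewrite le_eqVlt => /predU1P[->//|/profile_slope_lt/ltW]. Qed.

Lemma profile_tangent s t : l s + l1 s * (t - s) <= l t.
Proof.
have [d1 _ _] := sl; rewrite -lerBrDl; have [st|ts] := leP s t.
  have [c /andP[sc ct] ->] := MVT_le _ _ _ _ st (fun x _ => d1 x).
  by rewrite ler_wpM2r ?subr_ge0// profile_slope_le.
have [c /andP[tc cs] E] := MVT_le _ _ _ _ (ltW ts) (fun x _ => d1 x).
have : l1 c * (s - t) <= l1 s * (s - t).
  by rewrite ler_wpM2r ?subr_ge0 ?profile_slope_le// ltW.
rewrite -E !mulrBr; lra.
Qed.

(** The Bregman term (s - s0) l1 s - l s + l s0 is l2 s0 / 2 (s - s0)^2 to leading order, and l1 s -
    l1 s0 is l2 s0 (s - s0). The comparison is made in terms of l1 because only l1 is seen through x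
    = m l1 s. *)
Lemma profile_bregman (s0 eta : R) : 0 < eta -> exists2 r : R, 0 < r &
  forall s, `|s - s0| < r ->
  `|2 * l2 s0 * ((s - s0) * l1 s - l s + l s0) - (l1 s - l1 s0) ^+ 2|
    <= eta * (l1 s - l1 s0) ^+ 2.
Proof.
move=> eta0; have [d1 d2 p2] := sl.
have q0 := p2 s0; set q := l2 s0 in q0 *.
pose h := Num.min (q / 2) (eta * q / 40).
have h0 : 0 < h by rewrite lt_min !divr_gt0// mulr_gt0.
have h1 : h <= q / 2 by rewrite ge_min lexx.
have h2 : h <= eta * q / 40 by rewrite ge_min lexx orbT.
have [r r0 Hr] := (iffLR (is_derive1_epsP _ _ _) (d2 s0)) h h0.
exists r => // s sr.
set d := s - s0 in sr *.
have ss : s = s0 + d by rewrite /d addrC subrK.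
have A1 c : `|c - s0| <= `|d| -> `|l1 c - l1 s0 - q * (c - s0)| <= h * `|d|.
  move=> cd; have := Hr _ (le_lt_trans cd sr).
  rewrite (addrC s0) subrK => /le_trans; apply.
  by rewrite ler_wpM2l// ltW.
have A2 : `|l s - l s0 - l1 s0 * d - q / 2 * d ^+ 2| <= h * d ^+ 2.
  pose g c := l c - l1 s0 * (c - s0) - q / 2 * (c - s0) ^+ 2.
  have -> : l s - l s0 - l1 s0 * d - q / 2 * d ^+ 2 = g s - g s0.
    by rewrite /g /d; ring.
  have -> : h * d ^+ 2 = h * `|d| * `|s - s0| by rewrite -/d -mulrA -expr2 real_normK// num_real.
  apply: (MVT_norm_le g (fun c => l1 c - l1 s0 - q * (c - s0))) => c cd; last exact: A1.
  have dc : is_derive c 1 (fun c => c - s0) 1.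
    by have := is_derive_subf _ _ _ _ _ (is_derive_idf c) (is_derive_cstf s0 c); rewrite subr0.
  apply: is_derive_eqf (is_derive_subf _ _ _ _ _ (is_derive_subf _ _ _ _ _ (d1 c)
    (is_derive_scalef (l1 s0) _ _ _ dc)) (is_derive_scalef (q / 2) _ _ _ (is_derive_mulf _ _ _ _ _ dc dc))).
  by field.
have := A1 s (lexx _); rewrite -/d => {}A1.
set P := l1 s - l1 s0 in A1 *.
have [th [th1 PE]] : exists th, `|th| <= h /\ P = (q + th) * d.
  have [d_0|d_neq0] := eqVneq d 0.
    exists 0; rewrite normr0 (ltW h0); split => //.
    by move: A1; rewrite d_0 normr0 !mulr0 subr0 normr_le0 => /eqP.
  exists ((P - q * d) / d); split; last by field.
  by rewrite normrM normfV ler_pdivrMr ?normr_gt0.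
have [ps [ps1 QE]] : exists ps, `|ps| <= h /\ l s - l s0 - l1 s0 * d = (q / 2 + ps) * d ^+ 2.
  have [d_0|d_neq0] := eqVneq d 0.
    exists 0; rewrite normr0 (ltW h0); split => //.
    by move: A2; rewrite d_0 expr0n /= !mulr0 !subr0 normr_le0 => /eqP.
  have dd : 0 < d ^+ 2 by rewrite exprn_even_gt0.
  exists ((l s - l s0 - l1 s0 * d - q / 2 * d ^+ 2) / d ^+ 2); split; last by field.
  by rewrite normrM normfV (gtr0_norm dd) ler_pdivrMr.
have -> : 2 * q * (d * l1 s - l s + l s0) - P ^+ 2 = d ^+ 2 * (- 2 * q * ps - th ^+ 2).
  have -> : l1 s = P + l1 s0 by rewrite /P subrK.
  have -> : d * (P + l1 s0) - l s + l s0 = d * P - (l s - l s0 - l1 s0 * d) by ring.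
  by rewrite QE PE; field.
rewrite PE exprMn (mulrC _ (d ^+ 2)) mulrCA normrM (ger0_norm (sqr_ge0 d)) ler_wpM2l ?sqr_ge0//.
have qth : q / 2 <= q + th by move: th1; rewrite ler_norml; lra.
have : (q / 2) ^+ 2 <= (q + th) ^+ 2 by rewrite lerXn2r ?nnegrE; lra.
move=> qq; apply: (@le_trans _ _ (eta * (q / 2) ^+ 2)); last by rewrite ler_wpM2l// ltW.
apply: le_trans (ler_normB _ _) _; rewrite !normrM normrN.
rewrite (ger0_norm (ltW q0)) (ger0_norm (_ : 0 <= 2)%R)//.
have b1 : 2 * q * `|ps| <= 2 * q * h by rewrite ler_wpM2l// mulr_ge0// ltW.
have b2 : `|th| * `|th| <= q * h.
  by apply: ler_pM => //; apply: le_trans th1 _; lra.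
have b3 : q * h <= q * (eta * q / 40) by rewrite ler_wpM2l// ltW.
nra.
Qed.

End Profile.

(** The hypothesis makes dl of order |ze| + |dt| + dx^2. Hence dl^2 is bounded by multiples of ze^2,
    dt^2 and dx^4, and near 0 the last is a small multiple of dx^2. *)
Lemma expansion_absorb (D0 b mu ep C : R) : 0 < D0 -> 0 <= b -> 0 <= mu -> 0 < ep -> 0 <= C ->
  exists C' d : R, [/\ 0 <= C', 0 < d & forall dl dx ze dt : R,
    `|dl| <= d -> `|dx| <= d -> `|dt| <= d ->
    `|D0 * dl + (ze - b * dt - mu / 2 * dx ^+ 2)| <= ep * dx ^+ 2 + C * (dl ^+ 2 + dt ^+ 2) ->
    `|D0 * dl + (ze - b * dt - mu / 2 * dx ^+ 2)| <= 2 * ep * dx ^+ 2 + C' * (ze ^+ 2 + dt ^+ 2)].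
Proof.
move=> D00 b0 mu0 ep0 C0.
have [K KE] : exists K, K = 2 / D0 * (1 + b + C + mu + ep) by eexists.
have K0 : 0 < K by rewrite KE mulr_gt0 ?divr_gt0//; lra.
pose d := Num.min 1 (Num.min (D0 / (2 * (C + 1))) (ep / (3 * (C + 1) * K ^+ 2))).
have C1 : 0 < C + 1 by rewrite ltr_wpDl.
have K2 : 0 < K ^+ 2 by rewrite exprn_gt0.
have d0 : 0 < d.
  rewrite !lt_min ltr01 /=; apply/andP; split; apply: divr_gt0 => //; first by rewrite mulr_gt0.
  by rewrite mulr_gt0// mulr_gt0.
have d1 : d <= 1 by rewrite ge_min lexx.
have d2 : C * d <= D0 / 2.
  have : d <= D0 / (2 * (C + 1)) by rewrite !ge_min lexx orbT.
  rewrite ler_pdivlMr ?mulr_gt0// => h; nra.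
have d3 : 3 * C * K ^+ 2 * d <= ep.
  have : d <= ep / (3 * (C + 1) * K ^+ 2) by rewrite !ge_min lexx !orbT.
  rewrite ler_pdivlMr ?mulr_gt0 ?exprn_gt0// => h.
  by have := sqr_ge0 K; nra.
exists (C + 3 * C * K ^+ 2), d; split => //.
  by apply: addr_ge0 => //; apply: mulr_ge0; [lra|exact: ltW].
move=> dl dx ze dt hl hx ht H.
have xx : dx ^+ 2 <= d.
  by rewrite -(real_normK (num_real dx)) expr2; have := normr_ge0 dx; nra.
have ll : dl ^+ 2 = `|dl| ^+ 2 by rewrite real_normK// num_real.
have tt : dt ^+ 2 = `|dt| ^+ 2 by rewrite real_normK// num_real.
have lK : `|dl| <= K * (`|ze| + `|dt| + dx ^+ 2).
  have D1 : D0 * `|dl| <= `|ze| + b * `|dt| + mu / 2 * dx ^+ 2 + (ep * dx ^+ 2 + C * (dl ^+ 2 + dt ^+ 2)).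
    rewrite -{1}(ger0_norm (ltW D00)) -normrM.
    have -> : D0 * dl = (D0 * dl + (ze - b * dt - mu / 2 * dx ^+ 2)) - ze + b * dt + mu / 2 * dx ^+ 2 by ring.
    apply: le_trans (ler_normD _ _) _.
    rewrite [`|mu / 2 * dx ^+ 2|]ger0_norm; last by apply: mulr_ge0; [rewrite divr_ge0|exact: sqr_ge0].
    have := le_trans (ler_normD (D0 * dl + (ze - b * dt - mu / 2 * dx ^+ 2) - ze) (b * dt)) (lerD (ler_normB _ _) (lexx _)).
    rewrite [`|b * dt|]normrM (ger0_norm b0); lra.
  have C2 : C * dl ^+ 2 <= D0 / 2 * `|dl|.
    rewrite ll expr2 mulrA ler_wpM2r//.
    by apply: le_trans d2; rewrite ler_wpM2l.
  have C3 : C * dt ^+ 2 <= C * `|dt|.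
    by rewrite ler_wpM2l// tt expr2; have := normr_ge0 dt; nra.
  have D2 : D0 / 2 * `|dl| <= (1 + b + C + mu + ep) * (`|ze| + `|dt| + dx ^+ 2).
    have := sqr_ge0 dx; have := normr_ge0 dt; have := normr_ge0 ze.
    move: D1 C2 C3; move: (dl ^+ 2) (dt ^+ 2) (dx ^+ 2) `|dl| `|dt| `|ze| => L2 T2 X L T Z *.
    nra.
  rewrite KE; have -> : `|dl| = 2 / D0 * (D0 / 2 * `|dl|) by field; rewrite gt_eqF.
  by rewrite -(mulrA (2 / D0)) ler_wpM2l// divr_ge0// ltW.
have lK2 : dl ^+ 2 <= 3 * K ^+ 2 * (ze ^+ 2 + dt ^+ 2 + dx ^+ 2 * dx ^+ 2).
  have : dl ^+ 2 <= (K * (`|ze| + `|dt| + dx ^+ 2)) ^+ 2.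
    by rewrite ll lerXn2r ?nnegrE// mulr_ge0 ?(ltW K0)// addr_ge0 ?addr_ge0 ?sqr_ge0.
  move/le_trans; apply; rewrite exprMn.
  rewrite [leRHS](_ : _ = K ^+ 2 * (3 * (ze ^+ 2 + dt ^+ 2 + dx ^+ 2 * dx ^+ 2))); last by ring.
  rewrite ler_wpM2l ?sqr_ge0//.
  have zz : ze ^+ 2 = `|ze| ^+ 2 by rewrite real_normK// num_real.
  rewrite zz tt.
  move: (dx ^+ 2) `|dt| `|ze| => X T Z.
  have := sqr_ge0 (X - T); have := sqr_ge0 (X - Z); have := sqr_ge0 (Z - T); nra.
apply: (le_trans H).
have X0 := sqr_ge0 dx; have Z0 := sqr_ge0 ze; have T0 := sqr_ge0 dt.
have : C * dl ^+ 2 <= C * (3 * K ^+ 2 * (ze ^+ 2 + dt ^+ 2 + dx ^+ 2 * dx ^+ 2)) by rewrite ler_wpM2l.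
have : 3 * C * K ^+ 2 * (dx ^+ 2 * dx ^+ 2) <= ep * dx ^+ 2.
  rewrite mulrA ler_wpM2r//; apply: le_trans d3; rewrite ler_wpM2l//.
  by apply: mulr_ge0; [lra|exact: ltW].
have : 0 <= C * ze ^+ 2 by rewrite mulr_ge0.
lra.
Qed.

(** For y0 = l1 s and D the increment of l1, differencing x = m l1 s gives (m + dm) D = dx - y0 dm.
    The Bregman term [br] is about D^2 / (2 q), so (m + dm) br is about dx^2 / (2 m q); the cross
    term in dm dx is split by Young's inequality. *)
Lemma curvature_error (m q ep y0 : R) : 0 < m -> 0 < q -> 0 < ep ->
  exists K d eta : R, [/\ 0 <= K, 0 < d, 0 < eta & forall dm br D dx : R, `|dm| <= d ->
    (m + dm) * D = dx - y0 * dm -> `|2 * q * br - D ^+ 2| <= eta * D ^+ 2 ->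
    `|(m + dm) * br - (m * q)^-1 / 2 * dx ^+ 2| <= ep * dx ^+ 2 + K * dm ^+ 2].
Proof.
move=> m0 q0 ep0.
have mq0 : 0 < m * q by rewrite mulr_gt0.
have [p pE] : exists p, p = (m * q)^-1 by eexists.
have p0 : 0 < p by rewrite pE invr_gt0.
pose K := ep / 2 * y0 ^+ 2 + (y0 * p) ^+ 2 / (2 * ep) + y0 ^+ 2 * p / 2.
exists K, (Num.min (m / 2) (ep * q * m ^+ 2 / 8)), (ep * (m * q) / 8).
have mm0 : 0 < m ^+ 2 by rewrite exprn_gt0.
split.
- apply: addr_ge0; last by rewrite divr_ge0// mulr_ge0 ?sqr_ge0// ltW.
  apply: addr_ge0; first by rewrite mulr_ge0 ?sqr_ge0// divr_ge0// ltW.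
  by rewrite divr_ge0 ?sqr_ge0// mulr_ge0// ltW.
- rewrite lt_min; apply/andP; split; first by rewrite divr_gt0.
  by rewrite divr_gt0// mulr_gt0// mulr_gt0.
- by rewrite divr_gt0// mulr_gt0.
move=> dm br D dx; rewrite le_min => /andP[dm1 dm2] xiE Hbr.
have mt : m / 2 <= m + dm by move: dm1; rewrite ler_norml; lra.
have mt0 : 0 < m + dm by apply: lt_le_trans mt; rewrite divr_gt0.
rewrite -pE.
set xi := dx - y0 * dm in xiE.
have DE : D = xi / (m + dm) by rewrite -xiE mulrC mulKf// gt_eqF.
have X0 := sqr_ge0 xi.
have im : (m + dm)^-1 <= 2 / m by rewrite -[leRHS]invf_div lef_pV2 ?posrE ?divr_gt0.
have im0 : 0 < (m + dm)^-1 by rewrite invr_gt0.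
have S1 : `|(m + dm) * br - xi ^+ 2 / (2 * (m + dm) * q)| <= ep / 8 * xi ^+ 2.
  have -> : (m + dm) * br - xi ^+ 2 / (2 * (m + dm) * q) =
     (m + dm) / (2 * q) * (2 * q * br - D ^+ 2).
    by rewrite DE; field; rewrite !gt_eqF.
  have k0 : 0 <= (m + dm) / (2 * q) by rewrite divr_ge0 ?mulr_ge0// ltW.
  rewrite normrM (ger0_norm k0).
  apply: le_trans (ler_wpM2l k0 Hbr) _.
  have -> : (m + dm) / (2 * q) * (ep * (m * q) / 8 * D ^+ 2) =
      ep / 8 * xi ^+ 2 * ((m + dm)^-1 * (m / 2)).
    by rewrite DE; field; rewrite !gt_eqF.
  rewrite -[leRHS]mulr1; apply: ler_wpM2l; first by rewrite mulr_ge0// divr_ge0// ltW.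
  by rewrite mulrC -ler_pdivlMr// invrK mul1r.
have S2 : `|xi ^+ 2 / (2 * (m + dm) * q) - p / 2 * xi ^+ 2| <= ep / 8 * xi ^+ 2.
  have -> : xi ^+ 2 / (2 * (m + dm) * q) - p / 2 * xi ^+ 2 = - dm * ((m + dm)^-1 * (p / 2)) * xi ^+ 2.
    by rewrite pE; field; rewrite !gt_eqF.
  rewrite normrM (ger0_norm X0) ler_wpM2r// normrM normrN.
  have k0 : 0 <= (m + dm)^-1 * (p / 2) by rewrite mulr_ge0 ?divr_ge0// ltW.
  rewrite (ger0_norm k0).
  apply: le_trans (ler_wpM2r k0 dm2) _.
  apply: (@le_trans _ _ (ep * q * m ^+ 2 / 8 * (2 / m * (p / 2)))).
    apply: ler_wpM2l; first by rewrite divr_ge0// mulr_ge0 ?mulr_ge0// ltW.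
    by rewrite ler_wpM2r// divr_ge0// ltW.
  by rewrite le_eqVlt; apply/orP; left; apply/eqP; rewrite pE; field; rewrite !gt_eqF.
have S3 : `|p / 2 * xi ^+ 2 - p / 2 * dx ^+ 2| <= ep / 2 * dx ^+ 2 + ((y0 * p) ^+ 2 / (2 * ep) + y0 ^+ 2 * p / 2) * dm ^+ 2.
  have -> : p / 2 * xi ^+ 2 - p / 2 * dx ^+ 2 = - (y0 * p * dm * dx) + y0 ^+ 2 * p / 2 * dm ^+ 2.
    by rewrite /xi; field.
  apply: le_trans (ler_normD _ _) _; rewrite normrN.
  rewrite [`|_ * dm ^+ 2|]ger0_norm; last first.
    by apply: mulr_ge0; [rewrite divr_ge0// mulr_ge0 ?sqr_ge0// ltW|exact: sqr_ge0].
  rewrite (mulrDl _ _ (dm ^+ 2)) addrA lerD2r.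
  have H w : 0 <= (ep * dx + w) ^+ 2 / (2 * ep) by rewrite divr_ge0 ?sqr_ge0// mulr_ge0// ltW.
  have E w : (ep * dx + w) ^+ 2 / (2 * ep) = ep / 2 * dx ^+ 2 + w * dx + w ^+ 2 / (2 * ep).
    by field; rewrite gt_eqF.
  have := H (y0 * p * dm); have := H (- (y0 * p * dm)); rewrite !E.
  have -> : (y0 * p * dm) ^+ 2 / (2 * ep) = (y0 * p) ^+ 2 / (2 * ep) * dm ^+ 2 by rewrite exprMn mulrAC.
  have -> : (- (y0 * p * dm)) ^+ 2 / (2 * ep) = (y0 * p) ^+ 2 / (2 * ep) * dm ^+ 2 by rewrite sqrrN exprMn mulrAC.
  by rewrite ler_norml; lra.
have S4 : xi ^+ 2 <= 2 * dx ^+ 2 + 2 * (y0 ^+ 2 * dm ^+ 2).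
  have := sqr_ge0 (dx + y0 * dm).
  have -> : (dx + y0 * dm) ^+ 2 = 2 * dx ^+ 2 + 2 * (y0 ^+ 2 * dm ^+ 2) - xi ^+ 2 by rewrite /xi; ring.
  by lra.
have S5 : ep / 4 * xi ^+ 2 <= ep / 4 * (2 * dx ^+ 2 + 2 * (y0 ^+ 2 * dm ^+ 2)).
  by rewrite ler_wpM2l// divr_ge0// ltW.
move: S1 S2 S3; rewrite /K !ler_norml.
move: (_ / (2 * (m + dm) * q)) S5 => Y.
move: ((y0 * p) ^+ 2 / (2 * ep)) ((m + dm) * br) => Z Br.
lra.
Qed.

Lemma inv_le2 (lam : R) : 2^-1 <= lam -> 0 < lam /\ 0 < lam^-1 <= 2.
Proof.
move=> h; have h2 : (0 : R) < 2^-1 by rewrite invr_gt0.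
have h0 : 0 < lam by apply: lt_le_trans h.
by split => //; rewrite invr_gt0 h0 /= -[leRHS]invrK lef_pV2 ?posrE.
Qed.

(** The slope s with l1 s = x / m maximises s x - m l s. If the constraint were slack there, all
    constraints would still hold for a smaller lam, against minimality. *)
Lemma dilation_contact (l l1 l2 : R -> R) (c a e : R) (sl : smooth_profile l l1 l2) (c0 : 0 < c)
    (lc : forall s, c * (1 + `|s|) <= l s) (e0 : 0 <= e)
    (range_l1 : forall y k, (forall s, s * y - l s <= k) -> exists s, l1 s = y) x z t :
  let L := dilation l a e in 0 <= t -> e * t <= a -> 2^-1 < L x z t ->
  exists s, x = (L x z t + a - e * t) * l1 s /\
    z = s * x - (L x z t + a - e * t) * l s + t / L x z t.
Proof.
move=> L t0 eta; have := in_dilation l c a e c0 lc x z t t0 eta.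
set lam := L x z t => HP l2'.
set m := lam + a - e * t in HP *.
have l0 := growth_gt0 l c c0 lc.
have m0 : 0 < m by have [] := inv_le2 _ (ltW l2'); rewrite /m; lra.
have [s Es] : exists s, l1 s = x / m.
  apply: (range_l1 _ ((z - t / lam) / m)) => s.
  rewrite ler_pdivlMr// mulrBl -mulrA divfK ?gt_eqF//.
  by have := HP s; lra.
have xE : x = m * l1 s by rewrite Es mulrC divfK// gt_eqF.
exists s; split => //.
apply/eqP; rewrite eq_le; apply/andP; split; last by have := HP s; lra.
rewrite leNgt; apply/negP => gap.
set g := z - (s * x - m * l s + t / lam).
have g0 : 0 < g by rewrite /g; lra.
have ls1 : l1 s < l1 (s + 1) by apply: profile_slope_lt sl _ _ _; rewrite ltrDl.
have ls2 : l1 (s - 1) < l1 s by apply: profile_slope_lt sl _ _ _; rewrite ltrBlDr ltrDl.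
(* Lowering lam by d costs at most d M on [s - 1, s + 1]: l is at most l (s + 1) + 2 |l1 (s - 1)|
   there, and t / lam changes by at most 4 t d. *)
pose M := l (s + 1) + 2 * `|l1 (s - 1)| + 4 * t + 1.
have M0 : 0 < M by have := l0 (s + 1); have := normr_ge0 (l1 (s - 1)); rewrite /M; lra.
(* [A1] and [A2] keep x / m' between l1 (s - 1) and l1 (s + 1), so that the constraints outside
   [s - 1, s + 1] follow by convexity from those at its end points. *)
pose A1 := m * (l1 (s + 1) - l1 s) / (`|l1 (s + 1)| + 1).
pose A2 := m * (l1 s - l1 (s - 1)) / (`|l1 (s - 1)| + 1).
have n1 : 0 < `|l1 (s + 1)| + 1 by rewrite ltr_wpDl.
have n2 : 0 < `|l1 (s - 1)| + 1 by rewrite ltr_wpDl.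
have A10 : 0 < A1 by rewrite divr_gt0// mulr_gt0// subr_gt0.
have A20 : 0 < A2 by rewrite divr_gt0// mulr_gt0// subr_gt0.
pose d := Num.min (lam - 2^-1) (Num.min A1 (Num.min A2 (g / (2 * M)))).
have d0 : 0 < d by rewrite !lt_min subr_gt0 l2' A10 A20 /= divr_gt0// mulr_gt0.
have d1 : d <= lam - 2^-1 by rewrite ge_min lexx.
have d2 : d <= A1 by rewrite !ge_min lexx !orbT.
have d3 : d <= A2 by rewrite !ge_min lexx !orbT.
have d4 : d * (2 * M) <= g.
  by rewrite -ler_pdivlMr ?mulr_gt0// !ge_min lexx !orbT.
pose lam' := lam - d.
have l2'' : 2^-1 <= lam' by rewrite /lam'; lra.
suff : L x z t <= lam' by rewrite -/lam /lam'; lra.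
apply/(dilation_leP l c a e c0 lc) => // s'.
have -> : lam' + a - e * t = m - d by rewrite /lam' /m; ring.
set m' := m - d.
have m'0 : 0 < m'.
  by have [] := inv_le2 _ l2''; rewrite /m' /m /lam'; lra.
have B1 : x <= m' * l1 (s + 1).
  rewrite xE /m'; move: d2; rewrite ler_pdivlMr// => d2.
  have : d * l1 (s + 1) <= d * (`|l1 (s + 1)| + 1).
    by rewrite ler_wpM2l ?(ltW d0)//; have := ler_norm (l1 (s + 1)); lra.
  lra.
have B2 : m' * l1 (s - 1) <= x.
  rewrite xE /m'; move: d3; rewrite ler_pdivlMr// => d3.
  have : - (d * l1 (s - 1)) <= d * (`|l1 (s - 1)| + 1).
    by rewrite -mulrN ler_wpM2l ?(ltW d0)//; have := ler_norm (- l1 (s - 1)); rewrite normrN; lra.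
  lra.
have tl : t / lam' <= t / lam + 4 * t * d.
  have [lp /andP[i1 i2]] := inv_le2 _ (ltW l2'); have [lp' /andP[i1' i2']] := inv_le2 _ l2''.
  have E : t / lam' - t / lam = t * d * (lam^-1 * lam'^-1).
    by rewrite /lam'; field; rewrite !gt_eqF.
  have : lam^-1 * lam'^-1 <= 4.
    apply: le_trans (_ : 2 * 2 <= 4); last by rewrite -natrM.
    by apply: ler_pM => //; exact: ltW.
  move=> h; have : t * d * (lam^-1 * lam'^-1) <= t * d * 4 by rewrite ler_wpM2l// mulr_ge0// ltW.
  by rewrite -E; clear; lra.
have core r : s - 1 <= r <= s + 1 -> r * x - z + t / lam' <= m' * l r.
  move=> /andP[r1 r2].
  have lM : l r <= l (s + 1) + 2 * `|l1 (s - 1)|.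
    have := profile_tangent _ _ _ sl r (s + 1).
    have : l1 (s - 1) <= l1 r by apply: profile_slope_le sl _ _ _.
    have := ler_norm (- l1 (s - 1)); rewrite normrN.
    move: (l (s + 1)) (l r) (l1 (s - 1)) (l1 r) `|l1 (s - 1)| (normr_ge0 (l1 (s - 1))) => ? ? ? ? ? ? *; nra.
  have T : r * x - m * l r <= s * x - m * l s.
    have := profile_tangent _ _ _ sl s r; rewrite xE => h.
    have : m * (l s + l1 s * (r - s)) <= m * l r by rewrite ler_wpM2l ?(ltW m0).
    by lra.
  have dl : d * l r <= d * (l (s + 1) + 2 * `|l1 (s - 1)|) by rewrite ler_wpM2l ?(ltW d0).
  have : d * M <= g / 2 by move: d4; clear; lra.
  by move: T dl tl g0; rewrite /M /g /m'; clear -d0; lra.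
have [r1|r1] := leP s' (s + 1); last first.
  have := core (s + 1); rewrite lexx andbT => /(_ _)H; have {}H := H ltac:(lra).
  have := profile_tangent _ _ _ sl (s + 1) s' => h.
  have : m' * (l (s + 1) + l1 (s + 1) * (s' - (s + 1))) <= m' * l s' by rewrite ler_wpM2l ?(ltW m'0).
  have : x * (s' - (s + 1)) <= m' * l1 (s + 1) * (s' - (s + 1)) by rewrite ler_wpM2r// subr_ge0 ltW.
  lra.
have [r2|r2] := leP (s - 1) s'; first by apply: core; rewrite r2.
have := core (s - 1); rewrite lexx /= => /(_ _)H; have {}H := H ltac:(lra).
have := profile_tangent _ _ _ sl (s - 1) s' => h.
have : m' * (l (s - 1) + l1 (s - 1) * (s' - (s - 1))) <= m' * l s' by rewrite ler_wpM2l ?(ltW m'0).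
have : m' * l1 (s - 1) * ((s - 1) - s') <= x * ((s - 1) - s') by rewrite ler_wpM2r// subr_ge0 ltW.
lra.
Qed.

(** The contact equations of two neighbouring points are subtracted. The result [main] is exact: its
    nonlinear parts are the Bregman term of l, which yields mu / 2 dx^2, and a remainder of t / lam.
    Here [b] and [- D] are the derivatives in t and in lam of the leaf height s x - m l s + t /
    lam. *)
Lemma dilation_expansion (l l1 l2 : R -> R) (c a e : R) (sl : smooth_profile l l1 l2) (c0 : 0 < c)
    (lc : forall s, c * (1 + `|s|) <= l s) (e0 : 0 <= e)
    (range_l1 : forall y k, (forall s, s * y - l s <= k) -> exists s, l1 s = y) x0 z0 t0 :
  let L := dilation l a e in 0 < t0 -> 2^-1 < L x0 z0 t0 ->
  (exists2 r : R, 0 < r & forall dt, `|dt| < r -> e * (t0 + dt) <= a) ->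
  let lam := L x0 z0 t0 in let m := lam + a - e * t0 in
  exists s, x0 = m * l1 s /\
    let D := l s + t0 / lam ^+ 2 in let b := e * l s + lam^-1 in
    let mu := (m * l2 s)^-1 in
    forall ep : R, 0 < ep -> exists C d : R, [/\ 0 <= C, 0 < d &
      forall dx dz dt, `|dx| < d -> `|dz| < d -> `|dt| < d ->
      `|D * (L (x0 + dx) (z0 + dz) (t0 + dt) - lam) + (dz - s * dx - b * dt - mu / 2 * dx ^+ 2)|
        <= ep * dx ^+ 2 + C * ((dz - s * dx) ^+ 2 + dt ^+ 2)].
Proof.
move=> L t00 l2' [r1 r10 Hr1] lam m.
have et0 : e * t0 <= a by have := Hr1 0; rewrite normr0 addr0; apply.
have [s [xE zE]] := dilation_contact l l1 l2 c a e sl c0 lc e0 range_l1 x0 z0 t0 (ltW t00) et0 l2'.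
rewrite -/L -/lam -/m in xE zE l2'.
exists s; split => // D b mu ep ep0.
have [_ _ p2] := sl.
have l0 := growth_gt0 l c c0 lc.
have [lp /andP[i1 i2]] := inv_le2 _ (ltW l2').
have m0 : 0 < m by rewrite /m; lra.
have D0 : 0 < D by rewrite addr_gt0// divr_gt0// exprn_gt0.
have b0 : 0 <= b by rewrite addr_ge0 ?mulr_ge0 ?(ltW (l0 s))// ltW.
have q0 := p2 s; set q := l2 s in q0 mu *.
have mu0 : 0 < mu by rewrite invr_gt0 mulr_gt0.
pose ep1 := ep / 2.
have ep10 : 0 < ep1 by rewrite divr_gt0.
have [K [dK [eta [K0 dK0 eta0 HK]]]] := curvature_error m q ep1 (l1 s) m0 q0 ep10.
have [r r0 Hr] := profile_bregman _ _ _ sl s eta eta0.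
pose C1 := 2 * K * (1 + e ^+ 2) + 2 + 8 * t0.
have C10 : 0 <= C1.
  rewrite /C1; have := sqr_ge0 e => h.
  have : 0 <= K * (1 + e ^+ 2) by rewrite mulr_ge0// addr_ge0.
  lra.
have [C' [dA [C'0 dA0 HA]]] := expansion_absorb D b mu ep1 C1 D0 b0 (ltW mu0) ep10 C10.
(* The new contact slope s1 is controlled through l1 only: by monotonicity |l1 s1 - l1 s| < rho
   forces |s1 - s| < r / 2, within reach of [profile_bregman]. *)
pose rho := Num.min (l1 (s + r / 2) - l1 s) (l1 s - l1 (s - r / 2)).
have r20 : 0 < r / 2 by rewrite divr_gt0.
have rho0 : 0 < rho.
  by rewrite lt_min !subr_gt0; apply/andP; split; apply: (profile_slope_lt _ _ _ sl);
    rewrite ?ltrDl// ltrBlDr ltrDl.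
pose B := 4 / c + e + 1.
have B0 : 0 < B.
  have h : 0 < 4 / c by rewrite divr_gt0.
  by rewrite /B ltr_pwDr ?addr_ge0 ?(ltW h).
have y1 : 0 < 1 + `|l1 s| * (1 + e) by rewrite ltr_pwDl// mulr_ge0// addr_ge0.
pose d0 := Num.min (lam - 2^-1) (Num.min dA (Num.min (dK / (1 + e)) (Num.min (m / (2 * (1 + e))) (rho * m / (2 * (1 + `|l1 s| * (1 + e))))))).
have e1 : 0 < 1 + e by rewrite ltr_pwDl.
have d00 : 0 < d0.
  rewrite !lt_min subr_gt0 l2' dA0 /= !divr_gt0//.
  - by rewrite mulr_gt0.
  - by rewrite mulr_gt0.
  - by rewrite mulr_gt0.
have dd1 : d0 <= lam - 2^-1 by rewrite ge_min lexx.
have dd2 : d0 <= dA by rewrite !ge_min lexx !orbT.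
have dd3 : d0 * (1 + e) <= dK by rewrite -ler_pdivlMr// !ge_min lexx !orbT.
have dd4 : d0 * (2 * (1 + e)) <= m by rewrite -ler_pdivlMr ?mulr_gt0// !ge_min lexx !orbT.
have dd5 : d0 * (2 * (1 + `|l1 s| * (1 + e))) <= rho * m.
  by rewrite -ler_pdivlMr ?mulr_gt0// !ge_min lexx !orbT.
clearbody d0.
exists C', (Num.min (d0 / B) (Num.min d0 (Num.min r1 t0))); split => //.
  by rewrite !lt_min d00 r10 t00 divr_gt0.
move=> dx dz dt; rewrite !lt_min => /and4P[x1 x2 _ _] /and4P[z1 z2 _ _] /and4P[t1 t2 t3 t4].
have t0dt : 0 <= t0 + dt by move: t4; rewrite ltr_norml; clear; lra.
have eta1 := Hr1 _ t3.
set lam1 := L (x0 + dx) (z0 + dz) (t0 + dt).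
set dl := lam1 - lam.
have dlB : `|dl| < d0.
  have H1 := dilation_lipschitz l c a e c0 lc e0 x0 z0 t0 (x0 + dx) (z0 + dz) (t0 + dt) (ltW t00) et0 t0dt eta1.
  have H2 := dilation_lipschitz l c a e c0 lc e0 (x0 + dx) (z0 + dz) (t0 + dt) x0 z0 t0 t0dt eta1 (ltW t00) et0.
  have Sx (u v : R) : (u + v - u = v) * (u - (u + v) = - v) by split; ring.
  rewrite !Sx !normrN in H1 H2; rewrite -/L -/lam -/lam1 in H1 H2.
  have : `|dl| <= (`|dx| + `|dz| + 2 * `|dt|) / c + e * `|dt|.
    by rewrite ler_norml /dl; move: H1 H2; clear; move=> H1 H2; apply/andP; split; lra.
  move/le_lt_trans; apply.
  have E : d0 = (d0 / B + d0 / B + 2 * (d0 / B)) / c + e * (d0 / B) + d0 / B.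
    by rewrite [LHS](_ : _ = d0 / B * B); [rewrite /B; ring|rewrite divfK// gt_eqF].
  rewrite E; apply: ltr_pwDr; first by rewrite divr_gt0.
  apply: lerD; last by rewrite ler_wpM2l// ltW.
  by rewrite ler_wpM2r ?invr_ge0 ?(ltW c0)//; move: x1 z1 t1; clear; lra.
have l2'' : 2^-1 < lam1 by move: dlB dd1; rewrite /dl ltr_norml; clear; lra.
have [s1 [xE1 zE1]] := dilation_contact l l1 l2 c a e sl c0 lc e0 range_l1 _ _ _ t0dt eta1 l2''.
rewrite -/L -/lam1 in xE1 zE1.
pose dm := dl - e * dt.
have mE : lam1 + a - e * (t0 + dt) = m + dm by rewrite /dm /dl /m; ring.
rewrite mE in xE1 zE1.
have edt : e * `|dt| <= e * d0 by rewrite ler_wpM2l// ltW.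
have dmB : `|dm| <= d0 * (1 + e).
  apply: le_trans (ler_normB _ _) _; rewrite normrM (ger0_norm e0).
  by move: edt dlB; clear; lra.
set De := l1 s1 - l1 s.
have xi : (m + dm) * De = dx - l1 s * dm by rewrite /De mulrBr -xE1 xE; ring.
have mt : m / 2 <= m + dm.
  by move: dmB dd4; rewrite ler_norml; clear; lra.
have mt0 : 0 < m + dm by apply: lt_le_trans mt; rewrite divr_gt0.
have DeB : `|De| < rho.
  have : (m + dm) * `|De| < rho * (m / 2).
    rewrite -{1}(gtr0_norm mt0) -normrM xi.
    apply: le_lt_trans (ler_normB _ _) _; rewrite normrM.
    have : `|l1 s| * `|dm| <= `|l1 s| * (d0 * (1 + e)) by rewrite ler_wpM2l.
    by move: x2 dd5; clear; lra.
  have := ler_wpM2r (normr_ge0 De) mt; rewrite (mulrC rho).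
  move=> h1 h2; have := le_lt_trans h1 h2.
  by rewrite ltr_pM2l// divr_gt0.
have s1r : `|s1 - s| < r.
  suff : `|s1 - s| < r / 2 by move=> h; apply: lt_trans h _; rewrite ltr_pdivrMr// ltr_pMr// ltr1n.
  move: DeB; rewrite lt_min /De => /andP[h1 h2].
  rewrite ltr_norml; apply/andP; split.
    rewrite ltrBrDr addrC ltNge; apply/negP => h.
    have := profile_slope_le _ _ _ sl _ _ h.
    by move: h2; rewrite ltr_norml; clear; lra.
  rewrite ltrBlDr addrC ltNge; apply/negP => h.
  have := profile_slope_le _ _ _ sl _ _ h.
  by move: h1; rewrite ltr_norml; clear; lra.
have brE := Hr s1 s1r; rewrite -/De -/q in brE.
set br := (s1 - s) * l1 s1 - l s1 + l s in brE.
have KE := HK dm br De dx (le_trans dmB dd3) xi brE; rewrite -/mu in KE.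
have [lp1 /andP[j1 j2]] := inv_le2 _ (ltW l2'').
(* The remainder of t / lam after its first order terms in dt and dl. *)
pose E1 := dl * (lam1^-1 * lam^-1) * (t0 * dl * lam^-1 - dt).
have main : D * dl + (dz - s * dx - b * dt - mu / 2 * dx ^+ 2) = ((m + dm) * br - mu / 2 * dx ^+ 2) + E1.
  have -> : dz = s1 * (x0 + dx) - (m + dm) * l s1 + (t0 + dt) / lam1 - z0 by rewrite -zE1; ring.
  rewrite zE.
  have -> : s1 * (x0 + dx) = s * (x0 + dx) + (s1 - s) * ((m + dm) * l1 s1) by rewrite -xE1; ring.
  rewrite /E1 /br /D /b xE /dm.
  have -> : lam1 = lam + dl by rewrite /dl; ring.
  have : lam + dl != 0 by rewrite /dl addrC subrK gt_eqF.
  have : lam != 0 by rewrite gt_eqF.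
  move=> n1 n2; field.
  by rewrite n1 n2.
have E1B : `|E1| <= 2 * dt ^+ 2 + (2 + 8 * t0) * dl ^+ 2.
  have i40 : 0 <= lam1^-1 * lam^-1 by rewrite mulr_ge0 ?(ltW j1) ?(ltW i1).
  have i4 : lam1^-1 * lam^-1 <= 4.
    apply: le_trans (_ : 2 * 2 <= 4); last by rewrite -natrM.
    by apply: ler_pM; rewrite // ltW.
  have -> : E1 = (lam1^-1 * lam^-1) * (t0 * dl ^+ 2 * lam^-1 - dl * dt) by rewrite /E1; ring.
  rewrite normrM (ger0_norm i40).
  have h : `|t0 * dl ^+ 2 * lam^-1 - dl * dt| <= 2 * t0 * dl ^+ 2 + (dl ^+ 2 + dt ^+ 2) / 2.
    apply: le_trans (ler_normB _ _) _; apply: lerD.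
      rewrite ger0_norm; last by apply: mulr_ge0; [apply: mulr_ge0; [exact: ltW|exact: sqr_ge0]|exact: ltW].
      have tl0 : 0 <= t0 * dl ^+ 2 by apply: mulr_ge0; [exact: ltW|exact: sqr_ge0].
      by rewrite [leRHS](_ : _ = t0 * dl ^+ 2 * 2); [rewrite ler_wpM2l|ring].
    have := sqr_ge0 (dl - dt); have := sqr_ge0 (dl + dt).
    by rewrite ler_norml; move: (dl) (dt); clear => u v; rewrite !expr2; lra.
  apply: le_trans (ler_pM i40 (normr_ge0 _) i4 h) _.
  have := sqr_ge0 dl; have := sqr_ge0 dt; move: (dl ^+ 2) (dt ^+ 2); clear -t00; move=> *; lra.
have dm2 : dm ^+ 2 <= 2 * dl ^+ 2 + 2 * (e ^+ 2 * dt ^+ 2).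
  have := sqr_ge0 (dl + e * dt).
  have -> : (dl + e * dt) ^+ 2 = 2 * dl ^+ 2 + 2 * (e ^+ 2 * dt ^+ 2) - dm ^+ 2 by rewrite /dm; ring.
  by clear; lra.
rewrite (_ : ep = 2 * ep1); last by rewrite /ep1; field.
apply: HA; rewrite -/dl.
- exact: le_trans (ltW dlB) dd2.
- exact: le_trans (ltW x2) dd2.
- exact: le_trans (ltW t2) dd2.
rewrite main; apply: le_trans (ler_normD _ _) _.
have : K * dm ^+ 2 <= K * (2 * dl ^+ 2 + 2 * (e ^+ 2 * dt ^+ 2)) by rewrite ler_wpM2l.
have := sqr_ge0 dl; have := sqr_ge0 dt => T0 L0.
have : 0 <= K * dt ^+ 2 by rewrite mulr_ge0.
have : 0 <= K * e ^+ 2 * dl ^+ 2 by apply: mulr_ge0 => //; apply: mulr_ge0 => //; exact: sqr_ge0.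
have : 0 <= t0 * dt ^+ 2 by rewrite mulr_ge0// ltW.
move: KE E1B; rewrite /C1; move: `|_ - _| `|E1| => U1 U2.
by move: T0 L0; clear; lra.
Qed.

End Expansion.

(** * Quadratic test functions and comparison *)

Section QuadraticTests.
Context {R : realType}.
Implicit Types (q v w : R * R * R) (k a b c C : R).

Definition affine3 k a b c q : R := k + a * q.1.1 + b * q.1.2 + c * q.2.

Lemma line3E q v k : q + k *: v = ((q.1.1 + k * v.1.1, q.1.2 + k * v.1.2), q.2 + k * v.2).
Proof. by case: q => [[q1 q2] q3]; case: v => [[v1 v2] v3]. Qed.

Lemma norm3_le q : [/\ `|q.1.1| <= `|q|, `|q.1.2| <= `|q| & `|q.2| <= `|q|].
Proof.
case: q => [[x z] t]; rewrite !prod_normE /=.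
by split; rewrite !le_max lexx ?orbT.
Qed.

Lemma norm3_lt q d : (`|q| < d) = [&& `|q.1.1| < d, `|q.1.2| < d & `|q.2| < d].
Proof.
case: q => [[x z] t]; rewrite !prod_normE /= !gt_max.
by rewrite -andbA.
Qed.

Lemma affine3_continuous k a b c : continuous (affine3 k a b c).
Proof.
move=> q; apply/continuous_norm_epsP => e e0.
have C0 : 0 < `|a| + `|b| + `|c| + 1 by rewrite ltr_wpDl// !addr_ge0.
exists (e / (`|a| + `|b| + `|c| + 1)); first exact: divr_gt0.
move=> p; rewrite ltr_pdivlMr// => pq.
have [/= h1 h2 h3] := norm3_le (p - q).
rewrite /affine3.
have -> : k + a * p.1.1 + b * p.1.2 + c * p.2 - (k + a * q.1.1 + b * q.1.2 + c * q.2) =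
  a * (p.1.1 - q.1.1) + b * (p.1.2 - q.1.2) + c * (p.2 - q.2) by ring.
apply: le_lt_trans pq; apply: le_trans (ler_normD _ _) _.
apply: le_trans (lerD (ler_normD _ _) (lexx _)) _; rewrite !normrM !mulrDr mulr1 !(mulrC `|p - q|).
rewrite -[leLHS]addr0; apply: lerD => //.
by apply: lerD; [apply: lerD|]; rewrite ler_wpM2l.
Qed.

Lemma is_derive_affine3 k a b c q v :
  is_derive q v (affine3 k a b c) (a * v.1.1 + b * v.1.2 + c * v.2).
Proof.
apply/is_derive0_lineP.
apply: (@is_derive_ext _ (fun h : R => affine3 k a b c q + (a * v.1.1 + b * v.1.2 + c * v.2) * h)).
  by move=> h; rewrite line3E /affine3 /=; ring.
have := is_derive_addf _ _ _ _ _ (is_derive_cstf (affine3 k a b c q) 0)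
  (is_derive_scalef (a * v.1.1 + b * v.1.2 + c * v.2) _ _ _ (is_derive_idf 0)).
by rewrite add0r mulr1.
Qed.

Section Quadratic.
Context (q0 : R * R * R) (tau p1 p2 a b c C : R).

Definition quad3 q : R :=
  tau * (q.2 - q0.2) + p1 * (q.1.1 - q0.1.1) + p2 * (q.1.2 - q0.1.2)
  + (a * (q.1.1 - q0.1.1) ^+ 2 + 2 * b * ((q.1.1 - q0.1.1) * (q.1.2 - q0.1.2))
     + c * (q.1.2 - q0.1.2) ^+ 2) / 2
  + C * (q.2 - q0.2) ^+ 2.

Let dquad v : R * R * R -> R :=
  let ka := a * v.1.1 + b * v.1.2 in let kb := b * v.1.1 + c * v.1.2 in
  let kc := 2 * C * v.2 in
  affine3 (tau * v.2 + p1 * v.1.1 + p2 * v.1.2 - ka * q0.1.1 - kb * q0.1.2 - kc * q0.2)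
    ka kb kc.

Lemma is_derive_quad3 q v : is_derive q v quad3 (dquad v q).
Proof.
apply/is_derive0_lineP.
apply: (@is_derive_ext _ (fun h : R => quad3 q + dquad v q * h +
   ((a * v.1.1 ^+ 2 + 2 * b * (v.1.1 * v.1.2) + c * v.1.2 ^+ 2) / 2 + C * v.2 ^+ 2) * (h * h))).
  by move=> h; rewrite line3E /quad3 /dquad /affine3 /=; field.
have dI := is_derive_idf (0 : R).
apply: is_derive_eqf (is_derive_addf _ _ _ _ _ (is_derive_addf _ _ _ _ _
  (is_derive_cstf (quad3 q) 0) (is_derive_scalef (dquad v q) _ _ _ dI))
  (is_derive_scalef _ _ _ _ (is_derive_mulf _ _ _ _ _ dI dI))).
by ring.
Qed.

Lemma quad3_deriveE v : (fun q => 'D_v quad3 q) = dquad v.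
Proof. by apply/funext => q; have [] := is_derive_quad3 q v. Qed.

Lemma quad3_C2 A : C2_on A quad3.
Proof.
split=> [v p _|v w p _].
  split; first by have [] := is_derive_quad3 p v.
  by rewrite quad3_deriveE; exact: affine3_continuous.
rewrite quad3_deriveE /dquad; split.
  exact: (@ex_derive _ _ _ _ _ _ _ (is_derive_affine3 _ _ _ _ p w)).
have -> : (fun q => 'D_w (dquad v) q) = (fun=> (a * v.1.1 + b * v.1.2) * w.1.1 +
   (b * v.1.1 + c * v.1.2) * w.1.2 + 2 * C * v.2 * w.2).
  by apply/funext => q; have [_ ->] := is_derive_affine3
   (tau * v.2 + p1 * v.1.1 + p2 * v.1.2 - (a * v.1.1 + b * v.1.2) * q0.1.1 -
     (b * v.1.1 + c * v.1.2) * q0.1.2 - 2 * C * v.2 * q0.2)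
   (a * v.1.1 + b * v.1.2) (b * v.1.1 + c * v.1.2) (2 * C * v.2) q w.
exact: cst_continuous.
Qed.

Lemma quad3_time : 'D_st quad3 q0 = tau.
Proof.
have -> : 'D_st quad3 q0 = dquad st q0 by have [] := is_derive_quad3 q0 st.
by rewrite /dquad /affine3 /st /=; ring.
Qed.

Lemma quad3_jet : space_jet quad3 q0 = ((p1, p2), (a, b, c)).
Proof.
have D1 v : 'D_v quad3 q0 = dquad v q0 by have [] := is_derive_quad3 q0 v.
have D2 v w : 'D_w (fun q => 'D_v quad3 q) q0 = (a * v.1.1 + b * v.1.2) * w.1.1 +
   (b * v.1.1 + c * v.1.2) * w.1.2 + 2 * C * v.2 * w.2.
  rewrite quad3_deriveE.
  by have [_ ->] := is_derive_affine3
   (tau * v.2 + p1 * v.1.1 + p2 * v.1.2 - (a * v.1.1 + b * v.1.2) * q0.1.1 -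
     (b * v.1.1 + c * v.1.2) * q0.1.2 - 2 * C * v.2 * q0.2)
   (a * v.1.1 + b * v.1.2) (b * v.1.1 + c * v.1.2) (2 * C * v.2) q0 w.
have E1 : 'D_sx quad3 q0 = p1 by rewrite D1 /dquad /affine3 /=; ring.
have E2 : 'D_sz quad3 q0 = p2 by rewrite D1 /dquad /affine3 /=; ring.
have E3 : 'D_sx (fun q => 'D_sx quad3 q) q0 = a by rewrite D2 /=; ring.
have E4 : 'D_sz (fun q => 'D_sx quad3 q) q0 = b by rewrite D2 /=; ring.
have E5 : 'D_sz (fun q => 'D_sz quad3 q) q0 = c by rewrite D2 /=; ring.
exact: (congr2 pair (congr2 pair E1 E2) (congr2 pair (congr2 pair E3 E4) E5)).
Qed.

End Quadratic.

Section Subsolutions.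
Context (phi psi : R * R -> R).
Implicit Types (V : R * R * R -> R) (f : R -> R -> R -> R) (x z t : R).

(** A bound on the upper envelope at the jet, free of extended reals; the singular gradients are
    left out as in the envelope. *)
Definition op_le_near (p1 p2 a b c B : R) := exists2 d : R, 0 < d &
  forall p1' p2' a' b' c', `|p1' - p1| < d -> `|p2' - p2| < d -> `|a' - a| < d ->
    `|b' - b| < d -> `|c' - c| < d -> (p1', p2') != 0 :> R * R ->
    level_set_op phi psi ((p1', p2'), (a', b', c')) <= B.

(** Only the quadratic tests that [comparison] needs. The form is closed under translation in space
    and covers both a subsolution and the opposite of a supersolution. *)
Definition quad_subsolution f := forall x z t tau p1 p2 a b c C B d,
  0 < t -> 0 < d ->
  (forall dx dz dt, `|dx| < d -> `|dz| < d -> `|dt| < d ->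
    f (x + dx) (z + dz) (t + dt) <= f x z t + tau * dt + p1 * dx + p2 * dz
      + (a * dx ^+ 2 + 2 * b * (dx * dz) + c * dz ^+ 2) / 2 + C * dt ^+ 2) ->
  op_le_near p1 p2 a b c B -> tau <= B.

Lemma op_le_near_within (p1 p2 a b c B : R) : op_le_near p1 p2 a b c B ->
  within [set qY : R * R * (R * R * R) | qY.1 != 0] (nbhs ((p1, p2), (a, b, c)))
    [set qY | level_set_op phi psi qY <= B].
Proof.
move=> [d d0 H]; apply/nbhs_ballP; exists d => // -[[q1 q2] [[a' b'] c']].
rewrite -ball_normE /= distrC => Hd q0.
have : `|(q1, q2) - (p1, p2)| < d /\ `|(a', b', c') - (a, b, c)| < d.
  by move: Hd; rewrite prod_normE gt_max => /andP[].
rewrite norm3_lt prod_normE gt_max /= => -[/andP[h1 h2] /and3P[h3 h4 h5]].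
exact: H.
Qed.

Lemma viscosity_quad_subsolution V : viscosity_subsolution phi psi V ->
  quad_subsolution (fun x z t => V ((x, z), t)).
Proof.
move=> HV x z t tau p1 p2 a b c C B d t0 d0 Hd HB.
pose q0 : R * R * R := ((x, z), t).
have := HV _ (quad3_C2 q0 tau p1 p2 a b c C _) q0 t0.
rewrite quad3_jet quad3_time => Hsub.
have {}Hsub : (tau%:E <= level_set_op_upper phi psi (p1, p2, (a, b, c)))%E.
  apply: Hsub; apply/nbhs_ballP; exists d => // -[[x' z'] t'].
  rewrite -ball_normE /= distrC norm3_lt /= => /and3P[h1 h2 h3].
  have := Hd _ _ _ h1 h2 h3; rewrite !(addrC _ (_ - _)) !subrK /quad3 /=.
  by rewrite !subrr expr0n /= !mulr0; lra.
rewrite -lee_fin; apply: le_trans Hsub _.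
apply: ge_ereal_inf; eexists.
  by exists [set qY | level_set_op phi psi qY <= B] => //; exact: op_le_near_within HB.
by apply: ge_ereal_sup => _ [qY /= HqY <-]; rewrite lee_fin.
Qed.


(** The operator is odd in (p, X), because [mobility_curv] is even; changing sign therefore
    exchanges the two envelopes. *)
Lemma viscosity_quad_supersolution V : regular_norm phi -> is_norm psi ->
  viscosity_supersolution phi psi V ->
  quad_subsolution (fun x z t => - V ((x, z), t)).
Proof.
move=> rphi hpsi HV x z t tau p1 p2 a b c C B d t0 d0 Hd HB.
pose q0 : R * R * R := ((x, z), t).
have := HV _ (quad3_C2 q0 (- tau) (- p1) (- p2) (- a) (- b) (- c) (- C) _) q0 t0.
rewrite quad3_jet quad3_time => Hsup.
have {}Hsup : (level_set_op_lower phi psi ((- p1)%R, (- p2)%R, ((- a)%R, (- b)%R, (- c)%R)) <= (- tau)%:E)%E.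
  apply: Hsup; apply/nbhs_ballP; exists d => // -[[x' z'] t'].
  rewrite -ball_normE /= distrC norm3_lt /= => /and3P[h1 h2 h3].
  have := Hd _ _ _ h1 h2 h3; rewrite !(addrC _ (_ - _)) !subrK /quad3 /=.
  by rewrite !subrr expr0n /= !mulr0; lra.
rewrite -lerN2 -lee_fin; apply: le_trans Hsup.
rewrite /level_set_op_lower limf_einfE; apply: le_ereal_sup_tmp; eexists.
  exists [set qY | - B <= level_set_op phi psi qY] => //.
  have HB' : op_le_near p1 p2 a b c B by [].
  have [d' d'0 {}HB] := HB; apply/nbhs_ballP; exists d' => // -[[q1 q2] [[a' b'] c']].
  rewrite -ball_normE /= distrC => Hd' q'0.
  have : `|(q1, q2) - (- p1, - p2)| < d' /\ `|(a', b', c') - (- a, - b, - c)| < d'.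
    by move: Hd'; rewrite prod_normE gt_max => /andP[].
  have E (u v : R) : `|u - - v| = `|- u - v| by rewrite -normrN opprD opprK.
  rewrite norm3_lt prod_normE gt_max /= !E => -[/andP[h1 h2] /and3P[h3 h4 h5]].
  have q'0' : (- q1, - q2) != 0 :> R * R by rewrite -pairNE oppr_eq0.
  have := HB _ _ _ _ _ h1 h2 h3 h4 h5 q'0'.
  rewrite (level_set_opE phi rphi psi _ _ _ _ _ q'0').
  rewrite -[X in _ -> _ <= X]/(level_set_op phi psi ((q1, q2), (a', b', c'))).
  rewrite (level_set_opE phi rphi psi _ _ _ _ _ q'0).
  rewrite -pairNE -scaleN1r (mobility_curv_scale phi rphi psi hpsi) ?oppr_eq0 ?oner_eq0//.
  rewrite !sqrrN -lerN2 => /le_trans; apply; rewrite le_eqVlt; apply/orP; left; apply/eqP.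
  by ring.
by apply: le_ereal_inf_tmp => _ [qY /= HqY <-]; rewrite lee_fin.
Qed.

End Subsolutions.
End QuadraticTests.

(** * Comparison principle on boxes *)

Section Comparison.
Context {R : realType}.
Implicit Types (f v w : R -> R -> R -> R) (x z t e d k : R).

Definition slab_continuous (T : R) f := forall x z t (e : R), 0 <= t <= T -> 0 < e ->
  exists2 d : R, 0 < d & forall x' z' t', 0 <= t' <= T ->
    `|x' - x| < d -> `|z' - z| < d -> `|t' - t| < d -> `|f x' z' t' - f x z t| < e.

Lemma slab_continuousW (T T' : R) f : T' <= T -> slab_continuous T f -> slab_continuous T' f.
Proof.
move=> TT cf x z t e /andP[t0 tT] e0.
have [|d d0 H] := cf x z t e _ e0; first by rewrite t0 (le_trans tT).
by exists d => // x' z' t' /andP[t'0 t'T]; apply: H; rewrite t'0 (le_trans t'T).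
Qed.

Lemma slab_continuousB (T : R) f w : slab_continuous T f -> slab_continuous T w ->
  slab_continuous T (fun x z t => f x z t - w x z t).
Proof.
move=> cf cw x z t e t0 e0; have e2 : 0 < e / 2 by rewrite divr_gt0.
have [d1 d10 H1] := cf x z t _ t0 e2; have [d2 d20 H2] := cw x z t _ t0 e2.
exists (Num.min d1 d2); first by rewrite lt_min d10.
move=> x' z' t' t'0; rewrite !lt_min => /andP[a1 a2] /andP[b1 b2] /andP[c1 c2].
have := H1 _ _ _ t'0 a1 b1 c1; have := H2 _ _ _ t'0 a2 b2 c2.
by rewrite !ltr_norml; lra.
Qed.

Lemma slab_max (x1 x2 z1 z2 T : R) f : x1 <= x2 -> z1 <= z2 -> 0 <= T ->
  slab_continuous T f -> exists x0 z0 t0, [/\ x1 <= x0 <= x2, z1 <= z0 <= z2, 0 <= t0 <= T &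
    forall x z t, x1 <= x <= x2 -> z1 <= z <= z2 -> 0 <= t <= T -> f x z t <= f x0 z0 t0].
Proof.
move=> hx hz hT cf.
pose A : set (R * R * R) := (`[x1, x2]%classic `*` `[z1, z2]%classic) `*` `[0, T]%classic.
have cA : compact A.
  by apply: compact_setX; [apply: compact_setX|]; exact: segment_compact.
have A0 : A !=set0.
  by exists ((x1, z1), 0); split; [split|]; rewrite /= in_itv /= lexx ?hx ?hz.
have [|[[x0 z0] t0] /set_mem[[/= X Z] Tt] H] :=
    @compact_EVT_max _ R (fun q => f q.1.1 q.1.2 q.2) A A0 cA.
  apply/subspace_continuousP => -[[x z] t] [[/= X Z] Tt].
  apply/cvgrPdist_lt => e e0.
  have [|d d0 Hd] := cf x z t e _ e0; first by move: Tt; rewrite in_itv.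
  apply/nbhs_ballP; exists d => // -[[x' z'] t'].
  rewrite -ball_normE /= distrC norm3_lt /= => /and3P[h1 h2 h3] [[_ _] /= Tt'].
  by rewrite distrC; apply: Hd => //; move: Tt'; rewrite in_itv.
exists x0, z0, t0; split; [by move: X; rewrite in_itv|by move: Z; rewrite in_itv|by move: Tt; rewrite in_itv|].
move=> x z t X' Z' T'; have := H ((x, z), t); apply.
by apply/mem_set; split; [split|]; rewrite /= in_itv.
Qed.

Context (phi psi : R * R -> R).

(** w is touched from above by quadratics whose jets satisfy the supersolution inequality up to e.
    Where v - w has a maximum, the same quadratic, shifted, touches v from above. *)
Definition upper_test w x z t := forall e : R, 0 < e ->
  exists tau p1 p2 a b c C d : R, [/\ 0 < d,
    forall dx dz dt, `|dx| < d -> `|dz| < d -> `|dt| < d ->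
      w (x + dx) (z + dz) (t + dt) <= w x z t + tau * dt + p1 * dx + p2 * dz
        + (a * dx ^+ 2 + 2 * b * (dx * dz) + c * dz ^+ 2) / 2 + C * dt ^+ 2 &
    op_le_near phi psi p1 p2 a b c (tau + e)].

Lemma inv_taylor (r dt : R) : 0 < r -> `|dt| <= r / 2 ->
  (r - dt)^-1 <= r^-1 + r^-1 ^+ 2 * dt + 2 * r^-1 ^+ 3 * dt ^+ 2.
Proof.
move=> r0 h; have rd : r / 2 <= r - dt by move: h; rewrite ler_norml; lra.
have rd0 : 0 < r - dt by apply: lt_le_trans rd; rewrite divr_gt0.
have -> : (r - dt)^-1 = r^-1 + r^-1 ^+ 2 * dt + r^-1 ^+ 2 * dt ^+ 2 * (r - dt)^-1.
  by field; rewrite !gt_eqF.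
rewrite lerD2l.
have : (r - dt)^-1 <= 2 * r^-1.
  by rewrite -[leRHS]invrK lef_pV2 ?posrE// invfM invrK mulrC ?mulr_gt0 ?invr_gt0.
have : 0 <= r^-1 ^+ 2 * dt ^+ 2 by apply: mulr_ge0; exact: sqr_ge0.
move: (r - dt)^-1 => u; rewrite (_ : r^-1 ^+ 3 = r^-1 ^+ 2 * r^-1); last by ring.
move: (r^-1 ^+ 2) (r^-1) (dt ^+ 2) => A B D AD u2.
by have := ler_wpM2l AD u2; lra.
Qed.

(** At a maximum of v - w - k / (T - t) the quadratic above w, plus the expansion of the penalty, is
    a test for v. Its time derivative exceeds by k / (T - t)^2 what [upper_test] allows, a
    contradiction. *)
Lemma comparison v w (x1 x2 z1 z2 T : R) : quad_subsolution phi psi v ->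
  slab_continuous T v -> slab_continuous T w -> 0 < T ->
  (forall x z t, x1 < x < x2 -> z1 < z < z2 -> 0 < t < T -> upper_test w x z t) ->
  (forall x z t, x1 <= x <= x2 -> z1 <= z <= z2 -> 0 <= t < T ->
    [\/ x = x1 \/ x = x2, z = z1 \/ z = z2 | t = 0] -> v x z t <= w x z t) ->
  forall x z t, x1 <= x <= x2 -> z1 <= z <= z2 -> 0 <= t < T -> v x z t <= w x z t.
Proof.
move=> subv cv cw T0 testw bnd xs zs ts hxs hzs /andP[ts0 tsT].
rewrite leNgt; apply/negP => gap.
have hx12 : x1 <= x2 by have /andP[h1 h2] := hxs; exact: le_trans h1 h2.
have hz12 : z1 <= z2 by have /andP[h1 h2] := hzs; exact: le_trans h1 h2.
pose g x z t := v x z t - w x z t.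
have cg : slab_continuous T g by exact: slab_continuousB.
set G := g xs zs ts.
have G0 : 0 < G by rewrite subr_gt0.
have [xm [zm [tm [_ _ _ Hm]]]] := slab_max x1 x2 z1 z2 T g hx12 hz12 (ltW T0) cg.
set M := g xm zm tm in Hm.
have GM : G <= M by apply: Hm => //; rewrite ts0 ltW.
(* With this k the penalty at [ts] is half of the gap [G], so the penalised maximum is positive. *)
pose k := G * (T - ts) / 2.
have Tts : 0 < T - ts by rewrite subr_gt0.
have k0 : 0 < k by rewrite divr_gt0// mulr_gt0.
have M0 : 0 < M by apply: lt_le_trans GM.
(* At [T'] the penalty equals M + 1, more than the maximum M of v - w, so the penalised maximum
   occurs strictly before. *)
pose T' := T - k / (M + 1).
have M1 : 0 < M + 1 by rewrite addr_gt0.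
have kM : 0 < k / (M + 1) by rewrite divr_gt0.
have tsT' : ts < T'.
  rewrite /T' ltrBrDr -ltrBrDl ltr_pdivrMr// /k.
  have := ler_wpM2r (ltW Tts) GM.
  have : 0 < M * (T - ts) by rewrite mulr_gt0.
  by clear -Tts; lra.
have T'0 : 0 <= T' by apply: le_trans ts0 (ltW tsT').
have T'T : T' < T by rewrite /T' ltrBlDr ltrDl.
pose F x z t := g x z t - k / (T - t).
have cF : slab_continuous T' F.
  apply: slab_continuousB; first exact: slab_continuousW (ltW T'T) cg.
  move=> x z t e /andP[t0 tT'] e0.
  have Tt : 0 < T - t by rewrite subr_gt0 (le_lt_trans tT').
  have : {for t, continuous (fun s : R => k / (T - s))}.
    apply: continuousM; first exact: cst_continuous.
    apply: continuousV; first by rewrite gt_eqF.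
    exact: (is_derive1_continuous _ _ _ (is_derive_subf _ _ _ _ _ (is_derive_cstf T t) (is_derive_idf t))).
  move/continuous_epsP => /(_ e e0)[d d0 H]; exists d => // x' z' t' _ _ _ tt; exact: H.
have [x0 [z0 [t0 [hx0 hz0 ht0 HF]]]] := slab_max x1 x2 z1 z2 T' F hx12 hz12 T'0 cF.
have F0 : 0 < F x0 z0 t0.
  apply: (@lt_le_trans _ _ (F xs zs ts)); last by apply: HF => //; rewrite ts0 ltW.
  rewrite /F -/G (_ : k / (T - ts) = G / 2); first by clear -G0; lra.
  by rewrite /k; field; rewrite gt_eqF.
have t0T' : t0 < T'.
  rewrite lt_neqAle; case/andP: (ht0) => _ ->; rewrite andbT; apply/eqP => t0E.
  have : F x0 z0 t0 < 0.
    rewrite /F subr_lt0 t0E /T' subKr invf_div mulrCA divff ?gt_eqF// mulr1.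
    apply: le_lt_trans (_ : M < _); last by rewrite ltrDl.
    by apply: Hm => //; rewrite -/T' T'0 ltW.
  by rewrite ltNge (ltW F0).
have t0T : t0 < T by apply: lt_trans T'T.
have r0 : 0 < T - t0 by rewrite subr_gt0.
have vw0 : w x0 z0 t0 < v x0 z0 t0.
  rewrite -subr_gt0; apply: lt_trans F0 _; rewrite /F ltrBlDr ltrDl divr_gt0//.
have notb : ~ [\/ x0 = x1 \/ x0 = x2, z0 = z1 \/ z0 = z2 | t0 = 0].
  move=> /bnd h; have := h hx0 hz0; have /andP[-> _] := ht0; rewrite t0T.
  by move=> /(_ isT); rewrite leNgt vw0.
have tp : 0 < t0.
  rewrite lt_neqAle; case/andP: (ht0) => -> _; rewrite andbT; apply/eqP => E.
  by apply: notb; constructor 3.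
have xp1 : x1 < x0.
  rewrite lt_neqAle; case/andP: (hx0) => -> _; rewrite andbT; apply/eqP => E.
  by apply: notb; constructor 1; left.
have xp2 : x0 < x2.
  rewrite lt_neqAle; case/andP: (hx0) => _ ->; rewrite andbT; apply/eqP => E.
  by apply: notb; constructor 1; right.
have zp1 : z1 < z0.
  rewrite lt_neqAle; case/andP: (hz0) => -> _; rewrite andbT; apply/eqP => E.
  by apply: notb; constructor 2; left.
have zp2 : z0 < z2.
  rewrite lt_neqAle; case/andP: (hz0) => _ ->; rewrite andbT; apply/eqP => E.
  by apply: notb; constructor 2; right.
(* Half of the lower bound k / T^2 for the time derivative of the penalty. *)
pose ep := k / (2 * T ^+ 2).
have TT0 : 0 < 2 * T ^+ 2 by rewrite mulr_gt0// exprn_gt0.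
have ep0 : 0 < ep by rewrite divr_gt0.
have := testw x0 z0 t0; rewrite xp1 xp2 zp1 zp2 tp t0T.
move=> /(_ isT isT isT ep ep0)[tau [p1 [p2 [a [b [c [C [d [d0 Hw Hop]]]]]]]]].
pose rr := T - t0.
pose d' := Num.min d (Num.min (rr / 2) (Num.min t0 (Num.min (T' - t0)
   (Num.min (x0 - x1) (Num.min (x2 - x0) (Num.min (z0 - z1) (z2 - z0))))))).
have d'0 : 0 < d' by rewrite !lt_min d0 tp !subr_gt0 t0T' xp1 xp2 zp1 zp2 divr_gt0.
suff : tau + k * rr^-1 ^+ 2 <= tau + ep.
  rewrite lerD2l /ep ler_pdivlMr// mulrAC -mulrA ger_pMr// => H.
  have rrT : rr <= T by rewrite /rr; lra.
  have : 1 <= (rr^-1 ^+ 2) * T ^+ 2.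
    by rewrite -exprMn -[leLHS](expr1n _ 2) lerXn2r ?nnegrE// ?mulr_ge0 ?invr_ge0 ?(ltW r0) ?(ltW T0)// mulrC ler_pdivlMr// mul1r.
  by move: H; rewrite mulrCA; lra.
apply: (subv x0 z0 t0 (tau + k * rr^-1 ^+ 2) p1 p2 a b c (C + k * (2 * rr^-1 ^+ 3)) (tau + ep) d') => //.
move=> dx dz dt; rewrite !lt_min => /andP[x1' /andP[_ /andP[_ /andP[_ /andP[x5 /andP[x6 /andP[_ _]]]]]]] /andP[z1' /andP[_ /andP[_ /andP[_ /andP[_ /andP[_ /andP[z7 z8]]]]]]]
  /andP[t1' /andP[t2 /andP[t3 /andP[t4 /andP[_ /andP[_ /andP[_ _]]]]]]].
have hF : F (x0 + dx) (z0 + dz) (t0 + dt) <= F x0 z0 t0.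
  apply: HF.
  - by move: x5 x6; rewrite !ltr_norml; clear; lra.
  - by move: z7 z8; rewrite !ltr_norml; clear; lra.
  - by move: t3 t4; rewrite !ltr_norml; clear; lra.
have hw := Hw dx dz dt x1' z1' t1'.
have hi := inv_taylor rr dt r0 (ltW t2).
have E : T - (t0 + dt) = rr - dt by rewrite /rr; ring.
move: hF; rewrite /F /g E -/rr.
have := ler_wpM2l (ltW k0) hi.
move: hw; move: (w _ _ _) (w x0 z0 t0) (v _ _ _) (v x0 z0 t0) => W W0 V V0.
move: (rr - dt)^-1 (rr^-1) (rr^-1 ^+ 2) (rr^-1 ^+ 3) => I J J2 J3; clear; lra.
Qed.

End Comparison.

(** * Tests for the level set operator *)

Section Operator.
Context {R : realType} (phi psi : R * R -> R) (rphi : regular_norm phi) (hpsi : is_norm psi).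
Implicit Types (x z t e d k s : R).

Notation op := (level_set_op phi psi).
Notation mc := (mobility_curv phi psi).

Let hphi : is_norm phi. Proof. by case: rphi. Qed.

Lemma level_set_op_continuous pX : pX.1 != 0 -> {for pX, continuous op}.
Proof.
move=> p0; case: rphi => _ [_ C2] _.
have -> : op = (fun qY => psi qY.1 * (dxx phi qY.1 * qY.2.1.1 + 2 * dxz phi qY.1 * qY.2.1.2 + dzz phi qY.1 * qY.2.2)).
  by apply/funext => -[q [[a b] c]].
have c1 : {for pX, continuous (@fst (R * R)%type (R * R * R)%type)} by exact: cvg_fst.
have c2 : {for pX, continuous (@snd (R * R)%type (R * R * R)%type)} by exact: cvg_snd.
have aff a b c : {for pX, continuous (fun qY : R * R * (R * R * R) => affine3 0 a b c qY.2)}.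
  by apply: continuous_comp => //; exact: affine3_continuous.
have d2 v w : {for pX, continuous (fun qY : R * R * (R * R * R) => 'D_w (fun q => 'D_v phi q) qY.1)}.
  apply: (@continuous_comp _ _ _ fst (fun p => 'D_w (fun q => 'D_v phi q) p)) => //.
  by have [] := C2 v w pX.1 p0.
apply: continuousM.
  by apply: (@continuous_comp _ _ _ fst psi) => //; exact: norm_continuous_plane.
have E1 : (fun qY : R * R * (R * R * R) => qY.2.1.1) = (fun qY => affine3 0 1 0 0 qY.2).
  by apply/funext => qY; rewrite /affine3; ring.
have E2 : (fun qY : R * R * (R * R * R) => 2 * dxz phi qY.1 * qY.2.1.2) = (fun qY => dxz phi qY.1 * affine3 0 0 2 0 qY.2).
  by apply/funext => qY; rewrite /affine3; ring.
have E3 : (fun qY : R * R * (R * R * R) => qY.2.2) = (fun qY => affine3 0 0 0 1 qY.2).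
  by apply/funext => qY; rewrite /affine3; ring.
apply: continuousD; first apply: continuousD.
- by apply: continuousM; [exact: d2|rewrite E1; exact: aff].
- by rewrite E2; apply: continuousM; [exact: d2|exact: aff].
- by apply: continuousM; [exact: d2|rewrite E3; exact: aff].
Qed.

Lemma op_lt_near (p1 p2 a b c B : R) : (p1, p2) != 0 :> R * R ->
  op ((p1, p2), (a, b, c)) < B -> op_le_near phi psi p1 p2 a b c B.
Proof.
move=> p0 lB; have := level_set_op_continuous ((p1, p2), (a, b, c)) p0.
move/continuous_norm_epsP => /(_ (B - op ((p1, p2), (a, b, c)))); rewrite subr_gt0.
move=> /(_ lB)[d d0 H]; exists d => // p1' p2' a' b' c' h1 h2 h3 h4 h5 _.
have := H ((p1', p2'), (a', b', c')).
have -> : `|(p1', p2', (a', b', c')) - (p1, p2, (a, b, c))| < d.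
  rewrite prod_normE gt_max; apply/andP; split.
    by rewrite prod_normE gt_max /= h1.
  by rewrite norm3_lt /= h3 h4.
by move=> /(_ isT); move: (op _) (op _) => u v; rewrite ltr_norml; lra.
Qed.

(** The weight p2^2 / |p|^2 of the xx entry is kept because [far_field] needs it to be small for
    almost horizontal gradients; the other weights are bounded by 1. *)
Lemma level_set_op_le (CT p1 p2 a b c : R) :
  (forall p : R * R, p != 0 -> mc p <= CT) -> (p1, p2) != 0 :> R * R ->
  op ((p1, p2), (a, b, c)) <=
    CT * (p2 ^+ 2 / (p1 ^+ 2 + p2 ^+ 2) * `|a| + `|b| + `|c|).
Proof.
move=> HC p0; have N0 : 0 < p1 ^+ 2 + p2 ^+ 2 := plane_neq0_norm _ p0.
rewrite (level_set_opE phi rphi)// -mulrA.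
have m0 := mobility_curv_gt0 phi rphi psi hpsi _ p0.
have C0 : 0 <= CT by apply: le_trans (ltW m0) (HC _ p0).
set Q := _ / _; apply: (@le_trans _ _ (mc (p1, p2) * `|Q|)).
  by rewrite ler_wpM2l ?(ltW m0)// ler_norm.
apply: ler_pM => //; [exact: ltW|exact: HC|].
rewrite /Q normrM normfV (gtr0_norm N0) ler_pdivrMr//.
rewrite (mulrDl (_ + `|b|)) (mulrDl _ `|b|).
have -> : p2 ^+ 2 / (p1 ^+ 2 + p2 ^+ 2) * `|a| * (p1 ^+ 2 + p2 ^+ 2) = p2 ^+ 2 * `|a|.
  by field; rewrite gt_eqF.
apply: le_trans (ler_normD _ _) _.
apply: le_trans (lerD (ler_normB _ _) (lexx _)) _.
have na : `|p2 ^+ 2 * a| = p2 ^+ 2 * `|a| by rewrite normrM (ger0_norm (sqr_ge0 _)).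
have nc : `|p1 ^+ 2 * c| = p1 ^+ 2 * `|c| by rewrite normrM (ger0_norm (sqr_ge0 _)).
have nb : `|2 * (p1 * p2) * b| = 2 * (`|p1| * `|p2|) * `|b| by rewrite !normrM (ger0_norm (ler0n _ 2)).
rewrite na nb nc.
have pp : 2 * (`|p1| * `|p2|) <= p1 ^+ 2 + p2 ^+ 2.
  have := sqr_ge0 (`|p1| - `|p2|); rewrite -(real_normK (num_real p1)) -(real_normK (num_real p2)).
  by move: `|p1| `|p2| => u v; rewrite !expr2; lra.
have b1 := ler_wpM2r (normr_ge0 b) pp.
have c1 : 0 <= `|c| * p2 ^+ 2 by rewrite mulr_ge0 ?sqr_ge0.
move: b1 c1; clear; lra.
Qed.

(** The operator is singular at a zero gradient, but around it at most a constant times the size of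
    the Hessian. A function flat to second order in space thus has a test with zero time derivative
    and arbitrarily small Hessian. *)
Lemma upper_test_flat w x z t :
  (forall ep, 0 < ep -> exists C d : R, 0 < d /\ forall dx dz dt,
    `|dx| < d -> `|dz| < d -> `|dt| < d ->
    w (x + dx) (z + dz) (t + dt) - w x z t <= ep * (dx ^+ 2 + dz ^+ 2) + C * dt ^+ 2) ->
  upper_test phi psi w x z t.
Proof.
have [c [CT [_ CT0 HC]]] := mobility_curv_bounds phi rphi psi hpsi.
move=> H ep ep0; pose k := ep / (10 * CT).
have k0 : 0 < k by rewrite divr_gt0// mulr_gt0.
have [C [d [d0 Hd]]] := H _ k0.
exists 0, 0, 0, (2 * k), 0, (2 * k), C, d; split => //.
  by move=> dx dz dt h1 h2 h3; have := Hd _ _ _ h1 h2 h3; lra.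
exists k => // p1 p2 a' b' c' _ _ ha hb hc p0.
apply: le_trans (level_set_op_le CT _ _ _ _ _ _ p0) _.
  by move=> p /HC/andP[].
have N0 : 0 < p1 ^+ 2 + p2 ^+ 2 := plane_neq0_norm _ p0.
rewrite add0r.
have r1 : 0 <= p2 ^+ 2 / (p1 ^+ 2 + p2 ^+ 2) <= 1.
  rewrite divr_ge0 ?sqr_ge0 ?(ltW N0)//= ler_pdivrMr// mul1r lerDr sqr_ge0//.
have aa : p2 ^+ 2 / (p1 ^+ 2 + p2 ^+ 2) * `|a'| <= 1 * `|a'|.
  by case/andP: r1 => _ r1; rewrite ler_wpM2r.
have : p2 ^+ 2 / (p1 ^+ 2 + p2 ^+ 2) * `|a'| + `|b'| + `|c'| <= 10 * k.
  move: aa ha hb hc; move: (_ / _ * _) => u.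
  rewrite !ltr_norml subr0 mul1r => aa /andP[a1 a2] /andP[b1 b2] /andP[c1 c2].
  have : `|a'| <= 3 * k by rewrite ler_norml; lra.
  have : `|b'| <= k by rewrite ler_norml; lra.
  have : `|c'| <= 3 * k by rewrite ler_norml; lra.
  lra.
move=> /(ler_wpM2l (ltW CT0)) /le_trans; apply.
by rewrite /k le_eqVlt; apply/orP; left; apply/eqP; field; rewrite gt_eqF.
Qed.

(** The jet has gradient k (- s, 1), and the sign condition is the supersolution inequality for it.
    No smallness of C is asked: the Hessian of (dz - s dx)^2 is supported on the gradient direction
    and annihilated by the operator. *)
Lemma upper_test_jet w x z t (k s b mu : R) : k != 0 ->
  k * (b - mc (- s, 1) / (1 + s ^+ 2) * mu) <= 0 ->
  (forall ep, 0 < ep -> exists C d : R, 0 < d /\ forall dx dz dt,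
    `|dx| < d -> `|dz| < d -> `|dt| < d ->
    w (x + dx) (z + dz) (t + dt) - w x z t - k * (dz - s * dx - b * dt - mu / 2 * dx ^+ 2)
     <= ep * (dx ^+ 2 + dz ^+ 2) + C * ((dz - s * dx) ^+ 2 + dt ^+ 2)) ->
  upper_test phi psi w x z t.
Proof.
have [c [CT [_ CT0 HC]]] := mobility_curv_bounds phi rphi psi hpsi.
move=> k0 kb H ep ep0; pose h := ep / (4 * CT).
have h0 : 0 < h by rewrite divr_gt0// mulr_gt0.
have [C [d [d0 Hd]]] := H _ h0.
exists (- k * b), (- k * s), k, (- k * mu + 2 * h + 2 * C * s ^+ 2), (- 2 * C * s), (2 * h + 2 * C), C, d.
split => //.
  move=> dx dz dt h1 h2 h3; have := Hd _ _ _ h1 h2 h3.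
  have -> : (dz - s * dx) ^+ 2 = dz ^+ 2 - 2 * s * (dx * dz) + s ^+ 2 * dx ^+ 2 by ring.
  move: (w _ _ _) (w x z t) => W W0; move: (dx ^+ 2) (dz ^+ 2) (dt ^+ 2) (s ^+ 2) (dx * dz) => X Z T S XZ.
  by lra.
have p0 : (- k * s, k) != 0 :> R * R.
  by apply/eqP => -[_ /eqP]; rewrite (negbTE k0).
apply: op_lt_near => //.
rewrite (level_set_opE phi rphi)//.
have -> : (- k * s, k) = k *: (- s, 1) :> R * R by rewrite pairZE mulr1 mulrN mulNr.
rewrite (mobility_curv_scale phi rphi psi hpsi)// ?slope_neq0//.
have s1 : 0 < 1 + s ^+ 2 by rewrite ltr_pwDl// sqr_ge0.
(* All terms in [C] cancel here, whatever its size. *)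
have -> : mc (- s, 1) * (k ^+ 2 * (- k * mu + 2 * h + 2 * C * s ^+ 2) - 2 * (- k * s * k) * (- 2 * C * s)
    + (- k * s) ^+ 2 * (2 * h + 2 * C)) / ((- k * s) ^+ 2 + k ^+ 2) =
   - k * (mc (- s, 1) / (1 + s ^+ 2) * mu) + 2 * h * mc (- s, 1).
  have -> : (- k * s) ^+ 2 + k ^+ 2 = k ^+ 2 * (1 + s ^+ 2) by ring.
  by field; rewrite k0 /= gt_eqF.
have := HC _ (slope_neq0 s) => /andP[_ h1].
have : 2 * h * mc (- s, 1) <= ep / 2.
  have hE : ep / 2 = 2 * h * CT by rewrite /h; field; rewrite gt_eqF.
  by rewrite hE ler_wpM2l// mulr_ge0// ltW.
move: kb; rewrite mulrBr; lra.
Qed.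

End Operator.

Lemma cube_absorb {R : realType} (K ep : R) : 0 <= K -> 0 < ep -> exists2 d : R, 0 < d &
  forall u dx dz dt : R, `|dx| < d -> `|dz| < d -> `|dt| < d -> `|u| <= K * (`|dx| + `|dz| + `|dt|) ->
  4 * `|u| ^+ 3 <= ep * (dx ^+ 2 + dz ^+ 2) + ep * dt ^+ 2.
Proof.
move=> K0 ep0; have K3 : 0 <= K ^+ 3 by exact: exprn_ge0.
have D0 : 0 < 36 * K ^+ 3 + 1 by rewrite ltr_wpDl// mulr_ge0.
exists (ep / (36 * K ^+ 3 + 1)); first by rewrite divr_gt0.
move=> u dx dz dt h1 h2 h3 hu.
rewrite -(real_normK (num_real dx)) -(real_normK (num_real dz)) -(real_normK (num_real dt)).
have := normr_ge0 u; have := normr_ge0 dx; have := normr_ge0 dz; have := normr_ge0 dt.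
move: h1 h2 h3 hu; rewrite !ltr_pdivlMr//.
move: `|u| `|dx| `|dz| `|dt| => v x y t h1 h2 h3 hv t0 y0 x0 v0.
have s0 : 0 <= x + y + t by rewrite !addr_ge0.
have v3 : v ^+ 3 <= K ^+ 3 * (x + y + t) ^+ 3.
  by rewrite -exprMn lerXn2r// nnegrE mulr_ge0.
have sq : (x + y + t) ^+ 2 <= 3 * (x ^+ 2 + y ^+ 2 + t ^+ 2).
  by have := sqr_ge0 (x - y); have := sqr_ge0 (x - t); have := sqr_ge0 (y - t); rewrite !expr2; lra.
have sK : 12 * K ^+ 3 * (x + y + t) <= ep.
  have : 0 <= x + y + t by [].
  move: h1 h2 h3 K3; move: (K ^+ 3) => k; lra.
have c3 : K ^+ 3 * (x + y + t) ^+ 3 <= K ^+ 3 * (x + y + t) * (3 * (x ^+ 2 + y ^+ 2 + t ^+ 2)).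
  by rewrite exprS mulrA ler_wpM2l// mulr_ge0.
have q0 : 0 <= x ^+ 2 + y ^+ 2 + t ^+ 2 by rewrite !addr_ge0 ?sqr_ge0.
have := ler_wpM2r q0 sK.
move: v3 c3; clear; rewrite -mulrDr; lra.
Qed.

Lemma dilation_near_lipschitz {R : realType} (l : R -> R) (c a e : R) (c0 : 0 < c)
    (lc : forall s, c * (1 + `|s|) <= l s) (e0 : 0 <= e) (x0 z0 t0 : R) :
  let L := dilation l a e in 0 < t0 ->
  (exists2 r : R, 0 < r & forall dt, `|dt| < r -> e * (t0 + dt) <= a) ->
  exists K d : R, [/\ 0 <= K, 0 < d & forall dx dz dt, `|dt| < d ->
    `|L (x0 + dx) (z0 + dz) (t0 + dt) - L x0 z0 t0| <= K * (`|dx| + `|dz| + `|dt|)].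
Proof.
move=> L t0p [r r0 hr]; exists (2 / c + e), (Num.min r t0).
have ci : 0 < c^-1 by rewrite invr_gt0.
split; [by rewrite addr_ge0// divr_ge0// ltW|by rewrite lt_min r0|].
move=> dx dz dt; rewrite lt_min => /andP[h1 h2].
have ea0 : e * t0 <= a by have := hr 0; rewrite normr0 addr0; exact.
have t1 : 0 <= t0 + dt by move: h2; rewrite ltr_norml; lra.
have := dilation_lipschitz l c a e c0 lc e0 x0 z0 t0 (x0 + dx) (z0 + dz) (t0 + dt) (ltW t0p) ea0 t1 (hr _ h1).
have := dilation_lipschitz l c a e c0 lc e0 (x0 + dx) (z0 + dz) (t0 + dt) x0 z0 t0 t1 (hr _ h1) (ltW t0p) ea0.
have E (u v : R) : u - (u + v) = - v by ring.
have E' (u v : R) : (u + v) - u = v by ring.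
rewrite !E !E' !normrN -/L; move: (L _ _ _) (L _ _ _) => A B hA hB.
suff : (`|dx| + `|dz| + 2 * `|dt|) / c + e * `|dt| <= (2 / c + e) * (`|dx| + `|dz| + `|dt|).
  by move: hA hB; clear; rewrite ler_norml; lra.
have ex : 0 <= e * `|dx| by rewrite mulr_ge0.
have ez : 0 <= e * `|dz| by rewrite mulr_ge0.
have cx : 0 <= c^-1 * `|dx| by rewrite mulr_ge0// ltW.
have cz : 0 <= c^-1 * `|dz| by rewrite mulr_ge0// ltW.
move: ex ez cx cz; clear; lra.
Qed.

(** Where cutoff' vanishes so does cutoff'', and the cubic Taylor remainder makes W flat. Elsewhere
    lam > 1/2 and [dilation_expansion] applies, with k = cutoff' / D; the term cutoff'' dl^2 is
    absorbed since dl is of order |ze| + |dt| + dx^2, where ze = dz - s dx. *)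
Lemma cutoff_dilation_jet {R : realType} (l l1 l2 : R -> R) (c a e : R) (sl : smooth_profile l l1 l2)
    (c0 : 0 < c) (lc : forall s, c * (1 + `|s|) <= l s) (e0 : 0 <= e)
    (range_l1 : forall y k : R, (forall s, s * y - l s <= k) -> exists s, l1 s = y) (x0 z0 t0 : R) :
  let L := dilation l a e in let W := fun x z t => cutoff (1 - L x z t) in 0 < t0 ->
  (exists2 r : R, 0 < r & forall dt, `|dt| < r -> e * (t0 + dt) <= a) ->
  let lam := L x0 z0 t0 in
  (forall ep : R, 0 < ep -> exists C d : R, 0 < d /\ forall dx dz dt,
    `|dx| < d -> `|dz| < d -> `|dt| < d ->
    `|W (x0 + dx) (z0 + dz) (t0 + dt) - W x0 z0 t0| <= ep * (dx ^+ 2 + dz ^+ 2) + C * dt ^+ 2) \/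
  (2^-1 < lam /\ exists s k : R, 0 < k /\ forall ep : R, 0 < ep -> exists C d : R, 0 < d /\ forall dx dz dt,
    `|dx| < d -> `|dz| < d -> `|dt| < d ->
    `|W (x0 + dx) (z0 + dz) (t0 + dt) - W x0 z0 t0
       - k * (dz - s * dx - (e * l s + lam^-1) * dt - ((lam + a - e * t0) * l2 s)^-1 / 2 * dx ^+ 2)|
     <= ep * (dx ^+ 2 + dz ^+ 2) + C * ((dz - s * dx) ^+ 2 + dt ^+ 2)).
Proof.
move=> L W t0p hr lam.
have [K [dK [K0 dK0 HK]]] := dilation_near_lipschitz l c a e c0 lc e0 x0 z0 t0 t0p hr.
have ea0 : e * t0 <= a by case: hr => r r0 hr; have := hr 0; rewrite normr0 addr0; exact.
have lam2 : 2^-1 <= lam := dilation_ge l c a e c0 lc _ _ _ (ltW t0p) ea0.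
have [g0|g0] := eqVneq (cutoff' (1 - lam)) 0.
  left=> ep ep0; have [d d0 Hd] := cube_absorb K ep K0 ep0.
  exists ep, (Num.min d dK); split; first by rewrite lt_min d0.
  move=> dx dz dt; rewrite !lt_min => /andP[h1 _] /andP[h2 _] /andP[h3 h3'].
  have g2 : cutoff'' (1 - lam) = 0.
    by move: g0 => /eqP; rewrite /cutoff' /cutoff'' sqrf_eq0 => /eqP ->; rewrite mulr0.
  have := cutoff_taylor (1 - L (x0 + dx) (z0 + dz) (t0 + dt)) (1 - lam).
  rewrite g0 g2 !mul0r !subr0 => /le_trans; apply.
  have -> : 1 - L (x0 + dx) (z0 + dz) (t0 + dt) - (1 - lam) = - (L (x0 + dx) (z0 + dz) (t0 + dt) - lam) by ring.
  by rewrite normrN; apply: Hd => //; exact: HK.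
right.
have lam1 : 2^-1 < lam.
  rewrite lt_neqAle lam2 andbT; apply/eqP => E; move/eqP: g0; apply.
  by apply: cutoff'_hi; rewrite -E; lra.
split => //.
have [s [_ Hs]] := dilation_expansion l l1 l2 c a e sl c0 lc e0 range_l1 x0 z0 t0 t0p lam1 hr.
rewrite -/L -/lam in Hs HK.
exists s.
set D := l s + t0 / lam ^+ 2 in Hs; set b := e * l s + lam^-1 in Hs *.
set mu := ((lam + a - e * t0) * l2 s)^-1 in Hs *.
have lam0 : 0 < lam by lra.
have ls0 := growth_gt0 l c c0 lc s.
have D0 : 0 < D by rewrite ltr_wpDr// divr_ge0 ?exprn_ge0 ?ltW.
have b0 : 0 <= b by apply: addr_ge0; [apply: mulr_ge0 => //; exact: ltW|rewrite invr_ge0; exact: ltW].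
have mu0 : 0 <= mu.
  case: sl => _ _ /(_ s)/ltW h; rewrite invr_ge0 mulr_ge0//.
  by move: ea0 lam0; clear; lra.
have gp : 0 < cutoff' (1 - lam) by rewrite lt_neqAle eq_sym g0 cutoff'_ge0.
set g := cutoff' (1 - lam) in gp *.
clearbody D b mu.
exists (g / D); split; first by rewrite divr_gt0.
move=> ep ep0; have k0 : 0 < g / D by rewrite divr_gt0.
have ep'0 : 0 < ep / (2 * (g / D)) by rewrite divr_gt0// mulr_gt0.
have [C [d [C0 d0 Hd]]] := Hs _ ep'0.
have epE : g / D * (ep / (2 * (g / D))) = ep / 2 by field; rewrite !gt_eqF.
set ep' := ep / _ in Hd ep'0 epE.
pose A := ep' + C + 1 + b + mu; have A0 : 0 < A.
  by rewrite /A; move: ep'0 C0 b0 mu0; clear; lra.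
pose C3 := `|cutoff'' (1 - lam)| / 2 + 4; have C30 : 0 < C3.
  by rewrite ltr_wpDl// divr_ge0.
pose M := C3 * (3 * (A / D) ^+ 2).
have M0 : 0 <= M by apply: mulr_ge0; [exact: ltW|rewrite mulr_ge0// sqr_ge0].
have [d1 [d10 d1a d1b d1c]] : exists d1, [/\ 0 < d1, d1 <= (1 + `|s|)^-1, K * 3 * d1 <= 1 & d1 <= 1 /\ M * d1 <= ep / 2].
  have s1 : 0 < 1 + `|s| by rewrite ltr_pwDl.
  have k1 : 0 < K * 3 + 1 by rewrite ltr_wpDl// mulr_ge0.
  have m1 : 0 < 2 * M + 1 by rewrite ltr_wpDl// mulr_ge0.
  exists (Num.min (Num.min (1 + `|s|)^-1 (K * 3 + 1)^-1) (Num.min 1 (ep / (2 * M + 1)))).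
  split.
  - by rewrite !lt_min !invr_gt0 s1 k1 ltr01 divr_gt0.
  - by rewrite !ge_min lexx.
  - apply: (@le_trans _ _ (K * 3 * (K * 3 + 1)^-1)).
      by rewrite ler_wpM2l ?mulr_ge0// !ge_min lexx !orbT.
    by rewrite ler_pdivrMr// mul1r lerDl.
  - split; first by rewrite !ge_min lexx !orbT.
    apply: (@le_trans _ _ (M * (ep / (2 * M + 1)))).
      by rewrite ler_wpM2l// !ge_min lexx !orbT.
    by rewrite mulrA ler_pdivrMr//; move: ep0 M0; clear; lra.
exists (g / D * C + M), (Num.min (Num.min d dK) d1); split; first by rewrite !lt_min d0 dK0.
move=> dx dz dt; rewrite !lt_min => /andP[/andP[h1 _] h1'] /andP[/andP[h2 _] h2'] /andP[/andP[h3 h3k] h3'].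
have HE := Hd _ _ _ h1 h2 h3.
have HL := HK dx dz dt h3k.
have := cutoff_taylor (1 - L (x0 + dx) (z0 + dz) (t0 + dt)) (1 - lam).
rewrite /W -/g -/lam.
have -> : 1 - L (x0 + dx) (z0 + dz) (t0 + dt) - (1 - lam) = - (L (x0 + dx) (z0 + dz) (t0 + dt) - lam) by ring.
move: (cutoff (1 - L (x0 + dx) _ _)) (cutoff (1 - lam)) => W1 W0.
set dl := L _ _ _ - lam in HE HL *; clearbody dl.
rewrite normrN sqrrN => HT.
have dl1 : `|dl| <= 1.
  apply: le_trans HL _; apply: le_trans d1b.
  rewrite -mulrA ler_wpM2l//; move: h1' h2' h3'; clear; lra.
set ze := dz - s * dx in HE *.
have ze1 : `|ze| <= 1.
  apply: (@le_trans _ _ ((1 + `|s|) * d1)).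
    apply: le_trans (ler_normB _ _) _; rewrite normrM.
    have : `|s| * `|dx| <= `|s| * d1 by rewrite ler_wpM2l// ltW.
    by move: h2'; clear; lra.
  by rewrite -ler_pdivlMl ?mulr1// ltr_pwDl.
clearbody ze.
have [d11 d1M] := d1c.
have dt1 : `|dt| <= 1 by move: h3' d11; clear; lra.
have dx1 : `|dx| <= d1 by exact: ltW.
have sqle (y : R) : `|y| <= 1 -> y ^+ 2 <= `|y|.
  by move=> y1; rewrite -(real_normK (num_real y)) expr2 ler_piMr.
have Dl : D * `|dl| <= A * (`|ze| + `|dt| + dx ^+ 2).
  rewrite -(gtr0_norm D0) -normrM.
  have hz := sqle _ ze1; have ht := sqle _ dt1.
  have x2 := sqr_ge0 dx.
  have := normr_ge0 ze; have := normr_ge0 dt.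
  have : `|D * dl| <= ep' * dx ^+ 2 + C * (`|ze| + `|dt|) + `|ze| + b * `|dt| + mu * dx ^+ 2.
    have -> : D * dl = (D * dl + (ze - b * dt - mu / 2 * dx ^+ 2)) - (ze - b * dt - mu / 2 * dx ^+ 2) by ring.
    apply: le_trans (ler_normB _ _) _.
    have : `|ze - b * dt - mu / 2 * dx ^+ 2| <= `|ze| + b * `|dt| + mu * dx ^+ 2.
      apply: le_trans (ler_normB _ _) _.
      apply: le_trans (lerD (ler_normB _ _) (lexx _)) _.
      have m2 : 0 <= mu * dx ^+ 2 by rewrite mulr_ge0.
      rewrite normrM (ger0_norm b0) normrM (ger0_norm (divr_ge0 mu0 _))// (ger0_norm x2).
      by move: m2; clear; lra.
    have hC : C * (ze ^+ 2 + dt ^+ 2) <= C * (`|ze| + `|dt|) by rewrite ler_wpM2l// lerD.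
    by move: HE hC; clear; lra.
  move: ep'0 C0 b0 mu0 x2; rewrite /A; clear.
  move: (`|D * dl| : R) (`|ze| : R) (`|dt| : R) (dx ^+ 2) => u v w X h1 h2 h3 h4 h5 hu hw hv.
  have : 0 <= ep' * v by rewrite mulr_ge0// ltW.
  have : 0 <= ep' * w by rewrite mulr_ge0// ltW.
  have : 0 <= b * v by rewrite mulr_ge0.
  have : 0 <= mu * w by rewrite mulr_ge0.
  have : 0 <= mu * v by rewrite mulr_ge0.
  have : 0 <= b * X by rewrite mulr_ge0.
  have : 0 <= C * X by rewrite mulr_ge0.
  move: hu hv hw h5; clear; lra.
have dl2 : dl ^+ 2 <= 3 * (A / D) ^+ 2 * (ze ^+ 2 + dt ^+ 2 + d1 * dx ^+ 2).
  have dlA : `|dl| <= A / D * (`|ze| + `|dt| + dx ^+ 2).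
    by rewrite mulrAC ler_pdivlMr// mulrC.
  have q0 : 0 <= `|ze| + `|dt| + dx ^+ 2 by rewrite !addr_ge0 ?sqr_ge0.
  have AD0 : 0 <= A / D by rewrite divr_ge0// ltW.
  have : `|dl| ^+ 2 <= (A / D * (`|ze| + `|dt| + dx ^+ 2)) ^+ 2.
    by rewrite lerXn2r// nnegrE mulr_ge0.
  rewrite real_normK ?num_real// exprMn => /le_trans; apply.
  rewrite -[leRHS]mulrA [leRHS]mulrCA; apply: ler_wpM2l; first exact: sqr_ge0.
  have x4 : (dx ^+ 2) ^+ 2 <= d1 * dx ^+ 2.
    rewrite (expr2 (dx ^+ 2)) ler_wpM2r ?sqr_ge0//.
    rewrite -(real_normK (num_real dx)) expr2.
    apply: le_trans (ler_wpM2l (normr_ge0 _) dx1) _.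
    by apply: ler_piMl; [exact: ltW|apply: le_trans dx1 d11].
  rewrite -(real_normK (num_real ze)) -(real_normK (num_real dt)).
  move: x4; move: `|ze| `|dt| (dx ^+ 2) => u v w; clear => x4.
  have := sqr_ge0 (u - v); have := sqr_ge0 (u - w); have := sqr_ge0 (v - w).
  by move: x4; rewrite !expr2; lra.
have dl3 : `|dl| ^+ 3 <= dl ^+ 2.
  by rewrite exprS real_normK ?num_real// ler_piMl ?sqr_ge0.
have TC : `|W1 - W0 + g * dl| <= C3 * dl ^+ 2.
  have -> : W1 - W0 + g * dl = (W1 - W0 - g * - dl - cutoff'' (1 - lam) / 2 * dl ^+ 2) + cutoff'' (1 - lam) / 2 * dl ^+ 2 by ring.
  apply: le_trans (ler_normD _ _) _.
  rewrite [in X in _ + X]normrM (ger0_norm (sqr_ge0 _)) normrM (ger0_norm (_ : 0 <= 2^-1)) ?invr_ge0//.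
  by move: HT dl3; rewrite /C3; clear; lra.
have KE : `|g * dl + g / D * (ze - b * dt - mu / 2 * dx ^+ 2)| <= ep / 2 * dx ^+ 2 + g / D * C * (ze ^+ 2 + dt ^+ 2).
  have -> : g * dl + g / D * (ze - b * dt - mu / 2 * dx ^+ 2) = g / D * (D * dl + (ze - b * dt - mu / 2 * dx ^+ 2)).
    by field; rewrite gt_eqF.
  rewrite normrM (gtr0_norm k0) -epE.
  have -> : g / D * ep' * dx ^+ 2 + g / D * C * (ze ^+ 2 + dt ^+ 2) =
      g / D * (ep' * dx ^+ 2 + C * (ze ^+ 2 + dt ^+ 2)) by ring.
  by rewrite ler_wpM2l// ltW.
have -> : W1 - W0 - g / D * (ze - b * dt - mu / 2 * dx ^+ 2) =
  (W1 - W0 + g * dl) - (g * dl + g / D * (ze - b * dt - mu / 2 * dx ^+ 2)) by ring.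
apply: le_trans (ler_normB _ _) _; apply: le_trans (lerD TC KE) _.
have C3M : C3 * dl ^+ 2 <= M * (ze ^+ 2 + dt ^+ 2 + d1 * dx ^+ 2).
  by rewrite /M -mulrA ler_wpM2l// ltW.
have Mx : M * d1 * dx ^+ 2 <= ep / 2 * dx ^+ 2 by rewrite ler_wpM2r ?sqr_ge0.
have z2 : 0 <= ep * dz ^+ 2 by rewrite mulr_ge0 ?sqr_ge0// ltW.
move: C3M Mx z2; clear; lra.
Qed.

(** The last hypothesis compares upward speeds: that of the leaf, [e * l s + lam^-1], and the one
    prescribed by curvature. W decreases as leaves rise, so leaves that are not too fast give a
    supersolution. *)
Lemma barrier_upper_test {R : realType} (l l1 l2 : R -> R) (c a e : R) (sl : smooth_profile l l1 l2)
    (c0 : 0 < c) (lc : forall s, c * (1 + `|s|) <= l s) (e0 : 0 <= e)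
    (range_l1 : forall y k : R, (forall s, s * y - l s <= k) -> exists s, l1 s = y)
    (phi psi : R * R -> R) (rphi : regular_norm phi) (hpsi : is_norm psi) (x z t : R) :
  let W := fun x z t => cutoff (1 - dilation l a e x z t) in 0 < t ->
  (exists2 r : R, 0 < r & forall dt, `|dt| < r -> e * (t + dt) <= a) ->
  (forall s lam, 2^-1 < lam ->
    e * l s + lam^-1 <= weight psi s * slope_curv phi s * ((lam + a - e * t) * l2 s)^-1) ->
  upper_test phi psi W x z t.
Proof.
move=> W t0 hr H; have [F|[lam2 [s [k [k0 F]]]]] := cutoff_dilation_jet l l1 l2 c a e sl c0 lc e0 range_l1 x z t t0 hr.
  apply: upper_test_flat => // ep ep0; have [C [d [d0 Hd]]] := F _ ep0.
  exists C, d; split => // dx dz dt h1 h2 h3.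
  by apply: le_trans (Hd _ _ _ h1 h2 h3); exact: ler_norm.
apply: (@upper_test_jet _ _ _ rphi hpsi _ _ _ _ k s (e * l s + (dilation l a e x z t)^-1) ((dilation l a e x z t + a - e * t) * l2 s)^-1).
- by rewrite gt_eqF.
- by rewrite -slope_curvE// pmulr_rle0// subr_le0; exact: H.
move=> ep ep0; have [C [d [d0 Hd]]] := F _ ep0.
exists C, d; split => // dx dz dt h1 h2 h3.
by apply: le_trans (Hd _ _ _ h1 h2 h3); exact: ler_norm.
Qed.

(** Here the leaves are at least as fast as prescribed, and the jet of - W has the opposite factor -
    k. *)
Lemma barrier_lower_test {R : realType} (l l1 l2 : R -> R) (c a e : R) (sl : smooth_profile l l1 l2)
    (c0 : 0 < c) (lc : forall s, c * (1 + `|s|) <= l s) (e0 : 0 <= e)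
    (range_l1 : forall y k : R, (forall s, s * y - l s <= k) -> exists s, l1 s = y)
    (phi psi : R * R -> R) (rphi : regular_norm phi) (hpsi : is_norm psi) (x z t : R) :
  let W := fun x z t => cutoff (1 - dilation l a e x z t) in 0 < t ->
  (exists2 r : R, 0 < r & forall dt, `|dt| < r -> e * (t + dt) <= a) ->
  (forall s lam, 2^-1 < lam ->
    weight psi s * slope_curv phi s * ((lam + a - e * t) * l2 s)^-1 <= e * l s + lam^-1) ->
  upper_test phi psi (fun x z t => - W x z t) x z t.
Proof.
move=> W t0 hr H; have [F|[lam2 [s [k [k0 F]]]]] := cutoff_dilation_jet l l1 l2 c a e sl c0 lc e0 range_l1 x z t t0 hr.
  apply: upper_test_flat => // ep ep0; have [C [d [d0 Hd]]] := F _ ep0.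
  exists C, d; split => // dx dz dt h1 h2 h3.
  apply: le_trans (Hd _ _ _ h1 h2 h3).
  by rewrite -opprD -normrN; exact: ler_norm.
apply: (@upper_test_jet _ _ _ rphi hpsi _ _ _ _ (- k) s (e * l s + (dilation l a e x z t)^-1) ((dilation l a e x z t + a - e * t) * l2 s)^-1).
- by rewrite oppr_eq0 gt_eqF.
- by rewrite -slope_curvE// mulNr oppr_le0 pmulr_rge0// subr_ge0; exact: H.
move=> ep ep0; have [C [d [d0 Hd]]] := F _ ep0.
exists C, d; split => // dx dz dt h1 h2 h3.
apply: le_trans (Hd _ _ _ h1 h2 h3).
by rewrite mulNr -!opprD -normrN; exact: ler_norm.
Qed.

Definition C2_jet {R : realType} (om om1 om2 : R -> R) (K : R) := forall x h : R,
  `|om (x + h) - om x - om1 x * h - om2 x / 2 * h ^+ 2| <= K * `|h| ^+ 3.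

Lemma slab_continuous_fst {R : realType} (T K : R) (om : R -> R) : 0 <= K ->
  (forall x y, `|om x - om y| <= K * `|x - y|) -> slab_continuous T (fun x z t => om x).
Proof.
move=> K0 H x z t ep _ ep0; have K1 : 0 < K + 1 by rewrite ltr_wpDl.
exists (ep / (K + 1)); first by rewrite divr_gt0.
move=> x' z' t' _ h _ _; apply: le_lt_trans (H _ _) _.
move: h; rewrite ltr_pdivlMr// mulrDr mulr1 (mulrC K).
by have := normr_ge0 (x' - x); lra.
Qed.

Lemma slab_continuousD {R : realType} (T : R) (f w : R -> R -> R -> R) :
  slab_continuous T f -> slab_continuous T w ->
  slab_continuous T (fun x z t => f x z t + w x z t).
Proof.
move=> cf cw x z t ep tT ep0; have e20 : 0 < ep / 2 by rewrite divr_gt0.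
have [d d0 Hd] := cf x z t _ tT e20; have [d' d'0 Hd'] := cw x z t _ tT e20.
exists (Num.min d d'); first by rewrite lt_min d0.
move=> x' z' t' tT'; rewrite !lt_min => /andP[h1 h1'] /andP[h2 h2'] /andP[h3 h3'].
have := Hd _ _ _ tT' h1 h2 h3; have := Hd' _ _ _ tT' h1' h2' h3'.
move: (f _ _ _) (f _ _ _) (w _ _ _) (w _ _ _) => a b a' b'.
by clear; rewrite !ltr_norml; lra.
Qed.

Lemma slab_continuousN {R : realType} (T : R) (f : R -> R -> R -> R) :
  slab_continuous T f -> slab_continuous T (fun x z t => - f x z t).
Proof.
move=> cf x z t ep tT ep0; have [d d0 Hd] := cf x z t _ tT ep0.
exists d => // x' z' t' tT' h1 h2 h3.
by rewrite -opprD normrN; exact: Hd.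
Qed.

Lemma sqr_lipschitz_box {R : realType} (y0 y y' d : R) : `|y' - y| < d -> d <= 1 ->
  `|(y' - y0) ^+ 2 - (y - y0) ^+ 2| <= (2 * `|y - y0| + 1) * d.
Proof.
move=> h d1; have -> : (y' - y0) ^+ 2 - (y - y0) ^+ 2 = (y' - y) * (2 * (y - y0) + (y' - y)) by ring.
rewrite normrM mulrC; apply: ler_pM => //; last exact: ltW.
apply: le_trans (ler_normD _ _) _; rewrite normrM (ger0_norm (ler0n _ 2)).
by rewrite lerD2l; apply: le_trans (ltW h) d1.
Qed.

Lemma slab_continuous_sqr {R : realType} (T x0 z0 k k' m : R) :
  slab_continuous T (fun x z t => m + k * ((x - x0) ^+ 2 + (z - z0) ^+ 2) + k' * t).
Proof.
move=> x z t ep _ ep0.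
pose M := `|k| * (2 * `|x - x0| + 2 * `|z - z0| + 2) + `|k'| + 1.
have M0 : 0 < M by rewrite /M ltr_wpDl// addr_ge0// mulr_ge0// !addr_ge0// mulr_ge0.
exists (Num.min 1 (ep / M)); first by rewrite lt_min ltr01 divr_gt0.
set d := Num.min _ _; have d1 : d <= 1 by rewrite ge_min lexx.
have d0 : 0 < d by rewrite lt_min ltr01 divr_gt0.
have dM : d * M <= ep by rewrite -ler_pdivlMr// ge_min lexx orbT.
clearbody d; move=> x' z' t' _ h1 h2 h3.
have E1 := sqr_lipschitz_box x0 x x' d h1 d1.
have E2 := sqr_lipschitz_box z0 z z' d h2 d1.
have -> : m + k * ((x' - x0) ^+ 2 + (z' - z0) ^+ 2) + k' * t' - (m + k * ((x - x0) ^+ 2 + (z - z0) ^+ 2) + k' * t)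
  = k * (((x' - x0) ^+ 2 - (x - x0) ^+ 2) + ((z' - z0) ^+ 2 - (z - z0) ^+ 2)) + k' * (t' - t) by ring.
apply: le_lt_trans (ler_normD _ _) _; rewrite !normrM.
have F1 : `|k| * `|(x' - x0) ^+ 2 - (x - x0) ^+ 2 + ((z' - z0) ^+ 2 - (z - z0) ^+ 2)| <=
    `|k| * ((2 * `|x - x0| + 1) * d + (2 * `|z - z0| + 1) * d).
  by rewrite ler_wpM2l//; apply: le_trans (ler_normD _ _) _; exact: lerD.
have F2 : `|k'| * `|t' - t| <= `|k'| * d by rewrite ler_wpM2l// ltW.
by move: F1 F2 dM d0; rewrite /M; clear; lra.
Qed.

(** The last bound comes from |p1 p2| <= |p|^2. It makes a second derivative of order |p1| harmless
    when p2 is small. *)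
Lemma ratio_bound {R : realType} (p1 p2 : R) : (p1, p2) != 0 :> R * R ->
  [/\ 0 <= p2 ^+ 2 / (p1 ^+ 2 + p2 ^+ 2), p2 ^+ 2 / (p1 ^+ 2 + p2 ^+ 2) <= 1 &
      p2 ^+ 2 / (p1 ^+ 2 + p2 ^+ 2) * `|p1| <= `|p2|].
Proof.
move=> p0; have N0 : 0 < p1 ^+ 2 + p2 ^+ 2 := plane_neq0_norm _ p0.
split; first by rewrite divr_ge0 ?sqr_ge0 ?ltW.
  by rewrite ler_pdivrMr// mul1r lerDr sqr_ge0.
rewrite mulrAC ler_pdivrMr// -(real_normK (num_real p1)) -(real_normK (num_real p2)).
have := normr_ge0 p1; have := normr_ge0 p2; move: `|p1| `|p2| => u v v0 u0.
rewrite (_ : v ^+ 2 * u = v * (u * v)); last by ring.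
rewrite ler_wpM2l//; have := sqr_ge0 (u - v); have := mulr_ge0 u0 v0.
by rewrite !expr2; clear; lra.
Qed.

(* Compare v with om x + eta0 + Cb |p - p0| ^ 2 / r ^ 2 + (eta / T) t: its
   gradient is almost horizontal, and then the weight p2 ^ 2 / |p| ^ 2 of the
   second x-derivative in the operator is small unless om1 x is, in which case
   om2 x is small. *)
Lemma far_field {R : realType} (phi psi : R * R -> R) (rphi : regular_norm phi) (hpsi : is_norm psi)
    (om om1 om2 : R -> R) (K Kl T Cb eta : R) : 0 <= K -> 0 <= Kl ->
  C2_jet om om1 om2 K -> (forall x y, `|om x - om y| <= Kl * `|x - y|) ->
  (forall ep : R, 0 < ep -> exists2 C : R, 0 <= C & forall x, `|om2 x| <= ep + C * `|om1 x|) ->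
  0 < T -> 0 <= Cb -> 0 < eta ->
  exists2 r : R, 0 < r & forall v (eta0 x0 z0 : R),
    quad_subsolution phi psi v -> slab_continuous T v ->
    (forall x z, `|x - x0| <= r -> `|z - z0| <= r -> v x z 0 <= om x + eta0) ->
    (forall x z t : R, 0 <= t <= T -> v x z t <= om x + eta0 + Cb) ->
    forall t : R, 0 <= t < T -> v x0 z0 t <= om x0 + eta0 + eta.
Proof.
move=> K0 Kl0 Hj HL Hom T0 Cb0 eta0p.
have [c [CT [_ CT0 HC]]] := mobility_curv_bounds phi rphi psi hpsi.
(* The drift k of the barrier pays for an operator as large as k; [ep] and [de] share this budget
   according to [kE]. *)
pose k := eta / T; have k0 : 0 < k by rewrite divr_gt0.
pose ep := k / (2 * CT); have ep0 : 0 < ep by rewrite divr_gt0// mulr_gt0.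
have [C C0 HomC] := Hom _ ep0.
pose de := k / (2 * CT * (4 * C + 6)).
have C46 : 0 < 4 * C + 6 by move: C0; clear; lra.
have de0 : 0 < de by rewrite divr_gt0// !mulr_gt0.
have kE : CT * (ep + 4 * C * de + 6 * de) = k.
  have C46' : 4 * C + 6 != 0 by rewrite gt_eqF.
  by rewrite /ep /de; field; rewrite C46' gt_eqF.
(* The paraboloid must reach Cb at distance r with slope at most [de], that is 2 Cb / r <= de. The
   summand 1 ensures r >= 1, so that its second derivative 2 q is also at most [de]. *)
pose r := 1 + 2 * Cb / de.
have r1 : 1 <= r by rewrite lerDl; apply: divr_ge0; [exact: mulr_ge0|exact: ltW].
have r0 : 0 < r by exact: lt_le_trans r1.
have Ar : 2 * Cb / r <= de.
  rewrite ler_pdivrMr// /r mulrDr mulr1 mulrCA divff ?gt_eqF// mulr1.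
  by move: de0; clear; lra.
pose q := Cb / r ^+ 2; have q0 : 0 <= q by rewrite divr_ge0// sqr_ge0.
have qr : q * r ^+ 2 = Cb by rewrite /q divfK// expf_neq0// gt_eqF.
have qr1 : 2 * q * r <= de by rewrite /q (_ : 2 * (Cb / r ^+ 2) * r = 2 * Cb / r)//; field; rewrite gt_eqF.
have qd : 2 * q <= de.
  by apply: le_trans qr1; rewrite ler_peMr// mulr_ge0.
clearbody q r.
exists r => // v eta0 x0 z0 sv cv Hv0 Hvb t tT.
pose w x z t := om x + (eta0 + q * ((x - x0) ^+ 2 + (z - z0) ^+ 2) + k * t).
suff : v x0 z0 t <= w x0 z0 t.
  move/le_trans; apply; rewrite /w !subrr expr0n addr0 mulr0 addr0 addrA lerD2l.
  by rewrite /k mulrAC ler_pdivrMr// ler_wpM2l ?ltW//; case/andP: tT => _.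
apply: (@comparison _ phi psi v w (x0 - r) (x0 + r) (z0 - r) (z0 + r) T) => //; last 2 first.
- by rewrite !lerDl lerBlDr lerDl ltW.
- by rewrite !lerDl lerBlDr lerDl ltW.
- apply: slab_continuousD; first exact: (slab_continuous_fst T Kl).
  exact: slab_continuous_sqr.
- move=> x z s hx hz hs e ep'0.
  have hx' : `|x - x0| <= r by rewrite ler_norml; move: hx; clear; lra.
  have hz' : `|z - z0| <= r by rewrite ler_norml; move: hz; clear; lra.
  pose K1 := 2 * K + 1; have K10 : 0 < K1 by rewrite ltr_wpDl// mulr_ge0.
  exists k, (om1 x + 2 * q * (x - x0)), (2 * q * (z - z0)), (om2 x + 2 * q + de), 0, (2 * q), 0, (de / K1).
  split; first by rewrite divr_gt0.
    move=> dx dz dt h1 _ _.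
    have := Hj x dx; rewrite ler_norml => /andP[_ J].
    have J2 : K * `|dx| ^+ 3 <= de / 2 * dx ^+ 2.
      rewrite exprS real_normK ?num_real// mulrA ler_wpM2r ?sqr_ge0//.
      have : K * `|dx| <= K * (de / K1) by rewrite ler_wpM2l// ltW.
      move/le_trans; apply; rewrite mulrA ler_pdivrMr// /K1.
      by have := mulr_ge0 K0 (ltW de0); move: de0; clear; lra.
    rewrite /w; move: J J2; move: (om (x + dx)) (om x) (om1 x) (om2 x) (K * _) => a b a1 a2 kk; clear.
    rewrite !expr2; lra.
  exists de => // p1 p2 a' b' c' e1 e2 e3 e4 e5 p0.
  apply: le_trans (level_set_op_le phi psi rphi hpsi CT _ _ _ _ _ (fun p h => proj2 (andP (HC p h))) p0) _.
  apply: (@le_trans _ _ k); last by move: ep'0; clear; lra.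
  rewrite -kE; apply: ler_wpM2l; first exact: ltW.
  have [rho0 rho1 rhop] := ratio_bound p1 p2 p0; move: (_ / (_ + _)) rho0 rho1 rhop => rho rho0 rho1 rhop.
  have qx : `|2 * q * (x - x0)| <= de.
    apply: le_trans qr1; rewrite normrM (ger0_norm (mulr_ge0 _ q0))// ler_wpM2l// mulr_ge0//.
  have qz : `|2 * q * (z - z0)| <= de.
    apply: le_trans qr1; rewrite normrM (ger0_norm (mulr_ge0 _ q0))// ler_wpM2l// mulr_ge0//.
  have P2 : `|p2| <= 2 * de.
    by move: qz e2; clear; rewrite !ler_norml ltr_norml; lra.
  have O1 : `|om1 x| <= `|p1| + 2 * de.
    have E : om1 x = - (p1 - (om1 x + 2 * q * (x - x0))) + (p1 - 2 * q * (x - x0)) by ring.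
    rewrite {1}E; apply: le_trans (ler_normD _ _) _; rewrite normrN.
    by have := ler_normB p1 (2 * q * (x - x0)); move: qx e1; clear; lra.
  have Ra : rho * `|a'| <= ep + 4 * C * de + 3 * de.
    have A1 : `|a'| <= ep + C * (`|p1| + 2 * de) + 3 * de.
      have HO := HomC x.
      have CO := ler_wpM2l C0 O1.
      have -> : a' = (a' - (om2 x + 2 * q + de)) + om2 x + 2 * q + de by ring.
      apply: le_trans (ler_normD _ _) _; apply: le_trans (lerD (ler_normD _ _) (lexx _)) _.
      apply: le_trans (lerD (lerD (ler_normD _ _) (lexx _)) (lexx _)) _.
      rewrite (ger0_norm (mulr_ge0 _ q0))// (gtr0_norm de0).
      move: e3 HO CO qd; clear; lra.
    apply: le_trans (ler_wpM2l rho0 A1) _.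
    have c1 := ler_wpM2l C0 rhop; have c2 := ler_wpM2l C0 P2.
    have k1 : rho * ep <= 1 * ep by rewrite ler_wpM2r// ltW.
    have k2 : rho * (C * de) <= 1 * (C * de) by rewrite ler_wpM2r// mulr_ge0// ltW.
    have k3 : rho * de <= 1 * de by rewrite ler_wpM2r// ltW.
    move: c1 c2 k1 k2 k3; clear; lra.
  have B1 : `|b'| <= de by move: e4; rewrite subr0; exact: ltW.
  have C1 : `|c'| <= 2 * de.
    by move: e5 qd q0; clear; rewrite !ltr_norml ler_norml; lra.
  move: Ra B1 C1; clear; lra.
move=> x z s hx hz hs B.
have hx' : `|x - x0| <= r by rewrite ler_norml; move: hx; clear; lra.
have hz' : `|z - z0| <= r by rewrite ler_norml; move: hz; clear; lra.
have [s0|s0] := eqVneq s 0.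
  rewrite s0; apply: le_trans (Hv0 _ _ hx' hz') _; rewrite /w mulr0 addr0 addrA lerDl.
  by rewrite mulr_ge0// addr_ge0// sqr_ge0.
have hsT : 0 <= s <= T by case/andP: hs => -> /ltW ->.
apply: le_trans (Hvb _ _ _ hsT) _; rewrite /w -!addrA lerD2l lerD2l.
have ks : 0 <= k * s by apply: mulr_ge0; [exact: ltW|case/andP: hs].
have rr : r ^+ 2 <= (x - x0) ^+ 2 + (z - z0) ^+ 2.
  have x2 := sqr_ge0 (x - x0); have z2 := sqr_ge0 (z - z0).
  case: B => [[]|[]|]E; last by rewrite E eqxx in s0.
  - by rewrite E (_ : x0 - r - x0 = - r) ?sqrrN ?lerDl//; ring.
  - by rewrite E (_ : x0 + r - x0 = r) ?lerDl//; ring.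
  - by rewrite E (_ : z0 - r - z0 = - r) ?sqrrN ?lerDr//; ring.
  - by rewrite E (_ : z0 + r - z0 = r) ?lerDr//; ring.
by have := ler_wpM2l q0 rr; rewrite qr; move: ks; clear; lra.
Qed.

(** * Far field and comparison with the foliations *)

Section Asymptote.
Context {R : realType} (a ap am : R) (ap0 : 0 < ap) (am0 : 0 < am) (a0 : 0 <= a).
Implicit Types (x y h : R).

(* The limit as z -> +oo of the barrier whose profile has slopes in ]-am, ap[. *)
Definition asymptote x : R := cutoff (1 + a - x / ap) + cutoff (1 + a + x / am) - cutoff 2^-1.

Definition asymptote1 x : R := - (cutoff' (1 + a - x / ap) / ap) + cutoff' (1 + a + x / am) / am.

Definition asymptote2 x : R :=
  cutoff'' (1 + a - x / ap) / ap ^+ 2 + cutoff'' (1 + a + x / am) / am ^+ 2.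

Let ap1 : ap != 0. Proof. by rewrite gt_eqF. Qed.
Let am1 : am != 0. Proof. by rewrite gt_eqF. Qed.

Lemma asymptote_jet : C2_jet asymptote asymptote1 asymptote2 (4 * (ap^-1 ^+ 3 + am^-1 ^+ 3)).
Proof.
move=> x h.
have A := cutoff_taylor (1 + a - (x + h) / ap) (1 + a - x / ap).
have B := cutoff_taylor (1 + a + (x + h) / am) (1 + a + x / am).
rewrite (_ : 1 + a - (x + h) / ap - (1 + a - x / ap) = - (h / ap)) in A; last by field.
rewrite (_ : 1 + a + (x + h) / am - (1 + a + x / am) = h / am) in B; last by field.
have E k : 0 < k -> `|h / k| ^+ 3 = k^-1 ^+ 3 * `|h| ^+ 3.
  by move=> k0; rewrite normrM normfV (gtr0_norm k0) exprMn mulrC.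
rewrite normrN (E _ ap0) in A; rewrite (E _ am0) in B.
move: A B; rewrite /asymptote /asymptote1 /asymptote2.
move: (cutoff (1 + a - (x + h) / ap)) (cutoff (1 + a - x / ap)) (cutoff (1 + a + (x + h) / am)) (cutoff (1 + a + x / am)) (cutoff 2^-1) (cutoff' (1 + a - x / ap)) (cutoff' (1 + a + x / am)) (cutoff'' (1 + a - x / ap)) (cutoff'' (1 + a + x / am)) => u1 u2 v1 v2 u3 d1 d2 f1 f2 A B.
set X := (X in `|X| <= _); set Y := 4 * _ * _.
have -> : X = (u1 - u2 - d1 * - (h / ap) - f1 / 2 * (- (h / ap)) ^+ 2) +
   (v1 - v2 - d2 * (h / am) - f2 / 2 * (h / am) ^+ 2).
  by rewrite /X; field; rewrite ap1 am1.
apply: le_trans (ler_normD _ _) _; apply: le_trans (lerD A B) _.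
by rewrite /Y; lra.
Qed.

Lemma asymptote_lipschitz x y : `|asymptote x - asymptote y| <= (ap^-1 + am^-1) * `|x - y|.
Proof.
have A := cutoff_lipschitz (1 + a - x / ap) (1 + a - y / ap).
have B := cutoff_lipschitz (1 + a + x / am) (1 + a + y / am).
rewrite (_ : 1 + a - x / ap - (1 + a - y / ap) = - ((x - y) / ap)) in A; last by field.
rewrite (_ : 1 + a + x / am - (1 + a + y / am) = (x - y) / am) in B; last by field.
rewrite normrN normrM normfV (gtr0_norm ap0) in A; rewrite normrM normfV (gtr0_norm am0) in B.
move: A B; rewrite /asymptote; move: (cutoff (1 + a - x / ap)) (cutoff (1 + a - y / ap)) (cutoff (1 + a + x / am)) (cutoff (1 + a + y / am)) (cutoff 2^-1) => u1 u2 v1 v2 u3 A B.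
have -> : u1 + v1 - u3 - (u2 + v2 - u3) = (u1 - u2) + (v1 - v2) by ring.
by apply: le_trans (ler_normD _ _) _; rewrite mulrDl mulrC (mulrC am^-1); exact: lerD.
Qed.

Lemma cutoff''_hi (r : R) : 2^-1 <= r -> cutoff'' r = 0.
Proof.
by move=> h; have := cutoff'_hi r h; rewrite /cutoff' /cutoff'' => /eqP; rewrite sqrf_eq0 => /eqP ->; rewrite mulr0.
Qed.

Lemma asymptote_degenerate (ep : R) : 0 < ep ->
  exists2 C : R, 0 <= C & forall x, `|asymptote2 x| <= ep + C * `|asymptote1 x|.
Proof.
move=> ep0.
have key (k : R) : 0 < k -> exists2 C : R, 0 <= C & forall r, `|cutoff'' r| / k ^+ 2 <= ep + C * (cutoff' r / k).
  move=> k0; have k2 : 0 < k ^+ 2 by rewrite exprn_gt0.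
  have ek : 0 < ep * k ^+ 2 by rewrite mulr_gt0.
  exists (k / (ep * k ^+ 2) / k ^+ 2); first by rewrite !divr_ge0 ?ltW.
  move=> r; rewrite ler_pdivrMr//; apply: le_trans (cutoff''_le _ r ek) _.
  rewrite le_eqVlt; apply/orP; left; apply/eqP; field.
  by rewrite !gt_eqF.
have nd (u k : R) : 0 < k -> `|u / k| = `|u| / k by move=> k0; rewrite normrM normfV (gtr0_norm k0).
have [C1 C10 H1] := key _ ap0; have [C2 C20 H2] := key _ am0.
exists (C1 + C2); first by rewrite addr_ge0.
move=> x; rewrite /asymptote1 /asymptote2.
have [x0|x0] := leP 0 x.
  have h : 2^-1 <= 1 + a + x / am.
    by have := divr_ge0 x0 (ltW am0); move: a0; lra.
  rewrite (cutoff'_hi _ h) (cutoff''_hi _ h) !mul0r !addr0.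
  rewrite normrN (nd _ _ (exprn_gt0 2 ap0)) (nd _ _ ap0) (ger0_norm (cutoff'_ge0 _)).
  apply: le_trans (H1 _) _; rewrite lerD2l ler_wpM2r ?lerDl//.
  by rewrite divr_ge0 ?cutoff'_ge0// ltW.
have h : 2^-1 <= 1 + a - x / ap.
  have xN : 0 <= - x by rewrite oppr_ge0 ltW.
  by have := divr_ge0 xN (ltW ap0); rewrite mulNr; move: a0; lra.
rewrite (cutoff'_hi _ h) (cutoff''_hi _ h) !mul0r oppr0 !add0r.
rewrite (nd _ _ (exprn_gt0 2 am0)) (nd _ _ am0) (ger0_norm (cutoff'_ge0 _)).
apply: le_trans (H2 _) _; rewrite lerD2l ler_wpM2r ?lerDr//.
by rewrite divr_ge0 ?cutoff'_ge0// ltW.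
Qed.

Lemma asymptoteP x :
  (0 <= x /\ asymptote x = cutoff (1 + a - x / ap)) \/ (x <= 0 /\ asymptote x = cutoff (1 + a + x / am)).
Proof.
rewrite /asymptote; have [x0|/ltW x0] := leP 0 x; [left|right]; split => //.
  have h : 2^-1 <= 1 + a + x / am.
    by have := divr_ge0 x0 (ltW am0); move: a0; lra.
  by rewrite (cutoff_hi _ h) addrK.
have h : 2^-1 <= 1 + a - x / ap.
  have xN : 0 <= - x by rewrite oppr_ge0.
  by have := divr_ge0 xN (ltW ap0); rewrite mulNr; move: a0; lra.
by rewrite (cutoff_hi _ h) addrAC subrr add0r.
Qed.

End Asymptote.

(** ap and - am are the supremum and the infimum of l1, approached up to a relative error; K lies in
    the strip - am <= x <= ap. *)
Definition slope_range {R : realType} (l1 : R -> R) (ap am : R) :=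
  [/\ 0 < ap, 0 < am, forall s, - am <= l1 s <= ap,
    forall ep, 0 < ep -> exists s, ap * (1 - ep) <= l1 s &
    forall ep, 0 < ep -> exists s, l1 s <= - (am * (1 - ep))].

(** The constraints for s tending to plus or minus infinity: l s is at most l 0 + ap s for s >= 0,
    and symmetrically with am, so boundedness from above of s (x - m ap) forces the sign. *)
Lemma dilation_slopes {R : realType} (l l1 l2 : R -> R) (c a e ap am : R) (sl : smooth_profile l l1 l2)
    (c0 : 0 < c) (lc : forall s, c * (1 + `|s|) <= l s) (e0 : 0 <= e)
    (sr : slope_range l1 ap am) (x z t : R) : 0 <= t -> e * t <= a ->
  let m := dilation l a e x z t + a - e * t in x <= m * ap /\ - x <= m * am.
Proof.
move=> t0 ta m; have P := in_dilation l c a e c0 lc x z t t0 ta.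
have lam := dilation_ge l c a e c0 lc x z t t0 ta.
have m0 : 0 < m by rewrite /m; move: lam ta; clear; lra.
case: sr => ap0 am0 bd _ _.
set k := dilation l a e x z t in P lam m m0 *; rewrite -/m in P.
have key (y b : R) : (forall s : R, 0 <= s -> s * y <= m * l 0 + z - t / k + m * b * s) -> y <= m * b.
  move=> H; rewrite leNgt; apply/negP => yu.
  pose B : R := `|m * l 0 + z - t / k|.
  have yb : 0 < y - m * b by rewrite subr_gt0.
  pose s : R := (B + 1) / (y - m * b).
  have s0 : 0 <= s by apply: divr_ge0; [rewrite addr_ge0 ?normr_ge0|exact: ltW].
  have := H s s0; have : s * (y - m * b) = B + 1 by rewrite /s divfK// gt_eqF.
  by have := ler_norm (m * l 0 + z - t / k); rewrite -/B; clear; lra.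
split; apply: key => s s0.
  have := P s; have T := profile_tangent l l1 l2 sl s 0.
  have /andP[_ b1] := bd s; have T' := ler_wpM2l s0 b1.
  have T2 : l s <= l 0 + ap * s by move: T T'; clear; lra.
  by have := ler_wpM2l (ltW m0) T2; clear; lra.
have := P (- s); have T := profile_tangent l l1 l2 sl (- s) 0.
have /andP[b1 _] := bd (- s); have T' := ler_wpM2l s0 b1.
have T2 : l (- s) <= l 0 + am * s by move: T T'; clear; lra.
by have := ler_wpM2l (ltW m0) T2; clear; lra.
Qed.

Lemma barrier_le_asymptote {R : realType} (l l1 l2 : R -> R) (c a e ap am : R) (sl : smooth_profile l l1 l2)
    (c0 : 0 < c) (lc : forall s, c * (1 + `|s|) <= l s) (e0 : 0 <= e)
    (sr : slope_range l1 ap am) (x z t : R) : 0 <= t -> e * t <= a ->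
  cutoff (1 - dilation l a e x z t) <= asymptote a ap am x.
Proof.
move=> t0 ta; have [A B] := dilation_slopes l l1 l2 c a e ap am sl c0 lc e0 sr x z t t0 ta.
case: sr => ap0 am0 _ _ _.
have a0 : 0 <= a by apply: le_trans ta; exact: mulr_ge0.
have et0 : 0 <= e * t by exact: mulr_ge0.
move: A B; rewrite -!ler_pdivrMr// mulNr => A B.
case: (asymptoteP a ap am ap0 am0 a0 x) => -[_ ->]; apply: cutoff_mono; [move: A|move: B]; move: et0; clear; lra.
Qed.

(** In a leaf of size below Z the constraint at s = 0 bounds z from below and the strip bounds |x|.
    The choice Z = |a| + 2 leaves lam >= 2, beyond 3/2 where the cutoff has reached its bottom
    value. *)
Lemma barrier_low {R : realType} (l l1 l2 : R -> R) (c a e ap am : R) (sl : smooth_profile l l1 l2)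
    (c0 : 0 < c) (lc : forall s, c * (1 + `|s|) <= l s) (e0 : 0 <= e)
    (sr : slope_range l1 ap am) : exists2 Z : R, 0 < Z & forall x z t : R, 0 <= t -> e * t <= a ->
  z <= - Z \/ Z <= `|x| -> cutoff (1 - dilation l a e x z t) = - cutoff 2^-1.
Proof.
have l0 := growth_gt0 l c c0 lc 0; case: (sr) => ap0 am0 _ _ _.
pose Z := `|a| + 2; have Z0 : 0 < Z by rewrite ltr_wpDl.
have aa := ler_norm a.
exists (Z * (l 0 + ap + am)); first by rewrite mulr_gt0// !addr_gt0.
move=> x z t t0 ta H; apply: cutoff_lo.
have et0 : 0 <= e * t by exact: mulr_ge0.
have lam := dilation_ge l c a e c0 lc x z t t0 ta.
have P := in_dilation l c a e c0 lc x z t t0 ta 0.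
have [A B] := dilation_slopes l l1 l2 c a e ap am sl c0 lc e0 sr x z t t0 ta.
set k := dilation _ _ _ _ _ _ in A B P lam *.
suff : Z <= k + a - e * t by move: et0 aa; rewrite /Z; clear; lra.
rewrite leNgt; apply/negP => kZ.
have tk : 0 <= t / k by rewrite divr_ge0//; move: lam; clear; lra.
have P1 : (k + a - e * t) * l 0 < Z * l 0 by rewrite ltr_pM2r.
have P2 : (k + a - e * t) * ap < Z * ap by rewrite ltr_pM2r.
have P3 : (k + a - e * t) * am < Z * am by rewrite ltr_pM2r.
have Q1 := mulr_ge0 (ltW Z0) (ltW l0); have Q2 := mulr_ge0 (ltW Z0) (ltW ap0).
have Q3 := mulr_ge0 (ltW Z0) (ltW am0).
case: H => H.
  move: P P1 P2 P3 tk H Q1 Q2 Q3; rewrite mul0r; clear; lra.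
have : `|x| < Z * (l 0 + ap + am).
  by rewrite ltr_norml; move: A B P1 P2 P3 Q1 Q2 Q3; clear; lra.
by move: H; clear; lra.
Qed.

(** A tangent of slope close to ap bounds l from below by an almost optimal line. With lam larger by
    eta than the width of the strip requires, all constraints then hold once z exceeds the
    constants, uniformly in x. *)
Lemma barrier_ge_asymptote {R : realType} (l l1 l2 : R -> R) (c a e ap am T eta : R) (sl : smooth_profile l l1 l2)
    (c0 : 0 < c) (lc : forall s, c * (1 + `|s|) <= l s) (e0 : 0 <= e)
    (sr : slope_range l1 ap am) : e * T <= a -> 0 < eta -> exists2 Z : R, 0 < Z & forall x z t : R,
  0 <= t <= T -> Z <= z ->
  asymptote (a - e * t) ap am x - eta <= cutoff (1 - dilation l a e x z t).
Proof.
move=> eTa eta0; case: (sr) => ap0 am0 bd hp hm.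
(* [mb] bounds the leaf sizes m that occur, so a relative loss of slope eta / mb costs at most eta
   in m. *)
pose mb := 2 + eta + `|a|; have mb0 : 0 < mb by rewrite /mb ltr_wpDr// addr_gt0.
have em0 : 0 < eta / mb by rewrite divr_gt0.
have [sp Hp] := hp _ em0; have [sm Hm] := hm _ em0.
pose B := `|l1 sp * sp - l sp| + `|l1 sm * sm - l sm|.
have B0 : 0 <= B by rewrite addr_ge0.
have Bp s : 0 <= s -> ap * (1 - eta / mb) * s - B <= l s.
  move=> s0; have Tg := profile_tangent l l1 l2 sl sp s.
  have k1 := ler_wpM2r s0 Hp; have := ler_norm (l1 sp * sp - l sp).
  have := normr_ge0 (l1 sm * sm - l sm); move: Tg k1; rewrite /B; clear; lra.
have Bm s : 0 <= s -> am * (1 - eta / mb) * s - B <= l (- s).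
  move=> s0; have Tg := profile_tangent l l1 l2 sl sm (- s).
  have k1 := ler_wpM2r s0 Hm; have := ler_norm (l1 sm * sm - l sm).
  have := normr_ge0 (l1 sp * sp - l sp); move: Tg k1; rewrite /B; clear; lra.
have l_gt0 := growth_gt0 l c c0 lc.
exists (mb * B + 2 * `|T| + 1); first by rewrite ltr_wpDl// addr_ge0 ?mulr_ge0// ltW.
move=> x z t /andP[t0 tT] Zz.
have ta : e * t <= a by apply: le_trans eTa; exact: ler_wpM2l.
have et0 : 0 <= e * t by exact: mulr_ge0.
have lam0 (lam : R) : 2^-1 <= lam -> t / lam <= 2 * `|T|.
  move=> h; have [_ /andP[_ i2]] := inv_le2 lam h.
  by have := ler_wpM2l t0 i2; have := ler_norm T; move: tT; clear; lra.
have gen (b y : R) (lb : R -> R) : 0 < b -> 0 <= y -> (forall s, 0 < lb s) ->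
    (forall s, 0 <= s -> b * (1 - eta / mb) * s - B <= lb s) ->
    y / b + (e * t - a) <= 3 / 2 ->
    exists lam, [/\ 2^-1 <= lam, 1 - lam = Num.min 2^-1 (1 + (a - e * t) - y / b) - eta &
      forall s, s * y - z + t / lam <= (lam + a - e * t) * lb s].
  move=> b0 y0 lb0 Hb yb.
  pose lam := Num.max 2^-1 (y / b - (a - e * t)) + eta.
  have ll2 : 2^-1 + eta <= lam by rewrite lerD2r le_max lexx.
  have ly : y / b - (a - e * t) + eta <= lam by rewrite lerD2r le_max lexx orbT.
  exists lam; split; first by move: ll2 eta0; clear; lra.
    rewrite /lam /Num.max /Num.min.
    move: (y / b) => u; clear; case: ltP => ?; case: ltP => ?; lra.
  move=> s; have l2' : 2^-1 <= lam by move: ll2 eta0; clear; lra.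
  have tl := lam0 lam l2'.
  set m := lam + a - e * t.
  have mu : m <= mb.
    have : lam <= 3 / 2 + eta.
      by rewrite lerD2r ge_max; apply/andP; split; move: yb; clear; lra.
    by rewrite /m /mb; move: et0 (ler_norm a); clear; lra.
  have m0 : 0 < m by rewrite /m; move: l2' ta; clear; lra.
  have ym : y <= b * (m - eta).
    by rewrite mulrC -ler_pdivrMr// /m; move: ly; clear; lra.
  have mB : m * B <= mb * B by exact: ler_wpM2r.
  have [s0|s0] := leP 0 s.
    have h1 := ler_wpM2l s0 ym.
    have h2 := ler_wpM2l (ltW m0) (Hb s s0).
    have h3 : m * (eta / mb) <= eta.
      by rewrite mulrA ler_pdivrMr// mulrC; apply: ler_wpM2l => //; exact: ltW.
    have h4 := ler_wpM2l (mulr_ge0 (ltW b0) s0) h3.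
    move: h1 h2 h4 tl mB Zz; clear; lra.
  have h1 : s * y <= 0 by rewrite nmulr_rle0.
  have h2 : 0 < m * lb s by rewrite mulr_gt0.
  have h3 := mulr_ge0 (ltW mb0) B0.
  move: h1 h2 h3 tl Zz; clear; lra.
have ae0 : 0 <= a - e * t by rewrite subr_ge0.
have fin (w lam : R) : 2^-1 <= lam -> 1 - lam = Num.min 2^-1 w - eta ->
    (forall s, s * x - z + t / lam <= (lam + a - e * t) * l s) ->
    cutoff w - eta <= cutoff (1 - dilation l a e x z t).
  move=> lam2 E Hl; have D : dilation l a e x z t <= lam by apply/(dilation_leP l c a e c0 lc).
  have M : cutoff (Num.min 2^-1 w - eta) <= cutoff (1 - dilation l a e x z t).
    by rewrite -E; apply: cutoff_mono; move: D; clear; lra.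
  apply: le_trans M.
  have -> : cutoff w = cutoff (Num.min 2^-1 w).
    by rewrite /Num.min; case: ltP => // /ltW; exact: cutoff_hi.
  have := cutoff_lipschitz (Num.min 2^-1 w - eta) (Num.min 2^-1 w).
  rewrite (_ : Num.min 2^-1 w - eta - Num.min 2^-1 w = - eta); last by ring.
  by rewrite normrN (gtr0_norm eta0) ler_norml; clear; lra.
have triv (w : R) : w <= - 2^-1 -> cutoff w - eta <= cutoff (1 - dilation l a e x z t).
  move=> w0; rewrite (cutoff_lo _ w0); have := cutoff_le (dilation l a e x z t - 1).
  by rewrite -(opprB 1 (dilation l a e x z t)) cutoffN; move: eta0; clear; lra.
case: (asymptoteP (a - e * t) ap am ap0 am0 ae0 x) => -[x0 ->].
  have [h|h] := leP (x / ap + (e * t - a)) (3 / 2); last by apply: triv; move: h; clear; lra.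
  have [lam [lam2 E Hl]] := gen ap x l ap0 x0 l_gt0 Bp h.
  exact: (fin _ lam).
have xN : 0 <= - x by rewrite oppr_ge0.
have [h|h] := leP (- x / am + (e * t - a)) (3 / 2); last by apply: triv; move: h; rewrite mulNr; clear; lra.
have [lam [lam2 E Hl]] := gen am (- x) (fun s => l (- s)) am0 xN (fun s => l_gt0 _) Bm h.
apply: (fin _ lam) => //; first by rewrite E mulNr opprK.
by move=> s; have := Hl (- s); rewrite mulrNN opprK.
Qed.

Lemma upper_test_addc {R : realType} (phi psi : R * R -> R) (w : R -> R -> R -> R) (k x z t : R) :
  upper_test phi psi w x z t -> upper_test phi psi (fun x z t => w x z t + k) x z t.
Proof.
move=> H e e0; have [tau [p1 [p2 [a [b [c [C [d [d0 Hd Ho]]]]]]]]] := H _ e0.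
exists tau, p1, p2, a, b, c, C, d; split => // dx dz dt h1 h2 h3.
by move: (Hd _ _ _ h1 h2 h3); move: (w (x + dx) _ _) (w x z t) => A B; clear; lra.
Qed.

Lemma barrier_slab_continuous {R : realType} (l : R -> R) (c a e T : R) : 0 < c ->
  (forall s, c * (1 + `|s|) <= l s) -> 0 <= e -> e * T <= a ->
  slab_continuous T (fun x z t => cutoff (1 - dilation l a e x z t)).
Proof.
move=> c0 lc e0 eTa x z t ep /andP[t0 tT] ep0.
have ta (s : R) : s <= T -> e * s <= a by move=> sT; apply: le_trans eTa; exact: ler_wpM2l.
pose K := 4 / c + e; have K0 : 0 < K by rewrite ltr_wpDr// divr_gt0.
exists (ep / K); first by rewrite divr_gt0.
move=> x' z' t' /andP[t'0 t'T] h1 h2 h3; apply: le_lt_trans (cutoff_lipschitz _ _) _.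
have A := dilation_lipschitz l c a e c0 lc e0 x z t x' z' t' t0 (ta _ tT) t'0 (ta _ t'T).
have B := dilation_lipschitz l c a e c0 lc e0 x' z' t' x z t t'0 (ta _ t'T) t0 (ta _ tT).
rewrite (distrC x) (distrC z) (distrC t) in B.
set d := ep / K in h1 h2 h3.
have dK : d * K = ep by rewrite /d divfK// gt_eqF.
have ci : 0 < c^-1 by rewrite invr_gt0.
have D : (`|x' - x| + `|z' - z| + 2 * `|t' - t|) / c + e * `|t' - t| < ep.
  rewrite -dK /K mulrDr mulrA; apply: ltr_leD.
    rewrite ltr_pM2r//; move: h1 h2 h3; clear; lra.
  by rewrite mulrC; apply: ler_wpM2r => //; exact: ltW.
by move: A B D; clear; rewrite ltr_norml; lra.
Qed.

Lemma C2_jetN {R : realType} (om om1 om2 : R -> R) (K : R) : C2_jet om om1 om2 K ->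
  C2_jet (fun x => - om x) (fun x => - om1 x) (fun x => - om2 x) K.
Proof.
move=> H x h; have := H x h; rewrite -normrN.
rewrite (_ : - (om (x + h) - om x - om1 x * h - om2 x / 2 * h ^+ 2) =
  - om (x + h) - - om x - - om1 x * h - - om2 x / 2 * h ^+ 2)//.
by rewrite !mulNr; ring.
Qed.

Lemma far_field_cst {R : realType} (phi psi : R * R -> R) (rphi : regular_norm phi) (hpsi : is_norm psi)
    (k T Cb eta : R) : 0 < T -> 0 <= Cb -> 0 < eta ->
  exists2 r : R, 0 < r & forall v (eta0 x0 z0 : R),
    quad_subsolution phi psi v -> slab_continuous T v ->
    (forall x z, `|x - x0| <= r -> `|z - z0| <= r -> v x z 0 <= k + eta0) ->
    (forall x z t : R, 0 <= t <= T -> v x z t <= k + eta0 + Cb) ->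
    forall t : R, 0 <= t < T -> v x0 z0 t <= k + eta0 + eta.
Proof.
move=> T0 Cb0 eta0.
apply: (@far_field R phi psi rphi hpsi (fun=> k) (fun=> 0) (fun=> 0) 0 0 T Cb eta) => //.
- by move=> x h; rewrite subrr !mul0r !subr0 normr0.
- by move=> x y; rewrite subrr normr0 mul0r.
- by move=> ep ep0; exists 0 => // x; rewrite normr0 mul0r addr0 ltW.
Qed.

Lemma asymptote_bound {R : realType} (a ap am x : R) : `|asymptote a ap am x| <= 3.
Proof.
rewrite /asymptote; have := cutoff_bound (1 + a - x / ap); have := cutoff_bound (1 + a + x / am).
have := cutoff_bound (2^-1 : R); rewrite !ler_norml; lra.
Qed.

(** * Bounds for solutions by the two foliations *)

Section Comparisons.
Context {R : realType}.

(** [comparison] is applied on a box whose top lies in the region of [high] and whose other sides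
    lie in that of [low]. The three eta pay for the initial datum, the far field and the replacement
    of the asymptote by W. *)
Lemma upper_comparison (phi psi : R * R -> R) (rphi : regular_norm phi) (hpsi : is_norm psi)
    (l l1 l2 : R -> R) (c ap am T M eta : R) (v : R -> R -> R -> R)
    (sl : smooth_profile l l1 l2) (c0 : 0 < c) (lc : forall s, c * (1 + `|s|) <= l s)
    (range_l1 : forall y k : R, (forall s, s * y - l s <= k) -> exists s, l1 s = y)
    (sr : slope_range l1 ap am) (l2E : forall s, l2 s = weight psi s * slope_curv phi s) :
  let W := fun x z t => cutoff (1 - dilation l 0 0 x z t) in
  0 < T -> 0 < eta -> quad_subsolution phi psi v -> slab_continuous T v ->
  (forall x z t : R, 0 <= t <= T -> v x z t <= M) ->
  (forall x z, v x z 0 <= W x z 0 + eta) ->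
  forall x z t : R, 0 <= t < T -> v x z t <= W x z t + 3 * eta.
Proof.
move=> W T0 eta0 sv cv vM v0; case: (sr) => ap0 am0 _ _ _.
have T00 (t : R) : 0 * t <= 0 by rewrite mul0r.
pose Cb : R := `|M| + 4; have Cb0 : 0 <= Cb by rewrite addr_ge0.
have MM := ler_norm M.
have cb : `|cutoff 2^-1 : R| <= 1 := cutoff_bound _.
have Wlow x z t : - cutoff 2^-1 <= W x z t.
  by rewrite lerNl /W -cutoffN; exact: cutoff_le.
have [Zl Zl0 HZl] := barrier_low l l1 l2 c 0 0 ap am sl c0 lc (lexx 0) sr.
have [Zh Zh0 HZh] := barrier_ge_asymptote l l1 l2 c 0 0 ap am T eta sl c0 lc (lexx 0) sr (T00 T) eta0.
have [r1 r10 F1] := far_field phi psi rphi hpsi _ _ _ _ _ T Cb eta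
  (mulr_ge0 (ler0n _ 4) (addr_ge0 (exprn_ge0 3 (ltW (etrans (invr_gt0 _) ap0))) (exprn_ge0 3 (ltW (etrans (invr_gt0 _) am0)))))
  (addr_ge0 (ltW (etrans (invr_gt0 _) ap0)) (ltW (etrans (invr_gt0 _) am0)))
  (asymptote_jet 0 ap am ap0 am0) (asymptote_lipschitz 0 ap am ap0 am0)
  (asymptote_degenerate 0 ap am ap0 am0 (lexx 0)) T0 Cb0 eta0.
have [r2 r20 F2] := far_field_cst phi psi rphi hpsi (- cutoff 2^-1) T Cb eta T0 Cb0 eta0.
have high x z t : 0 <= t < T -> Zh <= z -> v x z t <= W x z t + 3 * eta.
  move=> tT hz; have h1 : v x z t <= asymptote 0 ap am x + eta + eta.
    apply: F1 => //.
      move=> x' z' _ _; apply: le_trans (v0 _ _) _; rewrite lerD2r.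
      exact: (barrier_le_asymptote l l1 l2 c 0 0 ap am).
    move=> x' z' t' /vM/le_trans; apply.
    by have := asymptote_bound 0 ap am x'; rewrite ler_norml /Cb; move: MM eta0; clear; lra.
  have tT' : 0 <= t <= T by case/andP: tT => -> /ltW ->.
  have := HZh x z t tT' hz; rewrite mul0r subr0 -/(W x z t).
  by move: h1; clear; lra.
have low x z t : 0 <= t < T -> z <= - (Zl + r2) \/ Zl + r2 <= `|x| -> v x z t <= W x z t + 3 * eta.
  move=> tT hz; have h1 : v x z t <= - cutoff 2^-1 + eta + eta.
    apply: F2 => //.
      move=> x' z' hx' hz'; apply: le_trans (v0 _ _) _; rewrite lerD2r /W (HZl x' z' 0)//.
      case: hz => hz; [left|right].
        by move: hz hz'; rewrite ler_norml; clear; lra.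
      have := ler_normB x' (x' - x); rewrite opprB addrCA subrr addr0.
      by move: hz hx'; clear; lra.
    move=> x' z' t' /vM/le_trans; apply.
    by move: cb; rewrite ler_norml /Cb; move: MM eta0; clear; lra.
  by have := Wlow x z t; move: h1 eta0; clear; lra.
move=> x z t tT.
pose B := Zl + r2 + Zh + `|x| + `|z|.
have xB : `|x| <= B by rewrite /B; have := normr_ge0 z; move: Zl0 r20 Zh0; clear; lra.
have zB : `|z| <= B by rewrite /B; have := normr_ge0 x; move: Zl0 r20 Zh0; clear; lra.
have B1 : Zl + r2 <= B by rewrite /B; have := normr_ge0 x; have := normr_ge0 z; move: Zh0; clear; lra.
have B2 : Zh <= B by rewrite /B; have := normr_ge0 x; have := normr_ge0 z; move: Zl0 r20; clear; lra.
have B0 : 0 <= B by apply: le_trans xB.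
rewrite ler_norml in xB; rewrite ler_norml in zB.
apply: (@comparison _ phi psi v (fun x z t => W x z t + 3 * eta) (- B) B (- B) B T) => //.
- apply: slab_continuousD; first exact: (barrier_slab_continuous l c).
  have := slab_continuous_sqr T 0 0 0 0 (3 * eta).
  by congr slab_continuous; apply/funext => x'; apply/funext => z'; apply/funext => t'; ring.
- move=> x' z' t' _ _ /andP[t'0 t'T]; apply: upper_test_addc.
  apply: (barrier_upper_test l l1 l2 c 0 0 sl c0 lc (lexx 0) range_l1 phi psi rphi hpsi) => //.
    by exists 1 => // dt _; rewrite mul0r.
  move=> s lam lam2; rewrite -l2E mul0r add0r mul0r subr0 addr0 invfM mulrCA mulfV ?mulr1//.
  by case: sl => _ _ /(_ s) /gt_eqF ->.
move=> x' z' t' hx' hz' ht' [[E|E]|[E|E]|E].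
- by apply: low => //; right; rewrite E normrN ger0_norm.
- by apply: low => //; right; rewrite E ger0_norm.
- by apply: low => //; left; rewrite E lerN2.
- by apply: high => //; rewrite E.
- by rewrite E; apply: le_trans (v0 _ _) _; rewrite lerD2l; move: eta0; clear; lra.
Qed.

(** Counterpart of [upper_comparison] for - W. The shrinking adds e l s to the speed of the leaves,
    which makes up for a profile whose second derivative l2 may be smaller than w f''. *)
Lemma lower_comparison (phi psi : R * R -> R) (rphi : regular_norm phi) (hpsi : is_norm psi)
    (l l1 l2 : R -> R) (c a e ap am T M eta : R) (v : R -> R -> R -> R)
    (sl : smooth_profile l l1 l2) (c0 : 0 < c) (lc : forall s, c * (1 + `|s|) <= l s)
    (range_l1 : forall y k : R, (forall s, s * y - l s <= k) -> exists s, l1 s = y)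
    (sr : slope_range l1 ap am) :
  let W := fun x z t => cutoff (1 - dilation l a e x z t) in
  (forall s, weight psi s * slope_curv phi s <= (1 + e / 2 * l s) * l2 s) ->
  0 <= e -> e * T <= a ->
  0 < T -> 0 < eta -> quad_subsolution phi psi v -> slab_continuous T v ->
  (forall x z t : R, 0 <= t <= T -> v x z t <= M) ->
  (forall x z, v x z 0 <= cutoff 2^-1) ->
  (forall x z, v x z 0 <= - W x z 0 + eta) ->
  forall x z t : R, 0 <= t < T -> v x z t <= - W x z t + 3 * eta.
Proof.
move=> W l2E e0 eTa T0 eta0 sv cv vM vh v0; case: (sr) => ap0 am0 _ _ _.
have ta (s : R) : s <= T -> e * s <= a by move=> sT; apply: le_trans eTa; exact: ler_wpM2l.
have a0 : 0 <= a by apply: le_trans eTa; rewrite mulr_ge0// ltW.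
pose Cb : R := `|M| + 4; have Cb0 : 0 <= Cb by rewrite addr_ge0.
have MM := ler_norm M.
have cb : `|cutoff 2^-1 : R| <= 1 := cutoff_bound _.
have [Zl Zl0 HZl] := barrier_low l l1 l2 c a e ap am sl c0 lc e0 sr.
have ea0 : e * 0 <= a by rewrite mulr0.
have [Zh Zh0 HZh] := barrier_ge_asymptote l l1 l2 c a e ap am 0 eta sl c0 lc e0 sr ea0 eta0.
have Hom (ep : R) : 0 < ep -> exists2 C : R, 0 <= C & forall x, `|- asymptote2 a ap am x| <= ep + C * `|- asymptote1 a ap am x|.
  move=> ep0; have [C C0 H] := asymptote_degenerate a ap am ap0 am0 a0 ep ep0.
  by exists C => // x; rewrite !normrN.
have Hl x y : `|- asymptote a ap am x - - asymptote a ap am y| <= (ap^-1 + am^-1) * `|x - y|.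
  by rewrite -opprD normrN; exact: asymptote_lipschitz.
have [r1 r10 F1] := far_field phi psi rphi hpsi _ _ _ _ _ T Cb eta
  (mulr_ge0 (ler0n _ 4) (addr_ge0 (exprn_ge0 3 (ltW (etrans (invr_gt0 _) ap0))) (exprn_ge0 3 (ltW (etrans (invr_gt0 _) am0)))))
  (addr_ge0 (ltW (etrans (invr_gt0 _) ap0)) (ltW (etrans (invr_gt0 _) am0)))
  (C2_jetN _ _ _ _ (asymptote_jet a ap am ap0 am0)) Hl Hom T0 Cb0 eta0.
have [r2 r20 F2] := far_field_cst phi psi rphi hpsi (cutoff 2^-1) T Cb eta T0 Cb0 eta0.
have high x z t : 0 <= t < T -> Zh + r1 <= z -> v x z t <= - W x z t + 3 * eta.
  move=> tT hz; have h1 : v x z t <= - asymptote a ap am x + 2 * eta + eta.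
    apply: F1 => //.
      move=> x' z' _ hz'; apply: le_trans (v0 _ _) _.
      have hz0 : Zh <= z' by move: hz hz'; rewrite ler_norml; clear; lra.
      have := HZh x' z' 0 (_ : 0 <= 0 <= 0); rewrite lexx mulr0 subr0 => /(_ isT hz0).
      by rewrite -/(W x' z' 0); clear; lra.
    move=> x' z' t' /vM/le_trans; apply.
    by have := asymptote_bound a ap am x'; rewrite ler_norml /Cb; move: MM eta0; clear; lra.
  have := barrier_le_asymptote l l1 l2 c a e ap am sl c0 lc e0 sr x z t.
  case/andP: tT => t0 /ltW tT /(_ t0 (ta _ tT)); rewrite -/(W x z t).
  by move: h1; clear; lra.
have low x z t : 0 <= t < T -> z <= - Zl \/ Zl <= `|x| -> v x z t <= - W x z t + 3 * eta.
  move=> tT hz; have h1 : v x z t <= cutoff 2^-1 + 0 + eta.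
    apply: F2 => //; first by move=> x' z' _ _; rewrite addr0.
    move=> x' z' t' /vM/le_trans; apply.
    by move: cb; rewrite ler_norml /Cb; move: MM; clear; lra.
  case/andP: tT => t0 /ltW tT.
  by rewrite /W (HZl x z t)//; [move: h1 eta0; clear; lra|exact: ta].
move=> x z t tT.
pose B := Zl + r1 + Zh + `|x| + `|z|.
have xB : `|x| <= B by rewrite /B; have := normr_ge0 z; move: Zl0 r10 Zh0; clear; lra.
have zB : `|z| <= B by rewrite /B; have := normr_ge0 x; move: Zl0 r10 Zh0; clear; lra.
have B1 : Zl <= B by rewrite /B; have := normr_ge0 x; have := normr_ge0 z; move: Zh0 r10; clear; lra.
have B2 : Zh + r1 <= B by rewrite /B; have := normr_ge0 x; have := normr_ge0 z; move: Zl0; clear; lra.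
have B0 : 0 <= B by apply: le_trans xB.
rewrite ler_norml in xB; rewrite ler_norml in zB.
apply: (@comparison _ phi psi v (fun x z t => - W x z t + 3 * eta) (- B) B (- B) B T) => //.
- apply: slab_continuousD; first by apply: slab_continuousN; exact: (barrier_slab_continuous l c).
  have := slab_continuous_sqr T 0 0 0 0 (3 * eta).
  by congr slab_continuous; apply/funext => x'; apply/funext => z'; apply/funext => t'; ring.
- move=> x' z' t' _ _ /andP[t'0 t'T]; apply: (upper_test_addc _ _ (fun x z t => - W x z t)).
  apply: (barrier_lower_test l l1 l2 c a e sl c0 lc e0 range_l1 phi psi rphi hpsi) => //.
    exists (T - t'); first by rewrite subr_gt0.
    by move=> dt; rewrite ltr_norml => h; apply: ta; move: h; clear; lra.
  move=> s lam lam2.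
  have l20 : 0 < l2 s by case: sl.
  have lam0 : 0 < lam by move: lam2; clear; lra.
  have m0 : lam <= lam + a - e * t' by have := ta _ (ltW t'T); clear; lra.
  have m1 : 0 < lam + a - e * t' by exact: lt_le_trans m0.
  have ls := growth_gt0 l c c0 lc s.
  have el : 0 <= e * l s by rewrite mulr_ge0// ltW.
  rewrite ler_pdivrMr ?mulr_gt0//; apply: le_trans (l2E s) _.
  rewrite mulrA ler_pM2r//.
  (* The leaf size is at least lam and lam > 1/2, so speed times size is at least 1 + e l s / 2;
     hence the factor e / 2 in [l2E]. *)
  have : (e * l s + lam^-1) * lam <= (e * l s + lam^-1) * (lam + a - e * t').
    by rewrite ler_wpM2l// addr_ge0// invr_ge0 ltW.
  apply: le_trans; rewrite mulrDl mulVf ?gt_eqF// addrC lerD2r mulrAC ler_wpM2l//.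
  by move: lam2; clear; lra.
move=> x' z' t' hx' hz' ht' [[E|E]|[E|E]|E].
- by apply: low => //; right; rewrite E normrN ger0_norm.
- by apply: low => //; right; rewrite E ger0_norm.
- by apply: low => //; left; rewrite E lerN2.
- by apply: high => //; rewrite E.
- by rewrite E; apply: le_trans (v0 _ _) _; rewrite lerD2l; move: eta0; clear; lra.
Qed.

End Comparisons.

(** * Stability of the foliation under convergence of the norms *)

Section Convex3.
Context {R : realType}.
Implicit Types (g l : R -> R) (x y z s : R).

(** Convexity without division or derivatives, a form that passes directly to pointwise limits. *)
Definition convex3 g := forall x y z, x <= y <= z ->
  (z - x) * g y <= (z - y) * g x + (y - x) * g z.

Lemma convex3_reflect g : convex3 g -> convex3 (fun s => g (- s)).
Proof.
move=> cg x y z /andP[xy yz]; have := cg (- z) (- y) (- x).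
rewrite !lerN2 xy yz => /(_ isT); lra.
Qed.

Lemma convex3_support g : (forall x, exists a, forall y, g x + a * (y - x) <= g y) -> convex3 g.
Proof.
move=> H x y z /andP[xy yz]; have [b Hb] := H y.
have zy : 0 <= z - y by rewrite subr_ge0.
have yx : 0 <= y - x by rewrite subr_ge0.
by have := ler_wpM2l zy (Hb x); have := ler_wpM2l yx (Hb z); lra.
Qed.

Lemma smooth_profile_convex3 l l1 l2 : smooth_profile l l1 l2 -> convex3 l.
Proof. by move=> sl; apply: convex3_support => x; exists (l1 x) => y; exact: profile_tangent sl _ _. Qed.

Lemma convex3_ray g s y : convex3 g -> 0 < s <= y -> g 0 + y * ((g s - g 0) / s) <= g y.
Proof.
move=> cg /andP[s0 sy]; have := cg 0 s y; rewrite (ltW s0) sy => /(_ isT).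
rewrite mulrA -lerBrDl ler_pdivrMr//; lra.
Qed.

(** S is such that the chord of ell over [0, S] has almost the slope [ap] of ell at infinity. The
    chord of g is then almost as steep, and convexity keeps g above its extension. Since 4 d = ep c,
    the errors, d in value at 0 and 3 d in slope, are covered by ep ell s. *)
Lemma convex3_lower_half (ell : R -> R) (c C ep : R) : 0 < c ->
  (forall s, c * (1 + `|s|) <= ell s) -> convex3 ell ->
  (forall s t, `|ell s - ell t| <= C * `|s - t|) -> 0 < ep ->
  exists S d : R, [/\ 0 < S, 0 < d & forall g, convex3 g ->
    (forall s, `|s| <= S -> `|g s - ell s| <= d) ->
    forall s, 0 <= s -> (1 - ep) * ell s <= g s].
Proof.
move=> c0 lc cl Cl ep0.
pose E : set R := [set r | exists2 s : R, 0 < s & r = (ell s - ell 0) / s].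
have E1 : E ((ell 1 - ell 0) / 1) by exists 1.
have ubE : ubound E C.
  move=> r [s s0 ->]; rewrite ler_pdivrMr//; have := Cl s 0.
  by rewrite subr0 (gtr0_norm s0); apply: le_trans; exact: ler_norm.
have hsE : has_sup E by split; [exists ((ell 1 - ell 0) / 1)|exists C].
pose ap := sup E.
have apU s : 0 < s -> ell s <= ell 0 + ap * s.
  move=> s0; rewrite -lerBlDl -ler_pdivrMr//; apply: ub_le_sup; first by exists C.
  by exists s.
pose d := ep * c / 4; have d0 : 0 < d by rewrite divr_gt0// mulr_gt0.
have [r [s1 s10 ->] rap] := sup_adherent d0 hsE.
rewrite -/ap in rap.
pose S := s1 + 1; have S1 : 1 <= S by rewrite lerDr ltW.
have S0 : 0 < S by exact: lt_le_trans S1.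
have slS : ap - d <= (ell S - ell 0) / S.
  apply: le_trans (ltW rap) _; have := convex3_ray ell s1 S cl.
  rewrite s10 lerDl ler01 => /(_ isT) h; rewrite ler_pdivlMr//; move: h; clear; lra.
exists S, d; split => // g cg Hg s s0.
have [sS|sS] := leP s S.
  have := Hg s; rewrite ger0_norm// => /(_ sS); rewrite ler_norml => /andP[h _].
  have h1 := lc s; have h2 : 0 <= c * `|s| by rewrite mulr_ge0// ltW.
  have h3 : c * 1 <= ell s by move: h1 h2; clear; lra.
  have h4 := ler_wpM2l (ltW ep0) h3; rewrite mulr1 in h4.
  have h5 : 0 < ep * c by rewrite mulr_gt0.
  by move: h h4 h5; rewrite /d; clear; lra.
have ray := convex3_ray g S s cg; rewrite S0 (ltW sS) in ray; have {}ray := ray isT.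
have gS := Hg S; rewrite gtr0_norm// lexx in gS; have {}gS := gS isT.
have g0 := Hg 0; rewrite normr0 (ltW S0) in g0; have {}g0 := g0 isT.
rewrite ler_norml in gS; rewrite ler_norml in g0.
have gsl : ap - 3 * d <= (g S - g 0) / S.
  rewrite ler_pdivlMr//; move: slS; rewrite ler_pdivlMr//.
  have dS : d * 1 <= d * S by rewrite ler_wpM2l// ltW.
  move: gS g0 dS; clear; lra.
have sg := ler_wpM2l s0 gsl.
have h1 := apU s (lt_trans S0 sS).
have h2 := ler_wpM2l (ltW ep0) (lc s); rewrite ger0_norm// in h2.
have dE : 4 * d = ep * c by rewrite /d; field.
have h3 : ep * (c * (1 + s)) = 4 * d * (1 + s) by rewrite dE mulrA.
have ds : 0 <= d * s by rewrite mulr_ge0// ltW.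
by move: ray g0 sg h1 h2 ds d0; rewrite h3; clear; lra.
Qed.

(** Two half-lines glued by reflection. The bound is one-sided by nature: beyond S a convex g may
    grow much faster than ell. *)
Lemma convex3_lower (ell : R -> R) (c C ep : R) : 0 < c ->
  (forall s, c * (1 + `|s|) <= ell s) -> convex3 ell ->
  (forall s t, `|ell s - ell t| <= C * `|s - t|) -> 0 < ep ->
  exists S d : R, [/\ 0 < S, 0 < d & forall g, convex3 g ->
    (forall s, `|s| <= S -> `|g s - ell s| <= d) ->
    forall s, (1 - ep) * ell s <= g s].
Proof.
move=> c0 lc cl Cl ep0.
have [S1 [d1 [S10 d10 H1]]] := convex3_lower_half ell c C ep c0 lc cl Cl ep0.
have [S2 [d2 [S20 d20 H2]]] : exists S d : R, [/\ 0 < S, 0 < d & forall g, convex3 g ->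
    (forall s, `|s| <= S -> `|g s - ell (- s)| <= d) ->
    forall s, 0 <= s -> (1 - ep) * ell (- s) <= g s].
  apply: (convex3_lower_half (fun s => ell (- s)) c C ep) => //.
  - by move=> s; rewrite -(normrN s).
  - exact: convex3_reflect.
  - by move=> s t; apply: le_trans (Cl _ _) _; rewrite -opprD normrN.
exists (Num.max S1 S2), (Num.min d1 d2); split; rewrite ?lt_max ?S10 ?lt_min ?d10//.
move=> g cg Hg s; have [s0|s0] := leP 0 s.
  apply: H1 => // t tS; have := Hg t; rewrite le_max tS => /(_ isT).
  by rewrite le_min => /andP[].
rewrite -(opprK s); apply: (H2 (fun s => g (- s))) => //.
- exact: convex3_reflect.
- move=> t tS; have := Hg (- t); rewrite normrN le_max tS orbT => /(_ isT).
  by rewrite le_min => /andP[].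
- by rewrite oppr_ge0 ltW.
Qed.

End Convex3.

Section DilationCompare.
Context {R : realType}.

(* Beyond 3/2 both barriers have reached the bottom value of the cutoff. *)
Lemma barrier_compare (l l' : R -> R) (c c' a e a' e' eta x z t : R) : 0 < c -> 0 < c' ->
  (forall s, c * (1 + `|s|) <= l s) -> (forall s, c' * (1 + `|s|) <= l' s) ->
  0 <= e -> 0 <= e' -> 0 <= t -> e * t <= a -> e' * t <= a' -> 0 <= eta ->
  (forall lam : R, 2^-1 <= lam <= 3 / 2 -> in_dilate l x z (t / lam) (lam + a - e * t) ->
    in_dilate l' x z (t / (lam + eta)) (lam + eta + a' - e' * t)) ->
  cutoff (1 - dilation l a e x z t) <= cutoff (1 - dilation l' a' e' x z t) + eta.
Proof.
move=> c0 c'0 lc lc' e0 e'0 t0 ta ta' eta0 H.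
have lam2 := dilation_ge l c a e c0 lc x z t t0 ta.
have P := in_dilation l c a e c0 lc x z t t0 ta.
move: lam2 P; set k := dilation l a e x z t => lam2 P.
have [k3|k3] := leP k (3 / 2).
  have k' : 2^-1 <= k + eta by apply: le_trans lam2 _; rewrite lerDl.
  have : dilation l' a' e' x z t <= k + eta.
    apply/(dilation_leP l' c' a' e' c'0 lc') => //.
    by apply: H => //; rewrite lam2 k3.
  move=> h; have : cutoff (1 - k - eta) <= cutoff (1 - dilation l' a' e' x z t).
    by apply: cutoff_mono; move: h; clear; lra.
  have := cutoff_lipschitz (1 - k - eta) (1 - k).
  rewrite (_ : 1 - k - eta - (1 - k) = - eta); last by ring.
  rewrite normrN (ger0_norm eta0).
  by rewrite ler_norml; clear; lra.
rewrite (cutoff_lo (1 - k)); last by move: k3; clear; lra.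
have := cutoff_le (- (1 - dilation l' a' e' x z t)); rewrite cutoffN.
by move: eta0; clear; lra.
Qed.

Lemma in_dilate_scale (l l' : R -> R) (m m' x z k k' : R) : 0 <= m -> k' <= k ->
  (forall s, m * l s <= m' * l' s) -> in_dilate l x z k m -> in_dilate l' x z k' m'.
Proof. by move=> m0 kk H P s; apply: le_trans (H s); apply: le_trans (P s); rewrite lerD2l. Qed.

(** Beyond S only the constraint of l at S is used: multiplied by s / S it bounds s x, while
    convexity bounds ell s from below by the ray through its values at 0 and S. The constants,
    including z, are absorbed by eta c S, which is why z must be bounded. *)
Lemma in_dilate_local_half (l ell : R -> R) (c C S d eta x z k k' m : R) : 0 < c ->
  (forall s, c * (1 + `|s|) <= ell s) -> convex3 ell -> 1 <= S -> 0 < d -> 0 <= m ->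
  (forall s, `|s| <= S -> `|l s - ell s| <= d) -> `|z| <= C -> 0 <= k' <= k ->
  m * d <= eta * c -> m * d + 2 * C + m * ell 0 <= eta * c * S -> 0 <= eta ->
  in_dilate l x z k m -> forall s, 0 <= s -> s * x - z + k' <= (m + eta) * ell s.
Proof.
move=> c0 lc cl S1 d0 m0 Hl zC /andP[k'0 kk] md mS eta0 P s s0.
have S0 : 0 < S by exact: lt_le_trans S1.
have ec := ler_wpM2l eta0 (lc s); rewrite (ger0_norm s0) in ec.
have es : 0 <= eta * c * s by rewrite !mulr_ge0// ltW.
have [sS|sS] := leP s S.
  have := Hl s; rewrite ger0_norm// => /(_ sS); rewrite ler_norml => /andP[_ h].
  have h2 := ler_wpM2l m0 h; have := P s.
  by move: ec es h2 md kk; clear; lra.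
have hS := Hl S; rewrite gtr0_norm// lexx ler_norml in hS; have /andP[_ {}hS] := hS isT.
have hm := ler_wpM2l m0 hS.
have PS := P S; have ray := convex3_ray ell S s cl; rewrite S0 (ltW sS) in ray; have {}ray := ray isT.
rewrite ler_norml in zC.
have xS : S * x <= m * ell S + m * d + C - k by move: PS hm zC; clear; lra.
have sx : s * x <= s / S * (m * ell S + m * d + C - k).
  have -> : s * x = s / S * (S * x) by field; rewrite gt_eqF.
  by rewrite ler_wpM2l// divr_ge0// ltW.
have rm := ler_wpM2l m0 ray.
have E : m * (s * ((ell S - ell 0) / S)) = s / S * (m * ell S) - s / S * (m * ell 0) by field; rewrite gt_eqF.
have ss : 1 <= s / S by rewrite ler_pdivlMr// mul1r ltW.
have s2 : s / S * (m * d + 2 * C + m * ell 0) <= eta * c * s.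
  have -> : eta * c * s = s / S * (eta * c * S) by field; rewrite gt_eqF.
  by rewrite ler_wpM2l// divr_ge0// ltW.
have C0 : 0 <= C by move: zC; clear; lra.
have sC : 1 * C <= s / S * C by rewrite ler_wpM2r.
have sk : 1 * k <= s / S * k by rewrite ler_wpM2r//; move: k'0 kk; clear; lra.
have l00 : 0 <= m * ell 0 by apply: mulr_ge0 => //; apply: ltW; exact: growth_gt0 lc 0.
have ec0 : 0 <= eta * c by rewrite mulr_ge0// ltW.
move: sx rm s2 sC sk ec zC kk l00 ec0; rewrite !mulrDr E.
clear; lra.
Qed.

Lemma in_dilate_local (l ell : R -> R) (c C S d eta x z k k' m : R) : 0 < c ->
  (forall s, c * (1 + `|s|) <= ell s) -> convex3 ell -> 1 <= S -> 0 < d -> 0 <= m ->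
  (forall s, `|s| <= S -> `|l s - ell s| <= d) -> `|z| <= C -> 0 <= k' <= k ->
  m * d <= eta * c -> m * d + 2 * C + m * ell 0 <= eta * c * S -> 0 <= eta ->
  in_dilate l x z k m -> in_dilate ell x z k' (m + eta).
Proof.
move=> c0 lc cl S1 d0 m0 Hl zC kk md mS eta0 P s; have [s0|s0] := leP 0 s.
  exact: (in_dilate_local_half l ell c C S d eta x z k k' m).
have := in_dilate_local_half (fun s => l (- s)) (fun s => ell (- s)) c C S d eta (- x) z k k' m c0
  _ _ S1 d0 m0 _ zC kk md _ eta0 _ (- s).
rewrite opprK mulrNN oppr0; apply => //.
- by move=> u; rewrite -(normrN u).
- exact: convex3_reflect.
- by move=> u; rewrite -(normrN u); exact: Hl.
- by move=> u; have := P (- u); rewrite mulNr mulrN.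
- by rewrite oppr_ge0 ltW.
Qed.

End DilationCompare.

(** * Range of the slopes of a profile *)

Section SlopeRange.
Context {R : realType}.
Implicit Types (l : R -> R).

Lemma smooth_profile_reflect l l1 l2 : smooth_profile l l1 l2 ->
  smooth_profile (fun s => l (- s)) (fun s => - l1 (- s)) (fun s => l2 (- s)).
Proof.
case=> d1 d2 p.
have dN (s : R) : is_derive s 1 (fun y : R => - y) (-1) by apply: is_derive_oppf; exact: is_derive_idf.
split => // s.
  by apply: is_derive_eqf (is_derive_compf l _ s _ _ (d1 _) (dN s)); rewrite mulrN1.
apply: is_derive_eqf (is_derive_oppf _ s _ (is_derive_compf l1 _ s _ _ (d2 _) (dN s))).
by rewrite mulrN1 opprK.
Qed.

Lemma slope_range_exists l l1 l2 (c B : R) : smooth_profile l l1 l2 -> 0 < c ->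
  (forall s, c * (1 + `|s|) <= l s) -> (forall s, `|l1 s| <= B) ->
  exists ap am, slope_range l1 ap am.
Proof.
move=> sl c0 lc HB.
have half l' l1' l2' : smooth_profile l' l1' l2' -> (forall s, c * (1 + `|s|) <= l' s) ->
    (forall s, `|l1' s| <= B) -> exists ap : R, [/\ 0 < ap, forall s, l1' s <= ap &
    forall ep, 0 < ep -> exists s, ap * (1 - ep) <= l1' s].
  move=> sl' lc' HB'; have hs : has_sup (range l1').
    by split; [exists (l1' 0), 0|exists B => _ [s _ <-]; have := HB' s; rewrite ler_norml => /andP[]].
  have ub s : l1' s <= sup (range l1') by apply: ub_le_sup; [case: hs|exists s].
  have ap0 : 0 < sup (range l1').
    have l0 := growth_gt0 l' c c0 lc' 0.
    pose s := (l' 0 + 1) / c; have s0 : 0 < s by rewrite divr_gt0// addr_gt0.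
    have T := profile_tangent l' l1' l2' sl' s 0.
    have cs : c * s = l' 0 + 1 by rewrite /s mulrCA divff ?mulr1// gt_eqF.
    have := lc' s; rewrite gtr0_norm// => h.
    have : 0 < l1' s * s by move: T cs h c0; clear; lra.
    by rewrite pmulr_lgt0// => /lt_le_trans; apply.
  exists (sup (range l1')); split => // ep ep0.
  have [_ [s _ <-] h] := sup_adherent (mulr_gt0 ap0 ep0) hs.
  by exists s; move: h; clear; lra.
have [ap [ap0 Hap ap1]] := half l l1 l2 sl lc HB.
have [am [am0 Ham am1]] : exists ap : R, [/\ 0 < ap, forall s, - l1 (- s) <= ap &
    forall ep, 0 < ep -> exists s, ap * (1 - ep) <= - l1 (- s)].
  apply: (half (fun s => l (- s)) (fun s => - l1 (- s)) (fun s => l2 (- s))).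
  - exact: smooth_profile_reflect.
  - by move=> s; rewrite -(normrN s).
  - by move=> s; rewrite normrN.
exists ap, am; split => //.
- by move=> s; rewrite Hap andbT lerNl; have := Ham (- s); rewrite opprK.
- by move=> ep /am1[s h]; exists (- s); rewrite lerNr.
Qed.

(** The lower bound on the derivative integrates to (k / 2) ln (1 + s^2), which is unbounded; an
    exponential witness makes the logarithm explicit. *)
Lemma log_growth (g : R -> R) (g' : R -> R) (k : R) : 0 < k ->
  (forall s : R, is_derive s 1 g (g' s)) -> (forall s : R, 0 <= s -> k * s / (1 + s ^+ 2) <= g' s) ->
  forall K : R, exists2 s : R, 0 <= s & K < g s.
Proof.
move=> k0 dg Hg K.
pose h s := g s - k / 2 * ln (1 + s ^+ 2).
have dh (s : R) : is_derive s 1 h (g' s - k / 2 * ((1 + s ^+ 2)^-1 * (2 * s))).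
  apply: is_derive_subf (dg s) _; apply: is_derive_scalef.
  have dq : is_derive s 1 (fun y : R => 1 + y ^+ 2) (2 * s).
    apply: is_derive_eqf (is_derive_addf _ _ s _ _ (is_derive_cstf 1 s)
      (is_derive_mulf _ _ s _ _ (is_derive_idf s) (is_derive_idf s))).
    by ring.
  have dl : is_derive (1 + s ^+ 2) 1 (@ln R) (1 + s ^+ 2)^-1.
    by apply: is_derive1_ln; rewrite ltr_pwDl// sqr_ge0.
  exact: (is_derive_compf _ (fun y : R => 1 + y ^+ 2) s _ _ dl dq).
pose r : R := (`|K| + `|g 0| + 1) / k.
exists (expR r); first exact: expR_ge0.
have : h 0 <= h (expR r).
  apply: (derive_ge0_le _ _ _ _ (expR_ge0 r) (fun s _ => dh s)) => s /andP[s0 _].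
  rewrite subr_ge0; apply: le_trans (Hg s s0).
  by rewrite le_eqVlt; apply/orP; left; apply/eqP; field; rewrite gt_eqF// ltr_pwDl// sqr_ge0.
rewrite /h expr0n addr0 ln1 mulr0 subr0.
have lnr : 2 * r <= ln (1 + expR r ^+ 2).
  have p1 : 0 < 1 + expR r ^+ 2 by rewrite ltr_pwDl// sqr_ge0.
  rewrite -(expRK (2 * r)) ler_ln ?posrE ?expR_gt0//.
  by rewrite expr2 -expRD (_ : r + r = 2 * r) ?lerDr//; ring.
have k2 : 0 <= k / 2 by rewrite divr_ge0// ltW.
have := ler_wpM2l k2 lnr.
have -> : k / 2 * (2 * r) = `|K| + `|g 0| + 1 by rewrite /r; field; rewrite gt_eqF.
have := ler_norm K; have := ler_norm (- g 0); rewrite normrN; clear; lra.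
Qed.

(** If l1 stayed below y, then s l1 s - l s, with derivative s l2 s >= k s / (1 + s^2), would be
    unbounded for s >= 0, although s y - l s <= K. So y lies between two values of l1. Consequently
    the supremum in the Legendre transform is attained wherever it is finite. *)
Lemma profile_slope_range l l1 l2 (k : R) : smooth_profile l l1 l2 -> 0 < k ->
  (forall s, k / (1 + s ^+ 2) <= l2 s) ->
  forall y K : R, (forall s, s * y - l s <= K) -> exists s, l1 s = y.
Proof.
move=> sl k0 Hl y K HK.
have half l' l1' l2' (y' : R) : smooth_profile l' l1' l2' -> (forall s, k / (1 + s ^+ 2) <= l2' s) ->
    (forall s, s * y' - l' s <= K) -> exists s, y' < l1' s.
  move=> sl' Hl' HK'; apply: contrapT => /forallNP H.
  have yl s : l1' s <= y' by rewrite leNgt; apply/negP.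
  case: (sl') => d1 d2 p2.
  have dg (s : R) : is_derive s 1 (fun s => s * l1' s - l' s) (s * l2' s).
    apply: is_derive_eqf (is_derive_subf _ _ s _ _ (is_derive_mulf _ _ s _ _ (is_derive_idf s) (d2 s)) (d1 s)).
    by ring.
  have [|s s0] := log_growth _ _ k k0 dg _ K.
    by move=> s s0; rewrite -mulrA mulrCA ler_wpM2l// -mulrA.
  by have := ler_wpM2l s0 (yl s); have := HK' s; clear; lra.
have [s1 h1] := half l l1 l2 y sl Hl HK.
have [s2 h2] : exists s, - y < - l1 (- s).
  apply: (half (fun s => l (- s)) (fun s => - l1 (- s)) (fun s => l2 (- s))).
  - exact: smooth_profile_reflect.
  - by move=> s; rewrite -(sqrrN s).
  - by move=> s; have := HK (- s); rewrite mulNr mulrN.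
rewrite ltrN2 in h2.
case: (sl) => _ d2 _.
have ss : - s2 <= s1.
  rewrite leNgt; apply/negP => /(profile_slope_lt l l1 l2 sl _ _).
  by move: h1 h2; clear; lra.
have := @IVT R l1 (- s2) s1 y ss.
have cl : {within `[- s2, s1], continuous l1}.
  by apply: continuous_subspaceT => x; exact: is_derive1_continuous (d2 x).
move=> /(_ cl); rewrite ge_min (ltW h2) le_max (ltW h1) orbT => /(_ isT)[s _ <-].
by exists s.
Qed.

End SlopeRange.

(** * Damped profiles *)

Section Damping.
Context {R : realType}.
Implicit Types (l m : R -> R) (s : R).

(* Curvature may escape to infinite slopes along L_n and be lost in the limit.
   Damping it beyond |s| = r brings the profile close to the limit one; this
   costs a factor 1 + e |s|, compensated by letting the leaves shrink. *)
Definition damp (e r s : R) : R := (1 + e * Num.min `|s| r)^-1.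

Lemma damp_bounds (e r s : R) : 0 <= e -> 0 <= r ->
  [/\ 0 < damp e r s, (1 + e * r)^-1 <= damp e r s, damp e r s <= 1 & 1 - damp e r s <= e * `|s|].
Proof.
move=> e0 r0; have m0 : 0 <= Num.min `|s| r by rewrite le_min normr_ge0.
have m1 : Num.min `|s| r <= `|s| by rewrite ge_min lexx.
have m2 : Num.min `|s| r <= r by rewrite ge_min lexx orbT.
rewrite /damp; move: (Num.min _ _) m0 m1 m2 => x x0 xs xr.
have ex : 0 <= e * x by rewrite mulr_ge0.
have exr : e * x <= e * r by rewrite ler_wpM2l.
have exs : e * x <= e * `|s| by rewrite ler_wpM2l.
have p : 0 < 1 + e * x by rewrite ltr_pwDl.
have i0 : 0 < (1 + e * x)^-1 by rewrite invr_gt0.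
have i1 : (1 + e * x)^-1 <= 1 by rewrite invf_le1// lerDl.
split => //.
  by rewrite lef_pV2 ?posrE// ?lerD2l// (lt_le_trans p)// lerD2l.
have : (1 + e * x)^-1 * (1 + e * x) = 1 by rewrite mulVf// gt_eqF.
have : e * x * (1 + e * x)^-1 <= e * x * 1 by rewrite ler_wpM2l.
by move: exs; clear; lra.
Qed.

Lemma damp_tail (e r s : R) : r <= `|s| -> damp e r s = (1 + e * r)^-1.
Proof. by move=> h; rewrite /damp; congr (_ + _ * _)^-1; apply/min_idPr. Qed.

Lemma damp_reflect (e r s : R) : damp e r (- s) = damp e r s.
Proof. by rewrite /damp normrN. Qed.

Lemma damp_continuous (e r : R) : 0 <= e -> 0 <= r -> continuous (damp e r).
Proof.
move=> e0 r0 s; apply: (@continuousV _ _ (fun s => 1 + e * Num.min `|s| r)).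
  by rewrite gt_eqF// ltr_pwDl// mulr_ge0// le_min normr_ge0.
apply: continuousD; first exact: cst_continuous.
apply: continuousM; first exact: cst_continuous.
by apply: continuous_min; [exact: norm_continuous|exact: cst_continuous].
Qed.

Lemma damped_profile l l1 l2 (e r : R) : smooth_profile l l1 l2 -> continuous l2 -> 0 <= e -> 0 <= r ->
  exists m m1, smooth_profile m m1 (fun s => damp e r s * l2 s) /\ m 0 = l 0 /\ m1 0 = l1 0.
Proof.
move=> [_ _ p2] c2 e0 r0.
have cd : continuous (fun s => damp e r s * l2 s).
  by move=> s; apply: continuousM; [exact: damp_continuous|exact: c2].
have [H1 [H10 dH1]] := antiderivative _ cd.
have dm1 (s : R) : is_derive s 1 (fun s => l1 0 + H1 s) (damp e r s * l2 s).
  by apply: is_derive_eqf (is_derive_addf _ _ s _ _ (is_derive_cstf (l1 0) s) (dH1 s)); rewrite add0r.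
have cm1 : continuous (fun s => l1 0 + H1 s) by move=> s; exact: is_derive1_continuous (dm1 s).
have [H [H0 dH]] := antiderivative _ cm1.
exists (fun s => l 0 + H s), (fun s => l1 0 + H1 s); split.
  split => //.
    by move=> s; apply: is_derive_eqf (is_derive_addf _ _ s _ _ (is_derive_cstf (l 0) s) (dH s)); rewrite add0r.
  by move=> s; rewrite mulr_gt0//; have [] := damp_bounds e r s e0 r0.
by rewrite H0 H10 !addr0.
Qed.

(** As 1 - damp <= e |s|, the slope loses at most e s C on [0, s]. Beyond r the damping factor is
    constant, so m1 gains at most that fraction of the total variation C of l1. *)
Lemma damped_profile_half l l1 l2 m m1 (e r C : R) : smooth_profile l l1 l2 ->
  smooth_profile m m1 (fun s => damp e r s * l2 s) -> m 0 = l 0 -> m1 0 = l1 0 -> 0 <= e -> 0 < r ->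
  (forall s t, `|l1 s - l1 t| <= C) ->
  forall s, 0 <= s -> [/\ m1 s <= l1 s, m s <= l s, l s - m s <= e * s ^+ 2 * C &
    r <= s -> m1 s <= m1 r + (1 + e * r)^-1 * C].
Proof.
move=> [dl dl1 l20] [dm dm1 _] m0 m10 e0 r0 HC s s0.
have C0 : 0 <= C by apply: le_trans (HC 0 0).
have B t := damp_bounds e r t e0 (ltW r0).
have d1 (t : R) : 0 <= t -> m1 t <= l1 t.
  move=> t0; have := derive_ge0_le (fun s => l1 s - m1 s) (fun s => l2 s - damp e r s * l2 s) 0 t t0
    (fun x _ => is_derive_subf _ _ x _ _ (dl1 x) (dm1 x)).
  rewrite m10 subrr subr_ge0; apply.
  move=> x _; have [_ _ h _] := B x.
  by rewrite -[X in X - _]mul1r -mulrBl mulr_ge0 ?subr_ge0// ltW.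
have d2 (t : R) : 0 <= t <= s -> l1 t - m1 t <= e * s * C.
  move=> /andP[t0 ts].
  have := derive_ge0_le (fun x => e * s * l1 x - (l1 x - m1 x)) (fun x => e * s * l2 x - (l2 x - damp e r x * l2 x)) 0 t t0.
  have dd (x : R) : 0 <= x <= t -> is_derive x 1 (fun x => e * s * l1 x - (l1 x - m1 x)) (e * s * l2 x - (l2 x - damp e r x * l2 x)).
    move=> _; exact: (is_derive_subf _ _ x _ _ (is_derive_scalef _ _ x _ (dl1 x)) (is_derive_subf _ _ x _ _ (dl1 x) (dm1 x))).
  move=> /(_ dd) h; have {}h : e * s * l1 0 - (l1 0 - m1 0) <= e * s * l1 t - (l1 t - m1 t).
    apply: h => x /andP[x0 xt]; have [_ _ _ h] := B x.
    have es : e * `|x| <= e * s by rewrite ler_wpM2l// ger0_norm// (le_trans xt).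
    have := ler_wpM2r (ltW (l20 x)) (le_trans h es); clear; lra.
  have := ler_wpM2l (mulr_ge0 e0 s0) (le_trans (ler_norm _) (HC t 0)).
  by move: h; rewrite m10; clear; lra.
split; first exact: d1.
- have := derive_ge0_le (fun s => l s - m s) (fun s => l1 s - m1 s) 0 s s0
    (fun x _ => is_derive_subf _ _ x _ _ (dl x) (dm x)).
  rewrite m0 subrr subr_ge0; apply.
  by move=> x /andP[x0 _]; rewrite subr_ge0; exact: d1.
- have [x xs] := MVT_le (fun s => l s - m s) (fun s => l1 s - m1 s) 0 s s0 (fun x _ => is_derive_subf _ _ x _ _ (dl x) (dm x)).
  rewrite m0 subrr !subr0 => ->.
  have := ler_wpM2r s0 (d2 x xs).
  by rewrite expr2; clear; lra.
move=> rs; set k := (1 + e * r)^-1.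
have k0 : 0 <= k by rewrite invr_ge0 addr_ge0// mulr_ge0// ltW.
have h : k * l1 r - m1 r <= k * l1 s - m1 s.
  apply: (derive_ge0_le (fun x => k * l1 x - m1 x) (fun x => k * l2 x - damp e r x * l2 x) r s rs
    (fun x _ => is_derive_subf _ _ x _ _ (is_derive_scalef k _ x _ (dl1 x)) (dm1 x))).
  move=> x /andP[rx _]; rewrite damp_tail ?subrr//.
  by rewrite ger0_norm// (le_trans (ltW r0)).
have := ler_wpM2l k0 (le_trans (ler_norm _) (HC s r)).
by move: h; clear; lra.
Qed.

(** Up to r + 1 the bound is inherited from l. Beyond, the slope of m is at most the chord slope of
    ell over [r, r + 1] plus 2 d + (1 + e r)^-1 C, and by convexity ell continues at least as
    steeply. *)
Lemma damped_profile_le_half l l1 l2 m m1 (ell : R -> R) (e r C d : R) : smooth_profile l l1 l2 ->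
  smooth_profile m m1 (fun s => damp e r s * l2 s) -> m 0 = l 0 -> m1 0 = l1 0 -> 0 <= e -> 0 < r ->
  (forall s t, `|l1 s - l1 t| <= C) -> convex3 ell -> 0 <= d ->
  (forall s, `|s| <= r + 1 -> `|l s - ell s| <= d) ->
  forall s, 0 <= s -> m s <= ell s + d + (2 * d + (1 + e * r)^-1 * C) * s.
Proof.
move=> sl sm m0 m10 e0 r0 HC cl d0 Hl s s0.
have C0 : 0 <= C by apply: le_trans (HC 0 0).
have H t := damped_profile_half l l1 l2 m m1 e r C sl sm m0 m10 e0 r0 HC t.
set k := (1 + e * r)^-1 in H *.
have k0 : 0 <= k by rewrite invr_ge0 addr_ge0// mulr_ge0// ltW.
have q0 : 0 <= (2 * d + k * C) * s by rewrite mulr_ge0// addr_ge0// mulr_ge0.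
have [sr|rs] := leP s (r + 1).
  have [_ h _ _] := H s s0; have := Hl s; rewrite ger0_norm// => /(_ sr).
  by rewrite ler_norml => /andP[_ h']; move: h h' q0; clear; lra.
have r1 : 0 <= r + 1 by rewrite addr_ge0// ltW.
have rs' : r <= s by move: rs; clear; lra.
have [_ _ _ /(_ rs') m1s] := H s s0.
have [m1r mr _ _] := H r (ltW r0).
have T := profile_tangent _ _ _ sm s r.
have T' := profile_tangent _ _ _ sl r (r + 1).
have h1 := Hl (r + 1); rewrite ger0_norm// lexx ler_norml in h1; have /andP[_ {}h1] := h1 isT.
have h0 := Hl r; rewrite gtr0_norm// lerDl ler01 ler_norml in h0; have /andP[h0a h0b] := h0 isT.
have cv := cl r (r + 1) s; rewrite lerDl ler01 (ltW rs) in cv; have {}cv := cv isT.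
have sr0 : 0 <= s - r by rewrite subr_ge0.
have slope : m1 s <= ell (r + 1) - ell r + (2 * d + k * C) by move: m1s m1r T' h1 h0a; clear; lra.
have := ler_wpM2l sr0 slope.
have : 0 <= (2 * d + k * C) * r by rewrite mulr_ge0 ?addr_ge0 ?mulr_ge0// ltW.
move: T cv mr h0b d0; clear; lra.
Qed.

End Damping.

Section ViscosityBounds.
Context {R : realType}.

Lemma unif_continuous_slab (V : R * R * R -> R) (T : R) : 0 < T ->
  unif_continuous_in_finite_time V -> slab_continuous T (fun x z t => V ((x, z), t)).
Proof.
move=> T0 uV x z t e tT e0; have [d d0 H] := uV T e T0 e0.
exists d => // x' z' t' tT' h1 h2 h3; apply: H => //.
by rewrite norm3_lt /= h1 h2 h3.
Qed.

(** Uniform continuity with tolerance 1 lets |V| grow by at most 1 per time step of length d / 2;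
    finitely many steps cover [0, T]. *)
Lemma unif_continuous_bounded (V : R * R * R -> R) (T : R) : 0 < T ->
  unif_continuous_in_finite_time V -> (forall p, `|V (p, 0)| <= 1) ->
  exists M : R, forall p t, 0 <= t <= T -> `|V (p, t)| <= M.
Proof.
move=> T0 uV V0; have [d d0 H] := uV T 1 T0 ltr01.
have d2 : 0 < d / 2 by rewrite divr_gt0.
have key n p (t : R) : 0 <= t <= T -> t <= n%:R * (d / 2) -> `|V (p, t)| <= 1 + n%:R.
  elim: n t => [|n IH] t /andP[t0 tT] tn.
    have -> : t = 0 by apply/eqP; rewrite eq_le t0 andbT (le_trans tn)// mul0r.
    by rewrite addr0.
  rewrite -natr1 mulrDl mul1r in tn.
  pose t' := Num.max 0 (t - d / 2).
  have t'0 : 0 <= t' by rewrite le_max lexx.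
  have t't : t' <= t by rewrite ge_max t0 lerBlDr lerDl ltW.
  have tt' : t - d / 2 <= t' by rewrite le_max lexx orbT.
  have h1 : `|V (p, t')| <= 1 + n%:R.
    apply: IH; first by rewrite t'0 (le_trans t't).
    by rewrite ge_max mulr_ge0 ?ler0n ?(ltW d2)//= lerBlDr.
  have h2 : `|V (p, t) - V (p, t')| < 1.
    apply: H; rewrite /= ?t0 ?tT ?t'0 ?(le_trans t't)//.
    rewrite norm3_lt /= !subrr normr0 d0 /= ger0_norm ?subr_ge0//.
    by move: tt' d2; clear; lra.
  have -> : V (p, t) = V (p, t') + (V (p, t) - V (p, t')) by rewrite addrC subrK.
  apply: le_trans (ler_normD _ _) _; rewrite -natr1 addrA.
  by apply: lerD => //; exact: ltW.
pose n := Num.truncn (T / (d / 2)).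
exists (1 + n.+1%:R) => p t tT; apply: key => //.
rewrite -ler_pdivrMr//; apply: (@le_trans _ _ (T / (d / 2))).
  by rewrite ler_wpM2r ?invr_ge0 ?(ltW d2)//; case/andP: tT.
exact/ltW/truncnS_gt.
Qed.

Lemma quad_subsolution_shift (phi psi : R * R -> R) (v : R -> R -> R -> R) (al h : R) :
  quad_subsolution phi psi v -> quad_subsolution phi psi (fun x z t => v (x + al) (z + h) t).
Proof.
move=> sv x z t tau p1 p2 a b c C B d t0 d0 H.
apply: (sv (x + al) (z + h) t tau p1 p2 a b c C B d t0 d0) => dx dz dt h1 h2 h3.
by have := H dx dz dt h1 h2 h3; rewrite !(addrAC _ _ al) !(addrAC _ _ h).
Qed.

Lemma slab_continuous_shift (T : R) (v : R -> R -> R -> R) (al h : R) :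
  slab_continuous T v -> slab_continuous T (fun x z t => v (x + al) (z + h) t).
Proof.
move=> cv x z t e tT e0; have [d d0 H] := cv (x + al) (z + h) t e tT e0.
exists d => // x' z' t' tT' h1 h2 h3; apply: H => //.
  by rewrite (_ : x' + al - (x + al) = x' - x)//; ring.
by rewrite (_ : z' + h - (z + h) = z' - z)//; ring.
Qed.

End ViscosityBounds.

Lemma slope_curv_lower {R : realType} (phi psi : R * R -> R) : regular_norm phi -> is_norm psi ->
  exists2 k : R, 0 < k & forall s, k / (1 + s ^+ 2) <= weight psi s * slope_curv phi s.
Proof.
move=> rphi hpsi; have [c [C [c0 _ H]]] := mobility_curv_bounds phi rphi psi hpsi.
exists c => // s; rewrite slope_curvE// ler_wpM2r ?invr_ge0 ?addr_ge0 ?sqr_ge0//.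
by have /andP[] := H _ (slope_neq0 s).
Qed.

(** S and d are fixed before phi, hence serve all n at once. The upper barrier needs l >= (1 - ep)
    ell globally at time 0, which convexity gives; the way back from l to ell is local, for |z| <=
    X. The lower barrier needs an upper bound on its profile globally, hence the damped profile m.
    Of the four [et], three come from the comparison and one from the passage to ell. *)
Lemma stability {R : realType} (psi : R * R -> R) (ell : R -> R) (c C T X eta : R) :
  is_norm psi -> 0 < c -> (forall s, c * (1 + `|s|) <= ell s) -> convex3 ell ->
  (forall s t, `|ell s - ell t| <= C * `|s - t|) -> 0 < T -> 0 < eta ->
  exists S d : R, [/\ 0 < S, 0 < d & forall phi l l1 l2 v (M : R), regular_norm phi ->
    smooth_profile l l1 l2 -> (forall s, l2 s = weight psi s * slope_curv phi s) ->
    (forall s t, `|l1 s - l1 t| <= C) -> (forall s, `|s| <= S -> `|l s - ell s| <= d) ->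
    quad_subsolution phi psi v -> quad_subsolution phi psi (fun x z t => - v x z t) ->
    slab_continuous T v -> (forall x z t : R, 0 <= t <= T -> `|v x z t| <= M) ->
    (forall x z, v x z 0 = cutoff (1 - dilation ell 0 0 x z 0)) ->
    forall x z t : R, `|z| <= X -> 0 <= t < T ->
      `|v x z t - cutoff (1 - dilation ell 0 0 x z t)| <= eta].
Proof.
move=> hpsi c0 lc cl Cl T0 etap.
have C0 : 0 <= C by have := Cl 1 0; rewrite subr0 normr1 mulr1; apply: le_trans.
pose et := Num.min (eta / 4) 1.
have et0 : 0 < et by rewrite lt_min divr_gt0//= ltr01.
have et1 : et <= 1 by rewrite ge_min lexx orbT.
have et4 : 4 * et <= eta.
  have : et <= eta / 4 by rewrite ge_min lexx.
  clear; lra.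
clearbody et.
pose ep := et / 3; have ep0 : 0 < ep by rewrite divr_gt0.
have ep2 : ep <= 2^-1 by rewrite /ep; move: et1; clear; lra.
have [S1 [d1 [S10 d10 low]]] := convex3_lower ell c C ep c0 lc cl Cl ep0.
(* Two demands on the damping rate: on [- S1, S1] the profile changes by at most d1 / 2, and leaves
   shrinking at rate 4 e / c lose at most et / 4 up to time T. *)
have [e [e0 eS eT]] : exists e : R, [/\ 0 < e, e * S1 ^+ 2 * C <= d1 / 2 & 4 * e / c * T <= et / 4].
  have k0 : 0 < S1 ^+ 2 * C + 1 by rewrite ltr_wpDl// mulr_ge0// sqr_ge0.
  exists (Num.min (d1 / 2 / (S1 ^+ 2 * C + 1)) (et * c / (16 * T))); split.
  - by rewrite lt_min !divr_gt0// mulr_gt0.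
  - apply: (@le_trans _ _ (d1 / 2 / (S1 ^+ 2 * C + 1) * (S1 ^+ 2 * C + 1))).
      rewrite -mulrA; apply: ler_pM => //.
      + by rewrite le_min !divr_ge0 ?mulr_ge0 ?(ltW d10) ?(ltW k0) ?(ltW et0) ?(ltW c0) ?(ltW T0).
      + by rewrite mulr_ge0// sqr_ge0.
      + by rewrite ge_min lexx.
      + by rewrite lerDl.
    by rewrite divfK// gt_eqF.
  - have : Num.min (d1 / 2 / (S1 ^+ 2 * C + 1)) (et * c / (16 * T)) <= et * c / (16 * T) by rewrite ge_min lexx orbT.
    set y := Num.min _ _ => h.
    have -> : 4 * y / c * T = y * (4 * T / c) by field; rewrite gt_eqF.
    have -> : et / 4 = et * c / (16 * T) * (4 * T / c) by field; rewrite !gt_eqF.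
    by rewrite ler_wpM2r// divr_ge0 ?mulr_ge0 ?ltW.
(* The slope that the damped profile can still gain beyond r must fit in half of the margin that the
   factor 1 + ep provides. *)
have [r [r0 kC]] : exists r : R, 0 < r /\ (1 + e * r)^-1 * C <= ep * c / 2.
  have epc : 0 < ep * c by rewrite mulr_gt0.
  exists (2 * (C + 1) / (e * (ep * c))); split; first by rewrite divr_gt0 ?mulr_gt0// ltr_wpDl.
  have -> : e * (2 * (C + 1) / (e * (ep * c))) = 2 * (C + 1) / (ep * c).
    by field; rewrite !gt_eqF.
  have p : 0 < 1 + 2 * (C + 1) / (ep * c) by rewrite ltr_pwDl// divr_ge0 ?mulr_ge0 ?addr_ge0// ltW.
  rewrite mulrC ler_pdivrMr//.
  have -> : ep * c / 2 * (1 + 2 * (C + 1) / (ep * c)) = ep * c / 2 + C + 1.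
    by field; rewrite !gt_eqF.
  by move: epc; clear; lra.
pose d := Num.min (d1 / 2) (Num.min (ep * c / 6) (2 / 3 * (et * c))).
have d0 : 0 < d by rewrite !lt_min !(divr_gt0, mulr_gt0).
have dd1 : d <= d1 / 2 by rewrite ge_min lexx.
have dd2 : d <= ep * c / 6 by rewrite !ge_min lexx !orbT.
have dd3 : d <= 2 / 3 * (et * c) by rewrite !ge_min lexx !orbT.
clearbody d.
have l00 := growth_gt0 ell c c0 lc 0.
have ec0 : 0 < et * c by rewrite mulr_gt0.
pose S2 := 1 + (2 * `|X| + 3 / 2 * ell 0) / (et * c).
have S21 : 1 <= S2 by rewrite lerDl divr_ge0 ?(ltW ec0)// addr_ge0 ?mulr_ge0 ?(ltW l00).
have S2E : et * c * S2 = et * c + 2 * `|X| + 3 / 2 * ell 0.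
  by rewrite /S2; field; rewrite !gt_eqF.
clearbody S2.
exists (S1 + (r + 1) + S2), d; split => //.
  by rewrite addr_gt0 ?(lt_le_trans _ S21)// addr_gt0// addr_gt0.
move=> phi l l1 l2 v M rphi sl l2E HC Hl sv sv' cv vM v0 x z t zX tT.
have [k k0 Hk] := slope_curv_lower phi psi rphi hpsi.
have lS1 s : `|s| <= S1 -> `|l s - ell s| <= d.
  by move=> h; apply: Hl; move: h S10 r0 S21; clear; lra.
have lS2 s : `|s| <= S2 -> `|l s - ell s| <= d.
  by move=> h; apply: Hl; move: h S10 r0 S21; clear; lra.
have lSr s : `|s| <= r + 1 -> `|l s - ell s| <= d.
  by move=> h; apply: Hl; move: h S10 r0 S21; clear; lra.
have llow : forall s, (1 - ep) * ell s <= l s.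
  apply: low; first exact: smooth_profile_convex3 sl.
  by move=> s /lS1; move: dd1 d10; clear; lra.
have c20 : 0 < c / 2 by rewrite divr_gt0.
have half (g : R -> R) : (forall s, (1 - ep) * ell s <= g s) -> forall s, c / 2 * (1 + `|s|) <= g s.
  move=> H s; apply: le_trans (H s).
  have e1 : 2^-1 <= 1 - ep by move: ep2; clear; lra.
  have := ler_wpM2r (ltW (growth_gt0 ell c c0 lc s)) e1.
  by have := lc s; clear; lra.
have llc := half l llow.
have lrange : forall y K : R, (forall s, s * y - l s <= K) -> exists s, l1 s = y.
  by apply: (profile_slope_range l l1 l2 k sl k0) => s; rewrite l2E.
have l1B s : `|l1 s| <= C + `|l1 0|.
  have := HC s 0; have := ler_normD (l1 s - l1 0) (l1 0); rewrite subrK; clear; lra.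
have [ap [am sr]] := slope_range_exists l l1 l2 (c / 2) _ sl c20 llc l1B.
have t0 : 0 <= t by case/andP: tT.
have MB (x' z' t' : R) : 0 <= t' <= T -> v x' z' t' <= M.
  by move=> h; exact: le_trans (ler_norm _) (vM _ _ _ h).
have MB' (x' z' t' : R) : 0 <= t' <= T -> - v x' z' t' <= M.
  by move=> h; apply: le_trans (vM x' z' t' h); rewrite -normrN; exact: ler_norm.
have scale (lam : R) : 2^-1 <= lam <= 3 / 2 -> 0 < lam /\ lam <= (lam + et) * (1 - ep).
  move=> /andP[h1 h2]; split; first by move: h1; clear; lra.
  have : ep * (lam + et) <= ep * 3.
    by rewrite ler_wpM2l ?(ltW ep0)//; move: h2 et1; clear; lra.
  by rewrite /ep; clear; lra.
have Wl (x' z' t' : R) (g : R -> R) (a' e' : R) : 0 <= t' -> 0 <= e' -> e' * t' <= a' -> (forall s, (1 - ep) * ell s <= g s) ->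
    cutoff (1 - dilation ell 0 0 x' z' t') <= cutoff (1 - dilation g a' e' x' z' t') + et.
  move=> t'0 e'0 ea Hg; apply: (barrier_compare ell g c (c / 2)) => //.
  - exact: half.
  - by rewrite mul0r.
  - exact: ltW.
  move=> lam lamP; have [lam0 lams] := scale lam lamP.
  rewrite mul0r subr0 addr0; apply: in_dilate_scale; [exact: ltW| |].
    by rewrite ler_wpM2l// lef_pV2 ?posrE ?addr_gt0// lerDl ltW.
  move=> s; have ls0 := growth_gt0 ell c c0 lc s.
  have lm : lam <= (lam + et + a' - e' * t') * (1 - ep).
    apply: le_trans lams _; rewrite ler_wpM2r//; first by move: ep2; clear; lra.
    by move: ea; clear; lra.
  have m0 : 0 <= lam + et + a' - e' * t' by move: ea lam0 et0; clear; lra.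
  have := ler_wpM2r (ltW ls0) lm; have := ler_wpM2l m0 (Hg s); clear; lra.
have upper : v x z t <= cutoff (1 - dilation ell 0 0 x z t) + 4 * et.
  have := upper_comparison phi psi rphi hpsi l l1 l2 (c / 2) ap am T M et v sl c20 llc lrange sr l2E T0 et0 sv cv MB.
  have h0 x' z' : v x' z' 0 <= cutoff (1 - dilation l 0 0 x' z' 0) + et.
    by rewrite v0; apply: Wl => //; rewrite mul0r.
  move=> /(_ h0 x z t tT).
  suff : cutoff (1 - dilation l 0 0 x z t) <= cutoff (1 - dilation ell 0 0 x z t) + et by clear; lra.
  apply: (barrier_compare l ell (c / 2) c) => //; try by rewrite mul0r.
  - exact: ltW.
  move=> lam /andP[lam2 lam3]; rewrite !mul0r !subr0 !addr0.
  have lam0 : 0 < lam by move: lam2; clear; lra.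
  apply: (in_dilate_local l ell c `|X| S2 d et x z _ _ lam c0 lc cl S21 d0 (ltW lam0) lS2).
  - by apply: le_trans zX _; exact: ler_norm.
  - rewrite divr_ge0 ?addr_ge0 ?(ltW lam0) ?(ltW et0)//=.
    by rewrite ler_wpM2l// lef_pV2 ?posrE ?addr_gt0// lerDl ltW.
  - by have := ler_wpM2r (ltW d0) lam3; move: dd3; clear; lra.
  - rewrite S2E; have := ler_wpM2r (ltW d0) lam3; have := ler_wpM2r (ltW l00) lam3.
    by move: dd3; clear; lra.
  - exact: ltW.
have c2 : continuous l2.
  have -> : l2 = (fun s => weight psi s * slope_curv phi s) by apply/funext.
  by move=> s; apply: continuousM; [exact: weight_continuous|exact: slope_curv_continuous].
have [m [m1 [sm [m0 m10]]]] := damped_profile l l1 l2 e r sl c2 (ltW e0) (ltW r0).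
have rl := smooth_profile_reflect _ _ _ sl.
have rm : smooth_profile (fun s => m (- s)) (fun s => - m1 (- s)) (fun s => damp e r s * l2 (- s)).
  have := smooth_profile_reflect _ _ _ sm; congr smooth_profile.
  by apply/funext => s; rewrite damp_reflect.
have rm0 : m (- 0) = l (- 0) by rewrite oppr0.
have rm10 : - m1 (- 0) = - l1 (- 0) by rewrite oppr0 m10.
have rHC s s' : `|- l1 (- s) - - l1 (- s')| <= C by rewrite -opprD normrN.
have P1 (s : R) : 0 <= s -> _ := damped_profile_half l l1 l2 m m1 e r C sl sm m0 m10 (ltW e0) r0 HC s.
have P2 (s : R) : 0 <= s -> _ := damped_profile_half _ _ _ _ _ e r C rl rm rm0 rm10 (ltW e0) r0 rHC s.
have mS s : `|s| <= S1 -> `|m s - ell s| <= d1.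
  move=> sS; have := lS1 s sS.
  have dm : 0 <= l s - m s <= e * S1 ^+ 2 * C.
    have s2 : e * s ^+ 2 * C <= e * S1 ^+ 2 * C.
      rewrite ler_wpM2r// ler_wpM2l ?(ltW e0)//.
      by rewrite -(real_normK (num_real s)) lerXn2r// nnegrE ltW.
    have [s0|s0] := leP 0 s.
      by have [_ h1 h2 _] := P1 s s0; rewrite subr_ge0 h1 (le_trans h2).
    have sN : 0 <= - s by rewrite oppr_ge0 ltW.
    by have [_ h1 h2 _] := P2 _ sN; move: h1 h2; rewrite opprK sqrrN subr_ge0 => -> h2; rewrite (le_trans h2).
  by move: dm dd1 eS; clear; rewrite !ler_norml; lra.
have mlow : forall s, (1 - ep) * ell s <= m s.
  by apply: low => //; exact: smooth_profile_convex3 sm.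
have mlc := half m mlow.
have mup s : m s <= (1 + ep) * ell s.
  have h : m s <= ell s + d + (2 * d + (1 + e * r)^-1 * C) * `|s|.
    have [s0|s0] := leP 0 s.
      rewrite ger0_norm//; exact: (damped_profile_le_half l l1 l2 m m1 ell e r C d sl sm m0 m10 (ltW e0) r0 HC cl (ltW d0) lSr).
    have sN : 0 <= - s by rewrite oppr_ge0 ltW.
    have := damped_profile_le_half _ _ _ _ _ (fun s => ell (- s)) e r C d rl rm rm0 rm10 (ltW e0) r0 rHC
      (convex3_reflect _ cl) (ltW d0) _ _ sN.
    by rewrite opprK (ltr0_norm s0); apply => s' h'; have := lSr (- s'); rewrite normrN; apply.
  have q : 2 * d + (1 + e * r)^-1 * C <= ep * c by move: kC dd2 d0; clear; lra.
  have := ler_wpM2r (normr_ge0 s) q; have := ler_wpM2l (ltW ep0) (lc s).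
  have : 0 < ep * c by rewrite mulr_gt0.
  by move: h dd2; clear; lra.
(* The shrinking rate that offsets the damping: m s >= c / 2 (1 + |s|) gives ee / 2 m s >= e |s|. *)
pose ee := 4 * e / c; have ee0 : 0 < ee by rewrite divr_gt0// mulr_gt0.
pose a := ee * T; have aet : a <= et / 4 by [].
have mrange : forall y K : R, (forall s, s * y - m s <= K) -> exists s, m1 s = y.
  have kk : 0 < (1 + e * r)^-1 * k by rewrite mulr_gt0// invr_gt0 ltr_pwDl// mulr_ge0// ltW.
  apply: (profile_slope_range m m1 _ _ sm kk) => s; rewrite l2E -mulrA.
  have [p0 p1 _ _] := damp_bounds e r s (ltW e0) (ltW r0).
  apply: ler_pM => //; first by rewrite invr_ge0 addr_ge0// mulr_ge0// ltW.
  by rewrite divr_ge0 ?(ltW k0)// addr_ge0 ?sqr_ge0.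
have m1B s : `|m1 s| <= C + `|l1 0|.
  have [s0|s0] := leP 0 s.
    have [h _ _ _] := P1 s s0; have h' := profile_slope_le _ _ _ sm _ _ s0.
    have := l1B s; have := l1B 0; move: h h' C0; rewrite m10 !ler_norml; clear; lra.
  have sN : 0 <= - s by rewrite oppr_ge0 ltW.
  have [h _ _ _] := P2 _ sN; have h' := profile_slope_le _ _ _ sm _ _ (ltW s0).
  rewrite opprK in h.
  have := l1B s; have := l1B 0; move: h h' C0; rewrite m10 !ler_norml; clear; lra.
have [bp [bm smr]] := slope_range_exists m m1 _ (c / 2) _ sm c20 mlc m1B.
have lower : - v x z t <= - cutoff (1 - dilation ell 0 0 x z t) + 4 * et.
  have w2 s : weight psi s * slope_curv phi s <= (1 + ee / 2 * m s) * (damp e r s * l2 s).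
    have l20 : 0 < l2 s by case: sl.
    rewrite -l2E mulrA ler_peMl ?(ltW l20)//.
    rewrite /damp ler_pdivlMr; last by rewrite ltr_pwDl// mulr_ge0 ?(ltW e0)// le_min normr_ge0 ltW.
    rewrite mul1r lerD2l; apply: (@le_trans _ _ (e * `|s|)).
      by rewrite ler_wpM2l ?(ltW e0)// ge_min lexx.
    have e20 : 0 <= ee / 2 by rewrite divr_ge0// ltW.
    apply: le_trans (ler_wpM2l e20 (mlc s)).
    have -> : ee / 2 * (c / 2 * (1 + `|s|)) = e * (1 + `|s|) by rewrite /ee; field; rewrite gt_eqF.
    by rewrite ler_wpM2l ?(ltW e0)// lerDr.
  have := lower_comparison phi psi rphi hpsi m m1 _ (c / 2) a ee bp bm T M et (fun x z t => - v x z t)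
    sm c20 mlc mrange smr w2 (ltW ee0) (lexx _) T0 et0 sv' (slab_continuousN _ _ cv) MB'.
  have h1 x' z' : - v x' z' 0 <= cutoff 2^-1 by rewrite v0 -cutoffN; exact: cutoff_le.
  have a0 : 0 <= a by rewrite mulr_ge0 ?ltW.
  have h2 x' z' : - v x' z' 0 <= - cutoff (1 - dilation m a ee x' z' 0) + et.
    rewrite v0; suff : cutoff (1 - dilation m a ee x' z' 0) <= cutoff (1 - dilation ell 0 0 x' z' 0) + et by clear; lra.
    apply: (barrier_compare m ell (c / 2) c) => //; rewrite ?mulr0 ?(ltW ee0) ?(ltW et0)//.
    move=> lam /andP[lam2 lam3]; rewrite !subr0 !addr0 !mul0r.
    have lam0 : 0 < lam by move: lam2; clear; lra.
    apply: in_dilate_scale => //; first by rewrite addr_ge0// ltW.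
    move=> s; have ls0 := growth_gt0 ell c c0 lc s.
    have la0 : 0 <= lam + a by rewrite addr_ge0// ltW.
    have h3 : (lam + a) * (1 + ep) <= lam + et.
      have h4 : lam * ep <= 3 / 2 * ep by rewrite ler_wpM2r// ltW.
      have h5 : a * ep <= a * 2^-1 by rewrite ler_wpM2l.
      by move: h4 h5 aet a0 et0; rewrite /ep; clear; lra.
    have := ler_wpM2l la0 (mup s); have := ler_wpM2r (ltW ls0) h3; clear; lra.
  move=> /(_ h1 h2 x z t tT).
  have eta' : ee * t <= a by rewrite ler_wpM2l ?(ltW ee0)//; case/andP: tT => _ /ltW.
  have := Wl x z t m a ee t0 (ltW ee0) eta' mlow.
  clear; lra.
by move: upper lower et4; clear; rewrite ler_norml; lra.
Qed.

(** * Limits of profiles *)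

Section Smoothing.
Context {R : realType}.
Implicit Types (w W f d : R -> R) (s r h : R).

Let shift W (W' : R -> R) (k : R) : (forall s : R, is_derive s 1 W (W' s)) ->
  forall s : R, is_derive s 1 (fun s => W (s + k)) (W' (s + k)).
Proof.
move=> dW s; apply: is_derive_eqf (is_derive_compf W (fun s => s + k) s _ 1 (dW _) _); first by rewrite mulr1.
by apply: is_derive_eqf (is_derive_addf _ _ s _ _ (is_derive_idf s) (is_derive_cstf k s)); rewrite addr0.
Qed.

Lemma second_difference w W1 W2 (K h : R) : 0 < h ->
  (forall s r, `|w s - w r| <= K * `|s - r|) ->
  (forall s : R, is_derive s 1 W1 (w s)) -> (forall s : R, is_derive s 1 W2 (W1 s)) ->
  forall s, `|(W2 (s + 2 * h) - 2 * W2 (s + h) + W2 s) / h ^+ 2 - w s| <= K * (2 * h).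
Proof.
move=> h0 HK d1 d2 s.
have dG (y : R) : is_derive y 1 (fun y => W2 (y + h) - W2 y) (W1 (y + h) - W1 y).
  exact: is_derive_subf (shift _ _ h d2 y) (d2 y).
have dH (y : R) : is_derive y 1 W1 (w y) := d1 y.
have sh : s <= s + h by rewrite lerDl ltW.
have [c1 /andP[c1a c1b] E1] := MVT_le _ _ s (s + h) sh (fun y _ => dG y).
have ch : c1 <= c1 + h by rewrite lerDl ltW.
have [c2 /andP[c2a c2b] E2] := MVT_le _ _ c1 (c1 + h) ch (fun y _ => dH y).
have -> : (W2 (s + 2 * h) - 2 * W2 (s + h) + W2 s) / h ^+ 2 = w c2.
  have -> : s + 2 * h = s + h + h by ring.
  have -> : W2 (s + h + h) - 2 * W2 (s + h) + W2 s = W2 (s + h + h) - W2 (s + h) - (W2 (s + h) - W2 s) by ring.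
  by rewrite E1 E2; field; rewrite gt_eqF.
have K0 : 0 <= K by have := HK 1 0; rewrite subr0 normr1 mulr1; apply: le_trans.
apply: le_trans (HK _ _) _; rewrite ler_wpM2l// ger0_norm; lra.
Qed.

(** Smoothing without convolution: the second difference of a double primitive of w is C^2 and
    within 2 K h of w. *)
Lemma smooth_approximation w (K k : R) : (forall s r, `|w s - w r| <= K * `|s - r|) -> continuous w -> 0 < k ->
  exists v v1 v2 : R -> R, [/\ forall s : R, is_derive s 1 v (v1 s), forall s : R, is_derive s 1 v1 (v2 s),
    continuous v2 & forall s, `|v s - w s| <= k].
Proof.
move=> HK cw k0.
have K0 : 0 <= K by have := HK 1 0; rewrite subr0 normr1 mulr1; apply: le_trans.
have K1 : 0 < 2 * K + 1 by rewrite ltr_wpDl// mulr_ge0.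
pose h := k / (2 * K + 1); have h0 : 0 < h by rewrite divr_gt0.
have hk : K * (2 * h) <= k.
  have -> : k = h * (2 * K + 1) by rewrite /h divfK// gt_eqF.
  by move: h0; clear; lra.
have [W1 [_ d1]] := antiderivative w cw.
have [W2 [_ d2]] := antiderivative W1 (fun s => is_derive1_continuous _ _ _ (d1 s)).
pose D (W : R -> R) s := (h ^+ 2)^-1 * (W (s + 2 * h) - 2 * W (s + h) + W s).
have dD W W' : (forall s : R, is_derive s 1 W (W' s)) -> forall s : R, is_derive s 1 (D W) (D W' s).
  move=> dW s; apply: is_derive_scalef; apply: is_derive_addf (dW s).
  apply: is_derive_subf; first exact: shift dW s.
  by apply: is_derive_scalef; exact: shift dW s.
exists (D W2), (D W1), (D w); split.
- exact: dD.
- exact: dD.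
- have cs (y : R) : continuous (fun s : R => w (s + y)).
    move=> s; apply: (@continuous_comp _ _ _ (fun s => s + y) w); last exact: cw.
    by apply: continuousD => //; exact: cst_continuous.
  rewrite /D => s; apply: (@continuousM _ _ (fun=> (h ^+ 2)^-1) (fun s => w (s + 2 * h) - 2 * w (s + h) + w s)); first exact: cst_continuous.
  apply: continuousD; last exact: cw.
  apply: continuousB; first exact: cs.
  by apply: continuousM; [exact: cst_continuous|exact: cs].
- move=> s; apply: le_trans hk; rewrite /D mulrC.
  exact: second_difference HK d1 d2 s.
Qed.

Lemma continuous_bounded_itv (g : R -> R) (S : R) : 0 <= S -> continuous g ->
  exists2 B : R, 0 < B & forall s, `|s| <= S -> `|g s| <= B.
Proof.
move=> S0 cg; have SS : - S <= S by rewrite lerNl (le_trans _ S0)// oppr_le0.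
have cn : {within `[- S, S], continuous (fun s => `|g s|)}.
  apply: continuous_subspaceT => x; apply: (@continuous_comp _ _ _ g (fun y : R => `|y|)); first exact: cg.
  exact: norm_continuous.
have [c _ Hc] := EVT_max SS cn.
exists (`|g c| + 1); first by rewrite ltr_wpDl.
move=> s; rewrite ler_norml => sS; apply: le_trans (Hc s _) _; first by rewrite in_itv.
by rewrite lerDl.
Qed.

(** Increments of E1 are dominated by those of F, hence by 2 M. Thus E2 may be large pointwise,
    provided that its total mass is small. *)
Lemma small_second_derivative (E E1 E2 F F1 : R -> R) (M S : R) : 0 <= S ->
  (forall s : R, is_derive s 1 E (E1 s)) -> (forall s : R, is_derive s 1 E1 (E2 s)) ->
  (forall s : R, is_derive s 1 F (F1 s)) -> (forall s, `|E2 s| <= F1 s) ->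
  (forall s, `|F s| <= M) ->
  forall s, `|s| <= S -> `|E s - E 0 - E1 0 * s| <= 2 * M * S.
Proof.
move=> S0 dE dE1 dF H HM.
have M0 : 0 <= M := le_trans (normr_ge0 _) (HM 0).
have up (a b : R) : a <= b -> `|E1 b - E1 a| <= F b - F a.
  move=> ab.
  have A := derive_ge0_le (fun s => F s - E1 s) (fun s => F1 s - E2 s) a b ab (fun s _ => is_derive_subf _ _ s _ _ (dF s) (dE1 s)).
  have B := derive_ge0_le (fun s => F s + E1 s) (fun s => F1 s + E2 s) a b ab (fun s _ => is_derive_addf _ _ s _ _ (dF s) (dE1 s)).
  have {}A : F a - E1 a <= F b - E1 b by apply: A => s _; have := H s; rewrite ler_norml; lra.
  have {}B : F a + E1 a <= F b + E1 b by apply: B => s _; have := H s; rewrite ler_norml; lra.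
  by rewrite ler_norml; lra.
have bd s : `|E1 s - E1 0| <= 2 * M.
  have [s0|s0] := leP 0 s.
    by apply: le_trans (up _ _ s0) _; have := HM s; have := HM 0; rewrite !ler_norml; lra.
  rewrite distrC; apply: le_trans (up _ _ (ltW s0)) _.
  by have := HM s; have := HM 0; rewrite !ler_norml; lra.
move=> s sS.
have dL (r : R) : is_derive r 1 (fun s => E s - E1 0 * s) (E1 r - E1 0 * 1).
  by apply: is_derive_subf (dE r) _; apply: is_derive_scalef; exact: is_derive_idf.
have := MVT_norm_le (fun s => E s - E1 0 * s) _ 0 s (2 * M) (fun c _ => dL c) _.
rewrite mulr0 !subr0 addrAC => h.
apply: le_trans (h _) _; first by move=> c _; rewrite mulr1.
by rewrite ler_wpM2l// mulr_ge0.
Qed.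

(** The second derivatives of f and g need not be close, so w is replaced by a C^2 function v and
    both derivatives are moved onto v. What remains, (w - v) (f2 - g2), has small total mass because
    f1 and g1 are bounded by N. *)
Lemma weighted_stability w (K N S eta : R) : (forall s r, `|w s - w r| <= K * `|s - r|) ->
  continuous w -> 0 < N -> 0 < S -> 0 < eta -> exists2 d : R, 0 < d &
  forall f f1 f2 g g1 g2 L L1 M M1 : R -> R,
    (forall s : R, is_derive s 1 f (f1 s)) -> (forall s : R, is_derive s 1 f1 (f2 s)) ->
    (forall s : R, is_derive s 1 g (g1 s)) -> (forall s : R, is_derive s 1 g1 (g2 s)) ->
    (forall s, 0 <= f2 s) -> (forall s, 0 <= g2 s) ->
    (forall s, `|f1 s| <= N) -> (forall s, `|g1 s| <= N) ->
    (forall s : R, is_derive s 1 L (L1 s)) -> (forall s : R, is_derive s 1 L1 (w s * f2 s)) ->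
    (forall s : R, is_derive s 1 M (M1 s)) -> (forall s : R, is_derive s 1 M1 (w s * g2 s)) ->
    (forall s, `|s| <= S -> `|f s - g s| <= d) ->
    exists a b : R, forall s, `|s| <= S -> `|L s - M s - (a + b * s)| <= eta.
Proof.
move=> HK cw N0 S0 eta0.
pose k := eta / (8 * N * S); have k0 : 0 < k by rewrite divr_gt0// !mulr_gt0.
have [v [v1 [v2 [dv dv1 cv2 vw]]]] := smooth_approximation w K k HK cw k0.
have cv : continuous v by move=> s; exact: is_derive1_continuous (dv s).
have cv1 : continuous v1 by move=> s; exact: is_derive1_continuous (dv1 s).
have [B0 B00 HB0] := continuous_bounded_itv v S (ltW S0) cv.
have [B1 B10 HB1] := continuous_bounded_itv v1 S (ltW S0) cv1.
have [B2 B20 HB2] := continuous_bounded_itv v2 S (ltW S0) cv2.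
pose B := B0 + 2 * B1 * S + B2 * S * S.
have Bp : 0 < B by rewrite /B !addr_gt0 ?mulr_gt0.
pose d := eta / (2 * B); have d0 : 0 < d by rewrite divr_gt0// mulr_gt0.
exists d => // f f1 f2 g g1 g2 L L1 M M1 df df1 dg dg1 f20 g20 fN gN dL dL1 dM dM1 fg.
pose D s := f s - g s; pose D1 s := f1 s - g1 s.
have dD (s : R) : is_derive s 1 D (D1 s) := is_derive_subf _ _ s _ _ (df s) (dg s).
have dD1 (s : R) : is_derive s 1 D1 (f2 s - g2 s) := is_derive_subf _ _ s _ _ (df1 s) (dg1 s).
have cD : continuous D by move=> s; exact: is_derive1_continuous (dD s).
have [P [P0 dP]] := antiderivative (fun s => v1 s * D s) (fun s => continuousM (cv1 s) (cD s)).
have [Q1 [Q10 dQ1]] := antiderivative (fun s => v2 s * D s) (fun s => continuousM (cv2 s) (cD s)).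
have [Q [Q0 dQ]] := antiderivative Q1 (fun s => is_derive1_continuous _ _ _ (dQ1 s)).
(* v D'' = (v D)'' - 2 (v' D)' + v'' D, so T is a double primitive of v D'' that involves only D
   itself and is small with it. *)
pose T s := v s * D s - 2 * P s + Q s.
pose T1 s := v s * D1 s - v1 s * D s + Q1 s.
have dT (s : R) : is_derive s 1 T (T1 s).
  apply: is_derive_eqf (is_derive_addf _ _ s _ _ (is_derive_subf _ _ s _ _ (is_derive_mulf _ _ s _ _ (dv s) (dD s)) (is_derive_scalef 2 _ s _ (dP s))) (dQ s)).
  by rewrite /T1; ring.
have dT1 (s : R) : is_derive s 1 T1 (v s * (f2 s - g2 s)).
  apply: is_derive_eqf (is_derive_addf _ _ s _ _ (is_derive_subf _ _ s _ _ (is_derive_mulf _ _ s _ _ (dv s) (dD1 s)) (is_derive_mulf _ _ s _ _ (dv1 s) (dD s))) (dQ1 s)).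
  by ring.
have TB s : `|s| <= S -> `|T s| <= eta / 2.
  move=> sS.
  have mb (H H' : R -> R) (b : R) : H 0 = 0 -> (forall s : R, is_derive s 1 H (H' s)) -> 0 <= b ->
      (forall s, `|s| <= S -> `|H' s| <= b) -> forall s, `|s| <= S -> `|H s| <= b * S.
    move=> H0 dH b0 Hb r rS.
    have := MVT_norm_le H H' 0 r b (fun c _ => dH c); rewrite H0 !subr0 => h.
    apply: le_trans (h _) _; last by rewrite ler_wpM2l.
    by move=> c; rewrite subr0 => cr; apply: Hb; exact: le_trans cr rS.
  have pb := mb P _ (B1 * d) P0 dP (ltW (mulr_gt0 B10 d0)).
  have {}pb : `|P s| <= B1 * d * S.
    by apply: pb => // r rS; rewrite normrM; apply: ler_pM => //; [exact: HB1|exact: fg].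
  have q1b := mb Q1 _ (B2 * d) Q10 dQ1 (ltW (mulr_gt0 B20 d0)).
  have {}q1b : forall r, `|r| <= S -> `|Q1 r| <= B2 * d * S.
    by apply: q1b => r rS; rewrite normrM; apply: ler_pM => //; [exact: HB2|exact: fg].
  have qb := mb Q _ (B2 * d * S) Q0 dQ (ltW (mulr_gt0 (mulr_gt0 B20 d0) S0)) q1b s sS.
  have vb : `|v s * D s| <= B0 * d.
    by rewrite normrM; apply: ler_pM => //; [exact: HB0|exact: fg].
  have dB : d * B = eta / 2 by rewrite /d; field; rewrite gt_eqF.
  rewrite /T; apply: le_trans (ler_normD _ _) _; apply: le_trans (lerD (ler_normB _ _) (lexx _)) _.
  rewrite [`|2 * _|]normrM (ger0_norm (ler0n _ 2)) -dB /B.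
  by move: pb qb vb; clear; lra.
pose E s := L s - M s - T s; pose E1 s := L1 s - M1 s - T1 s.
have dE (s : R) : is_derive s 1 E (E1 s).
  exact: is_derive_subf (is_derive_subf _ _ s _ _ (dL s) (dM s)) (dT s).
have dE1 (s : R) : is_derive s 1 E1 ((w s - v s) * (f2 s - g2 s)).
  apply: is_derive_eqf (is_derive_subf _ _ s _ _ (is_derive_subf _ _ s _ _ (dL1 s) (dM1 s)) (dT1 s)).
  by ring.
exists (E 0), (E1 0) => s sS.
have := small_second_derivative E E1 _ (fun s => k * (f1 s + g1 s)) (fun s => k * (f2 s + g2 s)) (2 * k * N) S (ltW S0) dE dE1.
have dF (r : R) : is_derive r 1 (fun s => k * (f1 s + g1 s)) (k * (f2 r + g2 r)).
  by apply: is_derive_scalef; exact: is_derive_addf.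
move=> /(_ dF) h; have {}h : `|E s - E 0 - E1 0 * s| <= 2 * (2 * k * N) * S.
  apply: h => // r.
    rewrite normrM; apply: ler_pM => //; first by rewrite distrC.
    by apply: le_trans (ler_normB _ _) _; rewrite !ger0_norm.
  rewrite normrM (gtr0_norm k0) (_ : 2 * k * N = k * (2 * N)); last by ring.
  apply: ler_wpM2l; first exact: ltW.
  by apply: le_trans (ler_normD _ _) _; have := fN r; have := gN r; clear; lra.
have kE : 2 * (2 * k * N) * S = eta / 2 by rewrite /k; field; rewrite !gt_eqF.
have := TB s sS; move: h; rewrite kE /E.
have -> : L s - M s - (L 0 - M 0 - T 0 + E1 0 * s) = (L s - M s - T s - (L 0 - M 0 - T 0) - E1 0 * s) + T s by ring.
by move=> h1 h2; apply: le_trans (ler_normD _ _) _; move: h1 h2; clear; lra.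
Qed.

End Smoothing.

(** * Curvature profiles and their limits *)

Section ProfileLimit.
Context {R : realType}.
Implicit Types (phi psi : R * R -> R) (l L : R -> R).

Lemma is_derive_lipschitz_le (f : R -> R) (x a K : R) : is_derive x 1 f a ->
  (forall k : R, `|f (x + k) - f x| <= K * `|k|) -> `|a| <= K.
Proof.
move=> /is_derive1_epsP H HK; rewrite leNgt; apply/negP => aK.
have e0 : 0 < (`|a| - K) / 2 by rewrite divr_gt0// subr_gt0.
have [d d0 Hd] := H _ e0; have d2 : 0 < d / 2 by rewrite divr_gt0.
have := Hd (d / 2); rewrite (gtr0_norm d2) => h; have {}h := h (ltac:(lra)).
have := HK (d / 2); rewrite [X in _ <= _ * X]gtr0_norm// => h2.
have : `|a * (d / 2)| <= K * (d / 2) + (`|a| - K) / 2 * (d / 2).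
  have -> : a * (d / 2) = (f (x + d / 2) - f x) - (f (x + d / 2) - f x - a * (d / 2)) by ring.
  by apply: le_trans (ler_normB _ _) _; exact: lerD.
rewrite normrM (gtr0_norm d2) -mulrDl ler_pM2r//; lra.
Qed.

Lemma norm_derive_le phi p v : regular_norm phi -> p != 0 -> `|'D_v phi p| <= phi v.
Proof.
move=> rphi p0; have hphi : is_norm phi by case: rphi.
have := regular_norm_derive phi rphi p v p0; move=> /is_derive0_lineP /is_derive_lipschitz_le; apply.
move=> k; rewrite add0r scale0r addr0.
have up : phi (p + k *: v) <= phi p + `|k| * phi v.
  by apply: le_trans (normD phi hphi _ _) _; rewrite normZ.
have dn : phi p <= phi (p + k *: v) + `|k| * phi v.
  rewrite -[X in phi X <= _](addrK (k *: v)); apply: le_trans (normD phi hphi _ _) _.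
  by rewrite normN// normZ.
by rewrite ler_norml mulrC; lra.
Qed.

Lemma weight_le1 psi s : is_norm psi -> weight psi s <= (psi e1 + psi e2) * (1 + `|s|).
Proof.
move=> hpsi; apply: le_trans (weight_le psi hpsi s) _.
have a := norm_ge0 psi hpsi e1; have b := mulr_ge0 (norm_ge0 psi hpsi e2) (normr_ge0 s).
by move: a b; clear; lra.
Qed.

(** The variation of l1 is the integral of w f'' <= Cw (1 + |s|) f'', and for s >= 0 the latter is
    the derivative of Cw (f' + s f' - f). Here f' is bounded by phi e1, and by Euler's relation f -
    s f' = phi_z (- s, 1) is bounded by phi e2. The bound involves the norms only, so it is uniform
    along phi_n. *)
Lemma profile_slope_bound phi psi (l1 : R -> R) : regular_norm phi -> is_norm psi ->
  (forall s : R, is_derive s 1 l1 (weight psi s * slope_curv phi s)) ->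
  forall s t, `|l1 s - l1 t| <= 4 * (psi e1 + psi e2) * (phi e1 + phi e2).
Proof.
move=> rphi hpsi dl1; pose Cw := psi e1 + psi e2; pose N := phi e1 + phi e2.
have Cw0 : 0 <= Cw by rewrite addr_ge0// norm_ge0.
pose f := weight phi; pose f1 s := - dx phi (- s, 1); pose f2 := slope_curv phi.
have df (s : R) : is_derive s 1 f (f1 s) := is_derive_profile phi rphi s.
have df1 (s : R) : is_derive s 1 f1 (f2 s) := is_derive_profile2 phi rphi s.
have f20 s : 0 <= f2 s := ltW (slope_curv_gt0 phi rphi psi hpsi s).
have f1N s : `|f1 s| <= phi e1 by rewrite normrN; exact: norm_derive_le rphi (slope_neq0 s).
have fE s : f s - s * f1 s = dz phi (- s, 1).
  have := norm_Euler phi rphi _ (slope_neq0 s); rewrite /f /weight /f1 /= => <-; ring.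
have fN s : `|f s - s * f1 s| <= phi e2.
  by rewrite fE; exact: norm_derive_le rphi (slope_neq0 s).
have mono (s t : R) : s <= t -> 0 <= l1 t - l1 s.
  move=> st; rewrite subr_ge0; apply: (derive_ge0_le _ _ s t st (fun x _ => dl1 x)) => x _.
  by rewrite mulr_ge0// norm_ge0.
have up (s : R) : 0 <= s -> l1 s - l1 0 <= 2 * Cw * N.
  move=> s0; pose G s := Cw * (f1 s + s * f1 s - f s) - l1 s.
  have dG (r : R) : is_derive r 1 G (Cw * ((1 + r) * f2 r) - weight psi r * f2 r).
    apply: is_derive_subf (dl1 r); apply: is_derive_scalef.
    apply: is_derive_eqf (is_derive_subf _ _ r _ _ (is_derive_addf _ _ r _ _ (df1 r) (is_derive_mulf _ _ r _ _ (is_derive_idf r) (df1 r))) (df r)).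
    by ring.
  have : G 0 <= G s.
    apply: (derive_ge0_le _ _ 0 s s0 (fun x _ => dG x)) => x /andP[x0 _].
    rewrite mulrA -mulrBl mulr_ge0// subr_ge0.
    by have := weight_le1 psi x hpsi; rewrite ger0_norm.
  have : Cw * ((f1 s + s * f1 s - f s) - (f1 0 + 0 * f1 0 - f 0)) <= Cw * (2 * N).
    apply: ler_wpM2l => //; rewrite /N; have := f1N s; have := f1N 0; have := fN s; have := fN 0.
    by rewrite !ler_norml; lra.
  by rewrite /G; lra.
have dn (s : R) : s <= 0 -> l1 0 - l1 s <= 2 * Cw * N.
  move=> s0; pose G s := Cw * (f1 s - s * f1 s + f s) - l1 s.
  have dG (r : R) : is_derive r 1 G (Cw * ((1 - r) * f2 r) - weight psi r * f2 r).
    apply: is_derive_subf (dl1 r); apply: is_derive_scalef.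
    apply: is_derive_eqf (is_derive_addf _ _ r _ _ (is_derive_subf _ _ r _ _ (df1 r) (is_derive_mulf _ _ r _ _ (is_derive_idf r) (df1 r))) (df r)).
    by ring.
  have : G s <= G 0.
    apply: (derive_ge0_le _ _ s 0 s0 (fun x _ => dG x)) => x /andP[_ x0].
    rewrite mulrA -mulrBl mulr_ge0// subr_ge0.
    by have := weight_le1 psi x hpsi; rewrite ler0_norm.
  have : Cw * ((f1 0 - 0 * f1 0 + f 0) - (f1 s - s * f1 s + f s)) <= Cw * (2 * N).
    apply: ler_wpM2l => //; rewrite /N; have := f1N s; have := f1N 0; have := fN s; have := fN 0.
    by rewrite !ler_norml; lra.
  by rewrite /G; lra.
have bd s : - (2 * Cw * N) <= l1 s - l1 0 <= 2 * Cw * N.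
  have CN : 0 <= 2 * Cw * N.
    have hphi : is_norm phi by case: rphi.
    by rewrite !mulr_ge0// addr_ge0// norm_ge0.
  have [s0|/ltW s0] := leP 0 s.
    by rewrite up// andbT; apply: le_trans (mono _ _ s0); rewrite oppr_le0.
  by rewrite -opprB lerN2 dn//=; apply: le_trans CN; rewrite oppr_le0 mono.
by move=> s t; have := bd s; have := bd t; rewrite -/Cw -/N ler_norml; lra.
Qed.

Lemma smooth_profile_affine (l l1 l2 : R -> R) (a b : R) : smooth_profile l l1 l2 ->
  smooth_profile (fun s => l s + (a + b * s)) (fun s => l1 s + b) l2.
Proof.
case=> d1 d2 p; split => // s.
  apply: is_derive_addf (d1 s) _.
  apply: is_derive_eqf (is_derive_addf _ _ s _ _ (is_derive_cstf a s) (is_derive_scalef b _ s _ (is_derive_idf s))).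
  by rewrite add0r mulr1.
by apply: is_derive_eqf (is_derive_addf _ _ s _ _ (d2 s) (is_derive_cstf b s)); rewrite addr0.
Qed.

Definition curvature_profile phi psi (l l1 : R -> R) :=
  smooth_profile l l1 (fun s => weight psi s * slope_curv phi s).

Lemma curvature_profile_exists phi psi : regular_norm phi -> is_norm psi ->
  exists l l1, [/\ curvature_profile phi psi l l1, l 0 = 0 & l1 0 = 0].
Proof.
move=> rphi hpsi.
have c2 : continuous (fun s => weight psi s * slope_curv phi s).
  by move=> s; apply: continuousM; [exact: weight_continuous|exact: slope_curv_continuous].
have [l1 [l10 dl1]] := antiderivative _ c2.
have [l [l0 dl]] := antiderivative l1 (fun s => is_derive1_continuous _ _ _ (dl1 s)).
exists l, l1; split => //; split => // s.
by rewrite mulr_gt0 ?(slope_curv_gt0 phi rphi psi hpsi)// /weight norm_gt0// slope_neq0.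
Qed.

Lemma slope_point_norm s (S : R) : 1 <= S -> `|s| <= S -> `|((- s, 1) : R * R)| <= S.
Proof. by move=> S1 sS; rewrite prod_normE ge_max /= normrN sS normr1. Qed.

Lemma e1_norm : `|(e1 : R * R)| = 1.
Proof. by rewrite prod_normE /= normr1 normr0; apply/max_idPl. Qed.

Lemma e2_norm : `|(e2 : R * R)| = 1.
Proof. by rewrite prod_normE /= normr1 normr0; apply/max_idPr. Qed.

(** Profiles are defined only up to affine functions, hence the correction a + b s. Both norms are
    compared with a third one, possibly not regular, which gives the Cauchy property of
    approximating profiles. *)
Lemma profile_closeness phi psi (S eta : R) : is_norm phi -> is_norm psi -> 1 <= S -> 0 < eta ->
  exists2 d : R, 0 < d <= 1 & forall phi1 phi2 l l1 m m1, regular_norm phi1 -> regular_norm phi2 ->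
    (forall p : R * R, `|p| <= S -> `|phi1 p - phi p| <= d) -> (forall p : R * R, `|p| <= S -> `|phi2 p - phi p| <= d) ->
    curvature_profile phi1 psi l l1 -> curvature_profile phi2 psi m m1 ->
    exists a b : R, forall s, `|s| <= S -> `|l s - m s - (a + b * s)| <= eta.
Proof.
move=> hphi hpsi S1 eta0; pose N := phi e1 + 1.
have N0 : 0 < N by rewrite ltr_wpDl// norm_ge0.
have S0 : 0 < S by exact: lt_le_trans S1.
have [d d0 H] := weighted_stability (weight psi) _ N S eta (weight_lipschitz psi hpsi) (weight_continuous psi hpsi) N0 S0 eta0.
exists (Num.min 1 (d / 2)); first by rewrite lt_min ltr01 divr_gt0//= ge_min lexx.
move=> phi1 phi2 l l1 m m1 r1 r2 H1 H2 [dl dl1 _] [dm dm1 _].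
have fN phi' : regular_norm phi' -> (forall p : R * R, `|p| <= S -> `|phi' p - phi p| <= Num.min 1 (d / 2)) ->
    forall s, `|- dx phi' (- s, 1)| <= N.
  move=> r Hp s; rewrite normrN; apply: le_trans (norm_derive_le _ _ _ r (slope_neq0 s)) _.
  have := Hp e1; rewrite e1_norm => /(_ S1); rewrite le_min => /andP[+ _].
  by rewrite /N ler_norml; lra.
apply: (H _ _ _ _ _ _ l l1 m m1 (is_derive_profile phi1 r1) (is_derive_profile2 phi1 r1)
  (is_derive_profile phi2 r2) (is_derive_profile2 phi2 r2) _ _ (fN _ r1 H1) (fN _ r2 H2)) => //.
- by move=> s; exact: ltW (slope_curv_gt0 phi1 r1 psi hpsi s).
- by move=> s; exact: ltW (slope_curv_gt0 phi2 r2 psi hpsi s).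
move=> s sS; rewrite /weight.
have := H1 _ (slope_point_norm s S S1 sS); have := H2 _ (slope_point_norm s S S1 sS).
by rewrite !le_min !ler_norml; lra.
Qed.

Lemma affine_small (e : R -> R) (a b eta S : R) : 1 <= S ->
  (forall s, `|s| <= S -> `|e s - (a + b * s)| <= eta) -> e 0 = 0 -> e 1 = 0 ->
  forall s, `|s| <= S -> `|e s| <= (2 + 2 * S) * eta.
Proof.
move=> S1 H e0 e1 s sS.
have h0 := H 0; rewrite normr0 e0 in h0; have {}h0 := h0 (ltac:(lra)).
have h1 := H 1; rewrite normr1 e1 in h1; have {}h1 := h1 S1.
have eta0 : 0 <= eta by exact: le_trans h0.
have A : `|a| <= eta by move: h0; rewrite !ler_norml; lra.
have B : `|b| <= 2 * eta by move: h0 h1; rewrite !ler_norml; lra.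
have -> : e s = (e s - (a + b * s)) + (a + b * s) by ring.
apply: le_trans (ler_normD _ _) _; have hs := H s sS.
have : `|b * s| <= 2 * eta * S by rewrite normrM; apply: ler_pM.
by have := ler_normD a (b * s); lra.
Qed.

(* If phi is not a locally uniform limit of regular norms, the last condition is
   vacuous and L = f will do. *)
Definition profile_limit phi psi L := exists C : R,
  [/\ forall s t, `|L s - L t| <= C * `|s - t|,
      exists2 c : R, 0 < c & convex3 (fun s => L s - c * weight phi s) &
      forall S eta : R, 0 < eta -> exists S' d : R, 0 < d /\ forall phi', regular_norm phi' ->
        (forall p : R * R, `|p| <= S' -> `|phi' p - phi p| <= d) ->
        exists l l1, [/\ curvature_profile phi' psi l l1, forall s t, `|l1 s - l1 t| <= C &
          forall s, `|s| <= S -> `|l s - L s| <= eta]].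

(** The second derivative is (w - c) f'' > 0. This margin survives the limit and is the source of
    the linear growth in [profile_limit_growth]. *)
Lemma curvature_profile_convex phi psi l l1 : regular_norm phi -> is_norm psi ->
  curvature_profile phi psi l l1 -> forall c : R, (forall s, 2 * c <= weight psi s) -> 0 < c ->
  convex3 (fun s => l s - c * weight phi s).
Proof.
move=> rphi hpsi [dl dl1 _] c Hc c0.
apply: (@smooth_profile_convex3 _ _ (fun s => l1 s - c * - dx phi (- s, 1)) (fun s => weight psi s * slope_curv phi s - c * slope_curv phi s)).
split => s.
- by apply: is_derive_subf (dl s) _; apply: is_derive_scalef; exact: is_derive_profile.
- by apply: is_derive_subf (dl1 s) _; apply: is_derive_scalef; exact: is_derive_profile2.
- by rewrite -mulrBl mulr_gt0 ?(slope_curv_gt0 phi rphi psi hpsi)//; have := Hc s; lra.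
Qed.

Lemma weight_convex phi : is_norm phi -> convex3 (weight phi).
Proof.
move=> hphi x y z /andP[xy yz].
have zy : 0 <= z - y by rewrite subr_ge0.
have yx : 0 <= y - x by rewrite subr_ge0.
have zx : 0 <= z - x by lra.
rewrite /weight -{1}(ger0_norm zx) -{1}(ger0_norm zy) -{1}(ger0_norm yx) -!normZ//.
apply: le_trans (normD phi hphi _ _); rewrite le_eqVlt; apply/orP; left; apply/eqP; congr phi.
by rewrite !pairZE pairDE; congr pair; ring.
Qed.

End ProfileLimit.

Section ProfileLimitExistence.
Context {R : realType}.
Implicit Types (phi psi : R * R -> R).

(** The limit is the supremum of the eventual lower bounds. Any index good for the Cauchy property
    at eta is good for the convergence at eta, which transfers uniformity in s to the limit. *)
Lemma cauchy_limit (u : nat -> R) :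
  (forall eta : R, 0 < eta -> exists K, forall j k, (K <= j)%N -> (K <= k)%N -> `|u j - u k| <= eta) ->
  exists l : R, forall eta : R, 0 < eta -> forall K, (forall j k, (K <= j)%N -> (K <= k)%N -> `|u j - u k| <= eta) ->
    forall k, (K <= k)%N -> `|u k - l| <= eta.
Proof.
move=> H; pose E : set R := [set x | exists K, forall k, (K <= k)%N -> x <= u k].
have lo (eta : R) K k : (forall j k, (K <= j)%N -> (K <= k)%N -> `|u j - u k| <= eta) -> (K <= k)%N -> E (u k - eta).
  move=> HK Kk; exists K => j Kj; have := HK _ _ Kj Kk; rewrite ler_norml; lra.
have up (eta : R) K k : (forall j k, (K <= j)%N -> (K <= k)%N -> `|u j - u k| <= eta) -> (K <= k)%N -> ubound E (u k + eta).
  move=> HK Kk x [K' HK']; apply: le_trans (HK' (maxn K K') (leq_maxr _ _)) _.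
  have := HK _ _ (leq_maxl K K') Kk; rewrite ler_norml; lra.
have hs : has_sup E.
  have [K HK] := H 1 ltr01; split; first by exists (u K - 1); exact: lo HK _.
  by exists (u K + 1); exact: up HK _.
exists (sup E) => eta eta0 K HK k Kk.
have := ub_le_sup (proj2 hs) (lo _ _ _ HK Kk).
have := ge_sup (proj1 hs) (up _ _ _ HK Kk).
by rewrite ler_norml; lra.
Qed.

(** Vanishing at 0 and 1 fixes the affine part. By the mean value theorem l1 then has a zero, so the
    bound on its increments bounds l1. *)
Lemma normalized_profile_exists phi psi : regular_norm phi -> is_norm psi ->
  exists l l1, [/\ curvature_profile phi psi l l1, l 0 = 0, l 1 = 0 &
    forall s, `|l1 s| <= 4 * (psi e1 + psi e2) * (phi e1 + phi e2)].
Proof.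
move=> rphi hpsi; have [l [l1 [cl l0 _]]] := curvature_profile_exists phi psi rphi hpsi.
have cl' := smooth_profile_affine _ _ _ 0 (- l 1) cl.
exists (fun s => l s + (0 + - l 1 * s)), (fun s => l1 s + - l 1); split => //.
- by rewrite l0; ring.
- by ring.
case: cl' => dl dl1 _.
have [c _] := MVT_le _ _ 0 1 ler01 (fun x _ => dl x).
rewrite l0 (_ : l 1 + (0 + - l 1 * 1) - (0 + (0 + - l 1 * 0)) = 0); last by ring.
rewrite subr0 mulr1 => c0 s.
by have := profile_slope_bound phi psi _ rphi hpsi dl1 s c; rewrite -c0 subr0.
Qed.

Lemma near_norm_bound phi psi phi' (S d : R) : is_norm psi -> 1 <= S -> d <= 1 ->
  (forall p : R * R, `|p| <= S -> `|phi' p - phi p| <= d) ->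
  4 * (psi e1 + psi e2) * (phi' e1 + phi' e2) <= 4 * (psi e1 + psi e2) * (phi e1 + phi e2 + 2).
Proof.
move=> hpsi S1 d1 H; rewrite ler_wpM2l ?mulr_ge0 ?addr_ge0 ?norm_ge0//.
have := H e1; rewrite e1_norm => /(_ S1); have := H e2; rewrite e2_norm => /(_ S1).
by rewrite !ler_norml; lra.
Qed.

Lemma profile_limit_regular phi psi L L1 : regular_norm phi -> is_norm psi ->
  curvature_profile phi psi L L1 -> L1 0 = 0 -> profile_limit phi psi L.
Proof.
move=> rphi hpsi cL L10; have hphi : is_norm phi by case: rphi.
have [c c0 Hc] := weight_lower_bound psi hpsi.
exists (4 * (psi e1 + psi e2) * (phi e1 + phi e2 + 2)); case: (cL) => dL dL1 _; split.
- move=> s t; apply: (MVT_norm_le L L1) => r _ //.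
  have := profile_slope_bound phi psi _ rphi hpsi dL1 r 0; rewrite L10 subr0 => /le_trans; apply.
  by rewrite ler_wpM2l ?mulr_ge0 ?addr_ge0 ?norm_ge0// lerDl.
- exists (c / 2); first by rewrite divr_gt0.
  by apply: (curvature_profile_convex phi psi L L1) => //; [move=> s; have := Hc s; lra|rewrite divr_gt0].
move=> S eta eta0; pose S1 := Num.max 1 S; have S11 : 1 <= S1 by rewrite le_max lexx.
have [d /andP[d0 d1] Hd] := profile_closeness phi psi S1 eta hphi hpsi S11 eta0.
exists S1, d; split => // phi' r' H'.
have [l [l1 [cl _ _]]] := curvature_profile_exists phi' psi r' hpsi.
have self (p : R * R) : `|p| <= S1 -> `|phi p - phi p| <= d by move=> _; rewrite subrr normr0 ltW.
have [a [b Hab]] := Hd _ _ l l1 L L1 r' rphi H' self cl cL.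
exists (fun s => l s + (- a + - b * s)), (fun s => l1 s + - b); split.
- exact: (smooth_profile_affine _ _ _ (- a) (- b) cl).
- move=> s t; have -> : l1 s + - b - (l1 t + - b) = l1 s - l1 t by ring.
  case: cl => _ dl1 _; apply: le_trans (profile_slope_bound phi' psi _ r' hpsi dl1 s t) _.
  exact: near_norm_bound H'.
- move=> s sS; have := Hab s; rewrite le_max sS orbT => /(_ isT).
  by congr (`|_| <= _); ring.
Qed.

(** A regular phi gets its own profile, normalised to match the initial values of u. Otherwise, when
    regular approximations exist, L is the limit of the profiles of norms [ph k] within 1 / (k + 1)
    of phi on the ball of radius k + 1. *)
Lemma profile_limit_exists phi psi : is_norm phi -> is_norm psi -> exists L, profile_limit phi psi L /\
  (regular_norm phi -> exists L1, [/\ curvature_profile phi psi L L1, L 0 = 0 & L1 0 = 0]).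
Proof.
move=> hphi hpsi.
have [rphi|nr] := pselect (regular_norm phi).
  have [L [L1 [cL L0 L10]]] := curvature_profile_exists phi psi rphi hpsi.
  by exists L; split; [exact: profile_limit_regular cL L10|exists L1].
suff [L HL] : exists L, profile_limit phi psi L by exists L.
clear nr.
have [ap|nap] := pselect (forall S d : R, 0 < d -> exists phi', regular_norm phi' /\
    (forall p : R * R, `|p| <= S -> `|phi' p - phi p| <= d)); last first.
  exists (weight phi), (phi e1); split; first exact: weight_lipschitz.
    by exists 1 => // x y z _; rewrite !mul1r !subrr !mulr0 addr0.
  move=> S eta _; move/existsNP: nap => [S' /existsNP[d /not_implyP[d0 H]]].
  exists S', d; split; first exact: d0.
  by move=> phi' r' H'; exfalso; apply: H; exists phi'; split; [exact: r'|exact: H'].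
have hk (k : nat) : exists phi', regular_norm phi' /\
    (forall p : R * R, `|p| <= k.+1%:R -> `|phi' p - phi p| <= k.+1%:R^-1).
  by apply: ap; rewrite invr_gt0 ltr0n.
have /choice[ph Hph] := hk.
have rph k : regular_norm (ph k) := proj1 (Hph k).
have nph k := proj2 (Hph k).
have /choice[l Hl] := fun k => normalized_profile_exists (ph k) psi (rph k) hpsi.
have /choice[l1 Hl1] := Hl.
have dn (d : R) : 0 < d -> exists K : nat, forall k, (K <= k)%N -> k.+1%:R^-1 <= d.
  move=> d0; exists (Num.truncn d^-1) => k Kk.
  rewrite -[leRHS]invrK lef_pV2 ?posrE ?invr_gt0 ?ltr0n//.
  by apply: le_trans (ltW (truncnS_gt _)) _; rewrite ler_nat.
have Sn (S : R) : exists K : nat, forall k, (K <= k)%N -> S <= k.+1%:R.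
  exists (Num.truncn S) => k Kk; apply: le_trans (ltW (truncnS_gt _)) _.
  by rewrite ler_nat.
have near (S d : R) : 0 < d -> exists K : nat, forall k, (K <= k)%N ->
    forall p : R * R, `|p| <= S -> `|ph k p - phi p| <= d.
  move=> d0; have [K1 H1] := dn d d0; have [K2 H2] := Sn S.
  exists (maxn K1 K2) => k; rewrite geq_max => /andP[k1 k2] p pS.
  by apply: le_trans (nph k p _) (H1 _ k1); exact: le_trans pS (H2 _ k2).
have cau (S eta : R) : 0 < eta -> exists K : nat, forall j k, (K <= j)%N -> (K <= k)%N ->
    forall s, `|s| <= S -> `|l j s - l k s| <= eta.
  move=> eta0; pose S1 := Num.max 1 S; have S11 : 1 <= S1 by rewrite le_max lexx.
  have p0 : 0 < 2 + 2 * S1 by lra.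
  have e0 : 0 < eta / (2 + 2 * S1) by rewrite divr_gt0.
  have [d /andP[d0 _] Hd] := profile_closeness phi psi S1 _ hphi hpsi S11 e0.
  have [K HK] := near S1 d d0; exists K => j k Kj Kk s sS.
  have [cj j0 j1 _] := Hl1 j; have [ck k0 k1 _] := Hl1 k.
  have [a [b Hab]] := Hd _ _ _ _ _ _ (rph j) (rph k) (HK j Kj) (HK k Kk) cj ck.
  have := affine_small (fun s => l j s - l k s) a b _ S1 S11 Hab; rewrite j0 k0 j1 k1 !subrr => /(_ erefl erefl s).
  rewrite le_max sS orbT => /(_ isT)/le_trans; apply.
  by rewrite mulrCA divff ?mulr1// gt_eqF.
have /choice[L HL] : forall s, exists x : R, forall eta : R, 0 < eta -> forall K : nat,
    (forall j k, (K <= j)%N -> (K <= k)%N -> `|l j s - l k s| <= eta) ->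
    forall k, (K <= k)%N -> `|l k s - x| <= eta.
  move=> s; apply: (cauchy_limit (fun k => l k s)) => eta eta0.
  by have [K HK] := cau `|s| eta eta0; exists K => j k Kj Kk; exact: HK.
have lim (S eta : R) : 0 < eta -> exists K : nat, forall k, (K <= k)%N ->
    forall s, `|s| <= S -> `|l k s - L s| <= eta.
  move=> eta0; have [K HK] := cau S eta eta0; exists K => k Kk s sS.
  by apply: HL Kk => // i j Ki Kj; exact: HK.
pose C := 4 * (psi e1 + psi e2) * (phi e1 + phi e2 + 2).
have slopes : exists K : nat, forall k, (K <= k)%N -> forall s, `|l1 k s| <= C.
  have [K HK] := near 1 1 ltr01; exists K => k Kk s.
  have [_ _ _ H] := Hl1 k; apply: le_trans (H s) _.
  exact: near_norm_bound (HK k Kk).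
have [K0 HK0] := slopes.
exists L, (2 * C); split.
- move=> s t; apply/ler_addgt0Pr => e e0.
  have e2 : 0 < e / 2 by rewrite divr_gt0.
  have [K HK] := lim (Num.max `|s| `|t|) _ e2.
  pose k := maxn K K0.
  have A := HK k (leq_maxl _ _) s; rewrite le_max lexx in A; have {}A := A isT.
  have B := HK k (leq_maxl _ _) t; rewrite le_max lexx orbT in B; have {}B := B isT.
  have [[dl _ _] _ _ _] := Hl1 k.
  have D := MVT_norm_le (l k) (l1 k) t s C (fun r _ => dl r) (fun r _ => HK0 k (leq_maxr _ _) r).
  have C0 : 0 <= C := le_trans (normr_ge0 _) (HK0 k (leq_maxr _ _) 0).
  have : 0 <= C * `|s - t| by rewrite mulr_ge0.
  by move: A B D; rewrite !ler_norml; lra.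
- have [c c0 Hc] := weight_lower_bound psi hpsi.
  exists (c / 2); first by rewrite divr_gt0.
  move=> x y z xyz; apply/ler_addgt0Pr => e e0.
  have zx : 0 <= z - x by case/andP: xyz => h1 h2; lra.
  (* Each value of L - (c / 2) f is approximated within e / q (1 + c / 2); the weights z - x, z - y
     and y - x add up to 2 (z - x), so the total error stays below e. *)
  pose q := 2 * (z - x + 1) * (1 + c / 2).
  have c2 : 0 < c / 2 by rewrite divr_gt0.
  have q0 : 0 < q by rewrite !mulr_gt0// ltr_wpDl.
  have eq : 0 < e / q by rewrite divr_gt0.
  pose S := 1 + `|x| + `|y| + `|z|.
  have [K HK] := lim S _ eq; have [K' HK'] := near S _ eq.
  pose k := maxn K K'; have {}HK := HK k (leq_maxl _ _); have {}HK' := HK' k (leq_maxr _ _).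
  have S1 : 1 <= S by rewrite /S; have := normr_ge0 x; have := normr_ge0 y; have := normr_ge0 z; lra.
  have g s : `|s| <= S -> `|L s - c / 2 * weight phi s - (l k s - c / 2 * weight (ph k) s)| <= e / q * (1 + c / 2).
    move=> sS; have A := HK s sS; have B := HK' _ (slope_point_norm s S S1 sS).
    have B' := ler_wpM2l (ltW c2) B.
    have -> : L s - c / 2 * weight phi s - (l k s - c / 2 * weight (ph k) s) =
      - (l k s - L s) + c / 2 * (ph k (- s, 1) - phi (- s, 1)) by rewrite /weight; ring.
    apply: le_trans (ler_normD _ _) _; rewrite normrN normrM (gtr0_norm c2).
    by move: A B'; lra.
  have xS : `|x| <= S by rewrite /S; have := normr_ge0 y; have := normr_ge0 z; lra.
  have yS : `|y| <= S by rewrite /S; have := normr_ge0 x; have := normr_ge0 z; lra.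
  have zS : `|z| <= S by rewrite /S; have := normr_ge0 x; have := normr_ge0 y; lra.
  have gx := g x xS; have gy := g y yS; have gz := g z zS.
  have [ck _ _ _] := Hl1 k.
  have cv := curvature_profile_convex _ _ _ _ (rph k) hpsi ck (c / 2) _ c2 x y z xyz.
  have {}cv := cv (fun s => ltac:(have := Hc s; lra)).
  case/andP: xyz => xy yz.
  have zy0 : 0 <= z - y by rewrite subr_ge0.
  have yx0 : 0 <= y - x by rewrite subr_ge0.
  rewrite ler_norml in gx; case/andP: gx => gx _.
  rewrite ler_norml in gy; case/andP: gy => _ gy.
  rewrite ler_norml in gz; case/andP: gz => gz _.
  have hx := ler_wpM2l zy0 gx; have hy := ler_wpM2l zx gy; have hz := ler_wpM2l yx0 gz.
  have E : e / q * (1 + c / 2) * (2 * (z - x + 1)) = e by rewrite /q; field; rewrite !gt_eqF//; lra.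
  have pq : 0 < e / q * (1 + c / 2) by rewrite mulr_gt0// ltr_wpDl.
  move: cv hx hy hz E pq; move: (e / q * _) => ee; clear; lra.
- move=> S eta eta0; pose S1 := Num.max 1 S; have S11 : 1 <= S1 by rewrite le_max lexx.
  have e2 : 0 < eta / 2 by rewrite divr_gt0.
  have [d /andP[d0 d1] Hd] := profile_closeness phi psi S1 _ hphi hpsi S11 e2.
  exists S1, d; split => // phi' r' H'.
  have [K HK] := near S1 d d0; have [K' HK'] := lim S1 _ e2.
  pose k := maxn K K'; have {}HK := HK k (leq_maxl _ _); have {}HK' := HK' k (leq_maxr _ _).
  have [m [m1 [cm _ _]]] := curvature_profile_exists phi' psi r' hpsi.
  have [ck _ _ _] := Hl1 k.
  have [a [b Hab]] := Hd _ _ m m1 _ _ r' (rph k) H' HK cm ck.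
  exists (fun s => m s + (- a + - b * s)), (fun s => m1 s + - b); split.
  + exact: (smooth_profile_affine _ _ _ (- a) (- b) cm).
  + move=> s t; have -> : m1 s + - b - (m1 t + - b) = m1 s - m1 t by ring.
    case: cm => _ dm1 _; apply: le_trans (profile_slope_bound phi' psi _ r' hpsi dm1 s t) _.
    apply: le_trans (near_norm_bound phi psi phi' S1 d hpsi S11 d1 H') _.
    have C0 : 0 <= C := le_trans (normr_ge0 _) (HK0 K0 (leqnn _) 0).
    by rewrite -/C; lra.
  + move=> s sS; have A := Hab s; rewrite le_max sS orbT in A; have {}A := A isT.
    have B := HK' s; rewrite le_max sS orbT in B; have {}B := B isT.
    by move: A B; rewrite !ler_norml; lra.
Qed.

End ProfileLimitExistence.

Section UniformConvergence.
Context {R : realType}.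
Lemma uniform_cvg_epsP (T : choiceType) (K : set T) (F : nat -> T -> R) (f : T -> R) :
  {uniform K, F @ \oo --> f} <-> forall e : R, 0 < e -> exists N, forall n, (N <= n)%N ->
    forall q, K q -> `|F n q - f q| <= e.
Proof.
split=> [H e e0|H].
  have : nbhs (f : {uniform` K -> R}) [set h | forall q, K q -> `|h q - f q| <= e].
    rewrite uniform_nbhs; exists [set xy | ball xy.1 e xy.2]; split.
      by rewrite -entourage_ballE; exists e.
    by move=> h Hh q Kq; have := Hh q Kq; rewrite /ball /= distrC => /ltW.
  by move=> /H [N _ HN]; exists N => n Nn q Kq; apply: (HN n).
move=> P; rewrite uniform_nbhs => -[E [entE sub]].
move: entE; rewrite -entourage_ballE => -[e /= e0 He].
have e2 : 0 < e / 2 by rewrite divr_gt0.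
have [N HN] := H _ e2; exists N => // n Nn; apply: sub => q Kq; apply: He => /=.
rewrite /ball /= distrC; apply: le_lt_trans (HN n Nn q Kq) _; lra.
Qed.

Lemma unif_continuous_lipschitz (f : R * R -> R) (K : R) :
  (forall p q, `|f p - f q| <= K * `|p - q|) -> unif_continuous f.
Proof.
move=> HK E; rewrite -entourage_ballE => -[e /= e0 He].
have K1 : 0 < `|K| + 1 by rewrite ltr_wpDl.
rewrite /= -entourage_ballE; exists (e / (`|K| + 1)); first by rewrite /= divr_gt0.
move=> [p q] /= pq; apply: He => /=; rewrite /ball /=.
have {}pq : `|p - q| < e / (`|K| + 1).
  by move: pq; rewrite -ball_normE.
apply: le_lt_trans (HK _ _) _; apply: (@le_lt_trans _ _ ((`|K| + 1) * `|p - q|)).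
  by rewrite ler_wpM2r//; have := ler_norm K; lra.
by rewrite mulrC -ltr_pdivlMr.
Qed.

Lemma compact_norm_bound (K : set (R * R * R)) : compact K -> exists M : R, forall q, K q -> `|q| <= M.
Proof.
move=> cK; have [M [_ HM]] := compact_bounded cK.
by exists (M + 1) => q Kq; apply: (HM (M + 1)) => //; rewrite ltrDl.
Qed.

Lemma square_compact (S : R) : compact [set p : R * R | `|p| <= S].
Proof.
have -> : [set p : R * R | `|p| <= S] = `[- S, S]%classic `*` `[- S, S]%classic.
  apply/seteqP; split => -[x z] /=; rewrite prod_normE ge_max /= !in_itv /= !ler_norml.
    by move=> /andP.
  by move=> [-> ->].
by apply: compact_setX; exact: segment_compact.
Qed.
End UniformConvergence.

(** * The level set function and its convergence *)

Section Flow.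
Context {R : realType}.
Implicit Types (phi psi : R * R -> R) (L : R -> R).

Lemma convex3_support_line (g : R -> R) : convex3 g -> exists a : R, forall s, g 0 + a * s <= g s.
Proof.
move=> cg; pose E : set R := [set r | exists2 x : R, 0 < x & r = (g 0 - g (- x)) / x].
have key (x z : R) : 0 < x -> 0 < z -> (g 0 - g (- x)) / x <= (g z - g 0) / z.
  move=> x0 z0; rewrite ler_pdivrMr// mulrAC ler_pdivlMr//.
  have := cg (- x) 0 z; rewrite oppr_le0 (ltW x0) (ltW z0) => /(_ isT); lra.
have hs : has_sup E.
  split; first by exists ((g 0 - g (- 1)) / 1), 1.
  by exists ((g 1 - g 0) / 1) => _ [x x0 ->]; exact: key.
exists (sup E) => s; have [s0|s0|->] := ltgtP s 0; last by rewrite mulr0 addr0.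
  have sN : 0 < - s by rewrite oppr_gt0.
  have : (g 0 - g s) / - s <= sup E.
    by apply: ub_le_sup; [case: hs|exists (- s); rewrite ?opprK].
  by rewrite ler_pdivrMr//; lra.
have : sup E <= (g s - g 0) / s.
  by apply: ge_sup; [case: hs|move=> _ [x x0 ->]; exact: key].
by rewrite ler_pdivlMr//; lra.
Qed.

Lemma convex3_affine (g : R -> R) (a b : R) : convex3 g -> convex3 (fun s => g s + (a + b * s)).
Proof. by move=> cg x y z xyz; have := cg x y z xyz; lra. Qed.

(** L - c f has a supporting line at 0 and f dominates a multiple of 1 + |s|, so L exceeds that line
    by such a multiple. The line provides the point (al, h), interior to the epigraph, from which
    the dilations are taken. *)
Lemma profile_limit_growth phi psi L : is_norm phi -> profile_limit phi psi L ->
  convex3 L /\ exists al h c : R, 0 < c /\ forall s, c * (1 + `|s|) <= L s + (h + - al * s).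
Proof.
move=> hphi [C [_ [c c0 cg] _]]; split.
  move=> x y z xyz; have := cg x y z xyz; have := weight_convex phi hphi x y z xyz.
  by move=> /(ler_wpM2l (ltW c0)); lra.
have [a Ha] := convex3_support_line _ cg.
have [k k0 Hk] := norm_lower_bound phi hphi.
exists a, (- (L 0 - c * weight phi 0)), (c * k / 2); split; first by rewrite divr_gt0// mulr_gt0.
move=> s; have := Ha s; have := Hk (- s, 1).
rewrite prod_normE /= normrN normr1 => h.
have h2 : k * ((1 + `|s|) / 2) <= weight phi s.
  apply: le_trans h; rewrite ler_wpM2l ?(ltW k0)// le_max.
  by have [h'|h'] := leP `|s| 1; apply/orP; [right|left]; lra.
by have := ler_wpM2l (ltW c0) h2; lra.
Qed.

(** Adding h - al s to L corresponds to moving the centre (al, h) to the origin, and makes the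
    profile positive as [dilation] requires. These are the exact leaves, hence a = e = 0. *)
Definition translator_level L (al h : R) (q : R * R * R) : R :=
  cutoff (1 - dilation (fun s => L s + (h + - al * s)) 0 0 (q.1.1 - al) (q.1.2 - h) q.2).

Section Convergence.
Context (phi psi : R * R -> R) (L : R -> R) (al h c : R) (hphi : is_norm phi) (hpsi : is_norm psi)
  (HL : profile_limit phi psi L) (c0 : 0 < c) (lc : forall s, c * (1 + `|s|) <= L s + (h + - al * s)).

Notation U := (translator_level L al h).

Lemma translator_level_lipschitz q q' : 0 <= q.2 -> 0 <= q'.2 -> `|U q - U q'| <= 4 / c * `|q - q'|.
Proof.
have gen (p p' : R * R * R) : 0 <= p.2 -> 0 <= p'.2 ->
    dilation (fun s => L s + (h + - al * s)) 0 0 (p'.1.1 - al) (p'.1.2 - h) p'.2 <=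
    dilation (fun s => L s + (h + - al * s)) 0 0 (p.1.1 - al) (p.1.2 - h) p.2 + 4 / c * `|p - p'|.
  move=> p0 p'0.
  have := dilation_lipschitz _ c 0 0 c0 lc (lexx 0) (p.1.1 - al) (p.1.2 - h) p.2 (p'.1.1 - al) (p'.1.2 - h) p'.2.
  rewrite !mul0r addr0 => /(_ p0 (lexx 0) p'0 (lexx 0)) /le_trans; apply; rewrite lerD2l.
  have [n1 n2 n3] := norm3_le (p - p').
  have E1 : `|p'.1.1 - al - (p.1.1 - al)| = `|(p - p').1.1|.
    by rewrite /= distrC; congr (`|_|); ring.
  have E2 : `|p'.1.2 - h - (p.1.2 - h)| = `|(p - p').1.2|.
    by rewrite /= distrC; congr (`|_|); ring.
  have E3 : `|p'.2 - p.2| = `|(p - p').2| by rewrite /= distrC.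
  rewrite E1 E2 E3 mulrAC ler_wpM2r ?invr_ge0 ?(ltW c0)//.
  move: n1 n2 n3; lra.
move=> q0 q'0; apply: le_trans (cutoff_lipschitz _ _) _.
have A := gen q q' q0 q'0; have B := gen q' q q'0 q0; rewrite distrC in B.
by rewrite ler_norml; lra.
Qed.

Lemma translator_level_continuous : {within [set q : R * R * R | 0 <= q.2], continuous U}.
Proof.
apply: (@subspace_continuousP _ _ _ _).2 => q q0; apply/cvgrPdist_lt => e e0.
have k0 : 0 < 4 / c by rewrite divr_gt0.
rewrite /= near_withinE; apply/nbhs_ballP; exists (e / (4 / c)); first by rewrite /= divr_gt0.
move=> q' /= qq' q'0; apply: le_lt_trans (translator_level_lipschitz q q' q0 q'0) _.
by move: qq'; rewrite -ball_normE /= ltr_pdivlMr// mulrC.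
Qed.

Lemma translator_level_unif : unif_continuous_in_finite_time U.
Proof.
move=> T e T0 e0; have k0 : 0 < 4 / c by rewrite divr_gt0.
exists (e / (4 / c)); first by rewrite divr_gt0.
move=> q q' /andP[q0 _] /andP[q'0 _]; rewrite ltr_pdivlMr// mulrC.
exact: le_lt_trans (translator_level_lipschitz q q' q0 q'0).
Qed.

Lemma translator_level_convergence (phi_ : nat -> R * R -> R) (U_ : nat -> R * R * R -> R) :
  (forall n, regular_norm (phi_ n)) ->
  (forall K, compact K -> {uniform K, phi_ @ \oo --> phi}) ->
  (forall n, viscosity_solution (phi_ n) psi (fun p => U (p, 0)) (U_ n)) ->
  forall K : set (R * R * R), compact K -> K `<=` [set q | 0 <= q.2] -> {uniform K, U_ @ \oo --> U}.
Proof.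
move=> rn cvn vn K cK K0; apply/uniform_cvg_epsP => eta eta0.
have [M HM] := compact_norm_bound K cK.
have [cL _] := profile_limit_growth phi psi L hphi HL.
have [C [LL _ Hap]] := HL.
pose ell s := L s + (h + - al * s).
have cell : convex3 ell := convex3_affine _ _ _ cL.
have ellL s t : `|ell s - ell t| <= (C + `|al|) * `|s - t|.
  have -> : ell s - ell t = (L s - L t) + - al * (s - t) by rewrite /ell; ring.
  apply: le_trans (ler_normD _ _) _; rewrite normrM normrN mulrDl; exact: lerD.
(* [stability] reaches times strictly before T only; the summand 1 puts the whole compact set there.
   In the next line |h| accounts for the recentering of z. *)
pose T := `|M| + 1; have T0 : 0 < T by rewrite ltr_wpDl.
have [S [d [S0 d0 Hst]]] := stability psi ell c (C + `|al|) T (`|M| + `|h|) eta hpsi c0 lc cell ellL T0 eta0.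
have [S' [d' [d'0 Hap']]] := Hap S d d0.
have /uniform_cvg_epsP/(_ _ d'0)[N HN] := cvn _ (square_compact S').
exists N => n Nn q Kq.
have [l [l1 [cl l1C lL]]] := Hap' (phi_ n) (rn n) (HN n Nn).
have [uV V0 sub sup] := vn n.
pose v x z t := U_ n ((x + al, z + h), t).
have b0 (p : R * R) : `|U_ n (p, 0)| <= 1 by rewrite V0; exact: cutoff_bound.
have [B HB] := unif_continuous_bounded (U_ n) T T0 uV b0.
have qM := HM q Kq; have q0 : 0 <= q.2 := K0 _ Kq.
have [n1 n2 n3] := norm3_le q.
have := Hst (phi_ n) (fun s => l s + (h + - al * s)) (fun s => l1 s + - al) _ v B (rn n)
  (smooth_profile_affine _ _ _ h (- al) cl) (fun s => erefl) _ _ _ _ _ _ _ (q.1.1 - al) (q.1.2 - h) q.2.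
rewrite /v !subrK -!surjective_pairing; apply.
- move=> s t; have -> : l1 s + - al - (l1 t + - al) = l1 s - l1 t by ring.
  by apply: le_trans (l1C s t) _; rewrite lerDl.
- move=> s /lL; congr (`|_| <= _); rewrite /ell; ring.
- exact: (quad_subsolution_shift _ _ (fun x z t => U_ n ((x, z), t)) al h (viscosity_quad_subsolution _ _ _ sub)).
- exact: (quad_subsolution_shift _ _ (fun x z t => - U_ n ((x, z), t)) al h (viscosity_quad_supersolution _ _ _ (rn n) hpsi sup)).
- exact: (slab_continuous_shift T (fun x z t => U_ n ((x, z), t)) al h (unif_continuous_slab _ _ T0 uV)).
- by move=> x z t tT; exact: HB.
- by move=> x z; rewrite V0 /translator_level /= !addrK.
- apply: le_trans (ler_normB _ _) _; rewrite lerD2r; apply: le_trans n2 _.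
  by apply: le_trans qM _; exact: ler_norm.
- rewrite q0 /T /=; have := ler_norm q.2; have := ler_norm M; move: n3 qM; lra.
Qed.

End Convergence.

End Flow.

(** * The level set solution for regular norms *)

Section Touching.
Context {R : realType}.
Notation Q := (R * R * R)%type.
Notation future := [set q : Q | 0 < q.2].
Implicit Types (g : Q -> R) (q v : Q).

Lemma open_future : open future.
Proof.
have -> : future = snd @^-1` [set t : R | 0 < t] by [].
apply: open_comp; last exact: open_gt.
by move=> q _; exact: cvg_snd.
Qed.

Lemma line_taylor g q v : C2_on future g -> 0 < q.2 -> forall e : R, 0 < e ->
  exists2 d : R, 0 < d & forall h, `|h| < d ->
  `|g (q + h *: v) - g q - 'D_v g q * h - 'D_v (fun q => 'D_v g q) q / 2 * h ^+ 2| <= e * h ^+ 2.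
Proof.
move=> [C1 C2] q0 e e0.
have [d1 d10 H1] := open_normP _ _ open_future q0.
have [dv _] := C2 v v q q0.
have /derivableP/is_derive0_lineP/is_derive1_epsP/(_ _ e0)[d2 d20 H2] := dv.
have v1 : 0 < `|v| + 1 by rewrite ltr_wpDl.
exists (Num.min (d1 / (`|v| + 1)) d2); first by rewrite lt_min divr_gt0.
move=> h; rewrite lt_min => /andP[h1 h2].
set A1 := 'D_v g q; set A2 := 'D_v _ q.
have inA (c : R) : `|c| <= `|h| -> 0 < (q + c *: v).2.
  move=> ch; apply: H1; rewrite addrAC subrr add0r normrZ.
  have : `|c| * `|v| <= `|h| * (`|v| + 1) by apply: ler_pM => //; rewrite lerDl.
  by move/le_lt_trans; apply; rewrite -ltr_pdivlMr.
have dG (c : R) : `|c - 0| <= `|h - 0| ->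
    is_derive c 1 (fun h => g (q + h *: v) - g q - A1 * h - A2 / 2 * h ^+ 2) ('D_v g (q + c *: v) - A1 - A2 * c).
  rewrite !subr0 => ch; have [dc _] := C1 v _ (inA c ch).
  have D1 : is_derive c 1 (fun h : R => g (q + h *: v)) ('D_v g (q + c *: v)).
    exact: (proj1 (is_derive_lineP g q v c _) (derivableP dc)).
  have D2 := is_derive_subf _ _ c _ _ D1 (is_derive_cstf (g q) c).
  have D3 := is_derive_subf _ _ c _ _ D2 (is_derive_scalef A1 _ c _ (is_derive_idf c)).
  have D4 := is_derive_subf _ _ c _ _ D3 (is_derive_scalef (A2 / 2) _ c _ (is_derive_mulf _ _ c _ _ (is_derive_idf c) (is_derive_idf c))).
  by apply: is_derive_eqf D4; rewrite subr0 mulr1; field.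
have := MVT_norm_le _ _ 0 h (e * `|h|) dG.
rewrite scale0r addr0 subrr mulr0 subr0 expr0n /= mulr0 !subr0 => H.
apply: le_trans (H _) _; last by rewrite -mulrA -expr2 real_normK ?num_real.
move=> c; rewrite subr0 => ch; have := H2 c (le_lt_trans ch h2); rewrite add0r scale0r addr0 => /le_trans; apply.
by rewrite ler_wpM2l// ltW.
Qed.

(** Increments h and - h give opposite inequalities to first order, which identifies the linear
    coefficients; the quadratic ones can then be compared. *)
Lemma quadratic_contact (A1 A2 a b : R) :
  (forall e : R, 0 < e -> exists2 d : R, 0 < d & forall h, `|h| < d ->
    a * h + b / 2 * h ^+ 2 <= A1 * h + A2 / 2 * h ^+ 2 + e * h ^+ 2) -> A1 = a /\ b <= A2.
Proof.
move=> H; have E : A1 = a.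
  have [d d0 Hd] := H 1 ltr01.
  pose K := `|(A2 - b) / 2| + 1.
  have K0 : 0 < K by rewrite ltr_wpDl.
  have KK : (A2 - b) / 2 + 1 <= K by rewrite lerD2r ler_norm.
  apply/eqP; rewrite -subr_eq0; apply/eqP; apply/normr0_eq0/eqP; rewrite eq_le normr_ge0 andbT.
  apply/ler_addgt0Pr => e e0; rewrite add0r.
  pose h := Num.min (d / 2) (e / K).
  have h0 : 0 < h by rewrite lt_min !divr_gt0.
  have hd : h < d by apply: (@le_lt_trans _ _ (d / 2)); [rewrite ge_min lexx|lra].
  have hK : K * h <= e by rewrite mulrC -ler_pdivlMr// ge_min lexx orbT.
  have := Hd h; rewrite (gtr0_norm h0) => /(_ hd) P.
  have := Hd (- h); rewrite normrN (gtr0_norm h0) => /(_ hd) N.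
  rewrite sqrrN in N.
  have Kh : ((A2 - b) / 2 + 1) * h * h <= e * h.
    apply: ler_wpM2r; first exact: ltW.
    by apply: le_trans hK; rewrite ler_wpM2r// ltW.
  have P' : (a - A1) * h <= e * h by move: P Kh; rewrite expr2; lra.
  have N' : (A1 - a) * h <= e * h by move: N Kh; rewrite expr2; lra.
  rewrite !ler_pM2r// in P' N'.
  by rewrite ler_norml; lra.
split=> //; apply/ler_addgt0Pr => e e0; have e4 : 0 < e / 2 by rewrite divr_gt0.
have [d d0 Hd] := H _ e4; have d2 : 0 < d / 2 by rewrite divr_gt0.
have := Hd (d / 2); rewrite (gtr0_norm d2) E => h; have {}h := h (ltac:(lra)).
have q : 0 < (d / 2) ^+ 2 by rewrite exprn_gt0.
have : b / 2 * (d / 2) ^+ 2 <= (A2 / 2 + e / 2) * (d / 2) ^+ 2 by move: h; lra.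
by rewrite ler_pM2r//; lra.
Qed.

Lemma touch_above g q v (a b : R) : C2_on future g -> 0 < q.2 ->
  (forall e : R, 0 < e -> exists2 d : R, 0 < d & forall h, `|h| < d ->
    a * h + b / 2 * h ^+ 2 - e * h ^+ 2 <= g (q + h *: v) - g q) ->
  'D_v g q = a /\ b <= 'D_v (fun q => 'D_v g q) q.
Proof.
move=> Cg q0 H; apply: quadratic_contact => e e0; have e2 : 0 < e / 2 by rewrite divr_gt0.
have [d d0 Hd] := H _ e2; have [d' d'0 Hd'] := line_taylor g q v Cg q0 _ e2.
exists (Num.min d d'); first by rewrite lt_min d0.
move=> h; rewrite lt_min => /andP[h1 h2]; have := Hd h h1; have := Hd' h h2.
by rewrite ler_norml; lra.
Qed.

Lemma touch_below g q v (a b : R) : C2_on future g -> 0 < q.2 ->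
  (forall e : R, 0 < e -> exists2 d : R, 0 < d & forall h, `|h| < d ->
    g (q + h *: v) - g q <= a * h + b / 2 * h ^+ 2 + e * h ^+ 2) ->
  'D_v g q = a /\ 'D_v (fun q => 'D_v g q) q <= b.
Proof.
move=> Cg q0 H.
suff [A B] : - 'D_v g q = - a /\ - b <= - 'D_v (fun q => 'D_v g q) q.
  by split; [exact: oppr_inj|rewrite -lerN2].
apply: quadratic_contact => e e0; have e2 : 0 < e / 2 by rewrite divr_gt0.
have [d d0 Hd] := H _ e2; have [d' d'0 Hd'] := line_taylor g q v Cg q0 _ e2.
exists (Num.min d d'); first by rewrite lt_min d0.
move=> h; rewrite lt_min => /andP[h1 h2]; have := Hd h h1; have := Hd' h h2.
by rewrite ler_norml; lra.
Qed.

Lemma op_upper_ge (phi psi : R * R -> R) pX (B : R) :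
  (forall d : R, 0 < d -> exists qY, [/\ qY.1 != 0, `|qY - pX| < d & B <= level_set_op phi psi qY]) ->
  (B%:E <= level_set_op_upper phi psi pX)%E.
Proof.
move=> H; apply: le_ereal_inf_tmp => _ [V + <-].
rewrite /within /= => /nbhs_ballP[d d0 Hd].
have [qY [q0 qd qB]] := H d d0.
apply: (@le_trans _ _ (level_set_op phi psi qY)%:E); first by rewrite lee_fin.
apply: ereal_sup_ubound; exists qY => //; apply: Hd => //.
by rewrite -ball_normE /= distrC.
Qed.

Lemma op_lower_le (phi psi : R * R -> R) pX (B : R) :
  (forall d : R, 0 < d -> exists qY, [/\ qY.1 != 0, `|qY - pX| < d & level_set_op phi psi qY <= B]) ->
  (level_set_op_lower phi psi pX <= B%:E)%E.
Proof.
move=> H; rewrite /level_set_op_lower limf_einfE; apply: ge_ereal_sup => _ [V + <-].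
rewrite /within /= => /nbhs_ballP[d d0 Hd].
have [qY [q0 qd qB]] := H d d0.
apply: (@le_trans _ _ (level_set_op phi psi qY)%:E); last by rewrite lee_fin.
apply: ereal_inf_lbound; exists qY => //; apply: Hd => //.
by rewrite -ball_normE /= distrC.
Qed.

Lemma direction_derive g q (s : R) : C2_on future g -> 0 < q.2 ->
  'D_(sx + s *: sz) g q = 'D_sx g q + s * 'D_sz g q /\
  'D_(sx + s *: sz) (fun q => 'D_(sx + s *: sz) g q) q =
    'D_sx (fun q => 'D_sx g q) q + 2 * s * 'D_sz (fun q => 'D_sx g q) q + s ^+ 2 * 'D_sz (fun q => 'D_sz g q) q.
Proof.
move=> Cg q0; split; last exact: C2_on_second open_future Cg q0.
have [C1 _] := Cg; have D := C1_on_deriveD _ g q sx (s *: sz) open_future C1 q0.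
rewrite (@derive_val _ _ _ _ _ _ _ D); congr (_ + _).
have [d _] := C1 sz q q0; have D' := deriveZ_dir g q sz s d.
exact: (@derive_val _ _ _ _ _ _ _ D').
Qed.

End Touching.

Section ViscositySolution.
Context {R : realType}.
Notation Q := (R * R * R)%type.
Notation future := [set q : Q | 0 < q.2].

Definition near_shift (q : Q) (dx dz dt : R) : Q := ((q.1.1 + dx, q.1.2 + dz), q.2 + dt).

Lemma near_shift_line (q : Q) (s u : R) :
  [/\ q + u *: (sx + s *: sz) = near_shift q u (s * u) 0, q + u *: sz = near_shift q 0 u 0 &
      q + u *: st = near_shift q 0 0 u].
Proof.
have E0 : s *: (0 : R) = 0 by exact: mulr0.
have E1 : s *: (1 : R) = s by exact: mulr1.
split.
- by rewrite line3E /near_shift /= E0 E1 !addr0 add0r mulr1 mulr0 addr0 mulrC.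
- by rewrite line3E /near_shift /= !(mulr0, mulr1).
- by rewrite line3E /near_shift /= !(mulr0, mulr1).
Qed.

Lemma near_shiftP (q : Q) (P : Q -> Prop) : (\forall q' \near q, P q') ->
  exists2 r : R, 0 < r & forall dx dz dt, `|dx| < r -> `|dz| < r -> `|dt| < r -> P (near_shift q dx dz dt).
Proof.
move=> /nbhs_ballP[r /= r0 H]; exists r => // dx dz dt h1 h2 h3; apply: H.
have E (u v : R) : u + v - u = v by rewrite addrAC subrr add0r.
by rewrite -ball_normE /ball_ /= distrC norm3_lt /near_shift /= !E h1 h2 h3.
Qed.

(** The sign [sg] covers contact from above and from below, so that the sub- and supersolution
    properties share one proof. *)
Lemma touch_signed (g : Q -> R) (q v : Q) (sg a b : R) : sg = 1 \/ sg = - 1 -> C2_on future g -> 0 < q.2 ->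
  (forall e : R, 0 < e -> exists2 d : R, 0 < d & forall u, `|u| < d ->
    sg * (a * u + b / 2 * u ^+ 2) - e * u ^+ 2 <= sg * (g (q + u *: v) - g q)) ->
  'D_v g q = a /\ sg * b <= sg * 'D_v (fun q => 'D_v g q) q.
Proof.
move=> [->|->] Cg q0 H.
  rewrite !mul1r; apply: touch_above => // e e0; have [d d0 Hd] := H e e0.
  by exists d => // u ud; have := Hd u ud; rewrite !mul1r.
rewrite !mulN1r lerN2; apply: touch_below => // e e0; have [d d0 Hd] := H e e0.
by exists d => // u ud; have := Hd u ud; rewrite !mulN1r; lra.
Qed.

(** Contact determines the first derivatives, but C is not small, so second derivatives are sharply
    controlled only along (1, s), where (dz - s dx)^2 vanishes. For K != 0 that is the one second
    derivative which the operator sees. *)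
Lemma touch_jet (g : Q -> R) (q : Q) (sg K s b mu : R) : sg = 1 \/ sg = - 1 -> C2_on future g -> 0 < q.2 ->
  (forall ep : R, 0 < ep -> exists C d : R, [/\ 0 <= C, 0 < d & forall dx dz dt,
    `|dx| < d -> `|dz| < d -> `|dt| < d ->
    sg * (K * (dz - s * dx - b * dt - mu / 2 * dx ^+ 2))
      - (ep * (dx ^+ 2 + dz ^+ 2) + C * ((dz - s * dx) ^+ 2 + dt ^+ 2)) <= sg * (g (near_shift q dx dz dt) - g q)]) ->
  [/\ 'D_st g q = - (K * b), 'D_sx g q = - (K * s), 'D_sz g q = K &
    sg * - (K * mu) <= sg * ('D_sx (fun q => 'D_sx g q) q + 2 * s * 'D_sz (fun q => 'D_sx g q) q
      + s ^+ 2 * 'D_sz (fun q => 'D_sz g q) q)].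
Proof.
move=> Hsg Cg q0 H; have [D1 D2] := direction_derive g q s Cg q0.
have [C [d [C0 d0 Hd]]] := H 1 ltr01.
have sg2 : sg * sg = 1 by case: Hsg => ->; rewrite ?mulrNN mulr1.
have zE : 'D_sz g q = K.
  have [|-> //] := touch_signed g q sz sg K (sg * - (2 * (1 + C))) Hsg Cg q0 _.
  move=> e e0; exists d => // u ud; have [_ -> _] := near_shift_line q 0 u.
  have := Hd 0 u 0; rewrite normr0 d0 => /(_ isT ud isT).
  have : 0 <= e * u ^+ 2 by rewrite mulr_ge0 ?sqr_ge0// ltW.
  rewrite expr0n /= !mulr0 !subr0 add0r addr0.
  have -> : sg * (K * u + sg * - (2 * (1 + C)) / 2 * u ^+ 2) = sg * (K * u) - (1 + C) * u ^+ 2.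
    by rewrite mulrDr; congr (_ + _); rewrite !mulrA sg2; field.
  by move: (sg * (g _ - _)) (sg * (K * u)) => X Y; clear; lra.
have tE : 'D_st g q = - (K * b).
  have [|-> //] := touch_signed g q st sg (- (K * b)) (sg * - (2 * C)) Hsg Cg q0 _.
  move=> e e0; exists d => // u ud; have [_ _ ->] := near_shift_line q 0 u.
  have := Hd 0 0 u; rewrite normr0 d0 => /(_ isT isT ud).
  have : 0 <= e * u ^+ 2 by rewrite mulr_ge0 ?sqr_ge0// ltW.
  rewrite expr0n /= !mulr0 !subr0 add0r expr0n /= !add0r mulr0 add0r.
  have -> : sg * (- (K * b) * u + sg * - (2 * C) / 2 * u ^+ 2) = sg * (K * - (b * u)) - C * u ^+ 2.
    by rewrite mulrDr; congr (_ + _); [ring|rewrite !mulrA sg2; field].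
  by move: (sg * (g _ - _)) (sg * (K * _)) => X Y; clear; lra.
have [eE ee] : 'D_(sx + s *: sz) g q = 0 /\ sg * - (K * mu) <= sg * 'D_(sx + s *: sz) (fun q => 'D_(sx + s *: sz) g q) q.
  apply: touch_signed => // e e0; have s1 : 0 < 1 + s ^+ 2 by rewrite ltr_pwDl// sqr_ge0.
  have e' : 0 < e / (1 + s ^+ 2) by rewrite divr_gt0.
  have [C' [d' [C'0 d'0 Hd']]] := H _ e'.
  have s2 : 0 < 1 + `|s| by rewrite ltr_pwDl.
  exists (d' / (1 + `|s|)); first by rewrite divr_gt0.
  move=> u ud; have [-> _ _] := near_shift_line q s u.
  have u1 : `|u| < d' /\ `|s * u| < d'.
    move: ud; rewrite ltr_pdivlMr// normrM; have := mulr_ge0 (normr_ge0 s) (normr_ge0 u).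
    by have := normr_ge0 u; clear; lra.
  have := Hd' u (s * u) 0; rewrite normr0 d'0 => /(_ (proj1 u1) (proj2 u1) isT).
  have -> : e / (1 + s ^+ 2) * (u ^+ 2 + (s * u) ^+ 2) = e * u ^+ 2 by field; rewrite gt_eqF.
  rewrite subrr expr0n /= !mulr0 !addr0 mulr0 addr0 subr0 sub0r mul0r add0r.
  have -> : sg * (- (K * mu) / 2 * u ^+ 2) = sg * (K * - (mu / 2 * u ^+ 2)) by field.
  by [].
rewrite D2 in ee; rewrite D1 zE in eE; split => //.
by move: eE; clear; lra.
Qed.

(** The flat case is encoded by K = s = 0, so that [touch_jet] serves both cases. *)
Lemma translator_level_jet (phi psi : R * R -> R) (L L1 : R -> R) (al h c : R) (q : Q) :
  regular_norm phi -> is_norm psi -> curvature_profile phi psi L L1 -> 0 < c ->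
  (forall s, c * (1 + `|s|) <= L s + (h + - al * s)) -> 0 < q.2 ->
  let U := translator_level L al h in exists K s b mu : R,
  ((K = 0 /\ s = 0) \/ (0 < K /\ weight psi s * slope_curv phi s * mu = b)) /\
  forall ep : R, 0 < ep -> exists C d : R, [/\ 0 <= C, 0 < d & forall dx dz dt,
    `|dx| < d -> `|dz| < d -> `|dt| < d ->
    `|U (near_shift q dx dz dt) - U q - K * (dz - s * dx - b * dt - mu / 2 * dx ^+ 2)|
      <= ep * (dx ^+ 2 + dz ^+ 2) + C * ((dz - s * dx) ^+ 2 + dt ^+ 2)].
Proof.
move=> rphi hpsi cL c0 lc q0 U.
have sl := smooth_profile_affine _ _ _ h (- al) cL.
have [k k0 Hk] := slope_curv_lower phi psi rphi hpsi.
have range := profile_slope_range _ _ _ k sl k0 Hk.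
have hr : exists2 r : R, 0 < r & forall dt, `|dt| < r -> 0 * (q.2 + dt) <= 0.
  by exists 1 => // dt _; rewrite mul0r.
pose ell s := L s + (h + - al * s).
have E dx dz dt : U (near_shift q dx dz dt) =
    cutoff (1 - dilation ell 0 0 (q.1.1 - al + dx) (q.1.2 - h + dz) (q.2 + dt)).
  by rewrite /U /translator_level /= !(addrAC _ _ dx) !(addrAC _ _ dz).
have wk (C ep X dx dz dt s : R) : X <= ep * (dx ^+ 2 + dz ^+ 2) + C * ((dz - s * dx) ^+ 2 + dt ^+ 2) ->
    X <= ep * (dx ^+ 2 + dz ^+ 2) + `|C| * ((dz - s * dx) ^+ 2 + dt ^+ 2).
  by move/le_trans; apply; rewrite lerD2l ler_wpM2r ?ler_norm// addr_ge0 ?sqr_ge0.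
case: (cutoff_dilation_jet ell _ _ c 0 0 sl c0 lc (lexx 0) range (q.1.1 - al) (q.1.2 - h) q.2 q0 hr) => [H|[lam2 [s [K [K0 H]]]]].
  exists 0, 0, 0, 0; split; first by left.
  move=> ep ep0; have [C [d [d0 Hd]]] := H ep ep0; exists `|C|, d; split => // dx dz dt h1 h2 h3.
  rewrite E mul0r subr0; apply: le_trans (Hd dx dz dt h1 h2 h3) _; rewrite lerD2l.
  apply: (@le_trans _ _ (`|C| * dt ^+ 2)); first by rewrite ler_wpM2r ?sqr_ge0 ?ler_norm.
  by rewrite ler_wpM2l// lerDr sqr_ge0.
exists K, s, (dilation ell 0 0 (q.1.1 - al) (q.1.2 - h) q.2)^-1,
  (dilation ell 0 0 (q.1.1 - al) (q.1.2 - h) q.2 * (weight psi s * slope_curv phi s))^-1.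
split.
  right; split => //; have sc : weight psi s * slope_curv phi s != 0.
    by rewrite gt_eqF// mulr_gt0 ?(slope_curv_gt0 phi rphi psi hpsi)// /weight norm_gt0// slope_neq0.
  by rewrite invfM mulrCA divff ?mulr1.
move=> ep ep0; have [C [d [d0 Hd]]] := H ep ep0; exists `|C|, d; split => // dx dz dt h1 h2 h3.
by apply: wk; have := Hd dx dz dt h1 h2 h3; rewrite E mul0r add0r mul0r subr0 addr0.
Qed.

Lemma op_at_slope (phi psi : R * R -> R) (K s a b c : R) : regular_norm phi -> is_norm psi -> K != 0 ->
  level_set_op phi psi ((- (K * s), K), (a, b, c)) = weight psi s * slope_curv phi s * (a + 2 * s * b + s ^+ 2 * c).
Proof.
move=> rphi hpsi K1; have s1 : 0 < 1 + s ^+ 2 by rewrite ltr_pwDl// sqr_ge0.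
rewrite (level_set_opE phi rphi); last by apply/eqP => -[_ /eqP]; rewrite (negbTE K1).
have -> : (- (K * s), K) = K *: (- s, 1) :> R * R by rewrite pairZE mulr1 mulrN.
rewrite (mobility_curv_scale phi rphi psi hpsi)// ?slope_neq0// slope_curvE//.
have -> : (- (K * s)) ^+ 2 + K ^+ 2 = K ^+ 2 * (1 + s ^+ 2) by ring.
by field; rewrite K1 gt_eqF.
Qed.

(** The zero gradient is approached along the vertical gradients (0, d / 2), where the operator is a
    positive multiple of the xx entry, the one whose sign the contact provides. *)
Lemma op_near_flat (phi psi : R * R -> R) (sg a b c d : R) : regular_norm phi -> is_norm psi ->
  0 < d -> 0 <= sg * a -> exists qY : R * R * (R * R * R),
    [/\ qY.1 != 0, `|qY - (0, (a, b, c))| < d & 0 <= sg * level_set_op phi psi qY].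
Proof.
move=> rphi hpsi d0 sa; have d2 : 0 < d / 2 by rewrite divr_gt0.
have n0 : (0, d / 2) != 0 :> R * R by apply/eqP => -[/eqP]; rewrite gt_eqF.
exists ((0, d / 2), (a, b, c)); split => //.
  rewrite prod_normE gt_max /= prod_normE gt_max /= !subr0 normr0 (gtr0_norm d2) d0 /=.
  by rewrite subrr normr0 d0 andbT; lra.
rewrite (level_set_opE phi rphi)//.
have -> : sg * (mobility_curv phi psi (0, d / 2) * ((d / 2) ^+ 2 * a - 2 * (0 * (d / 2)) * b + 0 ^+ 2 * c)
  / (0 ^+ 2 + (d / 2) ^+ 2)) = mobility_curv phi psi (0, d / 2) * (sg * a) by field; rewrite gt_eqF.
by rewrite mulr_ge0// ltW// (mobility_curv_gt0 phi rphi psi hpsi).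
Qed.

Lemma jet_operator (phi psi : R * R -> R) (sg K s b mu a1 a2 a3 : R) :
  regular_norm phi -> is_norm psi ->
  (K = 0 /\ s = 0) \/ (0 < K /\ weight psi s * slope_curv phi s * mu = b) ->
  sg * - (K * mu) <= sg * (a1 + 2 * s * a2 + s ^+ 2 * a3) ->
  forall d : R, 0 < d -> exists qY : R * R * (R * R * R),
    [/\ qY.1 != 0, `|qY - ((- (K * s), K), (a1, a2, a3))| < d &
    sg * - (K * b) <= sg * level_set_op phi psi qY].
Proof.
move=> rphi hpsi [[-> ->]|[K0 wE]] ee d d0.
  move: ee; rewrite !mul0r !mulr0 oppr0 mulr0 mul0r expr0n /= !mul0r !addr0 => ee.
  exact: op_near_flat.
exists ((- (K * s), K), (a1, a2, a3)); split.
- by apply/eqP => -[_ /eqP]; rewrite gt_eqF.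
- by rewrite subrr normr0.
rewrite op_at_slope ?gt_eqF// mulrCA -wE.
have w0 : 0 <= weight psi s * slope_curv phi s.
  by rewrite ltW// mulr_gt0 ?(slope_curv_gt0 phi rphi psi hpsi)// /weight norm_gt0// slope_neq0.
by apply: le_trans (ler_wpM2l w0 ee); rewrite le_eqVlt; apply/orP; left; apply/eqP; ring.
Qed.

Lemma translator_level_viscosity (phi psi : R * R -> R) (L L1 : R -> R) (al h c : R) :
  regular_norm phi -> is_norm psi -> curvature_profile phi psi L L1 -> 0 < c ->
  (forall s, c * (1 + `|s|) <= L s + (h + - al * s)) ->
  let U := translator_level L al h in viscosity_subsolution phi psi U /\ viscosity_supersolution phi psi U.
Proof.
move=> rphi hpsi cL c0 lc U.
have key (sg : R) (g : Q -> R) (q : Q) : sg = 1 \/ sg = - 1 -> C2_on future g -> 0 < q.2 ->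
    (\forall q' \near q, sg * (U q' - U q) <= sg * (g q' - g q)) ->
    forall d : R, 0 < d -> exists qY, [/\ qY.1 != 0, `|qY - space_jet g q| < d &
    sg * 'D_st g q <= sg * level_set_op phi psi qY].
  move=> Hsg Cg q0 /near_shiftP[r r0 Hr].
  have [K [s [b [mu [HK HU]]]]] := translator_level_jet phi psi L L1 al h c q rphi hpsi cL c0 lc q0.
  have [|tE xE zE ee] := touch_jet g q sg K s b mu Hsg Cg q0; last first.
    by rewrite /space_jet tE xE zE; exact: jet_operator HK ee.
  move=> ep ep0.
  have [C [d [C0 d0 Hd]]] := HU ep ep0.
  exists C, (Num.min r d); split => //; first by rewrite lt_min r0.
  move=> dx dz dt; rewrite !lt_min => /andP[h1 h1'] /andP[h2 h2'] /andP[h3 h3'].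
  apply: le_trans (Hr dx dz dt h1 h2 h3).
  have := Hd dx dz dt h1' h2' h3'; rewrite -/U.
  move: (U _ - U q) (K * _) (ep * _ + _) => X Y Z; rewrite ler_norml => /andP[A B].
  by case: Hsg => ->; rewrite ?mulN1r ?mul1r; move: A B; clear; lra.
split=> g Cg q q0 Hq.
- apply: op_upper_ge => d d0.
  have [|qY [n1 n2 n3]] := key 1 g q (or_introl erefl) Cg q0 _ d d0; last by exists qY; rewrite !mul1r in n3.
  by apply: filterS Hq => q' /=; rewrite !mul1r; clear; lra.
- apply: op_lower_le => d d0.
  have [|qY [n1 n2 n3]] := key (-1) g q (or_intror erefl) Cg q0 _ d d0; last by exists qY; rewrite !mulN1r lerN2 in n3.
  by apply: filterS Hq => q' /=; rewrite !mulN1r; clear; lra.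
Qed.

End ViscositySolution.

(** * The graph of the translator *)

Section Translator.
Context {R : realType} (L : R -> R) (al h c C : R) (c0 : 0 < c)
  (lc : forall s, c * (1 + `|s|) <= L s + (h + - al * s))
  (LL : forall s t, `|L s - L t| <= C * `|s - t|).
Implicit Types (x z t s : R).

(** The effective domain of the Legendre transform, that is the projection of K to the x axis. It
    contains an end point when the supremum is finite there, whence the vertical half-lines of
    [completed_graph]. *)
Definition translator_domain : set R := [set x | exists k, forall s, s * x - k <= L s].

Definition translator_profile x : R := sup [set r | exists s, r = s * x - L s].

(* The quantitative form of: (x, z) is interior to the epigraph. *)
Definition strictly_above x z := exists2 th : R, 0 < th & forall s, th * (1 + `|s|) <= L s - s * x + z.

Notation I := translator_domain.
Notation u := translator_profile.
Notation U := (translator_level L al h).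

Lemma translator_profile_has_sup x : I x -> has_sup [set r | exists s, r = s * x - L s].
Proof.
move=> [k Hk]; split; first by exists (0 * x - L 0), 0.
by exists k => _ [s ->]; have := Hk s; lra.
Qed.

Lemma translator_profile_le x z : I x -> (forall s, s * x - z <= L s) <-> u x <= z.
Proof.
move=> Ix; have hs := translator_profile_has_sup x Ix; split=> H.
  by apply: ge_sup; [case: hs|move=> _ [s ->]; have := H s; lra].
by move=> s; have : s * x - L s <= u x; [apply: ub_le_sup; [case: hs|exists s]|lra].
Qed.

Lemma translator_domain_interval : is_interval I.
Proof.
move=> x y [k Hk] [k' Hk'] z /andP[xz zy]; exists (Num.max k k') => s.
have hk := Hk s; have hk' := Hk' s.
have m1 : k <= Num.max k k' by rewrite le_max lexx.
have m2 : k' <= Num.max k k' by rewrite le_max lexx orbT.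
have [s0|s0] := leP 0 s.
  by have := ler_wpM2l s0 zy; lra.
by have := ler_wnM2l (ltW s0) xz; lra.
Qed.

Lemma interior_itvP x : interior I x <-> exists2 d : R, 0 < d & forall y, `|y - x| <= d -> I y.
Proof.
split.
  move=> /nbhs_ballP[d /= d0 H]; exists (d / 2); first by rewrite divr_gt0.
  move=> y yx; apply: H; rewrite /ball /= distrC; apply: le_lt_trans yx _; lra.
move=> [d d0 H]; apply/nbhs_ballP; exists d => // y.
by rewrite /ball /= distrC => /ltW; exact: H.
Qed.

Lemma strictly_aboveP x z : strictly_above x z <-> interior I x /\ u x < z.
Proof.
split.
  move=> [th th0 H]; have near_I y : `|y - x| <= th -> I y.
    move=> yx; exists z => s; have := H s; have := ler_wpM2l (normr_ge0 s) yx.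
    have := ler_norm (s * (y - x)); rewrite normrM mulrDr; lra.
  split; first by apply/interior_itvP; exists th.
  have Ix : I x by apply: near_I; rewrite subrr normr0 ltW.
  have : u x <= z - th.
    apply/(translator_profile_le x (z - th) Ix) => s; have := H s.
    by have := mulr_ge0 (ltW th0) (normr_ge0 s); rewrite mulrDr; lra.
  lra.
move=> [/interior_itvP[d d0 Hd] uz].
have Ix : I x by apply: Hd; rewrite subrr normr0 ltW.
have [k1 H1] := Hd (x + d) (ltac:(by rewrite addrAC subrr add0r gtr0_norm)).
have [k2 H2] := Hd (x - d) (ltac:(by rewrite addrAC subrr add0r normrN gtr0_norm)).
have H0 := (translator_profile_le x (u x) Ix).2 (lexx _).
pose g := z - u x; have g0 : 0 < g by rewrite subr_gt0.
pose k : R := `|k1| + `|k2| + `|z|; have kk : 0 <= k by rewrite !addr_ge0.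
have G1 s : g <= L s - s * x + z by have := H0 s; rewrite /g; lra.
have G2 s : d * `|s| - k <= L s - s * x + z.
  have := ler_norm k1; have := ler_norm k2; have := ler_norm (- z); rewrite normrN /k.
  have := normr_ge0 k1; have := normr_ge0 k2; have := H1 s; have := H2 s.
  have [s0|s0] := leP 0 s; rewrite ?(ger0_norm s0) ?(ltr0_norm s0); lra.
(* [G1] gives a constant gap, [G2] linear growth coming from the neighbours x + d and x - d. In
   their convex combination the weight [et] on the growth costs only half of the gap. *)
pose et := g / (2 * (g + k)); have gk : 0 < g + k by rewrite ltr_pwDl.
have et0 : 0 < et by rewrite divr_gt0// mulr_gt0.
have et1 : et <= 1.
  by rewrite ler_pdivrMr ?mulr_gt0// mul1r; lra.
have etE : et * (g + k) = g / 2 by rewrite /et; field; rewrite gt_eqF.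
exists (Num.min (g / 2) (et * d)); first by rewrite lt_min divr_gt0// mulr_gt0.
move=> s; have e1 : 0 <= 1 - et by rewrite subr_ge0.
have A := ler_wpM2l e1 (G1 s); have B := ler_wpM2l (ltW et0) (G2 s).
have m1 : Num.min (g / 2) (et * d) <= g / 2 by rewrite ge_min lexx.
have m2 : Num.min (g / 2) (et * d) * `|s| <= et * d * `|s| by rewrite ler_wpM2r// ge_min lexx orbT.
by move: A B m1 m2 etE; move: (Num.min _ _) (L s - s * x + z); clearbody g k et; clear; move=> m Y; lra.
Qed.

Lemma dilation_le1 x z t : 0 <= t ->
  dilation (fun s => L s + (h + - al * s)) 0 0 (x - al) (z - h) t <= 1 <-> (forall s, s * x - (z - t) <= L s).
Proof.
move=> t0; have l1 : 2^-1 <= (1 : R) by lra.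
have e0 : 0 * t <= (0 : R) by rewrite mul0r.
have D := dilation_leP _ c 0 0 c0 lc (x - al) (z - h) t 1 t0 e0 l1.
split=> [/D H s|H].
  by have := H s; rewrite divr1 mul0r subr0 addr0 mul1r; lra.
by apply/D => s; have := H s; rewrite divr1 mul0r subr0 addr0 mul1r; lra.
Qed.

Lemma profile_growth_le s : L s + (h + - al * s) <= (`|L 0| + `|h| + C + `|al| + 1) * (1 + `|s|).
Proof.
have A := ler_norm (L s - L 0); have := LL s 0; rewrite subr0 => B.
have E := ler_norm (L 0); have F := ler_norm h; have G := ler_norm (- al * s).
rewrite normrM normrN in G.
have C0 : 0 <= C by have := LL 1 0; rewrite subr0 normr1 mulr1; apply: le_trans.
have := normr_ge0 s; have := mulr_ge0 (normr_ge0 (L 0)) (normr_ge0 s); have := mulr_ge0 (normr_ge0 h) (normr_ge0 s).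
by have := normr_ge0 al; rewrite mulrDr mulr1 !mulrDl; lra.
Qed.

(** If lam < 1, the slack is at least (1 - lam) times the growth bound [lc]. Conversely a slack th
    (1 + |s|) lets lam drop below 1, because L, being Lipschitz, grows at most linearly. *)
Lemma dilation_lt1 x z t : 0 <= t ->
  dilation (fun s => L s + (h + - al * s)) 0 0 (x - al) (z - h) t < 1 <-> strictly_above x (z - t).
Proof.
move=> t0; have e0 : 0 * t <= (0 : R) by rewrite mul0r.
split.
  have P := in_dilation _ c 0 0 c0 lc (x - al) (z - h) t t0 e0.
  have := dilation_ge _ c 0 0 c0 lc (x - al) (z - h) t t0 e0.
  set k := dilation _ _ _ _ _ _ in P * => k2 k1.
  have k0 : 0 < k by lra.
  exists ((1 - k) * c); first by rewrite mulr_gt0// subr_gt0.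
  move=> s; have := P s; rewrite mul0r subr0 addr0.
  have k1' : 0 <= 1 - k by rewrite subr_ge0 ltW.
  have := ler_wpM2l k1' (lc s).
  have : t <= t / k by rewrite ler_pdivlMr// ler_piMr// ltW.
  by rewrite mulrA; lra.
move=> [th th0 H].
(* The growth constant of the profile, plus 2 t for the increase of t / lam when lam drops from 1 to
   1 - e with e <= 1/2. *)
pose B := `|L 0| + `|h| + C + `|al| + 1 + 2 * t.
have C0 : 0 <= C by have := LL 1 0; rewrite subr0 normr1 mulr1; apply: le_trans.
have B0 : 0 < B by rewrite /B; have := normr_ge0 (L 0); have := normr_ge0 h; have := normr_ge0 al; lra.
pose e := Num.min 2^-1 (th / B).
have e1 : 0 < e by rewrite lt_min divr_gt0// invr_gt0 ltr0n.
have e2 : e <= 2^-1 by rewrite ge_min lexx.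
have eB : e * B <= th by rewrite -ler_pdivlMr// ge_min lexx orbT.
have l2 : 2^-1 <= 1 - e by lra.
apply: (@le_lt_trans _ _ (1 - e)); last by lra.
apply/(dilation_leP _ c 0 0 c0 lc (x - al) (z - h) t (1 - e) t0 e0 l2) => s.
rewrite mul0r subr0 addr0.
have tk : t / (1 - e) <= t + 2 * t * e.
  have l0 : 0 < 1 - e by lra.
  rewrite ler_pdivrMr//; have : 0 <= t * e * (1 - 2 * e).
    by rewrite !mulr_ge0 ?(ltW e1)//; lra.
  by rewrite mulrBr; lra.
have gr := ler_wpM2l (ltW e1) (profile_growth_le s).
have s1 : 1 <= 1 + `|s| by rewrite lerDl.
have te : 2 * t * e <= 2 * t * e * (1 + `|s|) by rewrite ler_peMr// !mulr_ge0// ltW.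
have eBs := ler_wpM2r (le_trans ler01 s1) eB.
have := H s; move: gr tk te eBs; rewrite /B; lra.
Qed.

Lemma translator_level_gt0 x z t : 0 <= t -> 0 < U ((x, z), t) <-> strictly_above x (z - t).
Proof.
by move=> t0; rewrite /translator_level /= cutoff_gt0 subr_gt0; exact: dilation_lt1.
Qed.

Lemma translator_level_ge0 x z t : 0 <= t -> 0 <= U ((x, z), t) <-> (forall s, s * x - (z - t) <= L s).
Proof.
move=> t0; rewrite /translator_level /= leNgt -oppr_gt0 -cutoffN cutoff_gt0 oppr_gt0 subr_lt0 -leNgt.
exact: dilation_le1.
Qed.

Lemma translator_level_below t : 0 <= t ->
  shift_up (below_graph I u) t = [set p | U (p, t) <= 0].
Proof.
move=> t0; apply/seteqP; split => -[x z]; rewrite /shift_up /below_graph /= leNgt.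
  by move=> H; apply/negP => /(translator_level_gt0 x z t t0)/strictly_aboveP.
by move=> /negP H /strictly_aboveP S; apply: H; apply/translator_level_gt0.
Qed.

(** By continuity the frontier consists of zeros. Conversely, moving from a zero towards the centre
    (al, h + t) makes U positive at once, so no zero is interior to the set where U <= 0. *)
Lemma translator_level_frontier t : 0 <= t ->
  frontier [set p | U (p, t) <= 0] = [set p | U (p, t) = 0].
Proof.
move=> t0.
have k0 : 0 < 4 / c by rewrite divr_gt0.
have lip (p q : R * R) : `|U (p, t) - U (q, t)| <= 4 / c * `|p - q|.
  apply: le_trans (translator_level_lipschitz L al h c c0 lc (p, t) (q, t) t0 t0) _.
  rewrite ler_wpM2l ?(ltW k0)// prod_normE /= subrr normr0 ge_max lexx /=.
  exact: normr_ge0.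
have nb (p : R * R) (e : R) : 0 < e -> \forall q \near p, `|U (p, t) - U (q, t)| < e.
  move=> e0; apply/nbhs_ballP; exists (e / (4 / c)); first by rewrite /= divr_gt0.
  move=> q; rewrite -ball_normE /= ltr_pdivlMr// mulrC; exact: le_lt_trans (lip p q).
apply/seteqP; split => p.
  move=> [clp nip]; have le0 : U (p, t) <= 0.
    rewrite leNgt; apply/negP => Up; have [q [/= Uq]] := clp _ (nb p _ Up).
    by rewrite ltr_norml; lra.
  apply/eqP; rewrite eq_le le0 /= leNgt; apply/negP => Up.
  apply: nip; have Up' : 0 < - U (p, t) by rewrite oppr_gt0.
  by apply: filterS (nb p _ Up') => q /=; rewrite ltr_norml; lra.
move=> /= Up; split; first by apply: subset_closure; rewrite /= Up.
case: p Up => x z Up /nbhs_ballP[r /= r0 Hr].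
have H0 : forall s, s * x - (z - t) <= L s by apply/translator_level_ge0; rewrite ?Up.
pose y : R * R := (al, h + t).
pose tau := Num.min 1 (r / 2 / (`|y - (x, z)| + 1)).
have n1 : 0 < `|y - (x, z)| + 1 by rewrite ltr_wpDl.
have tau0 : 0 < tau by rewrite lt_min ltr01 !divr_gt0.
have tau1 : tau <= 1 by rewrite ge_min lexx.
have taur : tau * (`|y - (x, z)| + 1) <= r / 2 by rewrite -ler_pdivlMr// ge_min lexx orbT.
have : U (((x, z) + tau *: (y - (x, z))), t) <= 0.
  apply: Hr; rewrite -ball_normE /= opprD addrA subrr add0r normrN normrZ (gtr0_norm tau0).
  by apply: (@le_lt_trans _ _ (r / 2)); [apply: le_trans taur; rewrite ler_wpM2l ?(ltW tau0)// lerDl|lra].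
rewrite leNgt => /negP; apply.
have -> : (x, z) + tau *: (y - (x, z)) = (x + tau * (al - x), z + tau * (h + t - z)) :> R * R.
  exact: erefl.
apply/translator_level_gt0 => //; exists (tau * c); first by rewrite mulr_gt0.
move=> s; have A := ler_wpM2l (ltW tau0) (lc s).
have t1 : 0 <= 1 - tau by rewrite subr_ge0.
have B := ler_wpM2l t1 (H0 s).
by move: A B; rewrite mulrA; lra.
Qed.

Lemma translator_frontier : frontier (below_graph I u) = completed_graph I u.
Proof.
have -> : below_graph I u = [set p | U (p, 0) <= 0].
  rewrite -translator_level_below//; apply/seteqP; split => p; rewrite /shift_up /= subr0; by case: p.
rewrite translator_level_frontier//; apply/seteqP; split => -[x z] /=.
  move=> E; have H : forall s, s * x - z <= L s.
    by have := (translator_level_ge0 x z 0 (lexx 0)).1; rewrite E lexx subr0; apply.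
  have Ix : I x by exists z.
  have uz := (translator_profile_le x z Ix).1 H.
  have NS : ~ strictly_above x z.
    by have := (translator_level_gt0 x z 0 (lexx 0)).2; rewrite E ltxx subr0 => h' /h'.
  have [->|nz] := eqVneq z (u x); first by left.
  right; split => // iI; apply: NS; apply/strictly_aboveP; split => //.
  by rewrite lt_neqAle uz eq_sym nz.
move=> H; have [Ix uz] : I x /\ u x <= z by case: H => [[/= ? ->]|[]].
apply/eqP; rewrite eq_le; apply/andP; split.
  rewrite leNgt; apply/negP => /(translator_level_gt0 x z 0 (lexx 0)); rewrite subr0 => /strictly_aboveP[iI lt].
  case: H => [[_ /= E]|[_ nI _]]; last exact: nI.
  by rewrite E ltxx in lt.
by apply/translator_level_ge0 => //; rewrite subr0; apply/translator_profile_le.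
Qed.

Lemma translator_domain_interior : interior I al.
Proof.
apply: (proj1 (_ : _ /\ u al < h)); apply/strictly_aboveP; exists c => // s.
by apply: le_trans (lc s) _; rewrite le_eqVlt; apply/orP; left; apply/eqP; ring.
Qed.

Lemma translator_profile_combination x y (a b : R) : I x -> I y -> 0 <= a -> 0 <= b -> a + b = 1 ->
  u (a * x + b * y) <= a * u x + b * u y.
Proof.
move=> Ix Iy a0 b0 ab.
have Hx := (translator_profile_le x (u x) Ix).2 (lexx _).
have Hy := (translator_profile_le y (u y) Iy).2 (lexx _).
have H s : s * (a * x + b * y) - (a * u x + b * u y) <= L s.
  have := ler_wpM2l a0 (Hx s); have := ler_wpM2l b0 (Hy s).
  have : a * L s + b * L s = L s by rewrite -mulrDl ab mul1r.
  by move: (u x) (u y) (L s) => p q l; clear; lra.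
by apply/translator_profile_le => //; exists (a * u x + b * u y).
Qed.

Lemma translator_profile_convex : @convex_function R R^o I u.
Proof.
move=> t x y; rewrite !inE => Ix Iy; rewrite convRE.
apply: translator_profile_combination => //.
  by rewrite /unstable.onem subr_ge0.
by rewrite /unstable.onem addrC subrK.
Qed.

Lemma translator_level0_unif : unif_continuous (fun p : R * R => U (p, 0)).
Proof.
apply: (@unif_continuous_lipschitz _ _ (4 / c)) => p q.
apply: le_trans (translator_level_lipschitz L al h c c0 lc (p, 0) (q, 0) (lexx _) (lexx _)) _.
rewrite ler_wpM2l ?divr_ge0 ?(ltW c0)// prod_normE /= subrr normr0 ge_max lexx /=.
exact: normr_ge0.
Qed.

End Translator.

Section LocalDerivatives.
Context {R : realType}.
Implicit Types (A : set R) (f g : R -> R).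

Lemma is_derive_local A f g (x a : R) : open A -> A x -> (forall y, A y -> f y = g y) ->
  is_derive x 1 g a -> is_derive x 1 f a.
Proof.
move=> oA Ax fg /is_derive1_epsP H; apply/is_derive1_epsP => e e0.
have [d d0 Hd] := H e e0; have [r r0 Hr] := open_normP A x oA Ax.
exists (Num.min d r); first by rewrite lt_min d0.
move=> k; rewrite lt_min => /andP[k1 k2].
rewrite !fg//; first exact: Hd.
by apply: Hr; rewrite addrAC subrr add0r.
Qed.

Lemma continuous_local A f g (x : R) : open A -> A x -> (forall y, A y -> f y = g y) ->
  {for x, continuous g} -> {for x, continuous f}.
Proof.
move=> oA Ax fg /continuous_norm_epsP H; apply/continuous_norm_epsP => e e0.
have [d d0 Hd] := H e e0; have [r r0 Hr] := open_normP A x oA Ax.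
exists (Num.min d r); first by rewrite lt_min d0.
move=> y; rewrite lt_min => /andP[k1 k2].
by rewrite !fg//; [exact: Hd|exact: Hr].
Qed.

Lemma derive_real (f : R -> R) (x a v : R) : is_derive x 1 f a -> is_derive x v f (v * a).
Proof.
move=> df; have d1 := @ex_derive _ _ _ _ _ _ _ df.
have := deriveZ_dir f x 1 v d1; rewrite (@derive_val _ _ _ _ _ _ _ df).
by rewrite (_ : v *: 1 = v)//; exact: mulr1.
Qed.

Lemma C1_on_real A f f1 : open A -> (forall x, A x -> is_derive x 1 f (f1 x)) ->
  (forall x, A x -> {for x, continuous f1}) -> C1_on A f.
Proof.
move=> oA df cf v p Ap; split; first exact: (@ex_derive _ _ _ _ _ _ _ (derive_real f p _ v (df p Ap))).
apply: (continuous_local A _ (fun q => v * f1 q)) => //.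
  by move=> q Aq; have := derive_real f q _ v (df q Aq) => D; exact: (@derive_val _ _ _ _ _ _ _ D).
by apply: continuousM; [exact: cst_continuous|exact: cf].
Qed.

Lemma C2_on_real A f f1 f2 : open A -> (forall x, A x -> is_derive x 1 f (f1 x)) ->
  (forall x, A x -> is_derive x 1 f1 (f2 x)) -> (forall x, A x -> {for x, continuous f2}) -> C2_on A f.
Proof.
move=> oA df df1 cf2; split.
  by apply: (C1_on_real A f f1) => // x Ax; exact: is_derive1_continuous (df1 x Ax).
move=> v; apply: (C1_on_real A _ (fun q => v * f2 q)) => // x Ax.
  apply: (is_derive_local A _ (fun q => v * f1 q)) => //.
    by move=> q Aq; have := derive_real f q _ v (df q Aq) => D; exact: (@derive_val _ _ _ _ _ _ _ D).
  exact: is_derive_scalef (df1 x Ax).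
by apply: continuousM; [exact: cst_continuous|exact: cf2].
Qed.

Lemma C2_on_derive1 A f : C2_on A f -> forall x, A x ->
  is_derive x 1 f (derive1 f x) /\ is_derive x 1 (derive1 f) (derive1 (derive1 f) x).
Proof.
have E g : derive1 g = (fun q => 'D_1 g q) by apply/funext => q; rewrite derive1E.
move=> [C1 C2] x Ax; split.
  by rewrite derive1E; apply/derivableP; have [] := C1 1 x Ax.
by rewrite derive1E [derive1 f]E; apply/derivableP; have [] := C2 1 1 x Ax.
Qed.

End LocalDerivatives.

(** * Regular norms: the initial value problem *)

Section RegularTranslator.
Context {R : realType} (phi psi : R * R -> R) (L L1 : R -> R) (rphi : regular_norm phi) (hpsi : is_norm psi)
  (cL : curvature_profile phi psi L L1) (L0 : L 0 = 0) (L10 : L1 0 = 0).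
Implicit Types (x y z t s : R).

Notation I := (translator_domain L).
Notation u := (translator_profile L).
Notation L2 := (fun s => weight psi s * slope_curv phi s).

Let dL s : is_derive s 1 L (L1 s). Proof. by case: cL => d _ _; exact: d. Qed.
Let dL1 s : is_derive s 1 L1 (L2 s). Proof. by case: cL => _ d _; exact: d. Qed.
Let L2_gt0 s : 0 < L2 s. Proof. by case: cL => _ _ d; exact: d. Qed.

Lemma regular_domainP x : I x <-> exists s, L1 s = x.
Proof.
have [k k0 Hk] := slope_curv_lower phi psi rphi hpsi.
split; first by move=> [K HK]; apply: (profile_slope_range L L1 _ k cL k0 Hk x K) => s; have := HK s; lra.
move=> [s <-]; exists (s * L1 s - L s) => t.
by have := profile_tangent _ _ _ cL s t; lra.
Qed.

(** The inverse of L1, which turns out to be u'; outside the range of L1 it takes the default value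
    0. *)
Definition translator_slope x : R := xget 0 [set s | L1 s = x].
Notation S := translator_slope.

Lemma translator_slopeK x : I x -> L1 (S x) = x.
Proof. by move=> /regular_domainP[s Hs]; rewrite /translator_slope; case: xgetP => [_ -> //|/(_ s)]. Qed.

Lemma slope_translatorK s : S (L1 s) = s.
Proof.
have I1 : I (L1 s) by apply/regular_domainP; exists s.
have := translator_slopeK _ I1; have [h|h|//] := ltgtP (S (L1 s)) s.
  by have := profile_slope_lt _ _ _ cL _ _ h; lra.
by have := profile_slope_lt _ _ _ cL _ _ h; lra.
Qed.

Lemma regular_profileE x : I x -> u x = S x * x - L (S x).
Proof.
move=> Ix; apply/eqP; rewrite eq_le; apply/andP; split.
  apply/(translator_profile_le L x _ Ix) => s.
  by have := profile_tangent _ _ _ cL (S x) s; rewrite translator_slopeK//; lra.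
by have := (translator_profile_le L x (u x) Ix).2 (lexx _) (S x); lra.
Qed.

Lemma slope_between s t y : L1 s < y < L1 t -> I y /\ s < S y < t.
Proof.
move=> /andP[sy yt]; have st : s <= t.
  by rewrite leNgt; apply/negP => /(profile_slope_lt _ _ _ cL _ _); lra.
have cl : {within `[s, t], continuous L1}.
  by apply: continuous_subspaceT => x; exact: is_derive1_continuous (dL1 x).
have := @IVT R L1 s t y st cl; rewrite ge_min (ltW sy) le_max (ltW yt) orbT => /(_ isT)[r _ ry].
have Iy : I y by apply/regular_domainP; exists r.
rewrite -ry slope_translatorK; split; first by rewrite ry.
rewrite -ry in sy yt.
apply/andP; split; rewrite ltNge; apply/negP => /(profile_slope_le _ _ _ cL _ _); lra.
Qed.

Lemma regular_domain_open : open I.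
Proof.
rewrite openE => x Ix; apply/nbhs_ballP.
have K := translator_slopeK x Ix.
have a : L1 (S x - 1) < x by rewrite -{2}K; apply: profile_slope_lt cL _ _ _; lra.
have b : x < L1 (S x + 1) by rewrite -{1}K; apply: profile_slope_lt cL _ _ _; lra.
exists (Num.min (x - L1 (S x - 1)) (L1 (S x + 1) - x)); first by rewrite /= lt_min !subr_gt0 a.
move=> y; rewrite /ball /= lt_min !ltr_norml => /andP[h1 h2].
by have [] := slope_between (S x - 1) (S x + 1) y (ltac:(lra)).
Qed.

Lemma translator_slope_continuous x : I x -> {for x, continuous S}.
Proof.
move=> Ix; apply/continuous_norm_epsP => e e0; have K := translator_slopeK x Ix.
have a : L1 (S x - e) < x by rewrite -{2}K; apply: profile_slope_lt cL _ _ _; lra.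
have b : x < L1 (S x + e) by rewrite -{1}K; apply: profile_slope_lt cL _ _ _; lra.
exists (Num.min (x - L1 (S x - e)) (L1 (S x + e) - x)); first by rewrite /= lt_min !subr_gt0 a.
move=> y; rewrite lt_min !ltr_norml => /andP[h1 h2].
by have [_] := slope_between (S x - e) (S x + e) y (ltac:(lra)); lra.
Qed.

Lemma is_derive_translator_slope x : I x -> is_derive x 1 S (L2 (S x))^-1.
Proof.
move=> Ix; rewrite -{1}(translator_slopeK x Ix); apply: is_derive_inverse.
- by apply/nbhs_ballP; exists 1 => //= s _; exact: slope_translatorK.
- by apply/nbhs_ballP; exists 1 => //= s _; exact: is_derive1_continuous (dL1 s).
- exact: dL1.
- by rewrite gt_eqF.
Qed.

Lemma is_derive_regular_profile x : I x -> is_derive x 1 u (S x).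
Proof.
move=> Ix; apply: (is_derive_local I _ (fun x => S x * x - L (S x)) _ _ regular_domain_open Ix).
  exact: regular_profileE.
have dS := is_derive_translator_slope x Ix.
apply: is_derive_eqf (is_derive_subf _ _ x _ _ (is_derive_mulf _ _ x _ _ dS (is_derive_idf x))
  (is_derive_compf L S x _ _ (dL (S x)) dS)).
by rewrite translator_slopeK//; ring.
Qed.

Lemma regular_profile_derive1 x : I x -> derive1 u x = S x.
Proof. by move=> Ix; rewrite derive1E; exact: (@derive_val _ _ _ _ _ _ _ (is_derive_regular_profile x Ix)). Qed.

Lemma is_derive_regular_derive1 x : I x -> is_derive x 1 (derive1 u) (L2 (S x))^-1.
Proof.
move=> Ix; apply: (is_derive_local I _ S _ _ regular_domain_open Ix).
  exact: regular_profile_derive1.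
exact: is_derive_translator_slope.
Qed.

Lemma regular_profile_derive11 x : I x -> derive1 (derive1 u) x = (L2 (S x))^-1.
Proof. by move=> Ix; rewrite derive1E; exact: (@derive_val _ _ _ _ _ _ _ (is_derive_regular_derive1 x Ix)). Qed.

Lemma regular_domain0 : I 0.
Proof. by apply/regular_domainP; exists 0. Qed.

Lemma translator_slope0 : S 0 = 0.
Proof. by rewrite -L10 slope_translatorK L10. Qed.

Lemma regular_translator_ode : translator_ode phi psi I u.
Proof.
have I0 := regular_domain0.
split.
- apply: (C2_on_real I u S (fun x => (L2 (S x))^-1) regular_domain_open).
  + exact: is_derive_regular_profile.
  + exact: is_derive_translator_slope.
  move=> x Ix; apply: (@continuousV _ _ (fun x => L2 (S x))); first by rewrite gt_eqF.
  apply: (@continuous_comp _ _ _ S L2); first exact: translator_slope_continuous.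
  by apply: continuousM; [exact: weight_continuous|exact: slope_curv_continuous].
- move=> x Ix; rewrite regular_profile_derive1// regular_profile_derive11//.
  have n0 : L2 (S x) != 0 by rewrite gt_eqF.
  exact: (divff n0).
- by rewrite regular_profileE// translator_slope0 L0 mul0r subr0.
- by rewrite regular_profile_derive1// translator_slope0.
Qed.

Lemma regular_translator_equation : translator_equation phi psi I u.
Proof.
move=> x Ix.
have D : is_derive x 1 (fun y : R => dx phi (- derive1 u y, 1)) (- (slope_curv phi (S x) * (L2 (S x))^-1)).
  apply: (is_derive_ext (fun y => - - dx phi (- derive1 u y, 1))).
    by move=> y; rewrite opprK.
  apply: is_derive_oppf.
  have := is_derive_compf (fun r => - dx phi (- r, 1)) (derive1 u) x _ _
    (is_derive_profile2 phi rphi (derive1 u x)) (is_derive_regular_derive1 x Ix).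
  by rewrite regular_profile_derive1.
split; first exact: (@ex_derive _ _ _ _ _ _ _ D).
have E : derive1 (fun y : R => dx phi (- derive1 u y, 1)) x = - (slope_curv phi (S x) * (L2 (S x))^-1).
  by rewrite derive1E; exact: (@derive_val _ _ _ _ _ _ _ D).
rewrite E regular_profile_derive1// mulrNN mulrA.
have n0 : L2 (S x) != 0 by rewrite gt_eqF.
exact: (divff n0).
Qed.

Lemma eq_from_derivative (J : set R) (f g f' g' : R -> R) : is_interval J -> J 0 ->
  (forall x, J x -> is_derive x 1 f (f' x)) -> (forall x, J x -> is_derive x 1 g (g' x)) ->
  (forall x, J x -> f' x = g' x) -> f 0 = g 0 -> forall x, J x -> f x = g x.
Proof.
move=> iJ J0 df dg fg fg0 x Jx; apply/eqP; rewrite -subr_eq0; apply/eqP.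
have [x0|x0] := leP 0 x.
  have inJ y : 0 <= y <= x -> J y by apply: iJ.
  have [|y y0 E] := MVT_le (fun x => f x - g x) (fun x => f' x - g' x) 0 x x0.
    by move=> y y0; apply: is_derive_subf; [apply: df|apply: dg]; exact: inJ.
  by move: E; rewrite fg0 subrr subr0 fg ?subrr ?mul0r//; exact: inJ.
have inJ y : x <= y <= 0 -> J y by apply: iJ.
have [|y y0 E] := MVT_le (fun x => f x - g x) (fun x => f' x - g' x) x 0 (ltW x0).
  by move=> y y0; apply: is_derive_subf; [apply: df|apply: dg]; exact: inJ.
move: E; rewrite fg0 subrr sub0r fg ?subrr ?mul0r; last exact: inJ.
by move/eqP; rewrite oppr_eq0 => /eqP.
Qed.

(* The equation says that L1 (v' x) has derivative 1, hence equals x. *)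
Lemma regular_translator_unique (J : set R) (v : R -> R) : open J -> is_interval J -> J 0 ->
  translator_ode phi psi J v -> J `<=` I /\ forall x, J x -> v x = u x.
Proof.
move=> oJ iJ J0 [C2v eqv v0 v10].
have dv := C2_on_derive1 J v C2v.
have K x : J x -> L1 (derive1 v x) = x.
  apply: (eq_from_derivative J (fun x => L1 (derive1 v x)) (fun x => x) (fun x => L2 (derive1 v x) * derive1 (derive1 v) x) (fun=> 1)) => //.
  - by move=> y Jy; have [_ d] := dv y Jy; exact: is_derive_compf (dL1 _) d.
  - by rewrite v10.
have JI : J `<=` I by move=> x Jx; apply/regular_domainP; exists (derive1 v x); exact: K.
split => //; apply: (eq_from_derivative J v u (derive1 v) S) => //.
- by move=> x Jx; have [] := dv x Jx.
- by move=> x Jx; apply: is_derive_regular_profile; exact: JI.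
- by move=> x Jx; rewrite -[in RHS](K x Jx) slope_translatorK.
- by have [_ _ -> _] := regular_translator_ode.
Qed.

Lemma regular_completed_graph : completed_graph I u = graph I u.
Proof.
apply/seteqP; split=> p; last by left.
by case=> // -[Ip nI _]; case: nI; exact: regular_domain_open.
Qed.

End RegularTranslator.

Theorem theorem3p3 (R : realType) (phi psi : R * R -> R)
    (hphi : is_norm phi) (hpsi : is_norm psi) :
  exists (I : set R) (u : R -> R),
    [/\ is_interval I,
        interior I !=set0,
        @convex_function R R^o I u,
        frontier (below_graph I u) = completed_graph I u &
        anisotropic_flow phi psi (shift_up (below_graph I u))]
    /\ (regular_norm phi ->
          [/\ maximal_translator_solution phi psi I u,
              frontier (below_graph I u) = graph I u &
              translator_equation phi psi I u]).
Proof.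
(* For regular phi, [regL] makes L the profile of phi itself with L 0 = L1 0 = 0, so the graph built
   for an arbitrary norm is then the solution of the initial value problem. *)
have [L [HL regL]] := profile_limit_exists phi psi hphi hpsi.
have [_ [al [h [c [c0 lc]]]]] := profile_limit_growth phi psi L hphi HL.
have [C [LL _ _]] := HL.
have fr := translator_frontier L al h c C c0 lc LL.
exists (translator_domain L), (translator_profile L); split; first split.
- exact: translator_domain_interval.
- by exists al; exact: translator_domain_interior c0 lc.
- exact: translator_profile_convex.
- exact: fr.
- pose U := translator_level L al h.
  have below t : 0 <= t -> shift_up (below_graph (translator_domain L) (translator_profile L)) t = [set p | U (p, t) <= 0].
    exact: translator_level_below c0 lc LL t.
  exists (fun p => U (p, 0)), U; split.
  + exact: translator_level0_unif c0 lc.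
  + split => //.
    * exact: translator_level_continuous c0 lc.
    * move=> rphi; have [L1 [cL _ _]] := regL rphi.
      have [sub sup] := translator_level_viscosity phi psi L L1 al h c rphi hpsi cL c0 lc.
      split => //; exact: translator_level_unif c0 lc.
    * exact: translator_level_convergence hphi hpsi HL c0 lc.
  + exact: below.
  + by rewrite below//; exact: translator_level_frontier c0 lc LL 0 (lexx 0).
  + by move=> t t0; rewrite below//; exact: translator_level_frontier c0 lc LL t t0.
move=> rphi; have [L1 [cL L0 L10]] := regL rphi.
have gr := regular_completed_graph phi psi L L1 rphi hpsi cL.
split; last exact: regular_translator_equation rphi hpsi cL.
  split.
  - exact: regular_domain_open rphi hpsi cL.
  - exact: translator_domain_interval.
  - exact: regular_domain0 rphi hpsi cL L10.
  - exact: regular_translator_ode rphi hpsi cL L0 L10.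
  - exact: regular_translator_unique rphi hpsi cL L0 L10.
by rewrite fr.
Qed.
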